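(* Let $n\ge 2$ and $m\ge 1$ be integers, $Q\in\mathcal{K}_o^{1,m}$, and let $K\subset M_{n,1}(\mathbb{R})=\mathbb{R}^n$ be compact. Then $$C_{p,Q}(B_2^n)=\begin{cases}0,&\text{for }p\ge n,\\ n\omega_n d_{n,p}(Q)\big(\frac{n-p}{p-1}\big)^{p-1},&\text{for }1<p<n,\\ n\omega_n d_{n,1}(Q),&\text{for }p=1.\end{cases}$$ Moreover, for every $p\in[1,n)$, $$\Big(\frac{V_n(K)}{V_n(B_2^n)}\Big)^{\frac1n}\le\Big(\frac{C_{p,Q}(K)}{C_{p,Q}(B_2^n)}\Big)^{\frac1{n-p}},$$ with equality if $K$ is an ellipsoid.
   Context: $M_{n,m}(\mathbb{R})$ is the space of real $n\times m$ matrices with inner product $\mathrm{tr}(x^{\mathrm T}y)$ and the induced norm; $S^{nm-1}$ is its unit sphere and $du$ the spherical (Hausdorff) measure on it. $M_{n,1}(\mathbb{R})$ and $M_{1,m}(\mathbb{R})$ are identified with $\mathbb{R}^n$ and $\mathbb{R}^m$. $V_n$ and $V_{nm}$ denote volume (Lebesgue measure), $B_2^n$ is the Euclidean unit ball of $\mathbb{R}^n$, $\omega_n=V_n(B_2^n)$. An ellipsoid is a set $\phi B_2^n+y_0$ with $\phi\in GL(n)$ (invertible real $n\times n$ matrix) and $y_0\in\mathbb{R}^n$. $\mathcal{K}_o^{1,m}$ is the set of compact convex sets with nonempty interior in $M_{1,m}(\mathbb{R})$ containing the origin $o$. The support function is $h_Q(x)=\max\{x\cdot y:y\in Q\}$.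 For a smooth compactly supported $f:\mathbb{R}^n\to\mathbb{R}$ (i.e. $f\in C_c^\infty$) and $u\in S^{nm-1}$, put $\nabla_u f(x)=(\nabla f(x))^{\mathrm T}u\in M_{1,m}(\mathbb{R})$ (matrix product) and $\|h_Q(\nabla_u f)\|_p=\big(\int_{\mathbb{R}^n}h_Q(\nabla_u f(x))^p\,dx\big)^{1/p}$. For compact $K\subset\mathbb{R}^n$ and $p\in[1,\infty)$, the $m$th order $p$-affine capacity is $$C_{p,Q}(K)=\inf\Big\{\Big(\int_{S^{nm-1}}\|h_Q(\nabla_u f)\|_p^{-nm}\,du\Big)^{-\frac{p}{nm}}: f\in C_c^\infty,\ f\ge 1\text{ on }K\Big\},$$ with the conventions $0^{-a}=\infty$, $\infty^{-a}=0$ for $a>0$. The body $\Pi_{p,Q}B_2^n\subset M_{n,m}(\mathbb{R})$ is the convex body with support function $h_{\Pi_{p,Q}B_2^n}(x)=\big(\int_{S^{n-1}}h_Q(v^{\mathrm T}x)^p\,dv\big)^{1/p}$, $\Pi^*_{p,Q}B_2^n$ is its polar body, so $nm\,V_{nm}(\Pi_{p,Q}^*B_2^n)=\int_{S^{nm-1}}h_{\Pi_{p,Q}B_2^n}(u)^{-nm}\,du$, and $$d_{n,p}(Q)=(n\omega_n)^{-1}\big(nm\,V_{nm}(\Pi_{p,Q}^*B_2^n)\big)^{-\frac{p}{nm}}.$$ *)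

(* Defs.v *)
From HB Require Import structures.
From mathcomp Require Import all_boot all_order all_algebra.
From mathcomp Require Import all_classical all_reals all_analysis.
From mathcomp Require Import measurable_realfun.

Set Implicit Arguments.
Unset Strict Implicit.
Unset Printing Implicit Defensive.
Import Order.TTheory GRing.Theory Num.Theory numFieldNormedType.Exports.

Local Open Scope classical_set_scope.
Local Open Scope ring_scope.

Section cons_measure.
Context (R : realType) (n : nat)
  (mu : {sigma_finite_measure set (n.-tuple (measurableTypeR R)) -> \bar R}).

Definition cons_pair (x : measurableTypeR R * n.-tuple (measurableTypeR R)) :
  n.+1.-tuple (measurableTypeR R) := [the n.+1.-tuple _ of x.1 :: x.2].

Lemma measurable_cons_pair : measurable_fun [set: _] cons_pair.
Proof. exact: (measurable_cons measurable_fst measurable_snd). Qed.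

Definition cons_measure : set (n.+1.-tuple (measurableTypeR R)) -> \bar R :=
  pushforward (@lebesgue_measure R \x mu)%E cons_pair.

Let cons_measure0 : cons_measure set0 = 0%E.
Proof. by rewrite /cons_measure /pushforward preimage_set0 measure0. Qed.

Let cons_measure_ge0 A : (0 <= cons_measure A)%E.
Proof. by rewrite /cons_measure /pushforward; apply: measure_ge0. Qed.

Let cons_measure_sigma_additive : semi_sigma_additive cons_measure.
Proof.
by apply: measure_semi_sigma_additive; exact: measurable_cons_pair.
Qed.

HB.instance Definition _ := isMeasure.Build _ _ _ cons_measure
  cons_measure0 cons_measure_ge0 cons_measure_sigma_additive.

Let cons_measure_sigma_finite : sigma_finite setT cons_measure.
Proof.
have /sigma_finiteP[F [TF ndF Foo]] := sigma_finiteT (@lebesgue_measure R).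
have /sigma_finiteP[G [TG ndG Goo]] := sigma_finiteT mu.
exists (fun k => [set t : n.+1.-tuple (measurableTypeR R) |
    F k (thead t) /\ G k [tuple of behead t]]).
  rewrite predeqE => t; split=> // _.
  have [i _ Fi] : (\bigcup_k F k) (thead t) by rewrite -TF.
  have [j _ Gj] : (\bigcup_k G k) [tuple of behead t] by rewrite -TG.
  exists (maxn i j) => //; split.
    by move: (thead t) Fi; exact/subsetPset/ndF/leq_maxl.
  by move: [tuple of behead t] Gj; exact/subsetPset/ndG/leq_maxr.
move=> k; have [mF Fy] := Foo k; have [mG Gy] := Goo k; split.
  apply: measurableI.
    by have := @measurable_tnth _ _ n.+1 ord0 measurableT _ mF; rewrite setTI.
  by have := @measurable_behead _ (measurableTypeR R) n measurableT _ mG;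
    rewrite setTI.
rewrite /cons_measure /pushforward.
rewrite [X in product_measure1 _ _ X](_ : _ = F k `*` G k).
  by rewrite product_measure1E// lte_mul_pinfty// ge0_fin_numE.
have e xt : [tuple of behead (cons_pair xt)] = xt.2 by exact: val_inj.
apply/seteqP; split=> xt [Fx Gt]; split=> //; first by rewrite -(e xt).
by rewrite /= e.
Qed.

HB.instance Definition _ := Measure_isSigmaFinite.Build _ _ _ cons_measure
  cons_measure_sigma_finite.

End cons_measure.

Section lebesgue_tuple.
Context (R : realType).

Fixpoint lebesgue_tuple (n : nat) :
    {sigma_finite_measure set (n.-tuple (measurableTypeR R)) -> \bar R} :=
  match n with
  | 0 => \d_([tuple] : 0.-tuple (measurableTypeR R))
  | k.+1 => cons_measure (lebesgue_tuple k)
  end.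
End lebesgue_tuple.

Section matrix_space.
Context (R : realType) (n m : nat).

Definition borel_mx := g_sigma_algebraType (@open 'M[R]_(n, m)).

Definition mx_of_tuple (t : (n * m).-tuple (measurableTypeR R)) : borel_mx :=
  vec_mx (\row_k (tnth t k : R)).

Lemma mx_of_tupleE t i j : mx_of_tuple t i j = tnth t (mxvec_index i j).
Proof. by rewrite !mxE. Qed.

Lemma measurable_mx_of_tuple : measurable_fun [set: _] mx_of_tuple.
Proof.
apply: (measurability (@open 'M[R]_(n, m) : set (set borel_mx))).
  by [].
move=> _ [A oA <-]; rewrite setTI.
pose qball (qk : 'M[rat]_(n, m) * nat) : set 'M[R]_(n, m) :=
  ball (map_mx (@ratr R) qk.1) qk.2.+1%:R^-1.
pose G qk := if pselect (qball qk `<=` A) then mx_of_tuple @^-1` qball qk else set0.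
have -> : mx_of_tuple @^-1` A = \bigcup_qk G qk.
  apply/seteqP; split=> [t At|t [qk _]]; last first.
    by rewrite /G; case: pselect => // qA; exact: qA.
  have /nbhs_ballP[e /= e0 eA] : nbhs (mx_of_tuple t : 'M[R]_(n, m)) A.
    exact: open_nbhs_nbhs.
  have [k ke] : exists k : nat, k.+1%:R^-1 < e / 2.
    by have [k _ /(_ k (leqnn k))] := near_infty_natSinv_lt (PosNum (divr_gt0 e0 (ltr0n R 2))); exists k.
  have k0 : (0 : R) < k.+1%:R^-1 by rewrite invr_gt0.
  have /choice[q Hq] : forall ij : 'I_n * 'I_m, exists q : rat,
      ball (mx_of_tuple t ij.1 ij.2) (k.+1%:R^-1 : R) (ratr q).
    move=> ij; set x := mx_of_tuple t ij.1 ij.2 : R.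
    have /rat_in_itvoo[q qx] : x - k.+1%:R^-1 < x + k.+1%:R^-1.
      by rewrite ltrD2l gtrN.
    exists q; rewrite /ball /= ltr_distlC.
    by move: qx; rewrite in_itv.
  pose Q := \matrix_(i, j) q (i, j).
  have tQ : qball (Q, k) (mx_of_tuple t).
    split=> // i j; apply: ball_sym; rewrite !mxE.
    by have := Hq (i, j); rewrite /= mx_of_tupleE.
  exists (Q, k) => //; rewrite /G; case: pselect => [qA|nQA]; first exact: tQ.
  exfalso; apply: nQA => M QM.
  apply: eA; apply: (@ball_splitr _ _ (map_mx (@ratr R) Q)).
    by apply: le_ball tQ; exact: ltW.
  by apply: le_ball QM; exact: ltW.
apply: countable_bigcupT_measurable => // -[q k]; rewrite /G.
case: pselect => [qA|] //=.
have -> : mx_of_tuple @^-1` qball (q, k) =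
   \bigcap_(ij in [set: 'I_n * 'I_m]) ((fun t => tnth t (mxvec_index ij.1 ij.2)) @^-1`
     (ball (ratr (q ij.1 ij.2) : R) k.+1%:R^-1)).
  apply/seteqP; split=> [t [_ h] [i j] _ |t h].
    by have := h i j; rewrite mx_of_tupleE mxE.
  by split=> // i j; rewrite mx_of_tupleE mxE; exact: (h (i, j)).
apply: fin_bigcap_measurable; first exact: finite_finset.
move=> ij _; rewrite -[X in measurable X]setTI.
apply: measurable_tnth => //; apply: open_measurable; exact: ball_open.
Qed.

(* Lebesgue measure on M_{n,m}(R), identified with R^{nm} through its entries. *)
Definition lebesgue_mx : set borel_mx -> \bar R :=
  pushforward (lebesgue_tuple R (n * m)) mx_of_tuple.

Let lebesgue_mx0 : lebesgue_mx set0 = 0%E.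
Proof. by rewrite /lebesgue_mx /pushforward preimage_set0 measure0. Qed.

Let lebesgue_mx_ge0 A : (0 <= lebesgue_mx A)%E.
Proof. by rewrite /lebesgue_mx /pushforward; apply: measure_ge0. Qed.

Let lebesgue_mx_sigma_additive : semi_sigma_additive lebesgue_mx.
Proof.
by apply: measure_semi_sigma_additive; exact: measurable_mx_of_tuple.
Qed.

HB.instance Definition _ := isMeasure.Build _ _ _ lebesgue_mx
  lebesgue_mx0 lebesgue_mx_ge0 lebesgue_mx_sigma_additive.

End matrix_space.

Section euclidean_matrices.
Context (R : realType) (n m : nat).
Implicit Types x y : 'M[R]_(n, m).

Definition inner x y : R := \tr (x^T *m y).

(* The library's norm on 'M[R]_(n, m) is the sup norm. *)
Definition enorm x : R := Num.sqrt (inner x x).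

Definition unit_ball : set 'M[R]_(n, m) := [set x | enorm x <= 1].

Definition unit_sphere : set 'M[R]_(n, m) := [set x | enorm x = 1].

Definition cone (A : set 'M[R]_(n, m)) : set 'M[R]_(n, m) :=
  [set x | 0 < enorm x <= 1 /\ A ((enorm x)^-1 *: x)].

(* Spherical measure: (n m) times the Lebesgue measure of the cone
   {t u | u in A, 0 < t <= 1} spanned by A; on the unit sphere it is the
   (n m - 1)-dimensional Hausdorff measure, with the normalization for which
   polar coordinates read dx = r ^ (n m - 1) dr du. *)
Definition sphere_measure : set (borel_mx R n m) -> \bar R :=
  fun A => ((n * m)%:R%:E * lebesgue_mx (cone A))%E.

Lemma innerE x y : inner x y = \sum_i \sum_j x i j * y i j.
Proof.
rewrite /inner /mxtrace exchange_big /=; apply: eq_bigr => j _.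
by rewrite mxE; apply: eq_bigr => i _; rewrite mxE.
Qed.

Lemma continuous_enorm : continuous enorm.
Proof.
have c : continuous (fun x => inner x x).
  rewrite (_ : (fun x => _) = fun x => \sum_i \sum_j x i j * x i j); last first.
    by apply/funext => z; rewrite innerE.
  apply: (@continuous_big R 'I_n +%R 0 xpredT (@add_continuous R) _ _
    (fun i (x : 'M[R]_(n, m)) => \sum_j x i j * x i j)) => i _.
  apply: (@continuous_big R 'I_m +%R 0 xpredT (@add_continuous R) _ _
    (fun j (x : 'M[R]_(n, m)) => x i j * x i j)) => j _ x.
  have cij := @coord_continuous R n m i j x.
  exact: (cvgM cij cij).
move=> x; apply: (@continuous_comp _ _ _ (fun x => inner x x) (@Num.sqrt R)).
  exact: c.
exact: sqrt_continuous.
Qed.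

Lemma continuous_normalize x : 0 < enorm x ->
  (enorm y)^-1 *: y @[y --> x] --> (enorm x)^-1 *: x.
Proof.
move=> x0; have c := @continuous_enorm x.
refine (@cvgZ R _ _ (nbhs x) _ (fun y => (enorm y)^-1) id _ x
  (@cvgV R _ (nbhs x) _ enorm _ (lt0r_neq0 x0) c) _); exact: cvg_id.
Qed.

Lemma cone0 : cone set0 = set0.
Proof. by apply/seteqP; split=> // x []. Qed.

Lemma cone_bigcup (F : nat -> set 'M[R]_(n, m)) :
  cone (\bigcup_k F k) = \bigcup_k cone (F k).
Proof.
by apply/seteqP; split=> [x [x1 [k _ Fk]]|x [k _ [x1 Fk]]];
  [exists k|split=> //; exists k].
Qed.

Lemma measurable_cone (A : set (borel_mx R n m)) :
  measurable A -> measurable (cone A : set (borel_mx R n m)).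
Proof.
pose D : set (borel_mx R n m) := [set x : 'M[R]_(n, m) | 0 < enorm x <= 1].
pose g : borel_mx R n m -> borel_mx R n m :=
  fun x : 'M[R]_(n, m) => (enorm x)^-1 *: x.
have open_m (U : set 'M[R]_(n, m)) : open U ->
    measurable (U : set (borel_mx R n m)).
  by move=> oU; exact: sub_sigma_algebra.
have m1 : measurable (unit_ball : set (borel_mx R n m)).
  rewrite -[X in measurable X]setCK; apply: measurableC; apply: open_m.
  apply: closed_openC; apply: (@preimage_closed _ _ enorm [set y | y <= 1]).
    by move=> x _; exact: continuous_enorm.
  exact: closed_le.
have oP : open [set x | 0 < enorm x].
  apply: (@open_comp _ _ enorm [set y | 0 < y]); last exact: open_gt.
  by move=> x _; exact: continuous_enorm.
have DE (B : set 'M[R]_(n, m)) : D `&` g @^-1` B =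
    unit_ball `&` ([set x | 0 < enorm x] `&` g @^-1` B).
  by apply/seteqP; split=> [x [/andP[? ?] ?]|x [? [? ?]]] //; split=> //; apply/andP.
have mD : measurable D.
  rewrite -[D]setIT -(preimage_setT g) DE preimage_setT setIT.
  by apply: measurableI => //; exact: open_m.
have mg : measurable_fun D g.
  apply: (measurability (@open 'M[R]_(n, m) : set (set (borel_mx R n m)))).
    by [].
  move=> _ [U oU <-]; rewrite DE; apply: measurableI => //; apply: open_m.
  rewrite openE => x [x0 Ux].
  apply: filterI; first exact: (open_nbhs_nbhs (conj oP x0)).
  have gU : nbhs (g x : 'M[R]_(n, m)) U by apply: open_nbhs_nbhs; split.
  exact: (continuous_normalize x0 gU).
by move=> mA; exact: (mg mD _ mA).
Qed.

Let sphere_measure0 : sphere_measure set0 = 0%E.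
Proof. by rewrite /sphere_measure cone0 measure0 mule0. Qed.

Let sphere_measure_ge0 A : (0 <= sphere_measure A)%E.
Proof. by rewrite /sphere_measure mule_ge0// lee_fin. Qed.

Let sphere_measure_sigma_additive : semi_sigma_additive sphere_measure.
Proof.
move=> F mF tF mUF; rewrite /sphere_measure cone_bigcup.
rewrite (_ : (fun k => _) = (fun k => (n * m)%:R%:E *
    \sum_(0 <= i < k) lebesgue_mx (cone (F i)))%E); last first.
  by apply/funext => k; rewrite ge0_sume_distrr.
apply: cvgeZl => //; apply: measure_semi_sigma_additive.
- by move=> k; exact: measurable_cone.
- apply/trivIsetP => i j _ _ ij; apply/seteqP; split=> // x [[_ Fi] [_ Fj]].
  move/trivIsetP : tF => /(_ i j Logic.I Logic.I ij) FF.
  by have : (F i `&` F j) ((enorm x)^-1 *: x) by []; rewrite FF.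
- by apply: bigcupT_measurable => k; exact: measurable_cone.
Qed.

HB.instance Definition _ := isMeasure.Build _ _ _ sphere_measure
  sphere_measure0 sphere_measure_ge0 sphere_measure_sigma_additive.

End euclidean_matrices.

Arguments unit_ball {R n m}.
Arguments unit_sphere {R n m}.
Arguments sphere_measure {R n m}.
Arguments lebesgue_mx {R n m}.

Section smooth_functions.
Context (R : realType) (n : nat).
Implicit Types f : 'cV[R]_n -> R.

Definition partial (i : 'I_n) f : 'cV[R]_n -> R := 'D_(delta_mx i 0) f.

Definition gradient f (x : 'cV[R]_n) : 'cV[R]_n := \col_i partial i f x.

Fixpoint is_Ck (k : nat) f : Prop :=
  match k with
  | 0 => continuous f
  | k'.+1 => (forall i x, derivable f x (delta_mx i 0)) /\
             (forall i, is_Ck k' (partial i f))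
  end.

Definition is_Ccinfty f : Prop :=
  (forall k, is_Ck k f) /\ compact (closure [set x | f x != 0]).

End smooth_functions.

Section affine_capacity.
Context (R : realType) (n m : nat).
Local Open Scope ereal_scope.

(* x ^ (- a) for 0 <= x <= +oo and a > 0; 0 ^ (- a) = +oo and +oo ^ (- a) = 0. *)
Definition npoweR (x : \bar R) (a : R) : \bar R := (x `^ a)^-1.

Definition convex_body_o (Q : set 'rV[R]_m) : Prop :=
  [/\ compact Q, @convex_set R 'rV[R]_m Q, Q° !=set0 & Q 0%R].

(* On the compact sets Q containing 0 considered here the supremum is a
   maximum. *)
Definition support_fun (Q : set 'rV[R]_m) (x : 'rV[R]_m) : R :=
  sup [set inner x y | y in Q].

Definition gradient_in (u : 'M[R]_(n, m)) (f : 'cV[R]_n -> R) (x : 'cV[R]_n) :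
  'rV[R]_m := (gradient f x)^T *m u.

Definition gradient_norm (p : R) (Q : set 'rV[R]_m) (f : 'cV[R]_n -> R)
    (u : 'M[R]_(n, m)) : \bar R :=
  (\int[lebesgue_mx]_(x in [set: borel_mx R n 1])
     ((support_fun Q (gradient_in u f x)) `^ p)%:E) `^ p^-1.

Definition affine_energy (p : R) (Q : set 'rV[R]_m) (f : 'cV[R]_n -> R) :
    \bar R :=
  npoweR (\int[sphere_measure]_(u in (unit_sphere : set (borel_mx R n m)))
            npoweR (gradient_norm p Q f u) (n * m)%:R)
         (p / (n * m)%:R).

Definition affine_capacity (p : R) (Q : set 'rV[R]_m) (K : set 'cV[R]_n) :
    \bar R :=
  ereal_inf [set affine_energy p Q f |
    f in [set f | is_Ccinfty f /\ forall x, K x -> (1 <= f x)%R]].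

(* Support function of the body Pi_{p,Q} B_2^n. *)
Definition Pi_support (p : R) (Q : set 'rV[R]_m) (x : 'M[R]_(n, m)) : \bar R :=
  (\int[sphere_measure]_(v in (unit_sphere : set (borel_mx R n 1)))
     ((support_fun Q (v^T *m x)) `^ p)%:E) `^ p^-1.

(* The convex body is recovered from its support function as the intersection
   of its supporting half-spaces. *)
Definition Pi_body (p : R) (Q : set 'rV[R]_m) : set 'M[R]_(n, m) :=
  [set y | forall x, (inner x y)%:E <= Pi_support p Q x].

Definition polar (A : set 'M[R]_(n, m)) : set 'M[R]_(n, m) :=
  [set x | forall y, A y -> (inner x y <= 1)%R].

Definition omega : \bar R := lebesgue_mx (unit_ball : set (borel_mx R n 1)).

Definition d_const (p : R) (Q : set 'rV[R]_m) : \bar R :=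
  (n%:R%:E * omega)^-1 *
  npoweR ((n * m)%:R%:E * lebesgue_mx (polar (Pi_body p Q) : set (borel_mx R n m)))
         (p / (n * m)%:R).

Definition is_ellipsoid (K : set 'cV[R]_n) : Prop :=
  exists phi : 'M[R]_n, exists y0 : 'cV[R]_n,
    phi \in unitmx /\ K = [set (phi *m x + y0)%R | x in unit_ball].

End affine_capacity.

Arguments omega R n : clear implicits.
Arguments d_const {R} n {m} p Q.

(* Main.v *)
Require Import Defs.
From HB Require Import structures.
From mathcomp Require Import all_boot all_order all_algebra.
From mathcomp Require Import all_classical all_reals all_analysis.
From mathcomp Require Import measurable_realfun ring lra.

(* With N = n m and G u = ||h_Q(grad_u f)||_p^p, polar coordinates turn the affine energy of f into
   (N V(G <= 1))^(-p/N).

   Lower bound. Let A be the part of {G <= 1} in a large ball and W the convex body with support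
   function z |-> (int_A h_Q(z^T u)^p du)^(1/p). Homogeneity of G gives int_A G <= V(A) N/(N+p), and
   Fubini rewrites the left side as int h_W(grad f)^p, which the Brunn-Minkowski inequality bounds
   below in terms of the volumes of W and of {f >= 1}. On the other side the volume of W is bounded
   below by V(A): the set of u for which the Firey sum of W with a small multiple of u Q^T has
   bounded volume only grows under Steiner symmetrization of W, so it can be compared, to first
   order, with the corresponding set for a ball. It suffices to do this for polytopes containing W,
   where the first variation of the volume is explicit, and the bathtub principle concludes. The
   two factors involving W cancel, and so does V(A).

   Upper bound. For K = phi B + y0 the energies of smooth truncations of |phi^-1 (x - y0)|^-g are
   computed in polar coordinates; g = (n-p)/(p-1) is optimal for 1 < p < n, while one lets g go to
   infinity for p = 1 and to 0 for p >= n. *)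

Set Implicit Arguments.
Unset Strict Implicit.
Unset Printing Implicit Defensive.
Import Order.TTheory GRing.Theory Num.Theory numFieldNormedType.Exports.

Local Open Scope classical_set_scope.
Local Open Scope ring_scope.

(** * Lebesgue measure on matrices *)

(** The obstacle is regularity: W is only a convex body, A is not convex, and nothing excludes
    beforehand that {G <= 1} has infinite volume. Volume inequalities therefore take over the part
    of boundary integrals. Brunn-Minkowski for {f > tau} and a small multiple of -W stands for the
    coarea formula with the anisotropic isoperimetric inequality. The first variation of the volume
    is compared at a finite step e, where all errors are of order e^2 against a gain of order e.
    Symmetrization is only asked to reach, in finitely many steps, a body containing a ball of
    radius r' < r, where V(W) = V(r B); monotonicity of Firey sums does the rest. The polytopes have
    facet distances equal to h_W, and h_W^p is an integral over A. Hence every normalized facet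
    energy has integral 1 over A, and weighting by the cones over the facets gives exactly the
    volume of the polytope. Both bounds are then linear in r^p, one with V(A)^(1+p/N) and the other
    with V(A); what survives is a bound on V(A)^(p/N) that does not depend on the radius of
    truncation. *)

Section mx_measurability.
Context (R : realType) (n m : nat).

Lemma open_measurable_mx (A : set 'M[R]_(n, m)) :
  open A -> measurable (A : set (borel_mx R n m)).
Proof. by move=> oA; exact: sub_sigma_algebra. Qed.

Lemma closed_measurable_mx (A : set 'M[R]_(n, m)) :
  closed A -> measurable (A : set (borel_mx R n m)).
Proof.
move=> cA; rewrite -[X in measurable X]setCK; apply: measurableC.
by apply: open_measurable_mx; exact: closed_openC.
Qed.

Lemma continuous_measurable_mx (f : 'M[R]_(n, m) -> R) : continuous f ->
  measurable_fun [set: borel_mx R n m] (f : _ -> measurableTypeR R).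
Proof.
move=> cf; apply: (measurability _ (RGenOInfty.measurableE R)).
move=> _ [_ [x ->] <-]; rewrite setTI; apply: open_measurable_mx.
apply: open_comp => [? _|]; [exact: cf|exact: interval_open].
Qed.

Lemma measurable_mx_coord i j :
  measurable_fun [set: borel_mx R n m] (fun x : 'M[R]_(n, m) => x i j : measurableTypeR R).
Proof. by apply: continuous_measurable_mx; exact: coord_continuous. Qed.

Lemma measurable_fun_mxP d (T : measurableType d) (f : T -> borel_mx R n m) :
  measurable_fun setT f <->
  forall i j, measurable_fun setT (fun t => (f t : 'M[R]_(n, m)) i j : measurableTypeR R).
Proof.
split=> [mf i j|mf].
  exact: (measurableT_comp (measurable_mx_coord i j) mf).
pose g t : (n * m).-tuple (measurableTypeR R) :=
  mktuple (fun k => mxvec (f t : 'M[R]_(n, m)) 0 k : measurableTypeR R).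
have -> : f = @mx_of_tuple R n m \o g.
  apply/funext => t; apply/matrixP => i j.
  by rewrite /comp mx_of_tupleE tnth_mktuple mxvecE.
apply: measurableT_comp; first exact: measurable_mx_of_tuple.
apply/measurable_fun_tnthP => k; rewrite /comp.
under eq_fun do rewrite tnth_mktuple.
case/mxvec_indexP: k => i j.
by under eq_fun do rewrite mxvecE; exact: mf.
Qed.

End mx_measurability.

Lemma continuous_measurable_mx_mx (R : realType) (n m k l : nat)
    (f : 'M[R]_(n, m) -> 'M[R]_(k, l)) : continuous f ->
  measurable_fun [set: borel_mx R n m] (f : _ -> borel_mx R k l).
Proof.
move=> cf; apply: (measurability (@open 'M[R]_(k, l) : set (set (borel_mx R k l)))) => //.
move=> _ [A oA <-]; rewrite setTI; apply: open_measurable_mx.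
by apply: open_comp => // ? _; exact: cf.
Qed.

(** * Translation invariance of Lebesgue measure on tuples *)

Section tuple_lebesgue.
Context (R : realType).

Lemma lebesgue_measure_shift (a : R) (A : set (measurableTypeR R)) : measurable A ->
  lebesgue_measure ((fun x : R => x + a) @^-1` A) = lebesgue_measure A.
Proof.
move=> mA; have mf : measurable_fun setT ((fun x : R => x + a) : measurableTypeR R -> measurableTypeR R).
  exact: (measurable_funD (@measurable_id _ _ setT) (@measurable_cst _ _ _ _ setT a)).
pose F : {mfun measurableTypeR R >-> measurableTypeR R} :=
  HB.pack (fun x : R => x + a) (isMeasurableFun.Build _ _ _ _ _ mf).
apply/esym; apply: (@lebesgue_measure_unique R (pushforward lebesgue_measure F)) => // _ [[x y]] _ <-.
rewrite /= /pushforward /= lebesgue_measure_itv /=.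
have -> : (fun u : R => u + a) @^-1` `]x, y] = `](x - a), (y - a)]%classic.
  by apply/seteqP; split=> u /=; rewrite !in_itv /= ltrBlDr lerBrDr.
by rewrite lebesgue_measure_itv /= !lte_fin ltrD2r !EFinD EFinN; congr (if _ then _ else _);
  rewrite -!EFinD -?EFinN; congr (_%:E); ring.
Qed.

Definition tuple_shift n (a t : n.-tuple R) : n.-tuple R :=
  [tuple tnth t i + tnth a i | i < n].

Lemma measurable_tuple_shift n (a : n.-tuple R) :
  measurable_fun setT (tuple_shift a : n.-tuple (measurableTypeR R) -> n.-tuple (measurableTypeR R)).
Proof.
apply/measurable_fun_tnthP => k; rewrite /comp.
under eq_fun do rewrite tnth_mktuple.
by apply: measurable_funD => //; exact: measurable_tnth.
Qed.

Lemma lebesgue_tuple_shift n (a : n.-tuple R) (A : set (n.-tuple (measurableTypeR R))) :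
  measurable A -> lebesgue_tuple R n (tuple_shift a @^-1` A) = lebesgue_tuple R n A.
Proof.
elim: n a A => [|n IH] a A mA.
  congr (lebesgue_tuple R 0 _); apply/seteqP; split=> t /=; by rewrite (tuple0 t) (tuple0 (tuple_shift _ _)).
pose a0 := thead a; pose a' : n.-tuple R := [tuple of behead a].
pose phi (z : measurableTypeR R * n.-tuple (measurableTypeR R)) :
  measurableTypeR R * n.-tuple (measurableTypeR R) := (z.1 + a0, tuple_shift a' z.2).
have mphi : measurable_fun setT phi.
  apply: measurable_fun_pair.
    apply: measurable_funD; [exact: measurable_fst|exact: measurable_cst].
  exact: (measurableT_comp (measurable_tuple_shift a') measurable_snd).
pose F : {mfun _ >-> _} := HB.pack phi (isMeasurableFun.Build _ _ _ _ _ mphi).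
have mC : measurable (cons_pair (R:=R) (n:=n) @^-1` A).
  by rewrite -[X in measurable X]setTI; exact: measurable_cons_pair.
have E z : tuple_shift a (cons_pair z) = cons_pair (phi z).
  apply: eq_from_tnth => i; rewrite tnth_mktuple /cons_pair /=.
  case: (unliftP ord0 i) => [j ->|->]; rewrite ?tnthS ?tnth0 ?tnth_mktuple /a' //.
  by congr (_ + _); rewrite tnth_behead; congr (tnth a _); apply: val_inj; rewrite /= inordK // ltnS.
transitivity ((pushforward (@lebesgue_measure R \x lebesgue_tuple R n)%E F) (cons_pair (R:=R) (n:=n) @^-1` A)).
  rewrite /= /cons_measure /pushforward; congr (_ _); rewrite (_ : tuple_shift a @^-1` A = [set z | A (tuple_shift a z)]) //.
  by apply/seteqP; split=> z /=; rewrite -E.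
apply/esym; apply: (@product_measure_unique _ _ _ _ _ _ _ (pushforward (@lebesgue_measure R \x lebesgue_tuple R n)%E F)) => // X Y mX mY.
rewrite /= /pushforward.
have -> : F @^-1` (X `*` Y) = ((fun x : R => x + a0) @^-1` X) `*` (tuple_shift a' @^-1` Y) by [].
rewrite product_measure1E.
- by congr (_ * _)%E; [exact: lebesgue_measure_shift|exact: IH].
- rewrite -[X in measurable X]setTI.
  exact: (measurable_funD (@measurable_id _ _ setT) (@measurable_cst _ _ _ _ setT a0)).
- by rewrite -[X in measurable X]setTI; exact: measurable_tuple_shift.
Qed.

Definition tuple_cube (n : nat) (a b : R) : set (n.-tuple (measurableTypeR R)) :=
  [set t | forall i, a <= tnth t i < b].

Lemma measurable_tuple_cube n a b : measurable (@tuple_cube n a b).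
Proof.
rewrite (_ : tuple_cube _ _ = \bigcap_(i in [set: 'I_n]) ((fun t => tnth t i) @^-1` `[a, b[%classic)).
  apply: fin_bigcap_measurable => //.
  by move=> i _; rewrite -[X in measurable X]setTI; apply: measurable_tnth.
by apply/seteqP; split=> t /= h i; have := h i; rewrite /= in_itv /= => // /(_ Logic.I).
Qed.

Lemma lebesgue_tuple_cube n a b : a <= b ->
  lebesgue_tuple R n (@tuple_cube n a b) = ((b - a) ^+ n)%:E.
Proof.
move=> ab; elim: n => [|n IH].
  by rewrite /= diracE (_ : _ \in _) ?expr0 // inE => -[].
rewrite /= /cons_measure /pushforward.
rewrite [X in product_measure1 _ _ X](_ : _ = `[a, b[%classic `*` @tuple_cube n a b); last first.
  apply/seteqP; split=> -[x t] /=.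
    move=> h; split; first by have := h ord0; rewrite /= in_itv.
    by move=> i; have := h (lift ord0 i); rewrite /cons_pair /= tnthS; congr (_ <= tnth _ _ < _); exact: val_inj.
  move=> [/= xab h] i; rewrite /cons_pair /=; case: (unliftP ord0 i) => [j ->|->].
    by rewrite tnthS.
  by rewrite tnth0; move: xab; rewrite in_itv.
rewrite product_measure1E //; last exact: measurable_tuple_cube.
have e : lebesgue_measure (`[a, b[%classic : set (measurableTypeR R)) = (b - a)%:E.
  rewrite lebesgue_measure_itv /= lte_fin.
  by case: ltP => // ba; rewrite (le_anti (introT andP (conj ab ba))) subrr.
by rewrite exprS EFinM; congr (_ * _)%E; [exact: e|exact: IH].
Qed.

End tuple_lebesgue.

Section mx_lebesgue.
Context (R : realType) (n m : nat).
Local Notation V := (@lebesgue_mx R n m).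

Lemma measurable_mx_shift (a : 'M[R]_(n, m)) :
  measurable_fun [set: borel_mx R n m] ((fun x : 'M[R]_(n, m) => x + a) : _ -> borel_mx R n m).
Proof.
apply/measurable_fun_mxP => i j; under eq_fun do rewrite mxE.
by apply: measurable_funD => //; exact: measurable_mx_coord.
Qed.

Lemma lebesgue_mx_shift (a : 'M[R]_(n, m)) (A : set (borel_mx R n m)) : measurable A ->
  V ((fun x : 'M[R]_(n, m) => x + a) @^-1` A) = V A.
Proof.
move=> mA; pose a' : (n * m).-tuple R := [tuple mxvec a 0 k | k < (n * m)].
have m' : measurable (@mx_of_tuple R n m @^-1` A).
  by rewrite -[X in measurable X]setTI; exact: measurable_mx_of_tuple.
rewrite /lebesgue_mx /pushforward -[RHS](lebesgue_tuple_shift a' m').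
congr (_ _); apply/seteqP; split=> t /=.
all: suff -> : mx_of_tuple (tuple_shift a' t) = (mx_of_tuple t : 'M[R]_(n, m)) + a by [].
all: by apply/matrixP => i j; rewrite mx_of_tupleE !mxE !tnth_mktuple mxvecE.
Qed.

Definition mx_cube (a b : R) : set 'M[R]_(n, m) := [set x | forall i j, a <= x i j < b].

Lemma mx_of_tuple_cube a b : @mx_of_tuple R n m @^-1` mx_cube a b = @tuple_cube R (n * m) a b.
Proof.
apply/seteqP; split=> t /=; first by move=> h k; case/mxvec_indexP: k => i j; rewrite -mx_of_tupleE.
by move=> h i j; rewrite mx_of_tupleE.
Qed.

Lemma measurable_mx_cube a b : measurable (mx_cube a b : set (borel_mx R n m)).
Proof.
rewrite (_ : mx_cube _ _ = \bigcap_(i in [set: 'I_n]) \bigcap_(j in [set: 'I_m])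
   ((fun x : 'M[R]_(n, m) => x i j) @^-1` `[a, b[%classic)).
  apply: fin_bigcap_measurable => // i _; apply: fin_bigcap_measurable => // j _.
  by rewrite -[X in measurable X]setTI; apply: measurable_mx_coord.
apply/seteqP; split=> [t h i _ j _|t h i j] /=; first by rewrite in_itv; exact: h.
by have := h i Logic.I j Logic.I; rewrite /= in_itv.
Qed.

Lemma lebesgue_mx_cube a b : a <= b -> V (mx_cube a b) = ((b - a) ^+ (n * m))%:E.
Proof. by move=> ab; rewrite /lebesgue_mx /pushforward mx_of_tuple_cube lebesgue_tuple_cube. Qed.

Lemma mx_cube_cover : \bigcup_k mx_cube (- k%:R) k%:R = setT.
Proof.
apply/seteqP; split=> // x _.
exists (Num.truncn `|x|).+1 => // i j.
have h : `|x i j| < (Num.truncn `|x|).+1%:R.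
  apply: le_lt_trans (truncnS_gt _).
  rewrite [leRHS]/Num.norm /= mx_normrE.
  exact: (le_bigmax _ (fun ij : 'I_n * 'I_m => `|x ij.1 ij.2|) (i, j)).
by have := h; rewrite ltr_norml => /andP[h1 ->]; rewrite ltW.
Qed.

Lemma sigma_finite_of_cubes (mu : {measure set (borel_mx R n m) -> \bar R}) :
  (forall k : nat, mu (mx_cube (- k%:R) k%:R) < +oo)%E -> sigma_finite setT mu.
Proof.
move=> h; exists (fun k : nat => mx_cube (- k%:R) k%:R); first by rewrite mx_cube_cover.
by move=> k; split => //; exact: measurable_mx_cube.
Qed.

Lemma lebesgue_mx_sigma_finite : sigma_finite setT V.
Proof.
apply: sigma_finite_of_cubes => k; rewrite [X in (X < _)%E]lebesgue_mx_cube ?ltry //.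
by rewrite (@le_trans _ _ 0) ?oppr_le0.
Qed.

HB.instance Definition _ := Measure_isSigmaFinite.Build _ _ _ V lebesgue_mx_sigma_finite.

End mx_lebesgue.

(** * Slices of measurable sets *)

Section fubini_sets.
Context d1 d2 (T1 : measurableType d1) (T2 : measurableType d2) (R : realType).
Variables (m1 : {sigma_finite_measure set T1 -> \bar R})
  (m2 : {sigma_finite_measure set T2 -> \bar R}).
Variables (S : set (T1 * T2)) (mS : measurable S).

Let xsE x : xsection S x = [set y | S (x, y)].
Proof. by apply/seteqP; split=> y; rewrite /xsection /= inE. Qed.

Let ysE y : ysection S y = [set x | S (x, y)].
Proof. by apply/seteqP; split=> x; rewrite /ysection /= inE. Qed.

Lemma measurable_set_slice1 x : measurable [set y | S (x, y)].
Proof. by rewrite -xsE; exact: measurable_xsection. Qed.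

Lemma measurable_set_slice2 y : measurable [set x | S (x, y)].
Proof. by rewrite -ysE; exact: measurable_ysection. Qed.

Lemma measurable_fun_slice1 : measurable_fun setT (fun x => m2 [set y | S (x, y)]).
Proof.
rewrite (_ : (fun x => _) = m2 \o xsection S); last by apply/funext => x /=; rewrite xsE.
exact: measurable_fun_xsection.
Qed.

Lemma measurable_fun_slice2 : measurable_fun setT (fun y => m1 [set x | S (x, y)]).
Proof.
rewrite (_ : (fun x => _) = m1 \o ysection S); last by apply/funext => x /=; rewrite ysE.
exact: measurable_fun_ysection.
Qed.

Lemma product_measure_slice1 :
  ((m1 \x m2) S = \int[m1]_x m2 [set y | S (x, y)])%E.
Proof. by apply: eq_integral => x _ /=; rewrite xsE. Qed.

Lemma fubini_slice :
  (\int[m1]_x m2 [set y | S (x, y)] = \int[m2]_y m1 [set x | S (x, y)])%E.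
Proof.
have := @indic_fubini_tonelli _ _ _ _ R m1 m2 S mS.
rewrite indic_fubini_tonelli_FE // indic_fubini_tonelli_GE // => e.
transitivity (\int[m1]_x (m2 \o xsection S) x)%E; first by apply: eq_integral => x _ /=; rewrite xsE.
by rewrite e; apply: eq_integral => x _ /=; rewrite ysE.
Qed.

End fubini_sets.

Lemma pushforward_measure_exists d1 d2 (T1 : measurableType d1) (T2 : measurableType d2)
    (R : realType) (mu : {measure set T1 -> \bar R}) (f : T1 -> T2) :
  measurable_fun setT f ->
  exists nu : {measure set T2 -> \bar R}, forall A, nu A = mu (f @^-1` A).
Proof.
move=> mf.
by exists (pushforward mu f).
Unshelve.
exact: mf.
Qed.

(** * Uniqueness of translation-invariant measures *)

Section haar.
Context (R : realType) (n m : nat).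
Local Notation T := (borel_mx R n m).
Local Notation V := (@lebesgue_mx R n m).
Implicit Types mu nu : {measure set T -> \bar R}.

Definition shift_invariant mu := forall (a : 'M[R]_(n, m)) (A : set T),
  measurable A -> mu ((fun x : 'M[R]_(n, m) => x + a) @^-1` A) = mu A.

Lemma measurable_fun_mxD d (U : measurableType d) (f g : U -> T) :
  measurable_fun setT f -> measurable_fun setT g ->
  measurable_fun setT ((fun u => (f u : 'M[R]_(n, m)) + g u) : U -> T).
Proof.
move=> /measurable_fun_mxP mf /measurable_fun_mxP mg; apply/measurable_fun_mxP => i j.
under eq_fun do rewrite mxE.
exact: measurable_funD (mf i j) (mg i j).
Qed.

Lemma measurable_fun_mxN d (U : measurableType d) (f : U -> T) :
  measurable_fun setT f ->
  measurable_fun setT ((fun u => - (f u : 'M[R]_(n, m))) : U -> T).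
Proof.
move=> /measurable_fun_mxP mf; apply/measurable_fun_mxP => i j.
under eq_fun do rewrite mxE.
by apply: measurableT_comp; [exact: oppr_measurable|exact: mf].
Qed.

Lemma measurable_preimage d d' (U : measurableType d) (U' : measurableType d')
  (f : U -> U') (A : set U') :
  measurable_fun setT f -> measurable A -> measurable (f @^-1` A).
Proof. by move=> mf mA; rewrite -[X in measurable X]setTI; exact: mf. Qed.

(** Fubini for [{(x, y) | A x, C (x + y)}]. For fixed [x] in [A] the slice is a translate of [C];
    for fixed [y], shifting [x] by [y] turns the slice into [{x | A (x - y), C x}], and in this form
    the slices for fixed [x] are translates of [-A]. *)
Lemma haar_swap (mu nu : {sigma_finite_measure set T -> \bar R}) (A C : set T) :
  shift_invariant mu -> shift_invariant nu -> measurable A -> measurable C ->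
  (mu A * nu C = mu C * nu ((fun x : 'M[R]_(n, m) => (- x)%R) @^-1` A))%E.
Proof.
move=> smu snu mA mC.
pose S1 : set (T * T) := [set z | A z.1 /\ C ((z.1 : 'M[R]_(n, m)) + z.2)].
pose S2 : set (T * T) := [set z | A ((z.1 : 'M[R]_(n, m)) - z.2) /\ C z.1].
have mS1 : measurable S1.
  apply: measurableI; first by apply: measurable_preimage => //; exact: measurable_fst.
  exact: (@measurable_preimage _ _ _ _ (fun z : T * T => ((z.1 : 'M[R]_(n, m)) + z.2 : T)) C
    (measurable_fun_mxD measurable_fst measurable_snd)).
have mS2 : measurable S2.
  apply: measurableI; last exact: (@measurable_preimage _ _ _ _ fst C measurable_fst mC).
  exact: (@measurable_preimage _ _ _ _ (fun z : T * T => ((z.1 : 'M[R]_(n, m)) - z.2 : T)) A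
    (measurable_fun_mxD measurable_fst (measurable_fun_mxN measurable_snd))).
have mN : measurable ((fun x : 'M[R]_(n, m) => (- x)%R) @^-1` A : set T).
  exact: (@measurable_preimage _ _ _ _ (fun x : T => (- (x : 'M[R]_(n, m)) : T)) A (measurable_fun_mxN (@measurable_id _ _ _)) mA).
have ind_int (mu' : {measure set T -> \bar R}) (B : set T) (c : \bar R) (F : T -> \bar R) :
  measurable B -> (0 <= c)%E -> (forall x, B x -> F x = c) -> (forall x, ~ B x -> F x = 0%E) ->
  (\int[mu']_x F x = c * mu' B)%E.
  move=> mB c0 FB FN.
  rewrite -integral_cst // [RHS]integral_mkcond; apply: eq_integral => x _.
  rewrite patchE; case: ifPn => [|]; first by rewrite inE => /FB.
  by rewrite notin_setE => /FN.
transitivity (\int[mu]_x nu [set y | S1 (x, y)])%E.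
  rewrite muleC; apply/esym; apply: ind_int => // x.
  - move=> Ax; rewrite -(snu x C mC); congr (nu _).
    by apply/seteqP; split=> y /=; rewrite /S1 /= addrC => // -[].
  - move=> nAx; rewrite (_ : [set y | _] = set0) ?measure0 //.
    by apply/seteqP; split=> // y [].
rewrite fubini_slice //.
transitivity (\int[nu]_y mu [set x | S2 (x, y)])%E.
  apply: eq_integral => y _; rewrite -(smu y [set x | S2 (x, y)]).
    by congr (mu _); apply/seteqP; split=> x /=; rewrite /S1 /S2 /= addrK.
  exact: (measurable_set_slice2 mS2).
rewrite -fubini_slice // muleC.
apply: ind_int => // x.
- move=> Cx; rewrite -(snu (- x) _ mN); congr (nu _).
  by apply/seteqP; split=> y /=; rewrite /S2 /= opprB // => -[].
- move=> nCx; rewrite (_ : [set y | _] = set0) ?measure0 //.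
  by apply/seteqP; split=> // y [].
Qed.

(** With the unit cube as [C], [haar_swap] for [mu] against [V] and for [V] against itself both
    contain the factor [V (-A)]; eliminating it gives the formula. *)
Theorem haar_unique mu (A : set T) : shift_invariant mu ->
  (forall k : nat, mu (@mx_cube R n m (- k%:R) k%:R) < +oo)%E ->
  measurable A -> (mu A = V A * mu (@mx_cube R n m 0 1))%E.
Proof.
case: mu => mu0 c smu fmu mA.
pose mu : {measure set T -> \bar R} := Measure.Pack c.
pose mix := @Measure_isSigmaFinite.Build _ T R mu (@sigma_finite_of_cubes _ _ _ mu fmu).

pose mu' := HB.pack_for (SigmaFiniteMeasure.type T R) (Measure.sort mu) mix.
have V1 : V (@mx_cube R n m 0 1) = 1%E by rewrite lebesgue_mx_cube // subr0 expr1n.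
have sV : shift_invariant V by move=> a B mB; exact: lebesgue_mx_shift.
have mc := @measurable_mx_cube R n m 0 1.
have h1 : (mu A * V (@mx_cube R n m 0 1) =
  mu (@mx_cube R n m 0 1) * V ((fun x : 'M[R]_(n, m) => (- x)%R) @^-1` A))%E.
  exact: (@haar_swap mu' V A _ smu sV mA mc).
have h2 : (V A * V (@mx_cube R n m 0 1) =
  V (@mx_cube R n m 0 1) * V ((fun x : 'M[R]_(n, m) => (- x)%R) @^-1` A))%E.
  exact: (@haar_swap V V A _ sV sV mA mc).
move: h1 h2; rewrite V1 !mule1 mul1e => h1 ->.
by rewrite muleC; exact: h1.
Qed.

Lemma lebesgue_mxN (A : set T) : measurable A ->
  V ((fun x : 'M[R]_(n, m) => (- x)%R) @^-1` A) = V A.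
Proof.
move=> mA; have sV : shift_invariant V by move=> a B mB; exact: lebesgue_mx_shift.
have V1 : V (@mx_cube R n m 0 1) = 1%E by rewrite lebesgue_mx_cube // subr0 expr1n.
have h2 : (V A * V (@mx_cube R n m 0 1) =
  V (@mx_cube R n m 0 1) * V ((fun x : 'M[R]_(n, m) => (- x)%R) @^-1` A))%E.
  exact: (@haar_swap V V A _ sV sV mA (@measurable_mx_cube R n m 0 1)).
by move: h2; rewrite V1 mule1 mul1e => ->.
Qed.

End haar.

(** * Block decompositions of Lebesgue measure *)

Section lebesgue_mx_product.
Context (R : realType) (n m n1 m1 n2 m2 : nat).
Local Notation T1 := (borel_mx R n1 m1).
Local Notation T2 := (borel_mx R n2 m2).
Local Notation T := (borel_mx R n m).
Variable f : T1 * T2 -> T.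
Hypothesis mf : measurable_fun setT f.
Hypothesis fD : forall (x a : 'M[R]_(n1, m1)) (y b : 'M[R]_(n2, m2)),
  f (x + a, y + b) = (f (x, y) : 'M[R]_(n, m)) + f (a, b).
Hypothesis fsurj : forall z : 'M[R]_(n, m), exists ab, f ab = z.
Hypothesis fcube : forall a b : R, f @^-1` (@mx_cube R n m a b) =
  @mx_cube R n1 m1 a b `*` @mx_cube R n2 m2 a b.

(** The pushforward of the product measure under [f] is translation-invariant, because [f] is
    additive and onto, and it has the right value on cubes; uniqueness then takes the place of a
    reindexing of the entries. Stated for an abstract [f] so as to serve both stacked rows and
    adjoined columns. *)
Lemma lebesgue_mx_product (A : set T) : measurable A ->
  lebesgue_mx A = (@lebesgue_mx R n1 m1 \x @lebesgue_mx R n2 m2)%E (f @^-1` A).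
Proof.
move=> mA.
have [mu muE] := pushforward_measure_exists (@lebesgue_mx R n1 m1 \x @lebesgue_mx R n2 m2)%E mf.
have mc1 a b := @measurable_mx_cube R n1 m1 a b.
have mc2 a b := @measurable_mx_cube R n2 m2 a b.
have mucube a b : a <= b ->
  mu (@mx_cube R n m a b) = ((b - a) ^+ (n1 * m1) * (b - a) ^+ (n2 * m2))%:E.
  move=> ab; rewrite muE fcube EFinM.
  apply: etrans (product_measure1E _ _ (mc1 a b) (mc2 a b)) _.
  by congr (_ * _)%E; exact: lebesgue_mx_cube.
rewrite -muE.
have := @haar_unique R n m mu A _ _ mA => ->.
- by rewrite mucube // subr0 !expr1n mulr1 mule1.
- move=> z B mB; have [[a b] <-] := fsurj z.
  rewrite !muE.
  pose s (u : T1 * T2) : T1 * T2 := ((u.1 : 'M[R]_(n1, m1)) + a, (u.2 : 'M[R]_(n2, m2)) + b).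
  have ms : measurable_fun setT s.
    apply: measurable_fun_pair.
      exact: (measurableT_comp (measurable_mx_shift a) measurable_fst).
    exact: (measurableT_comp (measurable_mx_shift b) measurable_snd).
  have [nu nuE] := pushforward_measure_exists (@lebesgue_mx R n1 m1 \x @lebesgue_mx R n2 m2)%E ms.
  have -> : f @^-1` ((fun x : 'M[R]_(n, m) => x + f (a, b)) @^-1` B) = s @^-1` (f @^-1` B).
    by apply/seteqP; split=> -[x y] /=; rewrite /s /= fD.
  rewrite -nuE; apply/esym.
  apply: (@product_measure_unique _ _ _ _ _ _ _ nu); last exact: measurable_preimage.
  move=> X Y mX mY; rewrite nuE.
  have -> : s @^-1` (X `*` Y) = ((fun x : 'M[R]_(n1, m1) => x + a) @^-1` X) `*`
    ((fun y : 'M[R]_(n2, m2) => y + b) @^-1` Y) by [].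
  apply: etrans (product_measure1E _ _ (measurable_preimage (measurable_mx_shift a) mX)
    (measurable_preimage (measurable_mx_shift b) mY)) _.
  by congr (_ * _)%E; exact: lebesgue_mx_shift.
- by move=> k; rewrite mucube ?ltry // (@le_trans _ _ 0) ?oppr_le0.
Qed.

End lebesgue_mx_product.

Section block_lebesgue.
Context (R : realType).

Lemma measurable_col_mx n1 n2 m :
  measurable_fun setT ((fun z => col_mx z.1 z.2) :
    borel_mx R n1 m * borel_mx R n2 m -> borel_mx R (n1 + n2) m).
Proof.
apply/measurable_fun_mxP => i j; under eq_fun do rewrite mxE.
case: splitP => k _.
  exact: (measurableT_comp (measurable_mx_coord k j) measurable_fst).
exact: (measurableT_comp (measurable_mx_coord k j) measurable_snd).
Qed.

Lemma lebesgue_mx_col_mx n1 n2 m (A : set (borel_mx R (n1 + n2) m)) : measurable A ->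
  lebesgue_mx A = (@lebesgue_mx R n1 m \x @lebesgue_mx R n2 m)%E
    [set z | A (col_mx z.1 z.2)].
Proof.
apply: lebesgue_mx_product.
- exact: measurable_col_mx.
- by move=> x a y b /=; rewrite add_col_mx.
- by move=> z; exists (usubmx z, dsubmx z); rewrite /= vsubmxK.
- move=> a b; apply/seteqP; split=> -[x y] /=.
    by move=> h; split=> i j; [have := h (lshift _ i) j; rewrite col_mxEu|have := h (rshift _ i) j; rewrite col_mxEd].
  by move=> [h1 h2] i j; rewrite mxE; case: splitP => k _.
Qed.

Lemma measurable_row_mx n m1 m2 :
  measurable_fun setT ((fun z => row_mx z.1 z.2) :
    borel_mx R n m1 * borel_mx R n m2 -> borel_mx R n (m1 + m2)).
Proof.
apply/measurable_fun_mxP => i j; under eq_fun do rewrite mxE.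
case: splitP => k _.
  exact: (measurableT_comp (measurable_mx_coord i k) measurable_fst).
exact: (measurableT_comp (measurable_mx_coord i k) measurable_snd).
Qed.

Lemma lebesgue_mx_row_mx n m1 m2 (A : set (borel_mx R n (m1 + m2))) : measurable A ->
  lebesgue_mx A = (@lebesgue_mx R n m1 \x @lebesgue_mx R n m2)%E
    [set z | A (row_mx z.1 z.2)].
Proof.
apply: lebesgue_mx_product.
- exact: measurable_row_mx.
- by move=> x a y b /=; rewrite add_row_mx.
- by move=> z; exists (lsubmx z, rsubmx z); rewrite /= hsubmxK.
- move=> a b; apply/seteqP; split=> -[x y] /=.
    by move=> h; split=> i j; [have := h i (lshift _ j); rewrite row_mxEl|have := h i (rshift _ j); rewrite row_mxEr].
  by move=> [h1 h2] i j; rewrite mxE; case: splitP => k _.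
Qed.

End block_lebesgue.

(** * Linear changes of variable *)

Section dilation.
Context (R : realType).

Lemma continuous_mxP (T : topologicalType) n m (f : T -> 'M[R]_(n, m)) :
  (forall i j, continuous (fun t => f t i j)) -> continuous f.
Proof.
move=> cf t; apply/cvg_ballP => e e0.
have h i j : \forall t' \near t, ball (f t i j) e (f t' i j).
  by have /cvg_ballP := cf i j t; apply.
have H : \forall t' \near t, forall ij : 'I_n * 'I_m, ball (f t ij.1 ij.2) e (f t' ij.1 ij.2).
  by apply: filter_forall => -[i j]; exact: h.
by apply: filterS H => t' h'; split=> // i j; exact: (h' (i, j)).
Qed.

Lemma continuous_mulmxl n m k (phi : 'M[R]_(k, n)) :
  continuous (fun x : 'M[R]_(n, m) => phi *m x).
Proof.
apply: continuous_mxP => i j; under eq_fun do rewrite mxE.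
apply: (@continuous_big R 'I_n +%R 0 xpredT (@add_continuous R) _ _
    (fun l (x : 'M[R]_(n, m)) => phi i l * x l j)) => l _ x.
have cij := @coord_continuous R n m l j x.
exact: (cvgM (cvg_cst (phi i l)) cij).
Qed.

Lemma measurable_mulmxl n m k (phi : 'M[R]_(k, n)) :
  measurable_fun setT ((fun x => phi *m x) : borel_mx R n m -> borel_mx R k m).
Proof. by apply: continuous_measurable_mx_mx; exact: continuous_mulmxl. Qed.

Definition mulmx_cube n m (phi : 'M[R]_n) : set (borel_mx R n m) :=
  (fun x : 'M[R]_(n, m) => phi *m x) @^-1` (@mx_cube R n m 0 1).

(** The factor by which preimages under [phi] scale volume in [R^n], that is, the inverse of the
    absolute value of the determinant. *)
Definition dil n (phi : 'M[R]_n) : R := fine (lebesgue_mx (@mulmx_cube n 1 phi)).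

Lemma mulmx_preimage_cube_lty n m (phi : 'M[R]_n) (c : R) : phi \in unitmx ->
  (lebesgue_mx ((fun x : 'M[R]_(n, m) => (phi *m x)%R) @^-1` (@mx_cube R n m (- c) c)) < +oo)%E.
Proof.
move=> uphi.
pose s := \sum_i \sum_j `|invmx phi i j| * `|c|.
pose K := (Num.truncn s).+1%:R : R.
have sK : s < K by exact: truncnS_gt.
have mc a b := @measurable_mx_cube R n m a b.
apply: (@le_lt_trans _ _ (lebesgue_mx (@mx_cube R n m (- K) K))); last first.
  by rewrite lebesgue_mx_cube ?ltry // (@le_trans _ _ 0) ?oppr_le0.
apply: le_measure; rewrite ?inE //; first exact: (measurable_preimage (measurable_mulmxl phi)).
move=> x /= hx i j.
have xE : x = invmx phi *m (phi *m x) by rewrite mulKmx.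
have : `|x i j| < K.
  apply: le_lt_trans sK; rewrite xE mxE.
  apply: le_trans (ler_norm_sum _ _ _) _.
  rewrite /s [leRHS](bigD1 i) //= ler_wpDr //.
    by apply: sumr_ge0 => k _; apply: sumr_ge0 => l _; rewrite mulr_ge0.
  apply: ler_sum => l _; rewrite normrM ler_wpM2l //.
  have /andP[h1 h2] := hx l j.
  by rewrite (le_trans _ (ler_norm _)) // ler_norml h1 ltW.
by rewrite ltr_norml => /andP[h1 ->]; rewrite ltW.
Qed.

(** The pushforward of Lebesgue measure by [phi] is again translation-invariant, so it is a multiple
    of Lebesgue measure, read off on the unit cube. *)
Lemma lebesgue_mx_mull_cube n m (phi : 'M[R]_n) (A : set (borel_mx R n m)) :
  phi \in unitmx -> measurable A ->
  lebesgue_mx ((fun x : 'M[R]_(n, m) => (phi *m x)%R) @^-1` A) =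
  (lebesgue_mx A * lebesgue_mx (@mulmx_cube n m phi))%E.
Proof.
move=> uphi mA.
have [mu muE] := pushforward_measure_exists (@lebesgue_mx R n m) (@measurable_mulmxl n m n phi).
rewrite -[LHS]muE -[X in (_ * X)%E]muE.
apply: haar_unique => //.
- move=> a B mB; rewrite !muE.
  have -> : (fun x : 'M[R]_(n, m) => phi *m x) @^-1` ((fun x : 'M[R]_(n, m) => x + a) @^-1` B)
     = (fun x : 'M[R]_(n, m) => x + invmx phi *m a) @^-1` ((fun x : 'M[R]_(n, m) => phi *m x) @^-1` B).
    by apply/seteqP; split=> x /=; rewrite mulmxDr mulKVmx.
  by apply: lebesgue_mx_shift; exact: (measurable_preimage (measurable_mulmxl phi)).
- by move=> k; rewrite muE; exact: mulmx_preimage_cube_lty.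
Qed.

(** [phi] acts on each column separately, so splitting off a column contributes one more factor
    [dil phi]. *)
Lemma mulmx_cubeE n (phi : 'M[R]_n) m : phi \in unitmx ->
  lebesgue_mx (@mulmx_cube n m phi) = (dil phi ^+ m)%:E.
Proof.
move=> uphi.
have f1 : lebesgue_mx (@mulmx_cube n 1 phi) = (dil phi)%:E.
  rewrite fineK // ge0_fin_numE ?measure_ge0 //.
  apply: le_lt_trans (mulmx_preimage_cube_lty 1 1 uphi).
  apply: le_measure; rewrite ?inE.
  - exact: (measurable_preimage (measurable_mulmxl phi) (measurable_mx_cube _ _)).
  - exact: (measurable_preimage (measurable_mulmxl phi) (measurable_mx_cube _ _)).
  - move=> x h i j; have /andP[h1 ->] := h i j; rewrite andbT.
    by rewrite (le_trans _ h1) // oppr_le0.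
elim: m => [|m IH].
  have -> : @mulmx_cube n 0 phi = @mx_cube R n 0 0 1.
    by apply/seteqP; split=> x h i [].
  by rewrite lebesgue_mx_cube // subr0 expr1n expr0.
rewrite -[m.+1]/(1 + m)%N [LHS]lebesgue_mx_row_mx; last first.
  exact: (measurable_preimage (measurable_mulmxl phi) (measurable_mx_cube _ _)).
have -> : [set z : borel_mx R n 1 * borel_mx R n m | mulmx_cube phi (row_mx z.1 z.2)] =
   (@mulmx_cube n 1 phi) `*` (@mulmx_cube n m phi).
  rewrite /mulmx_cube; apply/seteqP; split=> -[x y] /=; rewrite mul_mx_row.
    by move=> h; split=> i j; [have := h i (lshift _ j); rewrite row_mxEl|have := h i (rshift _ j); rewrite row_mxEr].
  by move=> [h1 h2] i j; rewrite mxE; case: splitP => k _; [exact: h1|exact: h2].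
rewrite product_measure1E.
- by rewrite exprS EFinM; congr (_ * _)%E.
- exact: (measurable_preimage (measurable_mulmxl phi) (measurable_mx_cube _ _)).
- exact: (measurable_preimage (measurable_mulmxl phi) (measurable_mx_cube _ _)).
Qed.

Lemma lebesgue_mx_mull n m (phi : 'M[R]_n) (A : set (borel_mx R n m)) :
  phi \in unitmx -> measurable A ->
  lebesgue_mx ((fun x : 'M[R]_(n, m) => (phi *m x)%R) @^-1` A) =
  (lebesgue_mx A * (dil phi ^+ m)%:E)%E.
Proof. by move=> uphi mA; rewrite lebesgue_mx_mull_cube // mulmx_cubeE. Qed.

Lemma dilV n (phi : 'M[R]_n) : phi \in unitmx -> dil phi * dil (invmx phi) = 1.
Proof.
move=> uphi; have mc := @measurable_mx_cube R n 1 0 1.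
have : lebesgue_mx (@mx_cube R n 1 0 1) =
  (lebesgue_mx (@mx_cube R n 1 0 1) * (dil (invmx phi) ^+ 1)%:E * (dil phi ^+ 1)%:E)%E.
  rewrite -[X in (X * _)%E]lebesgue_mx_mull ?unitmx_inv // -lebesgue_mx_mull //.
    by congr (lebesgue_mx _); apply/seteqP; split=> x /=; rewrite mulKmx.
  exact: (measurable_preimage (measurable_mulmxl (invmx phi)) mc).
rewrite !lebesgue_mx_cube // subr0 expr1n !expr1 mul1e -EFinM => -[].
by rewrite mulrC.
Qed.

Lemma dil_gt0 n (phi : 'M[R]_n) : phi \in unitmx -> 0 < dil phi.
Proof.
move=> uphi; rewrite lt_neqAle fine_ge0 ?measure_ge0 // andbT.
apply/eqP => h; have := dilV uphi; rewrite -h mul0r => /eqP.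
by rewrite eq_sym oner_eq0.
Qed.

Lemma dil_scalar n (t : R) : 0 < t -> dil (t%:M : 'M[R]_n) = (t^-1) ^+ n.
Proof.
move=> t0; rewrite /dil.
have -> : @mulmx_cube n 1 t%:M = @mx_cube R n 1 0 t^-1.
  apply/seteqP; split=> x /= h i j; have := h i j; rewrite /mulmx_cube mul_scalar_mx mxE.
    by rewrite pmulr_rge0 // -ltr_pdivlMl // mulr1.
  by rewrite pmulr_rge0 // -[_ < 1]ltr_pdivlMl // mulr1.
by rewrite lebesgue_mx_cube ?invr_ge0 ?ltW //= subr0 muln1.
Qed.

Lemma lebesgue_mx_scale n m (t : R) (A : set (borel_mx R n m)) : 0 < t -> measurable A ->
  lebesgue_mx ((fun x : 'M[R]_(n, m) => (t *: x)%R) @^-1` A) =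
  (lebesgue_mx A * ((t^-1) ^+ (n * m))%:E)%E.
Proof.
move=> t0 mA; rewrite exprM -dil_scalar // -lebesgue_mx_mull //.
  by congr (lebesgue_mx _); apply/seteqP; split=> x /=; rewrite mul_scalar_mx.
by rewrite unitmxE det_scalar unitrX // unitfE gt_eqF.
Qed.

End dilation.

(** * Euclidean geometry and the Brunn-Minkowski inequality *)

Section inner_enorm.
Context (R : realType) (n m : nat).
Implicit Types x y z : 'M[R]_(n, m).

Lemma innerC x y : inner x y = inner y x.
Proof. by rewrite !innerE; apply: eq_bigr => i _; apply: eq_bigr => j _; rewrite mulrC. Qed.

Lemma innerDr x y z : inner x (y + z) = inner x y + inner x z.
Proof. by rewrite /inner mulmxDr mxtraceD. Qed.

Lemma innerDl x y z : inner (x + y) z = inner x z + inner y z.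
Proof. by rewrite innerC innerDr !(innerC z). Qed.

Lemma innerZr (a : R) x y : inner x (a *: y) = a * inner x y.
Proof. by rewrite /inner -scalemxAr mxtraceZ. Qed.

Lemma innerZl (a : R) x y : inner (a *: x) y = a * inner x y.
Proof. by rewrite innerC innerZr innerC. Qed.

Lemma innerNr x y : inner x (- y) = - inner x y.
Proof. by rewrite -scaleN1r innerZr mulN1r. Qed.

Lemma innerNl x y : inner (- x) y = - inner x y.
Proof. by rewrite innerC innerNr innerC. Qed.

Lemma inner0r x : inner x 0 = 0.
Proof. by rewrite -(scale0r x) innerZr mul0r. Qed.

Lemma inner0l x : inner 0 x = 0.
Proof. by rewrite innerC inner0r. Qed.

Definition innerE_lin := (innerDr, innerDl, innerZr, innerZl, innerNr, innerNl, inner0r, inner0l).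

Lemma inner_ge0 x : 0 <= inner x x.
Proof. by rewrite innerE; do 2! (apply: sumr_ge0 => ? _); rewrite -expr2 sqr_ge0. Qed.

Lemma enorm_ge0 x : 0 <= enorm x.
Proof. exact: sqrtr_ge0. Qed.

Lemma enorm_sqr x : enorm x ^+ 2 = inner x x.
Proof. by rewrite sqr_sqrtr // inner_ge0. Qed.

Lemma le_coord_enorm x i j : `|x i j| <= enorm x.
Proof.
rewrite -sqrtr_sqr ler_wsqrtr // innerE (bigD1 i) //= (bigD1 j) //= -expr2.
rewrite -addrA lerDl addr_ge0 //.
  by apply: sumr_ge0 => ? _; rewrite -expr2 sqr_ge0.
by do 2! (apply: sumr_ge0 => ? _); rewrite -expr2 sqr_ge0.
Qed.

Lemma enorm0 : enorm (0 : 'M[R]_(n, m)) = 0.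
Proof. by rewrite /enorm inner0r sqrtr0. Qed.

Lemma enorm_eq0 x : (enorm x == 0) = (x == 0).
Proof.
apply/eqP/eqP => [x0|->]; last exact: enorm0.
apply/matrixP => i j; rewrite mxE; apply/eqP; rewrite -normr_eq0 eq_le normr_ge0 andbT.
by rewrite -x0 le_coord_enorm.
Qed.

Lemma enorm_gt0 x : (0 < enorm x) = (x != 0).
Proof. by rewrite lt_neqAle enorm_ge0 andbT eq_sym enorm_eq0. Qed.

Lemma enormZ (a : R) x : enorm (a *: x) = `|a| * enorm x.
Proof. by rewrite /enorm innerZl innerZr mulrA -expr2 sqrtrM ?sqr_ge0 // sqrtr_sqr. Qed.

Lemma enormN x : enorm (- x) = enorm x.
Proof. by rewrite -scaleN1r enormZ normrN1 mul1r. Qed.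

Lemma inner_le x y : inner x y <= enorm x * enorm y.
Proof.
have [->|x0] := eqVneq x 0; first by rewrite inner0l enorm0 mul0r.
have [->|y0] := eqVneq y 0; first by rewrite inner0r enorm0 mulr0.
have a0 : 0 < enorm x by rewrite enorm_gt0.
have b0 : 0 < enorm y by rewrite enorm_gt0.
have := inner_ge0 (enorm y *: x - enorm x *: y).
rewrite !innerE_lin -!enorm_sqr (innerC y x).
set a := enorm x; set b := enorm y; set c := inner x y => h.
have ab : 0 < a * b by rewrite mulr_gt0.
have : 0 <= (a * b) * (a * b - c) by rewrite /a /b in h ab *; nra.
by rewrite pmulr_rge0 // subr_ge0.
Qed.

Lemma norm_inner_le x y : `|inner x y| <= enorm x * enorm y.
Proof.
rewrite ler_norml inner_le andbT lerNl -innerNl.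
by apply: le_trans (inner_le _ _) _; rewrite enormN.
Qed.

Lemma enormD x y : enorm (x + y) <= enorm x + enorm y.
Proof.
rewrite -(@ler_pXn2r _ 2) ?nnegrE ?enorm_ge0 ?addr_ge0 ?enorm_ge0 //.
rewrite enorm_sqr !innerE_lin -!enorm_sqr (innerC y x) sqrrD.
by have := inner_le x y; lra.
Qed.

Lemma enormB_le x y : enorm x - enorm y <= enorm (x - y).
Proof. by rewrite lerBlDr -{1}(subrK y x) enormD. Qed.

Lemma enorm_normalize x : x != 0 -> enorm ((enorm x)^-1 *: x) = 1.
Proof.
by move=> x0; rewrite enormZ ger0_norm ?invr_ge0 ?enorm_ge0 // mulVf // enorm_eq0.
Qed.

Lemma continuous_inner y : continuous (fun x => inner x y).
Proof.
rewrite (_ : (fun x => _) = fun x => \sum_i \sum_j x i j * y i j); last first.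
  by apply/funext => z; rewrite innerE.
apply: (@continuous_big R 'I_n +%R 0 xpredT (@add_continuous R) _ _
    (fun i (x : 'M[R]_(n, m)) => \sum_j x i j * y i j)) => i _.
apply: (@continuous_big R 'I_m +%R 0 xpredT (@add_continuous R) _ _
    (fun j (x : 'M[R]_(n, m)) => x i j * y i j)) => j _ x.
have cij := @coord_continuous R n m i j x.
exact: (cvgM cij (cvg_cst _)).
Qed.

Lemma mx_norm_le_enorm x : `|x| <= enorm x.
Proof.
rewrite [leLHS]/Num.norm /= mx_normrE; apply: bigmax_le; first exact: enorm_ge0.
by move=> ij _; exact: le_coord_enorm.
Qed.

Lemma le_coord_norm x i j : `|x i j| <= `|x|.
Proof.
rewrite [leRHS]/Num.norm /= mx_normrE.
exact: (le_bigmax _ (fun ij : 'I_n * 'I_m => `|x ij.1 ij.2|) (i, j)).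
Qed.

Lemma enorm_le_mx_norm x : enorm x <= (n * m)%:R * `|x|.
Proof.
case: (posnP (n * m)) => [nm0|nm0].
  rewrite nm0 mul0r /enorm innerE big1 ?sqrtr0 // => i _; rewrite big1 // => j _.
  suff : (0 < n * m)%N by rewrite nm0.
  by rewrite muln_gt0 (leq_ltn_trans _ (ltn_ord i)) // (leq_ltn_trans _ (ltn_ord j)).
rewrite -(@ler_pXn2r _ 2) ?nnegrE ?enorm_ge0 ?mulr_ge0 // enorm_sqr innerE.
apply: (@le_trans _ _ (\sum_(i < n) \sum_(j < m) `|x| ^+ 2)).
  apply: ler_sum => i _; apply: ler_sum => j _.
  by rewrite -expr2 -[x i j ^+ 2]real_normK ?num_real // ler_pXn2r ?nnegrE // le_coord_norm.
under eq_bigr do rewrite sumr_const card_ord.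
rewrite [leLHS](_ : _ = `|x| ^+ 2 *+ (n * m)); last first.
  by rewrite (eq_bigr (fun=> `|x| ^+ 2 *+ m)) // sumr_const card_ord -mulrnA mulnC.
rewrite -mulr_natl exprMn ler_wpM2r ?sqr_ge0 //.
by rewrite expr2 ler_peMl // ler1n.
Qed.

Definition eball (r : R) : set 'M[R]_(n, m) := [set x | enorm x <= r].

Lemma closed_eball r : closed (eball r).
Proof.
apply: (@preimage_closed _ _ (@enorm R n m) [set y | y <= r]); last exact: closed_le.
by move=> x _; exact: continuous_enorm.
Qed.

Lemma measurable_eball r : measurable (eball r : set (borel_mx R n m)).
Proof. by apply: closed_measurable_mx; exact: closed_eball. Qed.

Lemma enorm_bounded_lty (A : set (borel_mx R n m)) r : measurable A ->
  (forall x, A x -> enorm (x : 'M[R]_(n, m)) <= r) -> (lebesgue_mx A < +oo)%E.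
Proof.
move=> mA h; pose k := (Num.truncn `|r|).+1.
have rk : r < k%:R by apply: le_lt_trans (ler_norm _) (truncnS_gt _).
apply: (@le_lt_trans _ _ (lebesgue_mx (@mx_cube R n m (- k%:R) k%:R))); last first.
  by rewrite lebesgue_mx_cube ?ltry // (@le_trans _ _ 0) ?oppr_le0.
apply: le_measure; rewrite ?inE //; first exact: measurable_mx_cube.
move=> x /h xr i j.
have : `|(x : 'M[R]_(n, m)) i j| < k%:R.
  by apply: le_lt_trans rk; apply: le_trans xr; exact: le_coord_enorm.
by rewrite ltr_norml => /andP[h1 ->]; rewrite ltW.
Qed.

Lemma lebesgue_eball_lty r : (lebesgue_mx (eball r : set (borel_mx R n m)) < +oo)%E.
Proof. by apply: (@enorm_bounded_lty _ r) => //; exact: measurable_eball. Qed.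

Lemma lebesgue_eball_gt0 r : 0 < r -> (0 < lebesgue_mx (eball r : set (borel_mx R n m)))%E.
Proof.
move=> r0; pose e := r / ((n * m)%:R + 1).
have e0 : 0 < e by rewrite divr_gt0 // ltr_wpDl.
apply: (@lt_le_trans _ _ (lebesgue_mx (@mx_cube R n m 0 e))).
  by rewrite lebesgue_mx_cube ?ltW // lte_fin exprn_gt0 // subr0.
apply: le_measure; rewrite ?inE //; [exact: measurable_mx_cube|exact: measurable_eball|].
move=> x hx; rewrite /eball /=; apply: le_trans (enorm_le_mx_norm _) _.
apply: (@le_trans _ _ ((n * m)%:R * e)).
  rewrite ler_wpM2l // [leLHS]/Num.norm /= mx_normrE; apply: bigmax_le; first exact: ltW.
  by move=> ij _; have /andP[h1 h2] := hx ij.1 ij.2; rewrite ger0_norm // ltW.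
rewrite /e mulrCA; apply: ler_piMr; first exact: ltW.
by rewrite ler_pdivrMr ?ltr_wpDl // mul1r lerDl.
Qed.

Lemma lebesgue_eball r : 0 < r -> lebesgue_mx (eball r : set (borel_mx R n m)) =
  ((r ^+ (n * m))%:E * lebesgue_mx (unit_ball : set (borel_mx R n m)))%E.
Proof.
move=> r0; have -> : unit_ball = (fun x : 'M[R]_(n, m) => r *: x) @^-1` (eball r).
  by apply/seteqP; split=> x; rewrite /eball /unit_ball /= enormZ gtr0_norm // -{2}[r]mulr1 ler_pM2l.
rewrite lebesgue_mx_scale //; last exact: measurable_eball.
by rewrite muleC -muleA -EFinM -exprMn mulVf ?gt_eqF // expr1n mule1.
Qed.

Lemma compact_mx (A : set 'M[R]_(n, m)) r :
  closed A -> (forall x, A x -> enorm x <= r) -> compact A.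
Proof.
move=> cA bA.
pose f (x : 'rV[R]_(n * m)) : 'M[R]_(n, m) := vec_mx x.
have cf : continuous f.
  apply: continuous_mxP => i j; under eq_fun do rewrite mxE.
  exact: coord_continuous.
pose C : set 'rV[R]_(n * m) := [set v | forall i, `[- r, r]%classic (v 0 i)].
have cC : compact C by apply: (rV_compact (fun _ : 'I_(n * m) => @segment_compact R (- r) r)).
apply: (@subclosed_compact _ A (f @` C)) => //.
  by apply: continuous_compact => //; apply: continuous_subspaceT.
move=> x Ax; exists (mxvec x); last by rewrite /f mxvecK.
move=> k; case/mxvec_indexP: k => i j; rewrite mxvecE /= in_itv /= -ler_norml.
by apply: le_trans (bA _ Ax); exact: le_coord_enorm.
Qed.

Lemma compact_enorm_bounded (A : set 'M[R]_(n, m)) : compact A ->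
  exists2 r, 0 < r & forall x, A x -> enorm x <= r.
Proof.
move=> /compact_bounded [M [Mr HM]]; exists ((n * m)%:R * (`|M| + 1) + 1).
  by rewrite ltr_wpDl // mulr_ge0 // addr_ge0.
move=> x Ax; apply: le_trans (enorm_le_mx_norm _) _.
apply: (@le_trans _ _ ((n * m)%:R * (`|M| + 1))); last by rewrite lerDl.
by rewrite ler_wpM2l //; apply: (HM (`|M| + 1)) => //; rewrite (le_lt_trans (ler_norm _)) // ltrDl.
Qed.

Lemma compact_closed_mx (A : set 'M[R]_(n, m)) : compact A -> closed A.
Proof. by apply: compact_closed; exact: norm_hausdorff. Qed.

Lemma compact_measurable_mx (A : set 'M[R]_(n, m)) : compact A ->
  measurable (A : set (borel_mx R n m)).
Proof. by move=> /compact_closed_mx; exact: closed_measurable_mx. Qed.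

Lemma compact_lebesgue_lty (A : set 'M[R]_(n, m)) : compact A ->
  (lebesgue_mx (A : set (borel_mx R n m)) < +oo)%E.
Proof.
move=> cA; have [r _ Ar] := compact_enorm_bounded cA.
by apply: (@enorm_bounded_lty _ r) => //; exact: compact_measurable_mx.
Qed.

End inner_enorm.
Arguments eball {R n m}.

(** * Orthogonal maps and reflections *)

Section orthogonal.
Context (R : realType) (n m : nat).
Implicit Types x y : 'M[R]_(n, m).

Lemma inner_mulmxl (phi : 'M[R]_n) x y : inner (phi *m x) y = inner x (phi^T *m y).
Proof. by rewrite /inner trmx_mul -mulmxA. Qed.

Definition is_ortho (O : 'M[R]_n) := O^T *m O = 1%:M.

Lemma inner_ortho O x y : is_ortho O -> inner (O *m x) (O *m y) = inner x y.
Proof. by move=> oO; rewrite inner_mulmxl mulmxA oO mul1mx. Qed.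

Lemma enorm_ortho O x : is_ortho O -> enorm (O *m x) = enorm x.
Proof. by move=> oO; rewrite /enorm inner_ortho. Qed.

Lemma ortho_unit O : is_ortho O -> O \in unitmx.
Proof. by move=> /mulmx1_unit []. Qed.

Definition reflection (w : 'cV[R]_n) : 'M[R]_n := 1%:M - 2%:R *: (w *m w^T).

Lemma mxtrace_cV1 (w : 'cV[R]_n) (y : 'cV[R]_n) : w^T *m y = (inner w y)%:M.
Proof.
apply/matrixP => i j; rewrite !ord1 [RHS]mxE eqxx mulr1n /inner /mxtrace big_ord1.
by rewrite !mxE.
Qed.

Lemma reflectionE w (x : 'cV[R]_n) : reflection w *m x = x - (2 * inner w x) *: w.
Proof.
rewrite /reflection mulmxBl mul1mx -scalemxAl -mulmxA mxtrace_cV1 mul_mx_scalar.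
by rewrite scalerA.
Qed.

Lemma reflection_tr w : (reflection w)^T = reflection w.
Proof. by rewrite /reflection linearB /= linearZ /= trmx_mul trmxK trmx1. Qed.

Lemma reflection_ortho w : enorm w = 1 -> is_ortho (reflection w).
Proof.
move=> w1; rewrite /is_ortho reflection_tr {2}/reflection mulmxBr mulmx1 -scalemxAr mulmxA.
rewrite reflectionE -enorm_sqr w1 expr1n mulr1.
rewrite [w - _](_ : _ = - w); last by rewrite -{1}[w]scale1r -scalerBl -[RHS]scaleN1r; congr (_ *: _); lra.
by rewrite mulNmx scalerN opprK /reflection subrK.
Qed.

Lemma reflectionK w : enorm w = 1 -> reflection w *m reflection w = 1%:M.
Proof. by move=> w1; have := reflection_ortho w1; rewrite /is_ortho reflection_tr. Qed.

Lemma reflection_swap (x y : 'cV[R]_n) : enorm x = enorm y -> x != y ->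
  exists2 w : 'cV[R]_n, enorm w = 1 & reflection w *m x = y.
Proof.
move=> xy nxy; have d0 : x - y != 0 by rewrite subr_eq0.
exists ((enorm (x - y))^-1 *: (x - y)); first exact: enorm_normalize.
rewrite reflectionE innerZl scalerA.
set d := enorm (x - y).
have -> : 2 * (d^-1 * inner (x - y) x) * d^-1 = 1.
  have -> : 2 * (d^-1 * inner (x - y) x) * d^-1 = (2 * inner (x - y) x) / d ^+ 2 by rewrite expr2 invfM; ring.
  have -> : 2 * inner (x - y) x = d ^+ 2.
    rewrite /d enorm_sqr !innerE_lin (innerC y x) -!enorm_sqr xy; ring.
  by rewrite divff // expf_neq0 // enorm_eq0.
by rewrite scale1r opprB addrC subrK.
Qed.

End orthogonal.

(** The unit ball is invariant and has positive finite volume. *)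
Lemma dil_ortho (R : realType) n (O : 'M[R]_n) : is_ortho O -> dil O = 1.
Proof.
move=> oO; have mB := @measurable_eball R n 1 1.
have := lebesgue_mx_mull (ortho_unit oO) mB.
have -> : (fun x : 'M[R]_(n, 1) => O *m x) @^-1` (eball 1) = eball 1.
  by apply/seteqP; split=> x; rewrite /eball /= enorm_ortho.
have : (0 < lebesgue_mx (eball 1 : set (borel_mx R n 1)))%E by exact: lebesgue_eball_gt0.
have : (lebesgue_mx (eball 1 : set (borel_mx R n 1)) < +oo)%E by exact: lebesgue_eball_lty.
case: (lebesgue_mx _) => // b _; rewrite lte_fin => b0 [].
by rewrite expr1 -{1}[b]mulr1 => /(mulfI (lt0r_neq0 b0)) ->.
Qed.

Lemma lebesgue_mx_ortho (R : realType) n m (O : 'M[R]_n) (A : set (borel_mx R n m)) :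
  is_ortho O -> measurable A ->
  lebesgue_mx ((fun x : 'M[R]_(n, m) => (O *m x)%R) @^-1` A) = lebesgue_mx A.
Proof.
by move=> oO mA; rewrite lebesgue_mx_mull ?ortho_unit // dil_ortho // expr1n mule1.
Qed.

(** * The Brunn-Minkowski inequality on the line *)

Section real_line.
Context (R : realType).
Local Notation mu := (@lebesgue_measure R).
Local Notation L := (measurableTypeR R).

Lemma lebesgue_itv_oc (x y : R) : mu `]x, y]%classic = (Num.max 0 (y - x))%:E.
Proof.
rewrite lebesgue_measure_itv /= lte_fin; case: ltP => xy.
  by rewrite -EFinB max_r // subr_ge0 ltW.
by rewrite max_l // subr_le0.
Qed.

Lemma lebesgue_itv_cc_le (x y e : R) : 0 <= e -> y - x <= e -> (mu `[x, y]%classic <= e%:E)%E.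
Proof.
move=> e0 xye; rewrite lebesgue_measure_itv /= lte_fin; case: ltP => xy; last by rewrite lee_fin.
by rewrite -EFinB lee_fin.
Qed.

Lemma lebesgue_measure_scale (s : R) (A : set L) : 0 < s -> measurable A ->
  mu ((fun x : R => x / s) @^-1` A) = (s%:E * mu A)%E.
Proof.
move=> s0 mA.
have mf : measurable_fun setT ((fun x : R => x * s) : L -> L).
  exact: (measurable_funM (@measurable_id _ _ setT) (@measurable_cst _ _ _ _ setT s)).
have mg : measurable_fun setT ((fun x : R => x / s) : L -> L).
  exact: (measurable_funM (@measurable_id _ _ setT) (@measurable_cst _ _ _ _ setT s^-1)).
have [nu nuE] := pushforward_measure_exists mu mg.
have si0 : 0 <= s^-1 by rewrite invr_ge0 ltW.
pose nu' : {measure set L -> \bar R} := mscale (NngNum si0) nu.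
have e : mu A = nu' A.
  apply: (@lebesgue_measure_unique R nu') => // _ [[x y]] _ <-.
  rewrite /nu' /= /mscale /= nuE.
  have -> : (fun u : R => u / s) @^-1` `]x, y] = `](x * s), (y * s)]%classic.
    by apply/seteqP; split=> u /=; rewrite !in_itv /= ltr_pdivlMr // ler_pdivrMr.
  apply: etrans (lebesgue_itv_oc x y) _.
  apply: etrans (esym (congr1 (mule (s^-1)%:E) (lebesgue_itv_oc (x * s) (y * s)))).
  rewrite -EFinM -mulrBl; congr (_%:E).
  by rewrite maxr_pMr // mulr0 mulrCA mulVf ?mulr1 // gt_eqF.
rewrite e /nu' /= /mscale /= nuE muleA -EFinM divff ?mul1e //.
by rewrite gt_eqF.
Qed.

Lemma weighted_AMGM (l a b : R) : 0 < l -> l < 1 -> 0 <= a -> 0 <= b ->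
  a `^ (1 - l) * b `^ l <= (1 - l) * a + l * b.
Proof.
move=> l0 l1 a0 b0; have l1' : 0 < 1 - l by rewrite subr_gt0.
have := @conjugate_powR R (a `^ (1 - l)) (b `^ l) (1 - l)^-1 l^-1.
rewrite -!powRrM !mulfV ?gt_eqF // !powRr1 // !invrK !invr_gt0.
move=> /(_ (powR_ge0 _ _) (powR_ge0 _ _) l1' l0).
by rewrite subrK => /(_ erefl); rewrite [a * _]mulrC [b * _]mulrC.
Qed.

(** [X] and [Y] are the images of the part of [A] below [a] under [x -> (1-l) x + l b] and of the
    part of [B] from [b] on under [y -> (1-l) a + l y]. Both lie in [C], on the two sides of
    [(1-l) a + l b]. With [a] within [e] of [sup A] and [b] within [e] of [inf B], at most [e] of
    each measure is lost. *)
Lemma brunn_minkowski_line (l k : R) (A B C : set L) : 0 < l -> l < 1 ->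
  measurable A -> measurable B -> measurable C ->
  A !=set0 -> B !=set0 -> A `<=` `[- k, k]%classic -> B `<=` `[- k, k]%classic ->
  (forall x y, A x -> B y -> C ((1 - l) * x + l * y)) ->
  ((1 - l)%:E * mu A + l%:E * mu B <= mu C)%E.
Proof.
move=> l0 l1 mA mB mC A0 B0 Ak Bk ABC; have l1' : 0 < 1 - l by rewrite subr_gt0.
have hsA : has_sup A by split=> //; exists k => x /Ak /=; rewrite in_itv => /andP[].
have hiB : has_inf B by split=> //; exists (- k) => x /Bk /=; rewrite in_itv => /andP[].
have fin_mu (D : set L) : D `<=` `[- k, k]%classic -> measurable D -> mu D \is a fin_num.
  move=> Dk mD; rewrite ge0_fin_numE //; apply: (@le_lt_trans _ _ (mu `[- k, k]%classic)).
    by apply: le_measure; rewrite ?inE.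
  by rewrite lebesgue_measure_itv /=; case: ifP; rewrite // -EFinB ltry.
apply/lee_addgt0Pr => e e0.
have [a Aa ae] := sup_adherent e0 hsA.
have [b Bb be] := inf_adherent e0 hiB.
pose c := (1 - l) * a + l * b.
pose X : set L := (fun x : R => (x - l * b) / (1 - l)) @^-1` (A `&` `]-oo, a[%classic).
pose Y : set L := (fun x : R => (x - (1 - l) * a) / l) @^-1` (B `&` `[b, +oo[%classic).
have affE (s t : R) (D : set L) : 0 < s -> measurable D ->
  mu ((fun x : R => (x - t) / s) @^-1` D) = (s%:E * mu D)%E /\
  measurable ((fun x : R => (x - t) / s) @^-1` D : set L).
  move=> s0 mD.
  have mf : measurable_fun setT ((fun x : R => x / s) : L -> L).
    exact: (measurable_funM (@measurable_id _ _ setT) (@measurable_cst _ _ _ _ setT s^-1)).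
  have mg : measurable_fun setT ((fun x : R => x - t) : L -> L).
    exact: (measurable_funD (@measurable_id _ _ setT) (@measurable_cst _ _ _ _ setT (- t))).
  have mp := measurable_preimage mf mD.
  split; last exact: (measurable_preimage mg mp).
  by rewrite -lebesgue_measure_scale // -(lebesgue_measure_shift (- t) mp).
have mA' : measurable (A `&` `]-oo, a[%classic : set L) by exact: measurableI.
have mB' : measurable (B `&` `[b, +oo[%classic : set L) by exact: measurableI.
have [XE mX] := affE _ (l * b) _ l1' mA'.
have [YE mY] := affE _ ((1 - l) * a) _ l0 mB'.
have XY : X `&` Y = set0.
  apply/seteqP; split=> // z [[_ /= zx] [_ /= zy]].
  move: zx zy; rewrite !in_itv /= andbT ltr_pdivrMr // ler_pdivlMr //; lra.
have XYC : X `|` Y `<=` C.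
  move=> z [[Az _]|[Bz _]].
    have := ABC _ _ Az Bb; rewrite mulrC divfK ?gt_eqF //.
    by rewrite subrK.
  have := ABC _ _ Aa Bz; rewrite [l * _]mulrC divfK ?gt_eqF //.
  by rewrite addrC subrK.
have XYle : (mu X + mu Y <= mu C)%E.
  rewrite -measureU //; apply: le_measure; rewrite ?inE //; exact: measurableU.
have AE : (mu A <= mu (A `&` `]-oo, a[%classic) + e%:E)%E.
  apply: (@le_trans _ _ (mu ((A `&` `]-oo, a[%classic) `|` `[a, sup A]%classic))).
    apply: le_measure; rewrite ?inE //; first exact: measurableU.
    move=> x Ax; have [xa|ax] := ltP x a; first by left; split=> //=; rewrite in_itv.
    by right; rewrite /= in_itv /= ax ub_le_sup //; case: hsA.
  apply: le_trans (measureU2 _ _ _) _ => //; apply: leeD => //.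
  by apply: lebesgue_itv_cc_le; move: ae e0; lra.
have BE : (mu B <= mu (B `&` `[b, +oo[%classic) + e%:E)%E.
  apply: (@le_trans _ _ (mu ((B `&` `[b, +oo[%classic) `|` `[inf B, b]%classic))).
    apply: le_measure; rewrite ?inE //; first exact: measurableU.
    move=> x Bx; have [bx|xb] := leP b x; first by left; split=> //=; rewrite in_itv /= bx.
    by right; rewrite /= in_itv /= (ltW xb) andbT ge_inf //; case: hiB.
  apply: le_trans (measureU2 _ _ _) _ => //; apply: leeD => //.
  by apply: lebesgue_itv_cc_le; move: be e0; lra.
apply: (@le_trans _ _ ((1 - l)%:E * (mu (A `&` `]-oo, a[%classic) + e%:E) +
   l%:E * (mu (B `&` `[b, +oo[%classic) + e%:E))%E).
  by apply: leeD; apply: lee_wpmul2l => //; rewrite lee_fin ltW.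
have fA : mu (A `&` `]-oo, a[%classic) \is a fin_num by apply: fin_mu => // x [/Ak].
have fB : mu (B `&` `[b, +oo[%classic) \is a fin_num by apply: fin_mu => // x [/Bk].
apply: le_trans (leeD2r e%:E XYle); rewrite -/X -/Y XE YE.
move: fA fB; case: (mu _) => // r1 _; case: (mu _) => // r2 _.
by rewrite -?EFinD -?EFinM -?EFinD lee_fin; lra.
Qed.

End real_line.

Section layer_cake.
Context d (T : measurableType d) (R : realType).
Variable mu : {sigma_finite_measure set T -> \bar R}.
Local Notation L := (measurableTypeR R).

Lemma measurable_subgraph (f : T -> L) : measurable_fun setT f ->
  measurable [set z : T * L | 0 <= z.2 < f z.1].
Proof.
move=> mf; rewrite (_ : [set z | _] = [set z : T * L | 0 <= z.2] `&` [set z : T * L | z.2 < f z.1]); last first.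
  by apply/seteqP; split=> z /=; [move=> /andP[]|move=> [? ?]; apply/andP].
have mfst : measurable_fun setT (fun z : T * L => f z.1) by exact: (measurableT_comp mf measurable_fst).
apply: measurableI.
  rewrite [X in measurable X](_ : _ = snd @^-1` `[0, +oo[%classic).
    by apply: (measurable_preimage measurable_snd).
  by apply/seteqP; split=> z /=; rewrite in_itv /= andbT.
have := @measurable_fun_ltr _ _ R setT (snd : T * L -> R) (fun z : T * L => f z.1) measurable_snd mfst.
move=> /(_ measurableT [set true] Logic.I).
rewrite setTI; congr measurable; apply/seteqP; split=> z /=; by [].
Qed.

Lemma lebesgue_measure_0itv (a : R) : 0 <= a -> lebesgue_measure [set t : R | 0 <= t < a] = a%:E.
Proof.
move=> a0; have -> : [set t : R | 0 <= t < a] = `[0, a[%classic by apply/seteqP; split=> t /=; rewrite in_itv.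
rewrite lebesgue_measure_itv /= lte_fin; case: ltP => [_|a0']; first by rewrite sube0.
by congr (_%:E); apply: le_anti; rewrite a0 a0'.
Qed.

Lemma layer_cake (f : T -> L) : measurable_fun setT f -> (forall x, 0 <= f x) ->
  (\int[mu]_x (f x)%:E = \int[lebesgue_measure]_t mu [set x | (0 <= t < f x)%R])%E.
Proof.
move=> mf f0; have mS := measurable_subgraph mf.
rewrite -(fubini_slice mu (@lebesgue_measure R) mS).
by apply: eq_integral => x _; rewrite /= lebesgue_measure_0itv.
Qed.

Lemma measurable_fun_layer (f : T -> L) : measurable_fun setT f ->
  measurable_fun setT (fun t : L => mu [set x | (0 <= t < f x)%R]).
Proof. by move=> mf; exact: (measurable_fun_slice2 mu (measurable_subgraph mf)). Qed.

Lemma measurable_layer (f : T -> L) t : measurable_fun setT f ->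
  measurable [set x | (0 <= t < f x)%R].
Proof. by move=> mf; exact: (measurable_set_slice2 (measurable_subgraph mf) t). Qed.

End layer_cake.

(** * From the line to all dimensions: the Prekopa-Leindler inequality *)

Section prekopa_leindler_line.
Context (R : realType).
Local Notation mu := (@lebesgue_measure R).
Local Notation L := (measurableTypeR R).

(** Dividing [F] and [G] by their suprema makes all their superlevel sets at levels in [[0, 1)]
    nonempty, so that the one-dimensional Brunn-Minkowski inequality applies at every level.
    Integrating over the levels gives an arithmetic mean, which dominates the geometric one. *)
Lemma prekopa_leindler_line (l k M a b c : R) (F G H : L -> L) : 0 < l -> l < 1 ->
  measurable_fun setT F -> measurable_fun setT G -> measurable_fun setT H ->
  (forall x, 0 <= F x <= M) -> (forall x, 0 <= G x <= M) -> (forall x, 0 <= H x) ->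
  (forall x, F x != 0 -> - k <= x <= k) -> (forall x, G x != 0 -> - k <= x <= k) ->
  (forall x y, F x `^ (1 - l) * G y `^ l <= H ((1 - l) * x + l * y)) ->
  (\int[mu]_x (F x)%:E = a%:E)%E -> (\int[mu]_x (G x)%:E = b%:E)%E ->
  (\int[mu]_x (H x)%:E = c%:E)%E ->
  a `^ (1 - l) * b `^ l <= c.
Proof.
move=> l0 l1 mF mG mH F0 G0 H0 Fk Gk FGH aE bE cE.
have l1' : 0 < 1 - l by rewrite subr_gt0.
have F0' x : 0 <= F x by have /andP[] := F0 x.
have G0' x : 0 <= G x by have /andP[] := G0 x.
have c0 : 0 <= c by rewrite -lee_fin -cE integral_ge0 // => x _; rewrite lee_fin.
have a0 : 0 <= a by rewrite -lee_fin -aE integral_ge0 // => x _; rewrite lee_fin.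
have b0 : 0 <= b by rewrite -lee_fin -bE integral_ge0 // => x _; rewrite lee_fin.
have [->|an0] := eqVneq a 0; first by rewrite powR0 ?gt_eqF // mul0r.
have [->|bn0] := eqVneq b 0; first by rewrite powR0 ?gt_eqF // mulr0.
have sup_of (P : L -> L) (e : R) : (forall x, 0 <= P x <= M) -> (\int[mu]_x (P x)%:E = e%:E)%E ->
  e != 0 -> exists2 S, 0 < S & (forall x, P x <= S) /\ (forall t, t < S -> exists x, t < P x).
  move=> P0 eE e0.
  have hs : has_sup (range P).
    by split; [exists (P 0); exists 0|exists M => _ [x _ <-]; have /andP[] := P0 x].
  have le_S x : P x <= sup (range P) by apply: ub_le_sup; [case: hs|exists x].
  exists (sup (range P)); last first.
    split=> // t tS; have d0 : 0 < sup (range P) - t by rewrite subr_gt0.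
    have [_ [x _ <-]] := sup_adherent d0 hs.
    by rewrite opprB addrC subrK => h; exists x.
  rewrite lt_neqAle (le_trans _ (le_S 0)) ?andbT; last by have /andP[] := P0 0.
  apply: contra_neq e0 => S0.
  have : (\int[mu]_x (P x)%:E = \int[mu]_(x in setT) 0)%E.
    apply: eq_integral => x _; congr (_%:E); apply: le_anti.
    have /andP[-> _] := P0 x; rewrite andbT S0; exact: le_S.
  by rewrite eE integral0 => -[].
have [S S0 [FS SF]] := sup_of F a F0 aE an0.
have [K K0 [GK KG]] := sup_of G b G0 bE bn0.
pose s := S `^ (1 - l) * K `^ l.
have s0 : 0 < s by rewrite mulr_gt0 // powR_gt0.
have iv (x y : R) : 0 < x -> x^-1 `^ y = (x `^ y)^-1.
  move=> x0; have xy0 : x `^ y != 0 by rewrite gt_eqF // powR_gt0.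
  apply: (mulfI xy0); rewrite -powRM ?invr_ge0 ?ltW //.
  by rewrite divff ?gt_eqF // divff // powR1.
have sE : s^-1 = S^-1 `^ (1 - l) * K^-1 `^ l by rewrite !iv // invfM.
have intZ (P : L -> L) (e d : R) : 0 < d -> measurable_fun setT P -> (forall x, 0 <= P x) ->
  (\int[mu]_x (P x)%:E = e%:E)%E -> (\int[mu]_x (d * P x)%:E = (d * e)%:E)%E.
  move=> d0 mP P0 eE; under eq_integral do rewrite EFinM.
  rewrite ge0_integralZl_EFin ?ltW // ?eE //.
    by move=> x _; rewrite lee_fin.
  exact/measurable_EFinP.
have mZ (P : L -> L) (d : R) : measurable_fun setT P -> measurable_fun setT ((fun x => d * P x) : L -> L).
  by move=> mP; exact: (measurable_funM (@measurable_cst _ _ _ _ setT d) mP).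
pose f x := S^-1 * F x; pose g x := K^-1 * G x; pose h x := s^-1 * H x.
have mf : measurable_fun setT (f : L -> L) by exact: mZ.
have mg : measurable_fun setT (g : L -> L) by exact: mZ.
have mh : measurable_fun setT (h : L -> L) by exact: mZ.
have f0 x : 0 <= f x by rewrite mulr_ge0 // invr_ge0 ltW.
have g0 x : 0 <= g x by rewrite mulr_ge0 // invr_ge0 ltW.
have h0 x : 0 <= h x by rewrite mulr_ge0 // invr_ge0 ltW.
have fE : (\int[mu]_x (f x)%:E = (S^-1 * a)%:E)%E by apply: intZ; rewrite ?invr_gt0.
have gE : (\int[mu]_x (g x)%:E = (K^-1 * b)%:E)%E by apply: intZ; rewrite ?invr_gt0.
have hE : (\int[mu]_x (h x)%:E = (s^-1 * c)%:E)%E by apply: intZ; rewrite ?invr_gt0.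
have fgh x y : f x `^ (1 - l) * g y `^ l <= h ((1 - l) * x + l * y).
  rewrite /f /g /h !powRM ?invr_ge0 ?(ltW S0) ?(ltW K0) //.
  by rewrite mulrACA -sE ler_pM2l ?invr_gt0.
have key : ((1 - l) * (S^-1 * a) + l * (K^-1 * b) <= s^-1 * c).
  rewrite -lee_fin EFinD (EFinM (1 - l)) (EFinM l) -fE -gE -hE.
  rewrite !layer_cake //.
  have ml (P : L -> L) : measurable_fun setT P ->
    measurable_fun setT (fun t : L => mu [set x | (0 <= t < P x)%R]) by move=> mP; exact: measurable_fun_layer.
  rewrite -!ge0_integralZl_EFin ?(ltW l0) ?(ltW l1') //; [|exact: ml|exact: ml].
  rewrite -ge0_integralD //.
  - apply: ge0_le_integral => //.
    + by move=> t _; apply: adde_ge0; apply: mule_ge0; rewrite // lee_fin ltW.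
    + by apply: emeasurable_funD; apply: measurable_funeM; exact: ml.
    + exact: ml.
    + move=> t _.
      case: (boolP (t < 0)) => [t0|]; last rewrite -leNgt => t0.
        have e0 (P : L -> L) : [set x | 0 <= t < P x] = set0.
          by apply/seteqP; split=> // x /=; rewrite leNgt t0.
        by rewrite !e0 !measure0 !mule0 adde0.
      have [t1|t1] := leP 1 t.
        have e1 (P : L -> L) : (forall x, P x <= 1) -> [set x | 0 <= t < P x] = set0.
          by move=> P1; apply/seteqP; split=> // x /= /andP[_]; rewrite ltNge (le_trans (P1 x)).
        rewrite (e1 f) ?(e1 g) ?measure0 ?mule0 ?adde0 //.
          by move=> x; rewrite /g ler_pdivrMl // mulr1.
        by move=> x; rewrite /f ler_pdivrMl // mulr1.
      apply: (@brunn_minkowski_line R l k) => //.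
      * exact: measurable_layer.
      * exact: measurable_layer.
      * exact: measurable_layer.
      * have [|x tx] := SF (t * S); first by rewrite gtr_pMl.
        by exists x; rewrite /= t0 /f ltr_pdivlMl // mulrC.
      * have [|x tx] := KG (t * K); first by rewrite gtr_pMl.
        by exists x; rewrite /= t0 /g ltr_pdivlMl // mulrC.
      * move=> x /= /andP[_ tx]; rewrite in_itv /=; apply: Fk.
        by apply: contraTneq tx => Fx0; rewrite /f Fx0 mulr0 -leNgt.
      * move=> x /= /andP[_ tx]; rewrite in_itv /=; apply: Gk.
        by apply: contraTneq tx => Fx0; rewrite /g Fx0 mulr0 -leNgt.
      * move=> x y /= /andP[_ tx] /andP[_ ty]; rewrite t0 /=.
        apply: lt_le_trans (fgh x y).
        have -> : t = t `^ (1 - l) * t `^ l.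
          have [->|tn0] := eqVneq t 0; first by rewrite !powR0 ?gt_eqF // mulr0.
          by rewrite -powRD ?subrK ?powRr1 // tn0 implybT.
        by apply: ltr_pM; rewrite ?powR_ge0 //; apply: gt0_ltr_powR; rewrite ?nnegrE.
  - by move=> t _; apply: mule_ge0; rewrite // lee_fin ltW.
  - by apply: measurable_funeM; exact: ml.
  - by move=> t _; apply: mule_ge0; rewrite // lee_fin ltW.
  - by apply: measurable_funeM; exact: ml.
have a0' : 0 <= S^-1 * a by rewrite mulr_ge0 // invr_ge0 ltW.
have b0' : 0 <= K^-1 * b by rewrite mulr_ge0 // invr_ge0 ltW.
have := le_trans (weighted_AMGM l0 l1 a0' b0') key.
rewrite !powRM ?invr_ge0 ?(ltW S0) ?(ltW K0) //.
by rewrite mulrACA -sE ler_pM2l ?invr_gt0.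
Qed.

End prekopa_leindler_line.

Section tuple_brunn_minkowski.
Context (R : realType).
Local Notation L := (measurableTypeR R).

(** Induction on the dimension: the volumes of the slices at a given first coordinate satisfy the
    hypothesis of [prekopa_leindler_line] by the induction hypothesis. The common cube keeps all
    these volumes finite and bounded. *)
Lemma tuple_brunn_minkowski (l : R) n (k : R) (A B C : set (n.-tuple L)) : 0 < l -> l < 1 -> 0 <= k ->
  measurable A -> measurable B -> measurable C ->
  A `<=` @tuple_cube R n (- k) k -> B `<=` @tuple_cube R n (- k) k -> C `<=` @tuple_cube R n (- k) k ->
  (forall x y : n.-tuple R, A x -> B y -> C [tuple (1 - l) * tnth x i + l * tnth y i | i < n]) ->
  fine (lebesgue_tuple R n A) `^ (1 - l) * fine (lebesgue_tuple R n B) `^ l <=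
    fine (lebesgue_tuple R n C).
Proof.
move=> l0 l1 k0; have l1' : 0 < 1 - l by rewrite subr_gt0.
have kk : - k <= k by rewrite (le_trans _ k0) // oppr_le0.
elim: n A B C => [|n IH] A B C mA mB mC Ak Bk Ck ABC.
  have dE (D : set (0.-tuple L)) : lebesgue_tuple R 0 D = ([tuple] \in D)%:R%:E by exact: diracE.
  rewrite !dE /=; have [|nA] := boolP (_ \in A); last by rewrite powR0 ?gt_eqF // mul0r ler0n.
  have [|nB] := boolP (_ \in B); last by rewrite [0%:R `^ _]powR0 ?gt_eqF // mulr0 ler0n.
  rewrite !inE => B0 A0; have C0 := ABC _ _ A0 B0.
  rewrite (tuple0 [tuple _ | _ < 0]) in C0.
  by rewrite (mem_set C0) !powR1 mulr1.
pose sl (D : set (n.+1.-tuple L)) (x : L) : set (n.-tuple L) := [set t | D (cons_pair (x, t))].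
have slk D x : D `<=` @tuple_cube R n.+1 (- k) k -> sl D x `<=` @tuple_cube R n (- k) k.
  move=> Dk t /Dk h i; have := h (lift ord0 i).
  by rewrite /cons_pair /= tnthS; congr (_ <= tnth _ _ < _); exact: val_inj.
have mp D : measurable D -> measurable (cons_pair (R:=R) (n:=n) @^-1` D).
  by move=> mD; exact: (measurable_preimage (@measurable_cons_pair R n) mD).
have msl D x : measurable D -> measurable (sl D x).
  by move=> mD; exact: (measurable_set_slice1 (mp D mD) x).
have slle D x : D `<=` @tuple_cube R n.+1 (- k) k -> measurable D ->
   (lebesgue_tuple R n (sl D x) <= ((k - - k) ^+ n)%:E)%E.
  move=> Dk mD; rewrite -(lebesgue_tuple_cube n kk).
  by apply: le_measure; rewrite ?inE; [exact: msl|exact: measurable_tuple_cube|exact: slk].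
have slE D x : D `<=` @tuple_cube R n.+1 (- k) k -> measurable D ->
   lebesgue_tuple R n (sl D x) = (fine (lebesgue_tuple R n (sl D x)))%:E.
  move=> Dk mD; rewrite fineK // ge0_fin_numE //.
  by apply: le_lt_trans (slle D x Dk mD) _; rewrite ltry.
have VE D : D `<=` @tuple_cube R n.+1 (- k) k -> measurable D ->
  (\int[lebesgue_measure]_x (fine (lebesgue_tuple R n (sl D x)))%:E = (fine (lebesgue_tuple R n.+1 D))%:E)%E.
  move=> Dk mD; rewrite fineK; last first.
    rewrite ge0_fin_numE //; apply: (@le_lt_trans _ _ (lebesgue_tuple R n.+1 (@tuple_cube R n.+1 (- k) k))).
      by apply: le_measure; rewrite ?inE //; exact: measurable_tuple_cube.
    by rewrite lebesgue_tuple_cube // ltry.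
  transitivity ((@lebesgue_measure R \x lebesgue_tuple R n)%E (cons_pair (R:=R) (n:=n) @^-1` D)) => //.
  rewrite (product_measure_slice1 (@lebesgue_measure R) (lebesgue_tuple R n) (cons_pair (R:=R) (n:=n) @^-1` D)).
  by apply: eq_integral => x _; rewrite -slE.
have mF D : D `<=` @tuple_cube R n.+1 (- k) k -> measurable D ->
  measurable_fun setT ((fun x => fine (lebesgue_tuple R n (sl D x))) : L -> L).
  move=> Dk mD; apply: (measurableT_comp (fine_measurable measurableT)).
  exact: (measurable_fun_slice1 (lebesgue_tuple R n) (mp D mD)).
have supp D x : D `<=` @tuple_cube R n.+1 (- k) k -> fine (lebesgue_tuple R n (sl D x)) != 0 -> - k <= x <= k.
  move=> Dk; apply: contraR => nx; rewrite (_ : sl D x = set0) ?measure0 //.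
  apply/seteqP; split=> // t /Dk /(_ ord0); rewrite /cons_pair /= tnth0 => /andP[h1 h2].
  by move: nx; rewrite h1 ltW.
apply: (@prekopa_leindler_line R l k ((k - - k) ^+ n) _ _ _ _ _ _ l0 l1 (mF A Ak mA) (mF B Bk mB) (mF C Ck mC) _ _ _ _ _ _ (VE A Ak mA) (VE B Bk mB) (VE C Ck mC)).
- by move=> x; rewrite fine_ge0 //= -lee_fin -slE // slle.
- by move=> x; rewrite fine_ge0 //= -lee_fin -slE // slle.
- by move=> x; rewrite fine_ge0.
- by move=> x; exact: supp.
- by move=> x; exact: supp.
- move=> x y; apply: IH; [exact: msl|exact: msl|exact: msl|exact: slk|exact: slk|exact: slk|].
  move=> t u At Bu; have := ABC _ _ At Bu; rewrite /sl /=; congr (C _).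
  apply: eq_from_tnth => i; rewrite tnth_mktuple /cons_pair /=.
  by case: (unliftP ord0 i) => [j ->|->]; rewrite ?tnthS ?tnth0 // !(tnth_mktuple, tnthS);
   congr (_ * tnth _ _ + _ * tnth _ _); exact: val_inj.
Qed.

End tuple_brunn_minkowski.

Section brunn_minkowski.
Context (R : realType) (n m : nat).
Local Notation T := (borel_mx R n m).
Local Notation V := (@lebesgue_mx R n m).
Implicit Types A B C : set T.

Definition enorm_bounded (A : set 'M[R]_(n, m)) := exists r, forall x, A x -> enorm x <= r.

Lemma enorm_bounded_fin_num A : measurable A -> enorm_bounded A -> V A \is a fin_num.
Proof. by move=> mA [r Ar]; rewrite ge0_fin_numE // (@enorm_bounded_lty _ _ _ _ r). Qed.

Lemma brunn_minkowski_mul (l : R) A B C : 0 < l -> l < 1 ->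
  measurable A -> measurable B -> measurable C ->
  enorm_bounded A -> enorm_bounded B -> (V C < +oo)%E ->
  (forall x y : 'M[R]_(n, m), A x -> B y -> C ((1 - l) *: x + l *: y)) ->
  fine (V A) `^ (1 - l) * fine (V B) `^ l <= fine (V C).
Proof.
move=> l0 l1 mA mB mC [r Ar] [s Bs] Cy ABC.
have l1' : 0 < 1 - l by rewrite subr_gt0.
pose k : R := (Num.truncn (`|r| + `|s|)).+1%:R.
have rk : `|r| + `|s| < k by exact: truncnS_gt.
have r0 := normr_ge0 r; have s0 := normr_ge0 s.
have mk : measurable (@mx_cube R n m (- k) k : set T) by exact: measurable_mx_cube.
have sub (D : set T) c : c < k -> (forall x, D x -> enorm (x : 'M[R]_(n, m)) <= c) -> D `<=` @mx_cube R n m (- k) k.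
  move=> ck Dc x /Dc xc i j.
  have : `|(x : 'M[R]_(n, m)) i j| < k.
    by apply: le_lt_trans ck; apply: le_trans xc; exact: le_coord_enorm.
  by rewrite ltr_norml => /andP[h1 ->]; rewrite ltW.
have Ak : A `<=` @mx_cube R n m (- k) k.
  by apply: (@sub _ `|r|) => [|x /Ar /le_trans]; [lra|apply; exact: ler_norm].
have Bk : B `<=` @mx_cube R n m (- k) k.
  by apply: (@sub _ `|s|) => [|x /Bs /le_trans]; [lra|apply; exact: ler_norm].
(* Averages of points of [A] and [B] stay in the cube, so [C] may be cut down to it. *)
pose C' := C `&` (@mx_cube R n m (- k) k : set T).
have mC' : measurable C' by exact: measurableI.
apply: (@le_trans _ _ (fine (V C'))); last first.
  apply: fine_le; rewrite ?ge0_fin_numE //; last by apply: le_measure; rewrite ?inE // => x [].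
  by apply: le_lt_trans Cy; apply: le_measure; rewrite ?inE // => x [].
have mt (D : set T) : measurable D -> measurable (@mx_of_tuple R n m @^-1` D).
  by move=> mD; exact: (measurable_preimage (@measurable_mx_of_tuple R n m) mD).
have ct (D : set T) : D `<=` @mx_cube R n m (- k) k -> @mx_of_tuple R n m @^-1` D `<=` @tuple_cube R (n * m) (- k) k.
  by move=> Dk; rewrite -mx_of_tuple_cube => t; exact: Dk.
have k0 : 0 <= k by rewrite ler0n.
have C'k : C' `<=` @mx_cube R n m (- k) k by move=> x [].
apply: (@tuple_brunn_minkowski R l (n * m) k _ _ _ l0 l1 k0 (mt A mA) (mt B mB) (mt C' mC') (ct A Ak) (ct B Bk) (ct C' C'k)).
move=> x y Ax By; rewrite /= /C'.
have -> : mx_of_tuple [tuple (1 - l) * tnth x i + l * tnth y i | i < n * m] =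
   (1 - l) *: (mx_of_tuple x : 'M[R]_(n, m)) + l *: (mx_of_tuple y : 'M[R]_(n, m)).
  by apply/matrixP => i j; rewrite mx_of_tupleE tnth_mktuple !mxE.
split; first exact: ABC.
move=> i j; have /andP[h1 h2] := Ak _ Ax i j; have /andP[h3 h4] := Bk _ By i j.
rewrite !mxE; rewrite !mx_of_tupleE in h1 h2 h3 h4 *.
move: h1 h2 h3 h4; set u := tnth x _; set v := tnth y _ => h1 h2 h3 h4.
by apply/andP; split; nra.
Qed.

Lemma le_lebesgue_mean (l : R) A B C : 0 < l -> l < 1 ->
  measurable A -> measurable B -> measurable C ->
  enorm_bounded A -> enorm_bounded B -> V A = V B ->
  (forall x y : 'M[R]_(n, m), A x -> B y -> C ((1 - l) *: x + l *: y)) ->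
  (V A <= V C)%E.
Proof.
move=> l0 l1 mA mB mC bA bB AB ABC.
have := brunn_minkowski_mul l0 l1 mA mB mC bA bB.
have [Cy|] := ltP (V C) +oo%E; last by rewrite leye_eq => /eqP -> _; rewrite leey.
move=> /(_ erefl ABC); rewrite -AB.
have fA := enorm_bounded_fin_num mA bA.
have fC : V C \is a fin_num by rewrite ge0_fin_numE.
have [A0|A0] := eqVneq (fine (V A)) 0.
  by rewrite -(fineK fA) A0.
rewrite -powRD ?A0 ?implybT // subrK powRr1 ?fine_ge0 //.
by rewrite -lee_fin !fineK.
Qed.

(** Rescaling [A] and [B] to volume 1 reduces the additive form to sets of equal volume, with weight
    [l = b / (a + b)]. *)
Lemma brunn_minkowski_add (a b : R) A B C : 0 < a -> 0 < b ->
  measurable A -> measurable B -> measurable C ->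
  enorm_bounded A -> enorm_bounded B ->
  V A = (a ^+ (n * m))%:E -> V B = (b ^+ (n * m))%:E ->
  (forall x y : 'M[R]_(n, m), A x -> B y -> C (x + y)) ->
  (((a + b) ^+ (n * m))%:E <= V C)%E.
Proof.
move=> a0 b0 mA mB mC bA bB AE BE ABC.
have ab0 : 0 < a + b by rewrite addr_gt0.
pose sc t (D : set T) : set T := (fun x : 'M[R]_(n, m) => t *: x) @^-1` D.
have msc t D : measurable D -> measurable (sc t D).
  move=> mD; rewrite /sc (_ : (fun x => _) = (fun x : 'M[R]_(n, m) => (t%:M : 'M[R]_n) *m x)).
    exact: (measurable_preimage (measurable_mulmxl t%:M) mD).
  by apply/funext => x; rewrite mul_scalar_mx.
have bsc t D : 0 < t -> enorm_bounded D -> enorm_bounded (sc t D).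
  move=> t0 [r Dr]; exists (t^-1 * r) => x /Dr.
  by rewrite enormZ gtr0_norm // ler_pdivlMl.
have scE t D : 0 < t -> V D = (t ^+ (n * m))%:E -> measurable D -> V (sc t D) = 1%E.
  by move=> t0 DE mD; rewrite /sc lebesgue_mx_scale // DE -EFinM -exprMn divff ?expr1n // gt_eqF.
have : (V (sc a A) <= V (sc (a + b)%R C))%E.
  apply: (@le_lebesgue_mean (b / (a + b)) (sc a A) (sc b B)); try exact: msc; try exact: bsc.
  - by rewrite divr_gt0.
  - by rewrite ltr_pdivrMr // mul1r ltrDr.
  - by rewrite !scE.
  move=> x y Ax By; rewrite /sc /= scalerDr !scalerA.
  rewrite (_ : (a + b) * _ = a); last by field; rewrite gt_eqF.
  rewrite (_ : (a + b) * _ = b); last by field; rewrite gt_eqF.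
  exact: ABC.
rewrite scE // /sc lebesgue_mx_scale //.
have p0 : 0 < (a + b) ^+ (n * m) by rewrite exprn_gt0.
move=> h; rewrite -[X in (_ <= X)%E]mule1 -(divff (lt0r_neq0 p0)) EFinM muleCA.
rewrite -[X in (X <= _)%E]mule1; apply: lee_pmul => //; first by rewrite lee_fin ltW.
by rewrite -exprVn.
Qed.

(** [A] and [-A] have the same volume, and the hypothesis places their mean in [C]. This is what
    happens on a single fibre of a Steiner symmetrization. *)
Lemma le_lebesgue_half_diff A C : measurable A -> measurable C -> enorm_bounded A ->
  (forall x y : 'M[R]_(n, m), A x -> A y -> C (2^-1 *: (x - y))) ->
  (V A <= V C)%E.
Proof.
move=> mA mC [r Ar] AC.
apply: (@le_lebesgue_mean 2^-1 A ((fun x : 'M[R]_(n, m) => - x) @^-1` A)) => //.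
- by rewrite invf_lt1 ?ltr1n.
- exact: (@measurable_preimage _ _ _ _ (fun x : T => (- (x : 'M[R]_(n, m)) : T)) A (measurable_fun_mxN (@measurable_id _ _ _)) mA).
- by exists r.
- by exists r => x /Ar; rewrite enormN.
- by rewrite lebesgue_mxN.
move=> x y Ax Ay; have := AC _ _ Ax Ay; congr (C _).
by rewrite opprK scalerDr; congr (_ *: _ + _); lra.
Qed.

End brunn_minkowski.

(** * Polar coordinates and sublevel sets *)

Lemma sigma_finite_pack d (T : measurableType d) (R : realType) (mu : {measure set T -> \bar R}) :
  sigma_finite setT mu -> exists nu : {sigma_finite_measure set T -> \bar R}, forall A, nu A = mu A.
Proof.
case: mu => mu0 c sf; pose mu : {measure set T -> \bar R} := Measure.Pack c.
pose mix := @Measure_isSigmaFinite.Build _ T R mu sf.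
by exists (HB.pack_for (SigmaFiniteMeasure.type T R) (Measure.sort mu) mix).
Qed.

Lemma pushforward_integral d1 d2 (T1 : measurableType d1) (T2 : measurableType d2)
    (R : realType) (mu : {measure set T1 -> \bar R}) (f : T1 -> T2) :
  measurable_fun setT f ->
  exists nu : {measure set T2 -> \bar R}, (forall A, nu A = mu (f @^-1` A)) /\
    (forall D (h : T2 -> \bar R), measurable D -> measurable_fun setT h -> (forall y, 0 <= h y)%E ->
      \int[nu]_(y in D) h y = \int[mu]_(x in f @^-1` D) h (f x))%E.
Proof.
move=> mf; pose nu : {measure set T2 -> \bar R} := pushforward mu f; exists (nu mf); split=> // D h mD mh h0.
by rewrite ge0_integral_pushforward //; exact: measurable_funTS.
Qed.

Lemma ge0_integral_mrestr d (T : measurableType d) (R : realType) (mu : {measure set T -> \bar R})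
    (D : set T) (mD : measurable D) (f : T -> \bar R) :
  measurable_fun setT f -> (forall x, 0 <= f x)%E ->
  (\int[mrestr mu mD]_x f x = \int[mu]_(x in D) f x)%E.
Proof.
move=> mf f0; have mCD : measurable (~` D) by exact: measurableC.
rewrite -(setUv D) ge0_integral_setU //; last 2 first.
- by rewrite setUv.
- by rewrite disj_set2E setICr.
rewrite [X in (_ + X)%E](_ : _ = 0%E) ?adde0.
  apply: eq_measure_integral => A mA AD; rewrite /= /mrestr.
  by congr (mu _); apply/setIidPl.
rewrite (eq_measure_integral mzero); first by apply: integral_measure_zero.
move=> A mA AD; rewrite /= /mrestr (_ : A `&` D = set0) ?measure0 //.
by apply/seteqP; split=> // x [/AD].
Qed.

Section polar_coordinates.
Context (R : realType) (n m : nat).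
Local Notation T := (borel_mx R n m).
Local Notation V := (@lebesgue_mx R n m).
Local Notation N := (n * m)%N.
Local Notation L := (measurableTypeR R).
Local Notation leb := (@lebesgue_measure R).

Definition normalize (x : 'M[R]_(n, m)) : 'M[R]_(n, m) := (enorm x)^-1 *: x.

Definition punctured_ball : set T := [set x : 'M[R]_(n, m) | 0 < enorm x <= 1].

Lemma measurable_enorm : measurable_fun setT (@enorm R n m : T -> L).
Proof. by apply: continuous_measurable_mx; exact: continuous_enorm. Qed.

Lemma measurable_normalize : measurable_fun setT (normalize : T -> T).
Proof.
apply/measurable_fun_mxP => i j.
rewrite (_ : (fun t => _) = fun t : T => enorm (t : 'M[R]_(n, m)) `^ (-1) * (t : 'M[R]_(n, m)) i j).
  have mp : measurable_fun setT ((fun y : R => y `^ (-1)) : L -> L) by exact: measurable_powR.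
  exact: (measurable_funM (measurableT_comp mp measurable_enorm) (measurable_mx_coord i j)).
by apply/funext => t; rewrite mxE powR_inv1 // enorm_ge0.
Qed.

Lemma measurable_punctured_ball : measurable punctured_ball.
Proof.
have -> : punctured_ball = (@enorm R n m : T -> L) @^-1` `]0, 1]%classic.
  by apply/seteqP; split=> x /=; rewrite in_itv.
exact: (measurable_preimage measurable_enorm).
Qed.

Lemma enorm_normalize1 x : 0 < enorm x -> enorm (normalize x) = 1.
Proof. by move=> x0; apply: enorm_normalize; rewrite -enorm_gt0. Qed.

Lemma normalizeZ (t : R) x : 0 < t -> normalize (t *: x) = normalize x.
Proof.
move=> t0; have [->|x0] := eqVneq x 0; first by rewrite scaler0.
rewrite /normalize enormZ gtr0_norm // invfM scalerA mulrAC mulVf ?mul1r //.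
by rewrite gt_eqF.
Qed.

Lemma scale_normalize x : enorm x *: normalize x = x.
Proof.
have [->|x0] := eqVneq x 0; first by rewrite /normalize !scaler0.
by rewrite /normalize scalerA divff ?scale1r // enorm_eq0.
Qed.

(** By its definition through cones, the spherical measure is [N] times the image of Lebesgue
    measure on the punctured ball under normalization. *)
Lemma integral_sphere (k : T -> \bar R) :
  measurable_fun setT k -> (forall x, 0 <= k x)%E ->
  (\int[sphere_measure]_(u in (unit_sphere : set T)) k u =
   N%:R%:E * \int[V]_(x in punctured_ball) k (normalize x))%E.
Proof.
move=> mk k0.
have mS : measurable (unit_sphere : set T).
  rewrite (_ : unit_sphere = (@enorm R n m : T -> L) @^-1` [set 1]) //.
  exact: (measurable_preimage measurable_enorm).
(* Outside the punctured ball [g'] is 0, which is off the sphere; preimages of subsets of the sphere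
   are then exactly cones. *)
pose g' (x : T) : T := if x \in punctured_ball then normalize x else 0.
have mg' : measurable_fun setT g'.
  apply: measurable_fun_ifT; [|exact: measurable_normalize|exact: measurable_cst].
  apply: (measurable_fun_bool true); rewrite setTI.
  rewrite (_ : _ @^-1` _ = punctured_ball); first exact: measurable_punctured_ball.
  by apply/seteqP; split=> x /=; [move/set_mem|move/mem_set].
have [nu [nuE nuI]] := pushforward_integral V mg'.
have N0 : 0 <= N%:R :> R by [].
have coneE (A : set T) : A `<=` unit_sphere -> g' @^-1` A = cone A.
  move=> AS; apply/seteqP; split=> x /=; rewrite /g'; last first.
    by move=> [x1 Ax]; rewrite mem_set.
  case: ifPn; first by rewrite inE /punctured_ball /= => x1 Ax; split.
  by move=> _ /AS /= h; have := oner_neq0 R; rewrite -h enorm0 eqxx.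
rewrite (eq_measure_integral (mscale (NngNum N0) nu)); last first.
  by move=> A mA AS; rewrite /= /mscale /= nuE coneE.
rewrite ge0_integral_mscale //; last exact: measurable_funTS.
congr (_ * _)%E; rewrite nuI //.
have -> : g' @^-1` unit_sphere = punctured_ball.
  rewrite coneE //; apply/seteqP; split=> x; first by case.
  by move=> x1; split=> //; have /andP[x0 _] := x1; exact: enorm_normalize1.
by apply: eq_integral => x; rewrite /= /g' => ->.
Qed.

Hypothesis N0 : (0 < N)%N.

Lemma lebesgue_cone_ball (Y : set T) (t : R) : measurable Y -> 0 <= t ->
  V [set x : 'M[R]_(n, m) | 0 < enorm x /\ enorm x ^+ N <= t /\ Y (normalize x)] =
  (t%:E * V (punctured_ball `&` normalize @^-1` Y))%E.
Proof.
move=> mY; rewrite le_eqVlt => /orP[/eqP <-|t0].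
  rewrite mul0e (_ : [set x | _] = set0) ?measure0 //.
  apply/seteqP; split=> // x [x0 [h _]].
  by have : 0 < enorm x ^+ N by [rewrite exprn_gt0]; rewrite ltNge h.
pose s := t `^ (N%:R^-1).
have s0 : 0 < s by rewrite powR_gt0.
have NR : N%:R != 0 :> R by rewrite pnatr_eq0 -lt0n.
have sN : s ^+ N = t by rewrite -powR_mulrn ?(ltW s0) // -powRrM mulVf // powRr1 // ltW.
have -> : [set x : 'M[R]_(n, m) | 0 < enorm x /\ enorm x ^+ N <= t /\ Y (normalize x)] =
   (fun x : 'M[R]_(n, m) => (s^-1 *: x)%R) @^-1` (punctured_ball `&` normalize @^-1` Y).
  apply/seteqP; split=> x /=; rewrite /punctured_ball /= enormZ gtr0_norm ?invr_gt0 //;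
    rewrite normalizeZ ?invr_gt0 // pmulr_rgt0 ?invr_gt0 // ler_pdivrMl // mulr1.
    move=> [x0 [xt Yx]]; rewrite x0 /=; split=> //.
    by rewrite -(@ler_pXn2r _ N) ?nnegrE ?enorm_ge0 ?(ltW s0) // sN.
  move=> [/andP[x0 xs] Yx]; split=> //; split=> //.
  by rewrite -sN ler_pXn2r ?nnegrE ?enorm_ge0 ?(ltW s0).
rewrite lebesgue_mx_scale ?invr_gt0 //; first by rewrite invrK sN muleC.
apply: measurableI; first exact: measurable_punctured_ball.
exact: (measurable_preimage measurable_normalize).
Qed.

Let nz : set T := [set x : 'M[R]_(n, m) | 0 < enorm x].

Let mnz : measurable nz.
Proof.
have -> : nz = (@enorm R n m : T -> L) @^-1` `]0, +oo[%classic.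
  by apply/seteqP; split=> x /=; rewrite in_itv /= andbT.
exact: (measurable_preimage measurable_enorm).
Qed.

(** The radial coordinate is [|x|^N] instead of [|x|]: in it the radial part of Lebesgue measure is
    Lebesgue measure on the half-line, without the density [r^(N-1)]. *)
Definition polar_map (x : T) : T * L := (normalize x, enorm (x : 'M[R]_(n, m)) ^+ N).

Lemma measurable_polar_map : measurable_fun setT polar_map.
Proof.
apply: measurable_fun_pair; first exact: measurable_normalize.
exact: (measurable_funX N measurable_enorm).
Qed.

Lemma measurable_pos : measurable (`]0, +oo[%classic : set L).
Proof. by []. Qed.

(** The radial measure lives on [(0, +oo)], whereas uniqueness of Lebesgue measure concerns the
    whole line; so Lebesgue measure on the nonpositive half-line is added to it. Writing the
    identity as a sum avoids subtracting infinite measures. *)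
Lemma lebesgue_radial_set (Y : set T) (X : set L) : measurable Y -> measurable X ->
  (V (polar_map @^-1` (Y `*` X) `&` nz) + leb (X `&` `]-oo, 0%R]%classic) * V (punctured_ball `&` normalize @^-1` Y) =
   leb X * V (punctured_ball `&` normalize @^-1` Y))%E.
Proof.
move=> mY mX.
have mDY : measurable (punctured_ball `&` normalize @^-1` Y).
  by apply: measurableI; [exact: measurable_punctured_ball|exact: (measurable_preimage measurable_normalize)].
set s := V (punctured_ball `&` _).
have sfin : s \is a fin_num.
  by apply: enorm_bounded_fin_num => //; exists 1 => x [/andP[]].
have [c sE] : exists c, s = c%:E by exists (fine s); rewrite fineK.
have mq (Z : set L) : measurable Z -> measurable (polar_map @^-1` (Y `*` Z) `&` nz).
  move=> mZ; apply: measurableI => //; apply: (measurable_preimage measurable_polar_map).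
  exact: measurableX.
have mcb t : measurable ([set x : 'M[R]_(n, m) | 0 < enorm x /\ enorm x ^+ N <= t /\ Y (normalize x)] : set T).
  rewrite (_ : [set x | _] = (polar_map @^-1` (Y `*` `]-oo, t]%classic) `&` nz)); first exact: mq.
  by apply/seteqP; split=> x /=; rewrite in_itv /=; [move=> [? [? ?]]|move=> [[? ?] ?]].
(* The uniqueness argument divides by [s]. If [s = 0], the cone over [Y] is a countable union of
   dilates of a null set. *)
have [s0|sn0] := eqVneq s 0%E.
  rewrite s0 !mule0 adde0; apply/eqP; rewrite eq_le measure_ge0 andbT.
  have : V (\bigcup_(k : nat) [set x : 'M[R]_(n, m) | 0 < enorm x /\ enorm x ^+ N <= k%:R /\ Y (normalize x)]) = 0%E.
    apply: measure_negligible; first exact: bigcupT_measurable.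
    apply: negligible_bigcup => k; apply/negligibleP; first exact: mcb.
    by apply: etrans (lebesgue_cone_ball mY (ler0n _ k)) _; rewrite -/s s0 mule0.
  move=> <-; apply: le_measure; rewrite ?inE //; first exact: mq.
    exact: bigcupT_measurable.
  move=> x [[Yx _] x0]; exists (Num.truncn (enorm (x : 'M[R]_(n, m)) ^+ N)).+1 => //.
  by split=> //; split=> //; apply: ltW; exact: truncnS_gt.
have c0 : 0 <= c^-1 by rewrite invr_ge0 -lee_fin -sE measure_ge0.
have cn0 : c != 0 by move: sn0; rewrite sE eqe.
have mxl : measurable_fun setT (fun x : T => (enorm (x : 'M[R]_(n, m)) ^+ N : L)).
  exact: (measurable_funX N measurable_enorm).
have mY' : measurable (nz `&` normalize @^-1` Y).
  by apply: measurableI => //; exact: (measurable_preimage measurable_normalize).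
have [nu nuE] := pushforward_measure_exists (mrestr V mY') mxl.
have mneg : measurable (`]-oo, 0]%classic : set L) by [].
pose mu : {measure set L -> \bar R} := measure_add (mscale (NngNum c0) nu) (mrestr leb mneg).
have muE Z : mu Z = (c^-1%:E * nu Z + leb (Z `&` `]-oo, 0%R]%classic))%E by exact: measure_addE.
have nuE' Z : nu Z = V (polar_map @^-1` (Y `*` Z) `&` nz).
  rewrite nuE /mrestr /=; congr (V _).
  by apply/seteqP; split=> x /=; [move=> [? [? ?]]|move=> [[? ?] ?]].
have key : leb X = mu X.
  apply: (@lebesgue_measure_unique R mu) => // _ [[a b]] _ <-.
  rewrite muE nuE'.
  have mx0 (x : R) : 0 <= Num.max 0 x by rewrite le_max lexx.
  have Sab : V (polar_map @^-1` (Y `*` `]a, b]) `&` nz) = ((Num.max 0 b - Num.max 0 (Num.min a b))%:E * s)%E.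
    have -> : polar_map @^-1` (Y `*` `]a, b]) `&` nz =
      [set x : 'M[R]_(n, m) | 0 < enorm x /\ enorm x ^+ N <= Num.max 0 b /\ Y (normalize x)] `\`
      [set x : 'M[R]_(n, m) | 0 < enorm x /\ enorm x ^+ N <= Num.max 0 (Num.min a b) /\ Y (normalize x)].
      apply/seteqP; split=> x /=; rewrite in_itv /=.
        move=> [[Yx /andP[ax xb]] x0]; have xN : 0 < enorm (x : 'M[R]_(n, m)) ^+ N by rewrite exprn_gt0.
        split; first by split=> //; split=> //; rewrite le_max xb orbT.
        by case=> _ [+ _]; rewrite le_max leNgt xN /= le_min leNgt ax.
      move=> [[x0 [+ Yx]] h]; have xN : 0 < enorm (x : 'M[R]_(n, m)) ^+ N by rewrite exprn_gt0.
      rewrite le_max leNgt xN /= => xb; split=> //; split=> //; rewrite xb andbT ltNge.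
      by apply/negP => xa; apply: h; split=> //; split=> //; rewrite le_max le_min xa xb orbT.
    set A1 := [set x | _ /\ _ <= Num.max 0 b /\ _]; set A2 := [set x | _].
    have A1E : V A1 = (Num.max 0 b * c)%:E by rewrite lebesgue_cone_ball // -/s sE.
    have A2E : V A2 = (Num.max 0 (Num.min a b) * c)%:E by rewrite lebesgue_cone_ball // -/s sE.
    transitivity (V A1 - V (A1 `&` A2))%E.
      apply: measureD; [exact: mcb|exact: mcb|].
      have h : (V A1 < +oo)%E by rewrite A1E ltry.
      exact: h.
    rewrite setIidr ?A1E ?A2E ?sE -?EFinB -?EFinM ?mulrBl //.
    move=> x [x0 [h Yx]]; split=> //; split=> //; apply: le_trans h _.
    by case: (lerP a b) => // ab; rewrite ge_max !le_max lexx ab orbT.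
  rewrite Sab sE -EFinM.
  have -> : `]a, b] `&` `]-oo, 0] = `]a, (Num.min b 0)]%classic.
    apply/seteqP; split=> x /=; rewrite !in_itv /= le_min.
      by move=> [/andP[-> ->] ->].
    by move=> /andP[-> /andP[-> ->]].
  apply: etrans (lebesgue_itv_oc a b) _.
  apply: etrans (esym (congr1 (fun z => _ + z)%E (lebesgue_itv_oc a (Num.min b 0)))).
  rewrite -EFinD; congr (_%:E).
  rewrite mulrCA mulVf // mulr1.
  by clear -a b; case: (lerP a b) => ab; case: (lerP b 0) => b0; repeat match goal with
    |- context [Num.max 0 ?x] => case: (lerP 0 x) => ? end; lra.
rewrite [in RHS]key muE nuE' muleDl //; last first.
  by apply: ge0_adde_def; rewrite inE ?measure_ge0 // mule_ge0.
by congr (_ + _)%E; rewrite muleAC sE -EFinM mulVf ?mul1e.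
Qed.

Theorem polar_integral (F : T * L -> \bar R) : measurable_fun setT F -> (forall z, 0 <= F z)%E ->
  (\int[V]_(x in nz) F (normalize x, (enorm (x : 'M[R]_(n, m)) ^+ N)%R) =
   \int[V]_(x in punctured_ball) \int[leb]_(r in `]0%R, +oo[) F (normalize x, r))%E.
Proof.
move=> mF F0.
have mD := measurable_punctured_ball.
have [sg0 [sg0E sg0I]] := pushforward_integral (mrestr V mD) measurable_normalize.
have sg0fin : sigma_finite setT sg0.
  exists (fun=> setT); first by rewrite bigcup_const //; exists 0%N.
  move=> _; split=> //; rewrite sg0E.
  suff h : (V (normalize @^-1` setT `&` punctured_ball) < +oo)%E by exact: h.
  rewrite preimage_setT setTI.
  by apply: (@enorm_bounded_lty _ _ _ _ 1) => // x /andP[].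
have [sg sgE] := sigma_finite_pack sg0fin.
have sgE' A : sg A = V (punctured_ball `&` normalize @^-1` A) by rewrite sgE sg0E /mrestr /= setIC.
pose P : set (T * L) := setT `*` `]0, +oo[%classic.
have mP : measurable P by exact: measurableX.
have mP' : measurable (~` P) by exact: measurableC.
have [psi psiE] := pushforward_measure_exists (mrestr V mnz) measurable_polar_map.
have [pol [polE polI]] := pushforward_integral V measurable_polar_map.
(* By [lebesgue_radial_set], [m'] agrees with the product measure on all rectangles. On subsets of
   [P] its second term vanishes and the image of Lebesgue measure remains. *)
pose m' : {measure set (T * L) -> \bar R} := measure_add psi (mrestr (sg \x leb)%E mP').
have m'E A : m' A = (psi A + (sg \x leb)%E (A `&` ~` P))%E by exact: measure_addE.
have key A : measurable A -> A `<=` P -> pol A = (sg \x leb)%E A.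
  move=> mA AP.
  rewrite (@product_measure_unique _ _ _ _ _ sg leb m') //; last first.
    move=> Y X mY mX; rewrite m'E psiE /mrestr /=.
    have -> : (Y `*` X) `&` ~` P = Y `*` (X `&` `]-oo, 0]%classic).
      apply/seteqP; split=> -[y x] /=; rewrite /P /= !in_itv /= andbT.
        by move=> [[? ?] /not_andP[//|/negP]]; rewrite -leNgt.
      by move=> [Yy [Xx x0]]; split=> // -[_]; rewrite ltNge x0.
    rewrite product_measure1E //; last exact: measurableI.
    rewrite [X in (_ + X)%E]muleC [RHS]muleC.
    by have h := lebesgue_radial_set mY mX; rewrite -sgE' in h; exact: h.
  rewrite m'E psiE /mrestr /=.
  rewrite (_ : A `&` ~` P = set0) ?measure0 ?adde0; last by apply/seteqP; split=> // x [/AP].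
  rewrite polE; congr (V _); apply/esym/setIidPl => x /AP [_].
  rewrite /= in_itv /= andbT => xN; rewrite /nz /= lt_neqAle enorm_ge0 andbT.
  by apply/negP => /eqP x0; move: xN; rewrite -x0 expr0n gtn_eqF //= ltxx.
have mPF : measurable_fun setT (F \_ P) by apply/(measurable_restrictT _ mP); exact: measurable_funTS.
have PF0 z : (0 <= (F \_ P) z)%E by rewrite patchE; case: ifP.
transitivity (\int[sg \x leb]_z (F \_ P) z)%E.
  have -> : nz = polar_map @^-1` P.
    apply/seteqP; split=> x; rewrite /nz /P /= in_itv /= andbT.
      by move=> x0; split=> //; rewrite exprn_gt0.
    move=> [_ xN]; rewrite lt_neqAle enorm_ge0 andbT.
    by apply/negP => /eqP x0; move: xN; rewrite -x0 expr0n gtn_eqF //= ltxx.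
  by rewrite -integral_mkcond -(eq_measure_integral _ key) polI.
rewrite fubini_tonelli1 //.
have mG : measurable_fun setT (fubini_F leb (F \_ P)) by exact: measurable_fun_fubini_tonelli_F.
rewrite (eq_measure_integral sg0); last by move=> A _ _; exact: sgE.
rewrite sg0I //; last by move=> y; apply: integral_ge0.
rewrite preimage_setT; apply: etrans (@ge0_integral_mrestr _ _ _ V _ mD _ _ _) _.
- exact: (measurableT_comp mG measurable_normalize).
- by move=> x; apply: integral_ge0.
- apply: eq_integral => x _; rewrite /= /fubini_F [RHS]integral_mkcond.
  by apply: eq_integral => r _; rewrite !patchE /P in_setX in_setT.
Qed.

End polar_coordinates.

Lemma measurable_powR_comp d (T : measurableType d) (R : realType) (f : T -> measurableTypeR R) (e : R) :
  measurable_fun setT f -> measurable_fun setT ((fun x => f x `^ e) : T -> measurableTypeR R).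
Proof.
move=> mf; have mp : measurable_fun setT ((fun y : R => y `^ e) : measurableTypeR R -> measurableTypeR R).
  exact: measurable_powR.
exact: (measurableT_comp mp mf).
Qed.

Lemma npoweRE (R : realType) (x a : R) : 0 <= x -> 0 < a ->
  npoweR x%:E a = if x == 0 then +oo%E else (x `^ (- a))%:E.
Proof.
move=> x0 a0; rewrite /npoweR; case: eqVneq => [->|xn0].
  by rewrite poweR0r ?gt_eqF // inve0.
by rewrite poweR_EFin inver powRN gt_eqF // powR_gt0 // lt_neqAle eq_sym xn0.
Qed.

Section power_integrals.
Context (R : realType).
Local Notation leb := (@lebesgue_measure R).

Lemma derivable_powR_LR (e c : R) : 0 < e -> 0 < c ->
  derivable_oo_LRcontinuous (@powR R ^~ e) 0 c.
Proof.
move=> e0 c0; split.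
- by move=> x; rewrite in_itv /= => /andP[x0 _]; apply: derivable_powR; rewrite in_itv /= x0.
- by rewrite powR0 ?gt_eqF //; exact: powR_cvg0.
- have cc : {for c, continuous (@powR R ^~ e)}.
    apply: differentiable_continuous.
    by apply/derivable1_diffP; apply: derivable_powR; rewrite in_itv /= c0.
  by apply: cvg_at_left_filter; exact: cc.
Qed.

Lemma integral_powR (e c : R) : 0 < e -> 0 < c ->
  (\int[leb]_(t in `[0%R, c]) (t `^ e)%:E = (c `^ (e + 1) / (e + 1))%:E)%E.
Proof.
move=> e0 c0; have e10 : 0 < e + 1 by rewrite addr_gt0.
have LR := derivable_powR_LR e0 c0; have [d1 r1 l1] := derivable_powR_LR e10 c0.
rewrite (@continuous_FTC2 R (fun t => t `^ e) (fun t => (e + 1)^-1 * t `^ (e + 1)) 0 c c0).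
- by rewrite [0 `^ _]powR0 ?gt_eqF // mulr0 sube0 mulrC.
- exact: derivable_oo_LRcontinuous_within.
- split.
  + by move=> x xc; apply: derivableM; [exact: derivable_cst|exact: d1].
  + by apply: cvgM; [exact: cvg_cst|exact: r1].
  + by apply: cvgM; [exact: cvg_cst|exact: l1].
- move=> x; rewrite in_itv /= => /andP[x0 _].
  have h := @is_derive1_powR R (e + 1) x x0.
  have -> : (fun t : R => (e + 1)^-1 * t `^ (e + 1)) = (e + 1)^-1 \*: (@powR R ^~ (e + 1)) by [].
  rewrite derive1E deriveZ; last exact: ex_derive.
  rewrite derive_val /GRing.scale /= addrK mulrA mulVf ?mul1r //.
  by rewrite gt_eqF.
Qed.

Lemma powRN_cvg0 (b : R) : 0 < b -> x `^ (- b) @[x --> +oo] --> (0 : R).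
Proof.
move=> b0; apply/cvgrPdist_le => e e0; near=> x.
have x1 : e `^ (- b^-1) <= x by near: x; exact: nbhs_pinfty_ge.
have e1 : 0 < e `^ (- b^-1) by rewrite powR_gt0.
have x0 : 0 < x by exact: lt_le_trans x1.
rewrite sub0r normrN ger0_norm ?powR_ge0 //.
have -> : e = (e `^ (- b^-1)) `^ (- b) by rewrite -powRrM mulrNN mulVf ?powRr1 ?gt_eqF // ltW.
rewrite [x `^ _]powRN [(e `^ _) `^ _]powRN lef_pV2 ?posrE ?powR_gt0 //.
by apply: ge0_ler_powR; rewrite ?nnegrE ?ltW.
Unshelve. all: by end_near. Qed.

Lemma integral_powR_tail (s : R) : 1 < s ->
  (\int[leb]_(t in `[1%R, +oo[) (t `^ (- s))%:E = ((s - 1)^-1)%:E)%E.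
Proof.
move=> s1; have s10 : 0 < s - 1 by rewrite subr_gt0.
have dp (a x : R) : 0 < x -> derivable (@powR R ^~ a) x 1.
  by move=> x0; apply: derivable_powR; rewrite in_itv /= x0.
have cp (a x : R) : 0 < x -> {for x, continuous (@powR R ^~ a)}.
  by move=> x0; apply: differentiable_continuous; apply/derivable1_diffP; exact: dp.
rewrite (@ge0_continuous_FTC2y R _ (fun t => - (s - 1)^-1 * t `^ (- (s - 1))) 1 0).
- by rewrite powR1 mulr1 -EFinB opprK add0r.
- by move=> x _; exact: powR_ge0.
- apply: continuous_in_subspaceT => x; rewrite inE /= in_itv /= andbT => x1.
  by apply: cp; exact: lt_le_trans x1.
- rewrite -[X in _ --> X](mulr0 (- (s - 1)^-1)).
  by apply: cvgM; [exact: cvg_cst|exact: powRN_cvg0].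
- move=> x x1; apply: derivableM; first exact: derivable_cst.
  by apply: dp; exact: lt_trans x1.
- apply: cvgM; first exact: cvg_cst.
  by apply: cvg_at_right_filter; apply: cp.
- move=> x; rewrite in_itv /= andbT => x1.
  have h := @is_derive1_powR R (- (s - 1)) x (lt_trans ltr01 x1).
  have -> : (fun t : R => - (s - 1)^-1 * t `^ (- (s - 1))) = (- (s - 1)^-1) \*: (@powR R ^~ (- (s - 1))) by [].
  rewrite derive1E deriveZ; last exact: ex_derive.
  rewrite derive_val /GRing.scale /= mulrA mulrNN mulVf ?gt_eqF // mul1r.
  by congr (_ `^ _); lra.
Qed.

End power_integrals.

Lemma lebesgue_itv_cc (R : realType) (x y : R) :
  lebesgue_measure `[x, y]%classic = (Num.max 0 (y - x))%:E.
Proof.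
rewrite lebesgue_measure_itv /= lte_fin; case: ltP => hc.
  by rewrite -EFinB max_r // subr_ge0 ltW.
by rewrite max_l // subr_le0.
Qed.

(** * Layer decompositions and the bathtub principle *)

Section layers.
Context d (T : measurableType d) (R : realType).
Variable mu : {sigma_finite_measure set T -> \bar R}.
Local Notation L := (measurableTypeR R).
Local Notation leb := (@lebesgue_measure R).

(** Fubini on [{(x, t) | h x <= t <= c}]: the slice over [x] is an interval of length
    [max 0 (c - h x)]. *)
Lemma layer_truncate (A : set T) (h : T -> L) (c : R) : measurable A ->
  measurable_fun setT h -> (forall x, 0 <= h x) ->
  (\int[mu]_(x in A) (Num.max 0 (c - h x))%:E =
   \int[leb]_(t in `[0%R, c]) mu (A `&` [set x | h x <= t]%R))%E.
Proof.
move=> mA mh h0.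
pose S : set (T * L) := [set z | (A z.1 /\ 0 <= z.2 <= c) /\ h z.1 <= z.2].
have mS : measurable S.
  apply: measurableI.
    rewrite [X in measurable X](_ : _ = A `*` `[0, c]%classic); first exact: measurableX.
    by apply/seteqP; split=> z /=; rewrite in_itv.
  have mf : measurable_fun setT (fun z : T * L => h z.1) by exact: (measurableT_comp mh measurable_fst).
  have := @measurable_fun_ler _ _ R setT (fun z : T * L => h z.1) (snd : T * L -> R) mf measurable_snd.
  by move=> /(_ measurableT [set true] Logic.I); rewrite setTI.
have := fubini_slice mu leb mS.
rewrite [in X in X = _ -> _](_ : (fun x => _) = (fun x => (Num.max 0 (c - h x))%:E) \_ A); last first.
  apply/funext => x; rewrite patchE; case: ifPn => [|]; last first.
    rewrite notin_setE => nA; rewrite (_ : [set y | _] = set0) ?measure0 //.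
    by apply/seteqP; split=> // y [[]].
  rewrite inE => Ax; have -> : [set y | S (x, y)] = `[(h x), c]%classic.
    apply/seteqP; split=> y; rewrite /S /= in_itv /=; first by move=> [[_ /andP[_ ->]] ->].
    by move=> /andP[hy yc]; rewrite yc andbT; split=> //; split=> //; exact: le_trans hy.
  exact: lebesgue_itv_cc.
rewrite -integral_mkcond => ->; rewrite [RHS]integral_mkcond; apply: eq_integral => t _.
rewrite patchE; case: ifPn => [|]; last first.
  rewrite notin_setE /= in_itv /= => nt; rewrite (_ : [set y | _] = set0) ?measure0 //.
  by apply/seteqP; split=> // y [[_ /nt]].
rewrite inE /= in_itv /= => tc; congr (mu _).
by apply/seteqP; split=> y; rewrite /S /=; [move=> [[? _] ?]|move=> [? ?]].
Qed.

Lemma measurable_truncate (h : T -> L) (c : R) : measurable_fun setT h ->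
  measurable_fun setT ((fun x => Num.max 0 (c - h x)) : T -> L).
Proof.
move=> mh; apply: measurable_maxr; first exact: measurable_cst.
exact: (measurable_funB (@measurable_cst _ _ _ _ setT c) mh).
Qed.

Let layer_measurable (A : set T) (h : T -> L) : measurable A -> measurable_fun setT h ->
  measurable_fun setT (fun t : L => mu (A `&` [set x | h x <= t]%R)).
Proof.
move=> mA mh; have mS : measurable [set z : T * L | A z.1 /\ h z.1 <= z.2].
  apply: measurableI; first exact: (measurable_preimage measurable_fst mA).
  have mf : measurable_fun setT (fun z : T * L => h z.1) by exact: (measurableT_comp mh measurable_fst).
  have := @measurable_fun_ler _ _ R setT (fun z : T * L => h z.1) (snd : T * L -> R) mf measurable_snd.
  by move=> /(_ measurableT [set true] Logic.I); rewrite setTI.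
exact: (measurable_fun_slice2 mu mS).
Qed.

(** Integrate [c <= h + max 0 (c - h)] and bound the second term layer by layer. The bound is sharp
    when the sublevel sets have exactly the allowed measures and [A] is the one at level [c]. *)
Lemma bathtub (A : set T) (h : T -> L) (c v e : R) : measurable A -> measurable_fun setT h ->
  (forall x, 0 <= h x) -> 0 < c -> 0 < e -> 0 <= v ->
  (forall t, 0 < t -> (mu (A `&` [set x | (h x <= t)%R]) <= (v * t `^ e)%:E)%E) ->
  (c%:E * mu A <= \int[mu]_(x in A) (h x)%:E + (v * (c `^ (e + 1) / (e + 1)))%:E)%E.
Proof.
move=> mA mh h0 c0 e0 v0 H.
have mhA : measurable_fun A (fun x => (h x)%:E) by apply/measurable_EFinP; exact: measurable_funTS.
have mtA : measurable_fun A (fun x => (Num.max 0 (c - h x))%:E).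
  by apply/measurable_EFinP; apply: measurable_funTS; exact: measurable_truncate.
apply: (@le_trans _ _ (\int[mu]_(x in A) ((h x)%:E + (Num.max 0 (c - h x))%:E))%E).
  rewrite -integral_cst //; apply: ge0_le_integral => //.
  - by move=> x _; rewrite lee_fin ltW.
  - exact: emeasurable_funD.
  - by move=> x _; rewrite -EFinD lee_fin -lerBlDl le_max lexx orbT.
rewrite ge0_integralD //; last 2 first.
- by move=> x _; rewrite lee_fin.
- by move=> x _; rewrite lee_fin le_max lexx.
apply: leeD; first exact: lexx.
rewrite layer_truncate //.
apply: (@le_trans _ _ (\int[leb]_(t in `[0%R, c]) (v * t `^ e)%:E)%E).
  rewrite -(@integral_itv_obnd_cbnd R 0 (BRight c)) ; last first.
    by apply: measurable_funTS; exact: layer_measurable.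
  rewrite -(@integral_itv_obnd_cbnd R 0 (BRight c)); last first.
    apply/measurable_EFinP; apply: measurable_funM; first exact: measurable_cst.
    by apply: measurable_funTS; exact: measurable_powR.
  apply: ge0_le_integral => //.
  - by apply: measurable_funTS; exact: layer_measurable.
  - apply/measurable_EFinP; apply: measurable_funM; first exact: measurable_cst.
    by apply: measurable_funTS; exact: measurable_powR.
  - by move=> t; rewrite /= in_itv /= => /andP[t0 _]; exact: H.
under eq_integral do rewrite EFinM.
rewrite ge0_integralZl_EFin //.
- by rewrite integral_powR // -EFinM.
- by move=> t _; rewrite lee_fin powR_ge0.
- by apply/measurable_EFinP; apply: measurable_funTS; exact: measurable_powR.
Qed.

(** The estimate opposite to [bathtub]: on [A] the functions [h] and [1 - h] add up to 1, and the
    layers of [1 - h] are bounded below. *)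
Lemma layer_lower (A : set T) (h : T -> L) (a e : R) : measurable A -> measurable_fun setT h ->
  (forall x, 0 <= h x) -> 0 < e -> 0 <= a -> (mu A = a%:E)%E -> (forall x, A x -> h x <= 1) ->
  (forall t, 0 < t <= 1 -> ((a * t `^ e)%:E <= mu (A `&` [set x | (h x <= t)%R]))%E) ->
  (\int[mu]_(x in A) (h x)%:E <= (a * (e / (e + 1)))%:E)%E.
Proof.
move=> mA mh h0 e0 a0 aE h1 H.
have mhA : measurable_fun A (fun x => (h x)%:E) by apply/measurable_EFinP; exact: measurable_funTS.
have mtA : measurable_fun A (fun x => (Num.max 0 (1 - h x))%:E).
  by apply/measurable_EFinP; apply: measurable_funTS; exact: measurable_truncate.
have e10 : 0 < e + 1 by rewrite addr_gt0.
have sumE : (\int[mu]_(x in A) (h x)%:E + \int[mu]_(x in A) (Num.max 0 (1 - h x))%:E = a%:E)%E.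
  rewrite -ge0_integralD //; last 2 first.
  - by move=> x _; rewrite lee_fin.
  - by move=> x _; rewrite lee_fin le_max lexx.
  rewrite -aE -[RHS]mul1e -integral_cst //; apply: eq_integral => x; rewrite inE => Ax.
  by rewrite -EFinD max_r ?subr_ge0 ?h1 // addrC subrK.
have low : ((a * (e + 1)^-1)%:E <= \int[mu]_(x in A) (Num.max 0 (1 - h x))%:E)%E.
  rewrite layer_truncate //.
  apply: (@le_trans _ _ (\int[leb]_(t in `[0%R, 1%R]) (a * t `^ e)%:E)%E).
    under eq_integral do rewrite EFinM.
    rewrite ge0_integralZl_EFin //.
    - by rewrite integral_powR // powR1 -EFinM mul1r.
    - by move=> t _; rewrite lee_fin powR_ge0.
    - by apply/measurable_EFinP; apply: measurable_funTS; exact: measurable_powR.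
  rewrite -(@integral_itv_obnd_cbnd R 0 (BRight 1)); last first.
    apply/measurable_EFinP; apply: measurable_funM; first exact: measurable_cst.
    by apply: measurable_funTS; exact: measurable_powR.
  rewrite -(@integral_itv_obnd_cbnd R 0 (BRight 1)) ; last first.
    by apply: measurable_funTS; exact: layer_measurable.
  apply: ge0_le_integral => //.
  - by move=> t _; rewrite lee_fin mulr_ge0 // powR_ge0.
  - apply/measurable_EFinP; apply: measurable_funM; first exact: measurable_cst.
    by apply: measurable_funTS; exact: measurable_powR.
  - by apply: measurable_funTS; exact: layer_measurable.
have i0 : (0 <= \int[mu]_(x in A) (h x)%:E)%E by apply: integral_ge0 => x _; rewrite lee_fin.
move: sumE low i0; case: (\int[mu]_(x in A) (h x)%:E)%E => [x| |];
  case: (\int[mu]_(x in A) (Num.max _ _)%:E)%E => [y| |] //=.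
rewrite -EFinD => -[xy]; rewrite !lee_fin => ly _.
have -> : a * (e / (e + 1)) = a - a * (e + 1)^-1 by field; rewrite gt_eqF.
by lra.
Qed.

End layers.

Section polar_applications.
Context (R : realType) (n m : nat).
Local Notation T := (borel_mx R n m).
Local Notation V := (@lebesgue_mx R n m).
Local Notation N := (n * m)%N.
Local Notation L := (measurableTypeR R).
Local Notation leb := (@lebesgue_measure R).
Hypothesis N0 : (0 < N)%N.

(** Doubling fixes the origin and multiplies volumes by [2^N]. *)
Lemma lebesgue_mx_set1_0 : V [set (0 : 'M[R]_(n, m))] = 0%E.
Proof.
have m0 : measurable ([set (0 : 'M[R]_(n, m))] : set T).
  rewrite (_ : [set _] = eball 0); first exact: measurable_eball.
  apply/seteqP; split=> x; rewrite /eball /=; first by move=> ->; rewrite enorm0.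
  by rewrite le_eqVlt ltNge enorm_ge0 orbF enorm_eq0 => /eqP.
pose Z : set T := [set (0 : 'M[R]_(n, m))].
have scE : V Z = (V Z * ((2^-1)^-1 ^+ N)%:E)%E.
  rewrite -lebesgue_mx_scale ?invr_gt0 //; congr (V _); apply/seteqP; split=> x; rewrite /Z /=.
    by move=> ->; rewrite scaler0.
  by move/eqP; rewrite scaler_eq0 invr_eq0 pnatr_eq0 /= => /eqP.
have fin : V Z \is a fin_num.
  by apply: enorm_bounded_fin_num => //; exists 0 => x ->; rewrite enorm0.
rewrite -/Z; move: scE; rewrite -(fineK fin) -EFinM => -[]; set v := fine _ => vE.
have h : 1 < (2^-1)^-1 ^+ N :> R by rewrite invrK exprn_egt1 ?ltr1n // -lt0n.
congr (_%:E); apply/eqP; have : v * ((2^-1)^-1 ^+ N - 1) = 0 by rewrite mulrBr mulr1 -vE subrr.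
by move/eqP; rewrite mulf_eq0 [X in _ || X]subr_eq0 [X in _ || X](gt_eqF h) orbF.
Qed.

(** In the direction [y] the sublevel set consists of the radial coordinates [r = |x|^N] with
    [r H(y)^N <= 1], an interval of length [H(y)^(-N)]. Directions with [H y = 0] give a whole
    half-line, in agreement with the convention [0^(-N) = +oo]. *)
Theorem volume_sublevel (H : T -> L) : measurable_fun setT H -> (forall x, 0 <= H x) ->
  (forall (t : R) (x : 'M[R]_(n, m)), 0 < t -> H (t *: x) = t * H x) ->
  (\int[sphere_measure]_(u in (unit_sphere : set T)) npoweR (H u)%:E N%:R =
   N%:R%:E * V [set x | (H x <= 1)%R])%E.
Proof.
move=> mH H0 HZ.
have NR : (N%:R : R) != 0 by rewrite pnatr_eq0 -lt0n.
have mN : measurable_fun setT (fun u : T => npoweR (H u)%:E N%:R).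
  have NR0 : (0 : R) < N%:R by rewrite ltr0n.
  under eq_fun do rewrite npoweRE //.
  apply: measurable_fun_ifT.
  - apply: (measurable_fun_bool true); rewrite setTI (_ : _ @^-1` _ = H @^-1` [set 0]).
      exact: (measurable_preimage mH).
    by apply/seteqP; split=> x /= /eqP.
  - exact: measurable_cst.
  - by apply/measurable_EFinP; exact: measurable_powR_comp.
rewrite integral_sphere //; last by move=> x; rewrite /npoweR inve_ge0 poweR_ge0.
congr (_ * _)%E.
pose S : set (T * L) := [set z | z.2 * H z.1 ^+ N <= 1].
have mS : measurable S.
  have mf : measurable_fun setT ((fun z : T * L => z.2 * H z.1 ^+ N) : T * L -> L).
    apply: measurable_funM; first exact: measurable_snd.
    by apply: measurable_funX; exact: (measurableT_comp mH measurable_fst).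
  rewrite (_ : S = (fun z : T * L => z.2 * H z.1 ^+ N) @^-1` `]-oo, 1]%classic).
    exact: (measurable_preimage mf).
  by apply/seteqP; split=> z; rewrite /S /= in_itv.
have mi : measurable_fun setT (fun z : T * L => (\1_S z : R)%:E).
  by apply/measurable_EFinP; exact: measurable_indic.
have i0 (z : T * L) : (0 <= (\1_S z : R)%:E)%E by rewrite lee_fin.
have mHl : measurable ([set x | H x <= 1] : set T).
  rewrite (_ : [set x | _] = H @^-1` `]-oo, 1]%classic); first exact: (measurable_preimage mH).
  by apply/seteqP; split=> z; rewrite /= in_itv.
have mnz : measurable ([set x : 'M[R]_(n, m) | 0 < enorm x] : set T).
  rewrite (_ : [set x | _] = (@enorm R n m : T -> L) @^-1` `]0, +oo[%classic).
    exact: (measurable_preimage (@measurable_enorm R n m)).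
  by apply/seteqP; split=> z; rewrite /= in_itv /= andbT.
have SE (x : 'M[R]_(n, m)) : 0 < enorm x -> S (normalize x, enorm x ^+ N) <-> H x <= 1.
  move=> x0; rewrite /S /= -exprMn -HZ // scale_normalize.
  have Hx0 := H0 x; split=> [|h]; last by apply: exprn_ile1.
  by rewrite expr_le1.
transitivity (\int[V]_(x in [set x : 'M[R]_(n, m) | (0 < enorm x)%R]) (\1_S (normalize x, (enorm (x : 'M[R]_(n, m)) ^+ N)%R) : R)%:E)%E.
  rewrite (polar_integral N0 mi i0); apply: eq_integral => x; rewrite inE => -[/andP[x0 _]].
  set y := normalize x.
  transitivity (leb (`]0, +oo[ `&` [set r | r * H y ^+ N <= 1])).
    have [Hy0|Hy0] := eqVneq (H y) 0.
      rewrite Hy0 /npoweR poweR0r // inve0 (_ : _ `&` _ = `]0, +oo[%classic).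
        by apply/esym; apply: etrans (lebesgue_measure_itv `]0%R, +oo[) _; rewrite /= ltry.
      by apply/seteqP; split=> r /=; [case|split=> //]; rewrite expr0n gtn_eqF //= mulr0.
    have c0 : 0 < H y ^+ N by rewrite exprn_gt0 // lt_neqAle eq_sym Hy0 H0.
    rewrite (_ : _ `&` _ = `]0, (H y ^+ N)^-1]%classic).
      rewrite lebesgue_measure_itv /= lte_fin invr_gt0 c0 sube0 /npoweR poweR_EFin powR_mulrn //.
      by rewrite inver gt_eqF.
    have er (r : R) : (r * H y ^+ N <= 1) = (r <= (H y ^+ N)^-1) by rewrite -[(H y ^+ N)^-1]mul1r ler_pdivlMr.
    apply/seteqP; split=> r /=; rewrite !in_itv /= er ?andbT; first by move=> [-> ->].
    by move=> /andP[-> ->].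
  have e := @integral_indic _ L R leb `]0, +oo[%classic (measurable_pos (R := R)) _ (measurable_set_slice1 mS y).
  transitivity (leb ([set r | S (y, r)] `&` `]0, +oo[%classic)); first by rewrite setIC.
  rewrite -e; apply: eq_integral => r _; congr (_%:E).
rewrite [in RHS](_ : [set x | H x <= 1] = ([set x | H x <= 1] `&` [set x : 'M[R]_(n, m) | 0 < enorm x])
  `|` ([set x | H x <= 1] `&` [set (0 : 'M[R]_(n, m))])); last first.
  rewrite -setIUr (_ : _ `|` _ = setT) ?setIT //; apply/seteqP; split=> // x _.
  by have [->|x0] := eqVneq x (0 : 'M[R]_(n, m)); [right|left; rewrite /= enorm_gt0].
have m0 : measurable ([set (0 : 'M[R]_(n, m))] : set T).
  by rewrite -[X in measurable X]setCK; apply: measurableC; rewrite (_ : ~` _ = [set x : 'M[R]_(n, m) | 0 < enorm x]) //;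
    apply/seteqP; split=> x /=; rewrite enorm_gt0; [move/eqP|move/eqP].
rewrite [RHS]measureU //; last 3 first.
- exact: measurableI.
- exact: measurableI.
- by apply/seteqP; split=> // x [[_ x0] [_ xE]]; move: x0; rewrite /= xE enorm0 ltxx.
rewrite [X in (_ = _ + X)%E](_ : _ = 0%E) ?adde0; last first.
  apply/eqP; rewrite eq_le measure_ge0 andbT -lebesgue_mx_set1_0.
  by apply: le_measure; rewrite ?inE //; exact: measurableI.
apply: etrans (@integral_indic _ T R V _ mnz _ mHl).
apply: eq_integral => x; rewrite inE /= => x0; congr (_%:E); rewrite !indicE.
congr ((nat_of_bool _)%:R); apply/idP/idP; rewrite !inE; by move/(SE _ x0).
Qed.

Theorem tail_integral (k : T -> L) (a : R) : measurable_fun setT k -> (forall x, 0 <= k x) ->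
  N%:R < a ->
  (\int[V]_(x in [set x : 'M[R]_(n, m) | (1 <= enorm x)%R])
     (enorm (x : 'M[R]_(n, m)) `^ (- a) * k (normalize x))%:E =
   ((a - N%:R)^-1)%:E * \int[sphere_measure]_(u in (unit_sphere : set T)) (k u)%:E)%E.
Proof.
move=> mk k0 Na; have NR : 0 < N%:R :> R by rewrite ltr0n.
(* In the radial coordinate [r = |x|^N] the factor [|x|^(-a)] is [r^(-s)]. *)
pose s := a / N%:R; have s1 : 1 < s by rewrite ltr_pdivlMr // mul1r.
rewrite integral_sphere //; last by exact/measurable_EFinP.
pose F (z : T * L) : \bar R := if 1 <= z.2 then (z.2 `^ (- s) * k z.1)%:E else 0%E.
have mF : measurable_fun setT F.
  apply: measurable_fun_ifT.
  - apply: (measurable_fun_bool true); rewrite setTI (_ : _ @^-1` _ = snd @^-1` `[1, +oo[%classic).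
      exact: (measurable_preimage measurable_snd).
    by apply/seteqP; split=> z /=; rewrite in_itv /= andbT.
  - apply/measurable_EFinP; apply: measurable_funM.
      by apply: measurable_powR_comp; exact: measurable_snd.
    exact: (measurableT_comp mk measurable_fst).
  - exact: measurable_cst.
have F0 z : (0 <= F z)%E by rewrite /F; case: ifP => // _; rewrite lee_fin mulr_ge0 // powR_ge0.
transitivity (\int[V]_(x in [set x : 'M[R]_(n, m) | (0 < enorm x)%R]) F (normalize x, (enorm (x : 'M[R]_(n, m)) ^+ N)%R))%E.
  rewrite [LHS]integral_mkcond [RHS]integral_mkcond; apply: eq_integral => x _.
  rewrite !patchE /F /=.
  have e0 := enorm_ge0 x; rewrite (_ : (x \in _) = (1 <= enorm x)); last by apply/idP/idP; rewrite inE.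
  rewrite (_ : (x \in _) = (0 < enorm x)); last by apply/idP/idP; rewrite inE.
  rewrite expr_ge1 //; case: (lerP 1 (enorm x)) => h; last by case: ifP.
  rewrite (lt_le_trans ltr01 h); congr (_ * _)%:E.
  by rewrite -powR_mulrn // -powRrM mulrN /s mulrCA divff ?mulr1 // gt_eqF.
rewrite (polar_integral N0 mF F0).
transitivity (\int[V]_(x in (@punctured_ball R n m)) ((s - 1)^-1%:E * (k (normalize x))%:E))%E.
  apply: eq_integral => x _; set y := normalize x.
  transitivity (\int[leb]_(t in `[1%R, +oo[) ((t `^ (- s))%:E * (k y)%:E))%E.
    rewrite [LHS]integral_mkcond [RHS]integral_mkcond; apply: eq_integral => t _.
    rewrite !patchE /F /= !mem_setE !in_itv /= !andbT.
    case: (lerP 1 t) => h; last by case: ifP.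
    by rewrite (lt_le_trans ltr01 h) EFinM.
  rewrite ge0_integralZr //.
  - by rewrite integral_powR_tail.
  - apply/measurable_EFinP; apply: measurable_funTS; exact: measurable_powR.
  - by move=> t _; rewrite lee_fin powR_ge0.
  - by rewrite lee_fin.
rewrite ge0_integralZl_EFin //.
- rewrite muleA -EFinM; congr (_%:E * _)%E; rewrite /s.
  move: NR Na; move: (N%:R : R) => r r0 ra; field.
  by rewrite subr_eq0 !gt_eqF.
- exact: measurable_punctured_ball.
- by move=> x _; rewrite lee_fin.
- by apply/measurable_EFinP; apply: measurable_funTS; exact: (measurableT_comp mk (@measurable_normalize R n m)).
- by rewrite invr_ge0 subr_ge0 ltW.
Qed.

End polar_applications.

(** * Support functions and the body Pi *)

Section lipschitz.
Context (R : realType) (n m : nat).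

Lemma lipschitz_continuous (f : 'M[R]_(n, m) -> R) (c : R) : 0 < c ->
  (forall x y, f x <= f y + c * enorm (x - y)) -> continuous f.
Proof.
move=> c0 hc x A /nbhs_ballP[e /= e0 eA].
have k0 : 0 < c * ((n * m)%:R + 1) by rewrite mulr_gt0 // ltr_wpDl.
apply/nbhs_ballP; exists (e / (c * ((n * m)%:R + 1))) => /=; first by rewrite divr_gt0.
move=> y; rewrite -ball_normE /= ltr_pdivlMr // => xy; apply: eA; rewrite -ball_normE /=.
have k : c * enorm (x - y) < e.
  apply: le_lt_trans xy; rewrite [leRHS]mulrCA; apply: ler_wpM2l; first exact: ltW.
  by apply: le_trans (enorm_le_mx_norm _) _; rewrite mulrC ler_wpM2l // lerDl.
rewrite ltr_norml; have := hc x y; have := hc y x.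
by rewrite -(opprB x y) enormN => h1 h2; apply/andP; split; lra.
Qed.

Lemma continuous_enormB (x : 'M[R]_(n, m)) : continuous (fun y : 'M[R]_(n, m) => enorm (y - x)).
Proof.
apply: (@lipschitz_continuous _ 1) => // y z; rewrite mul1r [leRHS]addrC.
by have := enormD (y - z) (z - x); rewrite (_ : y - z + (z - x) = y - x) // addrA subrK.
Qed.

Lemma closed_le_continuous (f : 'M[R]_(n, m) -> R) (c : R) : continuous f ->
  closed [set x | f x <= c].
Proof.
move=> cf; apply: (@preimage_closed _ _ f [set y | y <= c]); last exact: closed_le.
by move=> x _; exact: cf.
Qed.

End lipschitz.

Section real_powers.
Context (R : realType).

Lemma bernoulli_powR (p y : R) : 1 <= p -> 0 <= y -> 1 + p * (y - 1) <= y `^ p.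
Proof.
move=> p1 y0; have p0 : 0 < p by exact: lt_le_trans p1.
have [->|pn1] := eqVneq p 1; first by rewrite powRr1 //; lra.
have l0 : 0 < p^-1 by rewrite invr_gt0.
have l1 : p^-1 < 1 by rewrite invf_lt1 // lt_neqAle eq_sym pn1.
have := weighted_AMGM l0 l1 ler01 (powR_ge0 y p).
rewrite powR1 mul1r -powRrM mulfV ?gt_eqF // powRr1 // mulr1 => h.
rewrite -(ler_pM2l l0) mulrDr mulrA mulVf ?gt_eqF //; lra.
Qed.

Lemma ler_powR_mono (p x y : R) : 0 <= p -> 0 <= x -> x <= y -> x `^ p <= y `^ p.
Proof. by move=> p0 x0 xy; apply: ge0_ler_powR; rewrite // nnegrE // (le_trans x0). Qed.

(** The combination of two tangent inequalities at the mean [z]; after division by [z] each of them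
    is Bernoulli's inequality. *)
Lemma powR_convex (p t x y : R) : 1 <= p -> 0 <= t <= 1 -> 0 <= x -> 0 <= y ->
  (t * x + (1 - t) * y) `^ p <= t * x `^ p + (1 - t) * y `^ p.
Proof.
move=> p1 /andP[t0 t1] x0 y0; have p0 : 0 < p by exact: lt_le_trans p1.
set z := t * x + _; have z0 : 0 <= z by rewrite /z; nra.
have [z00|zn0] := eqVneq z 0.
  rewrite z00 powR0 ?gt_eqF //; have := powR_ge0 x p; have := powR_ge0 y p; nra.
have zp : 0 < z by rewrite lt_neqAle eq_sym zn0.
have tang a : 0 <= a -> z `^ p * (1 + p * (a / z - 1)) <= a `^ p.
  move=> a0; have := bernoulli_powR p1 (divr_ge0 a0 z0).
  rewrite powRM ?invr_ge0 // => h.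
  have zz : z `^ p * z^-1 `^ p = 1 by rewrite -powRM ?invr_ge0 // divff // powR1.
  have zp0 := powR_ge0 z p.
  apply: le_trans (ler_wpM2l zp0 h) _.
  by rewrite mulrCA zz mulr1.
have hx := tang x x0; have hy := tang y y0.
have e : z `^ p = t * (z `^ p * (1 + p * (x / z - 1))) + (1 - t) * (z `^ p * (1 + p * (y / z - 1))).
  have -> : t * (z `^ p * (1 + p * (x / z - 1))) + (1 - t) * (z `^ p * (1 + p * (y / z - 1))) =
    z `^ p * (1 + p * ((t * x + (1 - t) * y) / z - 1)) by ring.
  by rewrite -/z divff // subrr mulr0 addr0 mulr1.
rewrite e; apply: lerD; apply: ler_wpM2l => //; lra.
Qed.

End real_powers.

Definition is_convex (R : realType) n m (A : set 'M[R]_(n, m)) :=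
  forall x y (t : R), A x -> A y -> 0 <= t <= 1 -> A (t *: x + (1 - t) *: y).

Section support.
Context (R : realType) (m : nat) (Q : set 'rV[R]_m).
Hypothesis hQ : convex_body_o Q.
Local Notation h := (support_fun Q).

Lemma convex_body_convex : is_convex Q.
Proof.
case: hQ => _ cQ _ _ x y t Qx Qy /andP[t0 t1].
pose l := @Itv01 R t t0 t1.
have := cQ x y l; rewrite !inE => /(_ Qx Qy).
by congr (Q _).
Qed.

Lemma convex_body_bounded : exists2 c, 0 < c & forall y, Q y -> enorm y <= c.
Proof. by case: hQ => cQ _ _ _; exact: compact_enorm_bounded. Qed.

Lemma has_sup_support x : has_sup [set inner x y | y in Q].
Proof.
split; first by exists 0, 0; [case: hQ|rewrite inner0r].
have [c c0 Qc] := convex_body_bounded; exists (enorm x * c) => _ [y Qy <-].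
by apply: le_trans (inner_le _ _) _; rewrite ler_wpM2l ?enorm_ge0 ?Qc.
Qed.

Lemma le_support x y : Q y -> inner x y <= h x.
Proof. by move=> Qy; apply: ub_le_sup; [case: (has_sup_support x)|exists y]. Qed.

Lemma support_le x c : (forall y, Q y -> inner x y <= c) -> h x <= c.
Proof.
move=> H; apply: ge_sup; first by case: (has_sup_support x).
by move=> _ [y Qy <-]; exact: H.
Qed.

Lemma support_ge0 x : 0 <= h x.
Proof. by case: hQ => _ _ _ Q0; have := le_support x Q0; rewrite inner0r. Qed.

Lemma supportD x y : h (x + y) <= h x + h y.
Proof. by apply: support_le => z Qz; rewrite innerDl lerD ?le_support. Qed.

Lemma supportZ (t : R) x : 0 <= t -> h (t *: x) = t * h x.
Proof.
move=> t0; have le s z : 0 <= s -> h (s *: z) <= s * h z.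
  by move=> s0; apply: support_le => y Qy; rewrite innerZl ler_wpM2l ?le_support.
apply/eqP; rewrite eq_le le //=.
have [->|tn0] := eqVneq t 0; first by rewrite mul0r support_ge0.
have {}t0 : 0 < t by rewrite lt_neqAle eq_sym tn0.
rewrite -ler_pdivlMl //; apply: le_trans (le _ _ _); last by rewrite invr_ge0 ltW.
by rewrite scalerA mulVf ?gt_eqF // scale1r.
Qed.

Lemma support0 : h 0 = 0.
Proof. by rewrite -(scale0r (0 : 'rV_m)) supportZ // mul0r. Qed.

Lemma support_le_enorm : exists2 c, 0 < c & forall x, h x <= c * enorm x.
Proof.
have [c c0 Qc] := convex_body_bounded; exists c => // x; apply: support_le => y Qy.
by apply: le_trans (inner_le _ _) _; rewrite mulrC ler_wpM2r ?enorm_ge0 ?Qc.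
Qed.

Lemma support_lip : exists2 c, 0 < c & forall x y, h x <= h y + c * enorm (x - y).
Proof.
have [c c0 hc] := support_le_enorm; exists c => // x y.
by rewrite -{1}(subrK y x) addrC; apply: le_trans (supportD _ _) _; rewrite lerD.
Qed.

Lemma continuous_support : continuous h.
Proof.
by have [c c0 hc] := support_lip; exact: (lipschitz_continuous c0 hc).
Qed.

(** The origin may lie on the boundary of [Q], so [h] can vanish in some directions. The ball around
    an interior point [y0] bounds the sum below, since the terms [inner x y0] and [inner (-x) y0]
    cancel. *)
Lemma support_sym_lower : exists2 c, 0 < c & forall x, c * enorm x <= h x + h (- x).
Proof.
case: hQ => _ _ [y0 /nbhs_ballP[e /= e0 eQ]] _.
exists (e / 2) => [|x]; first by rewrite divr_gt0.
have [->|x0] := eqVneq x 0; first by rewrite enorm0 mulr0 oppr0 support0 addr0.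
have xp : 0 < enorm x by rewrite enorm_gt0.
have eh : 0 < e / 2 by rewrite divr_gt0.
pose z := (e / 2) *: normalize x.
have zb (s : bool) : Q (y0 + (-1) ^+ s *: z).
  apply: eQ; rewrite -ball_normE /= opprD addrA subrr sub0r normrN.
  apply: (@le_lt_trans _ _ (e / 2)); last by rewrite ltr_pdivrMr // ltr_pMr // ltr1n.
  apply: le_trans (mx_norm_le_enorm _) _.
  by rewrite 2!enormZ enorm_normalize1 // normr_sign mul1r mulr1 gtr0_norm.
have xz : inner x z = e / 2 * enorm x.
  rewrite /z /normalize !innerZr -enorm_sqr expr2 !mulrA; congr (_ * _).
  by rewrite -mulrA mulVf ?mulr1 // gt_eqF.
have h1 : inner x y0 + e / 2 * enorm x <= h x.
  by rewrite -xz -innerDr; apply: le_support; have := zb false; rewrite expr0 scale1r.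
have h2 : - inner x y0 + e / 2 * enorm x <= h (- x).
  rewrite -xz -[inner x z]opprK -opprD -innerNr -innerDr -innerNl.
  by apply: le_support; have := zb true; rewrite expr1 scaleN1r.
by have := ltW (mulr_gt0 eh xp); lra.
Qed.

End support.

Section support_mulmx.
Context (R : realType) (n m : nat) (Q : set 'rV[R]_m).
Hypothesis hQ : convex_body_o Q.
Local Notation h := (support_fun Q).

Lemma enorm_trmx_mul (x : 'cV[R]_n) (u : 'M[R]_(n, m)) : enorm (x^T *m u) <= enorm x * enorm u.
Proof.
rewrite -(@ler_pXn2r _ 2) ?nnegrE ?mulr_ge0 ?enorm_ge0 // exprMn !enorm_sqr.
rewrite [X in X <= _]innerE big_ord1 [X in _ <= _ * X]innerE exchange_big mulr_sumr /=.
apply: ler_sum => j _; rewrite mxE -expr2.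
pose c := col j u.
have -> : \sum_k x^T 0 k * u k j = inner x c.
  by rewrite innerE; apply: eq_bigr => k _; rewrite big_ord1 !mxE.
have -> : \sum_i u i j * u i j = inner c c.
  by rewrite innerE; apply: eq_bigr => k _; rewrite big_ord1 !mxE.
rewrite -!enorm_sqr -exprMn -[X in X <= _]real_normK ?num_real //.
by rewrite ler_pXn2r ?nnegrE ?mulr_ge0 ?enorm_ge0 // norm_inner_le.
Qed.

Lemma support2_le : exists2 c, 0 < c &
  forall (x : 'cV[R]_n) (u : 'M[R]_(n, m)), h (x^T *m u) <= c * enorm x * enorm u.
Proof.
have [c c0 hc] := support_le_enorm hQ; exists c => // x u.
by apply: le_trans (hc _) _; rewrite -mulrA; apply: ler_wpM2l; [exact: ltW|exact: enorm_trmx_mul].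
Qed.

Lemma measurable_support2 d (U : measurableType d) (f : U -> borel_mx R n 1) (g : U -> borel_mx R n m) :
  measurable_fun setT f -> measurable_fun setT g ->
  measurable_fun setT ((fun z => h ((f z : 'cV[R]_n)^T *m (g z : 'M[R]_(n, m)))) : U -> measurableTypeR R).
Proof.
move=> /measurable_fun_mxP mf /measurable_fun_mxP mg.
apply: (measurableT_comp (continuous_measurable_mx (continuous_support hQ))).
apply/measurable_fun_mxP => i j; under eq_fun do rewrite mxE.
apply: measurable_sum => k; under eq_fun do rewrite mxE.
by apply: measurable_funM; [exact: mf|exact: mg].
Qed.

End support_mulmx.

Section separation.
Context (R : realType) (n m : nat).

Lemma inner_sqr_subZ (t : R) (v z : 'M[R]_(n, m)) :
  inner (t *: v - z) (t *: v - z) = t ^+ 2 * inner v v - 2 * t * inner z v + inner z z.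
Proof. by rewrite !innerE_lin (innerC v z); ring. Qed.

(* The separating functional is the difference with the nearest point of A. *)
Lemma convex_separation (A : set 'M[R]_(n, m)) (x : 'M[R]_(n, m)) : closed A -> is_convex A -> A 0 ->
  ~ A x -> exists z, exists c : R, 0 <= c /\ (forall y, A y -> inner z y <= c) /\ c < inner z x.
Proof.
move=> cA vA A0 nAx.
pose r := enorm x + 1.
have cAr : compact (A `&` [set y | enorm (y - x) <= enorm x]).
  apply: (@compact_mx _ _ _ _ (enorm x + enorm x)).
    apply: closedI => //.
    by apply: closed_le_continuous; exact: continuous_enormB.
  by move=> y [_ /= h]; rewrite -{1}(subrK x y); apply: le_trans (enormD _ _) _; rewrite lerD2r.
have cd : continuous (fun y : 'M[R]_(n, m) => - enorm (y - x)).
  apply: (@lipschitz_continuous _ _ _ _ 1) => // y z; rewrite mul1r.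
  have := enormD (y - z) (z - x); have := enormD (z - y) (y - x).
  rewrite !addrA !subrK -(enormN (z - y)) opprB; lra.
have ne : (A `&` [set y | enorm (y - x) <= enorm x]) !=set0.
  by exists 0; split=> //=; rewrite sub0r enormN.
have [a [Aa ax] amin] : exists2 a, (A `&` [set y | enorm (y - x) <= enorm x]) a &
    forall y, (A `&` [set y | enorm (y - x) <= enorm x]) y -> enorm (a - x) <= enorm (y - x).
  have [a] := @compact_EVT_max _ _ (fun y : 'M[R]_(n, m) => - enorm (y - x)) _ ne cAr (continuous_subspaceT cd).
  rewrite inE => Ba amax; exists a => // y By.
  by rewrite -lerN2; apply: amax; rewrite inE.
have amin' y : A y -> enorm (a - x) <= enorm (y - x).
  move=> Ay; have [h|h] := leP (enorm (y - x)) (enorm x); first by apply: amin.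
  by apply: le_trans ax _; exact: ltW.
pose z := x - a.
have z0 : 0 < inner z z.
  rewrite -enorm_sqr exprn_gt0 // enorm_gt0 subr_eq0; apply/eqP => xa.
  by apply: nAx; rewrite xa.
have key y : A y -> inner z (y - a) <= 0.
  move=> Ay; rewrite leNgt; apply/negP => ip.
  have q0 : 0 <= inner (y - a) (y - a) by exact: inner_ge0.
  set q := inner (y - a) (y - a) in q0 *; set s := inner z (y - a) in ip *.
  (* Moving from [a] towards [y] by the fraction [t] changes the squared distance to [x] by
     [t^2 q - 2 t s], which is negative for this [t]; this contradicts the choice of [a]. *)
  pose t := s / (s + q + 1).
  have d0 : 0 < s + q + 1 by lra.
  have t0 : 0 < t by rewrite divr_gt0.
  have t1 : t <= 1 by rewrite ler_pdivrMr // mul1r; lra.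
  have := amin' _ (vA _ _ t Ay Aa (introT andP (conj (ltW t0) t1))).
  rewrite -(@ler_pXn2r _ 2) ?nnegrE ?enorm_ge0 // !enorm_sqr.
  have -> : t *: y + (1 - t) *: a - x = t *: (y - a) - z.
    by rewrite /z scalerBr scalerBl scale1r opprB; rewrite [_ + (a - _)]addrC addrA [X in X - x]addrC !addrA addrAC.
  have -> : a - x = - z by rewrite /z opprB.
  rewrite inner_sqr_subZ innerNl innerNr opprK -/q -/s => H.
  have ts : t * (s + q + 1) = s by rewrite /t divfK // gt_eqF.
  have : 0 <= t * (t * q - 2 * s) by rewrite expr2 in H; lra.
  rewrite pmulr_rge0 //; nra.
have za : inner z x = inner z a + inner z z by rewrite -innerDr {3}/z addrC subrK.
exists z, (inner z a); split; last split.
- by have := key 0 A0; rewrite sub0r innerNr; lra.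
- by move=> y /key; rewrite innerDr innerNr; lra.
- by rewrite za; lra.
Qed.

End separation.

(** * Integrals of p-th powers and the gauges they define *)

Section power_mean.
Context d (X : measurableType d) (R : realType) (mu : {measure set X -> \bar R}).
Context (D : set X) (a b : nat) (k : X -> 'M[R]_(a, b) -> R) (p c : R).
Hypotheses (mD : measurable D) (muD : (mu D < +oo)%E) (p1 : 1 <= p) (c0 : 0 <= c).
Hypotheses (k0 : forall x z, 0 <= k x z)
  (kD : forall x y z, k x (y + z) <= k x y + k x z)
  (kZ : forall x t z, 0 <= t -> k x (t *: z) = t * k x z)
  (kc : forall x z, D x -> k x z <= c * enorm z)
  (mk : forall z, measurable_fun D (k ^~ z : X -> measurableTypeR R)).

(** An integral of [p]-th powers, without root or averaging. It is used with three kinds of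
    parameter [x]: points of the punctured ball for [Pi_fun], matrices for [centroid_power], and
    points of the support of [f] for [gradient_power]. *)
Definition power_mean (z : 'M[R]_(a, b)) : R := fine (\int[mu]_(x in D) (k x z `^ p)%:E)%E.

Let p0 : 0 < p. Proof. exact: lt_le_trans p1. Qed.

Let mkp z : measurable_fun D (fun x => (k x z `^ p)%:E).
Proof.
apply/measurable_EFinP.
have mp : measurable_fun setT ((fun y : R => y `^ p) : measurableTypeR R -> measurableTypeR R) by exact: measurable_powR.
exact: (measurableT_comp mp (mk z)).
Qed.

Let kp0 z x : D x -> (0 <= (k x z `^ p)%:E)%E. Proof. by rewrite lee_fin powR_ge0. Qed.

Let int_ge0 z : (0 <= \int[mu]_(x in D) (k x z `^ p)%:E)%E.
Proof. by apply: integral_ge0 => x _; rewrite lee_fin powR_ge0. Qed.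

Let upper z : (\int[mu]_(x in D) (k x z `^ p)%:E <= ((c * enorm z) `^ p)%:E * mu D)%E.
Proof.
rewrite -(integral_cst mu mD).
apply: (@ge0_le_integral _ _ _ mu D mD _ _ _ (mkp z)).
- by move=> x _; rewrite lee_fin powR_ge0.
- exact: measurable_cst.
- by move=> x Dx; rewrite lee_fin; apply: ler_powR_mono; [exact: ltW|exact: k0|exact: kc].
Qed.

Lemma power_meanE z : (\int[mu]_(x in D) (k x z `^ p)%:E)%E = (power_mean z)%:E.
Proof.
rewrite /power_mean fineK // (ge0_fin_numE (int_ge0 z)).
apply: le_lt_trans (upper z) _; rewrite lte_mul_pinfty //.
by rewrite lee_fin powR_ge0.
Qed.

Lemma power_mean_ge0 z : 0 <= power_mean z.
Proof. by rewrite -lee_fin -power_meanE; exact: int_ge0. Qed.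

Lemma power_mean_upper z : power_mean z <= fine (mu D) * c `^ p * enorm z `^ p.
Proof.
rewrite -lee_fin -power_meanE; apply: le_trans (upper z) _.
rewrite powRM ?enorm_ge0 // -{1}(@fineK _ (mu D)) ?ge0_fin_numE // -EFinM lee_fin.
by rewrite mulrC mulrA.
Qed.

Lemma power_meanZ t z : 0 <= t -> power_mean (t *: z) = t `^ p * power_mean z.
Proof.
move=> t0; apply: EFin_inj; apply: etrans (esym (power_meanE _)) _.
apply: etrans (_ : ((t `^ p)%:E * \int[mu]_(x in D) (k x z `^ p)%:E)%E = _); last by rewrite EFinM (power_meanE z).
transitivity (\int[mu]_(x in D) ((t `^ p)%:E * (k x z `^ p)%:E))%E.
  by apply: eq_integral => x _; rewrite kZ // powRM // EFinM.
apply: ge0_integralZl_EFin; [exact: mD| |exact: mkp|exact: powR_ge0].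
by move=> x _; rewrite lee_fin powR_ge0.
Qed.

Lemma power_mean_convex t y z : 0 <= t <= 1 ->
  power_mean (t *: y + (1 - t) *: z) <= t * power_mean y + (1 - t) * power_mean z.
Proof.
move=> t01; have /andP[t0 t1] := t01; have t1' : 0 <= 1 - t by rewrite subr_ge0.
have pz w x : D x -> (0 <= (k x w `^ p)%:E)%E by rewrite lee_fin powR_ge0.
have sc s w : 0 <= s -> (\int[mu]_(x in D) (s%:E * (k x w `^ p)%:E) = (s * power_mean w)%:E)%E.
  move=> s0; rewrite (ge0_integralZl_EFin mu mD (pz w) (mkp w) s0).
  by rewrite power_meanE EFinM.
have E1 := sc t y t0; have E2 := sc _ z t1'; have E3 := power_meanE (t *: y + (1 - t) *: z).
rewrite -lee_fin EFinD; apply: le_trans (_ : (_ <= \int[mu]_(x in D) (t%:E * (k x y `^ p)%:E) + \int[mu]_(x in D) ((1 - t)%:E * (k x z `^ p)%:E))%E) _; last by rewrite E1 E2.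
apply: le_trans (_ : (_ <= \int[mu]_(x in D) (k x (t *: y + (1 - t) *: z) `^ p)%:E)%E) _; first by rewrite E3.
have sz s w x : 0 <= s -> D x -> (0 <= s%:E * (k x w `^ p)%:E)%E.
  by move=> s0 Dx; apply: mule_ge0; [rewrite lee_fin|exact: pz].
rewrite -(ge0_integralD mu mD (fun x => @sz t y x t0) (measurable_funeM _ (mkp y)) (fun x => @sz (1 - t) z x t1') (measurable_funeM _ (mkp z))).
apply: (@ge0_le_integral _ _ _ mu D mD _ _ _ (mkp _)).
- exact: pz.
- by apply: emeasurable_funD; apply: measurable_funeM; exact: mkp.
- move=> x Dx; rewrite -!EFinM -EFinD lee_fin.
  apply: le_trans (powR_convex p1 t01 (k0 _ _) (k0 _ _)).
  apply: ler_powR_mono; [exact: ltW|exact: k0|].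
  by apply: le_trans (kD _ _ _) _; rewrite (kZ _ _ t0) (kZ _ _ t1').
Qed.

End power_mean.

Section gauge.
Context (R : realType) (a b : nat) (F : 'M[R]_(a, b) -> R) (p c C : R).
Hypotheses (p1 : 1 <= p) (c0 : 0 < c) (C0 : 0 < C).
Hypotheses (FZ : forall t z, 0 <= t -> F (t *: z) = t `^ p * F z)
  (Fc : forall z, c * enorm z `^ p <= F z) (FC : forall z, F z <= C * enorm z `^ p)
  (Fcvx : forall t y z, 0 <= t <= 1 -> F (t *: y + (1 - t) *: z) <= t * F y + (1 - t) * F z).

Let p0 : 0 < p. Proof. exact: lt_le_trans p1. Qed.

Definition gauge_root z : R := F z `^ p^-1.

Lemma gauge_F_ge0 z : 0 <= F z.
Proof. by apply: le_trans (Fc z); rewrite mulr_ge0 ?powR_ge0 // ltW. Qed.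

Lemma gauge_root_ge0 z : 0 <= gauge_root z. Proof. exact: powR_ge0. Qed.

Lemma gauge_rootK z : gauge_root z `^ p = F z.
Proof. by rewrite -powRrM mulVf ?gt_eqF // powRr1 // gauge_F_ge0. Qed.

Lemma gauge_rootZ t z : 0 <= t -> gauge_root (t *: z) = t * gauge_root z.
Proof.
move=> t0; rewrite /gauge_root FZ // powRM ?powR_ge0 ?gauge_F_ge0 //.
by rewrite -powRrM mulfV ?gt_eqF // powRr1.
Qed.

Lemma gauge_root_le1 z : (gauge_root z <= 1) = (F z <= 1).
Proof.
have one (q : R) : 1 `^ q = 1 :> R by rewrite powR1.
apply/idP/idP => h.
  by rewrite -gauge_rootK -(one p); apply: ler_powR_mono; rewrite ?gauge_root_ge0 // ltW.
by rewrite -(one p^-1); apply: ler_powR_mono; rewrite ?gauge_F_ge0 // invr_ge0 ltW.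
Qed.

Lemma gauge_root_upper z : gauge_root z <= C `^ p^-1 * enorm z.
Proof.
have -> : C `^ p^-1 * enorm z = (C * enorm z `^ p) `^ p^-1.
  by rewrite powRM ?powR_ge0 ?(ltW C0) // -powRrM mulfV ?gt_eqF // powRr1 // enorm_ge0.
by apply: ler_powR_mono; rewrite ?gauge_F_ge0 // invr_ge0 ltW.
Qed.

Lemma gauge_root_lower z : c `^ p^-1 * enorm z <= gauge_root z.
Proof.
have -> : c `^ p^-1 * enorm z = (c * enorm z `^ p) `^ p^-1.
  by rewrite powRM ?powR_ge0 ?(ltW c0) // -powRrM mulfV ?gt_eqF // powRr1 // enorm_ge0.
by apply: ler_powR_mono; rewrite ?mulr_ge0 ?powR_ge0 ?(ltW c0) // invr_ge0 ltW.
Qed.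

Lemma gauge_root_eq0 z : (gauge_root z == 0) = (z == 0).
Proof.
apply/eqP/eqP => [z0|->]; last by rewrite -(scale0r (0 : 'M[R]_(a, b))) gauge_rootZ // mul0r.
apply/eqP; rewrite -enorm_eq0 eq_le enorm_ge0 andbT.
have cp : 0 < c `^ p^-1 by rewrite powR_gt0.
by rewrite -(pmulr_rle0 _ cp) -z0 gauge_root_lower.
Qed.

(** Minkowski's inequality from convexity of [F]: normalize [y] and [z] to [F = 1] and combine them
    with weights proportional to their gauges. *)
Lemma gauge_rootD y z : gauge_root (y + z) <= gauge_root y + gauge_root z.
Proof.
have [->|y0] := eqVneq y 0; first by rewrite add0r lerDr gauge_root_ge0.
have [->|z0] := eqVneq z 0; first by rewrite addr0 lerDl gauge_root_ge0.
have gp w : w != 0 -> 0 < gauge_root w by move=> w0; rewrite lt_neqAle eq_sym gauge_root_eq0 w0 gauge_root_ge0.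
set s := gauge_root y; set r := gauge_root z; have s0 : 0 < s := gp y y0; have r0 : 0 < r := gp z z0.
have sr : 0 < s + r by rewrite addr_gt0.
have one w : w != 0 -> F ((gauge_root w)^-1 *: w) = 1.
  move=> w0; rewrite -gauge_rootK gauge_rootZ ?invr_ge0 ?gauge_root_ge0 // mulVf ?powR1 //.
  by rewrite gt_eqF ?gp.
pose t := s / (s + r).
have t01 : 0 <= t <= 1.
  by rewrite divr_ge0 ?(ltW s0) ?(ltW sr) // ler_pdivrMr // mul1r lerDl ltW.
have := Fcvx (s^-1 *: y) (r^-1 *: z) t01; rewrite !one // !mulr1 (_ : t + (1 - t) = 1); last by ring.
have -> : t *: (s^-1 *: y) + (1 - t) *: (r^-1 *: z) = (s + r)^-1 *: (y + z).
  rewrite !scalerA scalerDr; congr (_ *: _ + _ *: _); rewrite /t; field; by rewrite !gt_eqF.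
rewrite -gauge_root_le1 gauge_rootZ ?invr_ge0 ?(ltW sr) //.
by rewrite ler_pdivrMl // mulr1.
Qed.

Lemma continuous_gauge_root : continuous gauge_root.
Proof.
have C1 : 0 < C `^ p^-1 by rewrite powR_gt0.
apply: (lipschitz_continuous C1) => x y.
rewrite -{1}(subrK y x) addrC; apply: le_trans (gauge_rootD _ _) _.
by rewrite lerD2l gauge_root_upper.
Qed.

Lemma measurable_gauge_F : measurable_fun setT (F : borel_mx R a b -> measurableTypeR R).
Proof.
rewrite (_ : F = fun z => gauge_root z `^ p); last by apply/funext => z; rewrite gauge_rootK.
by apply: measurable_powR_comp; apply: continuous_measurable_mx; exact: continuous_gauge_root.
Qed.

Lemma gauge_ball_convex : is_convex [set z | F z <= 1].
Proof.
move=> x y t /= Fx Fy t01; apply: le_trans (Fcvx _ _ t01) _.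
by have /andP[t0 t1] := t01; nra.
Qed.

Lemma gauge_ball_closed : closed [set z | F z <= 1].
Proof.
rewrite (_ : [set z | _] = [set z | gauge_root z <= 1]).
  by apply: closed_le_continuous; exact: continuous_gauge_root.
by apply/seteqP; split=> z /=; rewrite gauge_root_le1.
Qed.

Lemma gauge_ball_bounded z : F z <= 1 -> enorm z <= (c `^ p^-1)^-1.
Proof.
rewrite -gauge_root_le1 => z1; rewrite -[leRHS]mulr1 ler_pdivlMl ?powR_gt0 //.
exact: le_trans (gauge_root_lower z) z1.
Qed.

Lemma sub_gauge_ball z : enorm z <= (C `^ p^-1)^-1 -> F z <= 1.
Proof.
rewrite -[leRHS]mulr1 ler_pdivlMl ?powR_gt0 // -gauge_root_le1 => h.
exact: le_trans (gauge_root_upper z) h.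
Qed.

(** The bipolar theorem for the closed convex unit ball of the gauge. A point outside is separated
    by some [z]; dividing [z] by a number strictly between the two separated values yields a member
    of the inner set whose product with the point exceeds 1. *)
Lemma gauge_ball_polar : [set z | F z <= 1] =
  polar [set y | forall x, inner x y <= gauge_root x].
Proof.
apply/seteqP; split=> x /=.
  by rewrite -gauge_root_le1 => x1 y /(_ x) /le_trans; apply.
move=> h; apply: contrapT => nx.
have F0 : F 0 <= 1.
  by rewrite -gauge_root_le1 (eqP (_ : gauge_root 0 == 0)) ?gauge_root_eq0.
have [z [s [s0 [zs zx]]]] := convex_separation gauge_ball_closed gauge_ball_convex F0 nx.
pose s' := (s + inner z x) / 2; have s'0 : 0 < s' by rewrite /s'; lra.
have zw w : inner w (s'^-1 *: z) <= gauge_root w.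
  have [->|w0] := eqVneq w 0; first by rewrite inner0l gauge_root_ge0.
  have gw : 0 < gauge_root w by rewrite lt_neqAle eq_sym gauge_root_eq0 w0 gauge_root_ge0.
  rewrite innerZr innerC ler_pdivrMl // -ler_pdivrMr // mulrC -innerZr.
  apply: le_trans (zs _ _) _; last by rewrite /s'; lra.
  by rewrite /= -gauge_root_le1 gauge_rootZ ?invr_ge0 ?(ltW gw) // mulVf // gt_eqF.
have := h _ zw; rewrite innerZr innerC ler_pdivrMl // mulr1 /s'; lra.
Qed.

End gauge.

Section change_of_variable.
Context (R : realType) (n m : nat).
Local Notation T := (borel_mx R n m).
Local Notation V := (@lebesgue_mx R n m).

Lemma integral_mull (phi : 'M[R]_n) (D : set T) (f : T -> \bar R) : phi \in unitmx ->
  measurable D -> measurable_fun setT f -> (forall x, 0 <= f x)%E ->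
  (\int[V]_(x in (fun x : 'M[R]_(n, m) => (phi *m x)%R) @^-1` D) f (phi *m x) =
   (dil phi ^+ m)%:E * \int[V]_(x in D) f x)%E.
Proof.
move=> uphi mD mf f0.
have [nu [nuE nuI]] := pushforward_integral V (@measurable_mulmxl R n m n phi).
have d0 : 0 <= dil phi ^+ m by rewrite exprn_ge0 // ltW // dil_gt0.
rewrite -nuI // (eq_measure_integral (mscale (NngNum d0) V)).
  by rewrite ge0_integral_mscale //; exact: measurable_funTS.
move=> A mA _; apply: etrans (nuE A) _; apply: etrans (lebesgue_mx_mull uphi mA) _.
by rewrite /= /mscale muleC.
Qed.

Lemma integral_mull_setT (phi : 'M[R]_n) (f : T -> \bar R) : phi \in unitmx ->
  measurable_fun setT f -> (forall x, 0 <= f x)%E ->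
  (\int[V]_x f (phi *m x) = (dil phi ^+ m)%:E * \int[V]_x f x)%E.
Proof. by move=> uphi mf f0; rewrite -integral_mull // preimage_setT. Qed.

Lemma integral_mxN (D : set T) (f : T -> \bar R) :
  (fun x : 'M[R]_(n, m) => - x) @^-1` D = D -> measurable D ->
  measurable_fun setT f -> (forall x, 0 <= f x)%E ->
  (\int[V]_(x in D) f (- (x : 'M[R]_(n, m)))%R = \int[V]_(x in D) f x)%E.
Proof.
move=> DN mD mf f0.
have oN : is_ortho (- 1%:M : 'M[R]_n) by rewrite /is_ortho [(- _)^T]linearN /= trmx1 mulNmx mulmxN opprK mul1mx.
have := integral_mull (ortho_unit oN) mD mf f0.
rewrite dil_ortho // expr1n mul1e => <-.
rewrite (_ : _ @^-1` D = D); last by rewrite -{2}DN; apply/seteqP; split=> x /=; rewrite mulNmx mul1mx.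
by apply: eq_integral => x _; rewrite mulNmx mul1mx.
Qed.

Lemma integral_mx_shift (a : 'M[R]_(n, m)) (f : T -> \bar R) :
  measurable_fun setT f -> (forall x, 0 <= f x)%E ->
  (\int[V]_x f (x + a)%R = \int[V]_x f x)%E.
Proof.
move=> mf f0.
have [nu [nuE nuI]] := pushforward_integral V (@measurable_mx_shift R n m a).
have := nuI setT f measurableT mf f0; rewrite preimage_setT => <-.
apply: eq_measure_integral => A mA _; apply: etrans (nuE A) _; exact: lebesgue_mx_shift.
Qed.

(** Serves the situation of [support_sym_lower], in which only one of [f x] and [f (-x)] is known to
    be large, without saying which. *)
Lemma le_integral_symmetric (D B : set T) (f : T -> \bar R) (c : R) :
  (fun x : 'M[R]_(n, m) => - x) @^-1` D = D -> measurable D -> measurable B -> B `<=` D ->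
  measurable_fun setT f -> (forall x, 0 <= f x)%E -> 0 <= c ->
  (forall x, B x -> c%:E <= f x + f (- (x : 'M[R]_(n, m)))%R)%E ->
  (c%:E * V B <= \int[V]_(x in D) f x + \int[V]_(x in D) f x)%E.
Proof.
move=> DN mD mB BD mf f0 c0 H.
have mN : measurable_fun setT ((fun x : 'M[R]_(n, m) => - x) : T -> T).
  exact: (measurable_fun_mxN (@measurable_id _ T setT)).
have mfN : measurable_fun setT (fun x : T => f (- (x : 'M[R]_(n, m)))%R) by exact: (measurableT_comp mf mN).
rewrite -{2}(integral_mxN DN mD mf f0) -ge0_integralD //; [|exact: measurable_funTS|exact: measurable_funTS].
have mS : measurable_fun setT (fun x : T => f x + f (- (x : 'M[R]_(n, m)))%R)%E by exact: emeasurable_funD.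
apply: (@le_trans _ _ (\int[V]_(x in B) (f x + f (- (x : 'M[R]_(n, m)))%R))%E).
  rewrite -integral_cst //; apply: ge0_le_integral => //; exact: measurable_funTS.
apply: ge0_subset_integral => //; first exact: measurable_funTS.
by move=> x _; rewrite adde_ge0.
Qed.

Lemma integral_sphereN (f : T -> \bar R) : measurable_fun setT f -> (forall x, 0 <= f x)%E ->
  (\int[sphere_measure]_(v in (unit_sphere : set T)) f (- (v : 'M[R]_(n, m)))%R =
   \int[sphere_measure]_(v in (unit_sphere : set T)) f v)%E.
Proof.
move=> mf f0.
have mN : measurable_fun setT ((fun x : 'M[R]_(n, m) => - x) : T -> T).
  exact: (measurable_fun_mxN (@measurable_id _ T setT)).
have mfN : measurable_fun setT (fun x : T => f (- (x : 'M[R]_(n, m)))%R) by exact: (measurableT_comp mf mN).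
have mfn : measurable_fun setT (fun x : T => f (normalize x)) by exact: (measurableT_comp mf (@measurable_normalize R n m)).
rewrite !integral_sphere //; congr (_ * _)%E.
rewrite -(@integral_mxN (@punctured_ball R n m) (fun x => f (normalize x))) //.
- by apply: eq_integral => x _; rewrite /normalize enormN scalerN.
- by apply/seteqP; split=> x; rewrite /punctured_ball /= enormN.
- exact: measurable_punctured_ball.
Qed.

End change_of_variable.

Section Pi.
Context (R : realType) (n m : nat) (Q : set 'rV[R]_m) (p : R).
Hypotheses (hQ : convex_body_o Q) (p1 : 1 <= p) (n0 : (0 < n)%N) (m0 : (0 < m)%N).
Local Notation h := (support_fun Q).
Local Notation T := (borel_mx R n 1).
Local Notation V := (@lebesgue_mx R n 1).
Local Notation D := (@punctured_ball R n 1).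

Let p0 : 0 < p. Proof. exact: lt_le_trans p1. Qed.

(** The factor [n^(1/p)] comes from [integral_sphere]: it turns the spherical integral into one over
    the punctured ball, to which [power_mean] applies. *)
Definition Pi_kernel (x : T) (u : 'M[R]_(n, m)) : R :=
  n%:R `^ p^-1 * h ((normalize (x : 'cV[R]_n))^T *m u).

Definition Pi_fun : 'M[R]_(n, m) -> R := power_mean V D Pi_kernel p.

Let bound : {c : R | 0 < c & forall x u, D x -> Pi_kernel x u <= c * enorm u}.
Proof.
apply: cid2; have [c c0 hc] := @support2_le R n m Q hQ.
have n1 : 0 < n%:R `^ p^-1 :> R by rewrite powR_gt0 // ltr0n.
exists (n%:R `^ p^-1 * c); first exact: mulr_gt0.
move=> x u /andP[x0 _]; rewrite -mulrA /Pi_kernel ler_wpM2l ?(ltW n1) //.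
by apply: le_trans (hc _ _) _; rewrite enorm_normalize1 // mulr1.
Qed.

Let mk u : measurable_fun setT (Pi_kernel ^~ u : T -> measurableTypeR R).
Proof.
apply: measurable_funM; first exact: measurable_cst.
exact: (measurable_support2 hQ (@measurable_normalize R n 1) (@measurable_cst _ _ _ (borel_mx R n m) _ u)).
Qed.

Let k0 x u : 0 <= Pi_kernel x u.
Proof. by rewrite mulr_ge0 ?powR_ge0 // support_ge0. Qed.

Let kD x u v : Pi_kernel x (u + v) <= Pi_kernel x u + Pi_kernel x v.
Proof. by rewrite /Pi_kernel mulmxDr -mulrDr ler_wpM2l ?powR_ge0 // supportD. Qed.

Let kZ x t u : 0 <= t -> Pi_kernel x (t *: u) = t * Pi_kernel x u.
Proof. by move=> t0; rewrite /Pi_kernel -scalemxAr supportZ // mulrCA. Qed.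

Let Dfin : (V D < +oo)%E.
Proof. by apply: (@enorm_bounded_lty _ _ _ _ 1); [exact: measurable_punctured_ball|move=> x /andP[]]. Qed.

Let mD := @measurable_punctured_ball R n 1.

Let mkD u : measurable_fun D (Pi_kernel ^~ u : T -> measurableTypeR R).
Proof. by apply: measurable_funTS; exact: mk. Qed.

Let kE u : (\int[V]_(x in D) (Pi_kernel x u `^ p)%:E)%E = (Pi_fun u)%:E.
Proof.
by case: bound => c _ hc; exact: (power_meanE mD Dfin p1 k0 hc mkD).
Qed.

Lemma Pi_funE (u : 'M[R]_(n, m)) :
  (\int[sphere_measure]_(v in (unit_sphere : set T)) ((h (v^T *m u)) `^ p)%:E = (Pi_fun u)%:E)%E.
Proof.
rewrite integral_sphere; last 2 first.
- apply/measurable_EFinP; apply: measurable_powR_comp.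
  exact: (measurable_support2 hQ (@measurable_id _ T _) (@measurable_cst _ _ _ (borel_mx R n m) _ u)).
- by move=> x; rewrite lee_fin powR_ge0.
rewrite muln1 -kE -ge0_integralZl_EFin //.
- apply: eq_integral => x _; rewrite /Pi_kernel powRM ?powR_ge0 ?support_ge0 //.
  by rewrite -powRrM mulVf ?gt_eqF // powRr1 // EFinM.
- by move=> x _; rewrite lee_fin powR_ge0.
- apply/measurable_EFinP; apply: measurable_funTS; apply: measurable_powR_comp.
  exact: (measurable_support2 hQ (@measurable_normalize R n 1) (@measurable_cst _ _ _ (borel_mx R n m) _ u)).
Qed.

Lemma Pi_funN (u : 'M[R]_(n, m)) :
  (\int[sphere_measure]_(v in (unit_sphere : set T)) ((h ((- v)^T *m u)) `^ p)%:E = (Pi_fun u)%:E)%E.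
Proof.
have mf : measurable_fun setT (fun v : T => ((h (v^T *m u)) `^ p)%:E).
  apply/measurable_EFinP; apply: measurable_powR_comp.
  exact: (measurable_support2 hQ (@measurable_id _ T _) (@measurable_cst _ _ _ (borel_mx R n m) _ u)).
rewrite -Pi_funE; apply: (integral_sphereN mf) => v.
by rewrite lee_fin powR_ge0.
Qed.

Lemma Pi_homo t u : 0 <= t -> Pi_fun (t *: u) = t `^ p * Pi_fun u.
Proof.
by case: bound => c _ hc; exact: (power_meanZ mD Dfin p1 k0 kZ hc mkD).
Qed.

Lemma Pi_convex t u v : 0 <= t <= 1 ->
  Pi_fun (t *: u + (1 - t) *: v) <= t * Pi_fun u + (1 - t) * Pi_fun v.
Proof.
by case: bound => c _ hc; exact: (power_mean_convex mD Dfin p1 k0 kD kZ hc mkD).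
Qed.

Lemma Pi_upper : exists2 C, 0 < C & forall u, Pi_fun u <= C * enorm u `^ p.
Proof.
case: bound => c c0 hc; exists (fine (V D) * c `^ p + 1).
  by rewrite ltr_wpDl // mulr_ge0 ?powR_ge0 ?fine_ge0.
move=> u; apply: (@le_trans _ _ (fine (V D) * c `^ p * enorm u `^ p)).
  exact: (power_mean_upper mD Dfin p1 (ltW c0) k0 hc mkD).
by rewrite ler_wpM2r ?powR_ge0 // lerDl.
Qed.

(** On a small ball inside the punctured ball [|x^T u|] is comparable with [|u|], and there
    [support_sym_lower] makes the kernel large at [x] or at [-x]. *)
Lemma Pi_lower : exists2 c, 0 < c & forall u, c * enorm u `^ p <= Pi_fun u.
Proof.
have [c c0 hc] := support_sym_lower hQ.
have N0 : (0 < n * m)%N by rewrite muln_gt0 n0 m0.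
have NR : 1 <= (n * m)%:R :> R by rewrite ler1n.
pose dl : R := (4 * (n * m)%:R)^-1.
have d0 : 0 < dl by rewrite invr_gt0 mulr_gt0 // ltr0n.
have d4 : dl <= 4^-1 by rewrite lef_pV2 ?posrE ?mulr_gt0 ?ltr0n // ler_peMr.
have n1 : 0 < n%:R `^ p^-1 :> R by rewrite powR_gt0 // ltr0n.
pose s0 : R := n%:R `^ p^-1 * (c * dl / 2).
have s00 : 0 < s0 by rewrite mulr_gt0 // divr_gt0 // mulr_gt0.
have Bfin : V (eball dl) \is a fin_num by rewrite ge0_fin_numE // lebesgue_eball_lty.
have Bpos : 0 < fine (V (eball dl)).
  by rewrite fine_gt0 // lebesgue_eball_gt0 //= lebesgue_eball_lty.
exists (s0 `^ p * fine (V (eball dl)) / 2) => [|u].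
  by rewrite divr_gt0 // mulr_gt0 // powR_gt0.
have [->|u0] := eqVneq u 0.
  rewrite enorm0 powR0 ?gt_eqF // mulr0; rewrite -lee_fin -kE.
  by apply: integral_ge0 => x _; rewrite lee_fin powR_ge0.
have [[i j] uij] : exists ij : 'I_n * 'I_m, `|u| = `|u ij.1 ij.2|.
  by apply: mx_norm_neq0; have := u0; rewrite -normr_eq0.
have ule : enorm u <= (n * m)%:R * `|u i j| by have := enorm_le_mx_norm u; rewrite uij.
(* [w0] is half the coordinate vector of the row containing the largest entry of [u], so
   [|w0^T u| >= |u| / (2N)]. Within distance [dl = 1 / (4N)] of [w0] at least half of this is
   kept. *)
pose w0 : 'cV[R]_n := 2^-1 *: delta_mx i 0.
have w0n : enorm w0 = 2^-1.
  rewrite enormZ gtr0_norm ?invr_gt0 // /enorm innerE (bigD1 i) //= big_ord1 !mxE !eqxx big1 ?addr0 ?mulr1 ?sqrtr1 ?mulr1 //.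
  by move=> k ki; rewrite big_ord1 !mxE (negbTE ki) mulr0.
pose B : set T := [set x : 'cV[R]_n | enorm (x - w0) <= dl].
have mB : measurable B.
  by apply: closed_measurable_mx; apply: closed_le_continuous; exact: continuous_enormB.
have VB : V B = V (eball dl).
  by rewrite -(lebesgue_mx_shift (- w0) (@measurable_eball _ _ _ dl)).
have BD : B `<=` D.
  move=> x; rewrite /B /= => xw; have h1 := enormB_le x w0.
  have h2 := enormB_le w0 (w0 - x); rewrite subKr in h2.
  rewrite -(enormN (w0 - x)) opprB in h2.
  rewrite /punctured_ball /= w0n in h1 h2 *; apply/andP; split; lra.
have low (x : T) : B x -> s0 * enorm u <= Num.max (Pi_kernel x u) (Pi_kernel (- x : 'cV[R]_n) u).
  move=> Bx; have /andP[x0 x1] := BD _ Bx.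
  have e1 : normalize (- x : 'cV[R]_n) = - normalize x by rewrite /normalize enormN scalerN.
  rewrite /Pi_kernel e1 linearN /= mulNmx -maxr_pMr ?(ltW n1) // /s0 -mulrA ler_wpM2l ?(ltW n1) //.
  have lw : dl * enorm u <= enorm ((normalize x)^T *m u).
    have nx : enorm (x^T *m u) <= enorm ((normalize x)^T *m u).
      rewrite -{1}(scale_normalize x) linearZ /= -scalemxAl enormZ ger0_norm ?enorm_ge0 //.
      by rewrite ler_piMl ?enorm_ge0.
    apply: le_trans nx.
    have t1 : enorm (w0^T *m u) - enorm ((x - w0)^T *m u) <= enorm (x^T *m u).
      rewrite lerBlDr; have := enormD (x^T *m u) (- ((x - w0)^T *m u)).
      rewrite enormN [X in enorm X <= _](_ : _ = w0^T *m u) //.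
      by rewrite -mulNmx -mulmxDl -linearN -linearD /= opprB addrC subrK.
    have t2 : enorm ((x - w0)^T *m u) <= dl * enorm u.
      by apply: le_trans (enorm_trmx_mul _ _) _; rewrite ler_wpM2r ?enorm_ge0.
    have t3 : 2^-1 * `|u i j| <= enorm (w0^T *m u).
      have -> : w0^T *m u = 2^-1 *: row i u by rewrite linearZ /= -scalemxAl trmx_delta rowE.
      rewrite enormZ [`|2^-1|]gtr0_norm ?invr_gt0 // ler_wpM2l ?invr_ge0 //.
      by have := le_coord_enorm (row i u) 0 j; rewrite mxE.
    have t4 : 2 * (dl * enorm u) <= 2^-1 * `|u i j|.
      have dN : dl * (n * m)%:R = 4^-1 by rewrite /dl invfM -mulrA mulVf ?mulr1 // gt_eqF // ltr0n.
      have : dl * enorm u <= dl * ((n * m)%:R * `|u i j|) by rewrite ler_wpM2l // ltW.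
      rewrite [X in _ <= X -> _]mulrA dN; lra.
    lra.
  have := hc ((normalize x)^T *m u); set q := enorm ((normalize x)^T *m u) in lw * => hs.
  rewrite le_max; apply/orP.
  have q2 : c * dl / 2 * enorm u * 2 <= c * q.
    rewrite (_ : _ * 2 = c * (dl * enorm u)); last by field.
    by rewrite ler_wpM2l // ltW.
  by case: (leP (c * dl / 2 * enorm u) (h ((normalize x)^T *m u))) => [|h3]; [left|right; lra].
pose f (x : T) : \bar R := (Pi_kernel x u `^ p)%:E.
have mf : measurable_fun setT f by apply/measurable_EFinP; exact: measurable_powR_comp.
have f0 x : (0 <= f x)%E by rewrite lee_fin powR_ge0.
have DN : (fun x : 'cV[R]_n => - x) @^-1` D = D.
  by apply/seteqP; split=> x; rewrite /punctured_ball /= enormN.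
have su0 : 0 <= s0 * enorm u by rewrite mulr_ge0 ?enorm_ge0 // ltW.
have Bf x : B x -> (((s0 * enorm u) `^ p)%:E <= f x + f (- (x : 'cV[R]_n))%R)%E.
  move=> Bx; rewrite -EFinD lee_fin; have := low x Bx; rewrite le_max => /orP[] hx.
    by rewrite -[leLHS]addr0 lerD ?powR_ge0 // ler_powR_mono // ltW.
  by rewrite -[leLHS]add0r lerD ?powR_ge0 // ler_powR_mono // ltW.
have := le_integral_symmetric DN mD mB BD mf f0 (powR_ge0 _ _) Bf.
rewrite VB kE -(fineK Bfin) -EFinM -EFinD.
rewrite lee_fin powRM ?enorm_ge0 ?(ltW s00) //; lra.
Qed.

Definition Pi_root (u : 'M[R]_(n, m)) : R := gauge_root Pi_fun p u.

Lemma Pi_supportE u : Pi_support p Q u = (Pi_root u)%:E.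
Proof. by rewrite /Pi_support Pi_funE poweR_EFin. Qed.

Lemma polar_Pi_body : polar (Pi_body p Q) = [set u : 'M[R]_(n, m) | Pi_fun u <= 1].
Proof.
have [c c0 hc] := Pi_lower; have [C C0 hC] := Pi_upper.
rewrite (gauge_ball_polar p1 c0 C0 Pi_homo hc hC Pi_convex); congr polar.
by apply/seteqP; split=> y hy x; have := hy x; rewrite Pi_supportE lee_fin.
Qed.

Lemma measurable_Pi_ball : measurable ([set u : 'M[R]_(n, m) | Pi_fun u <= 1] : set (borel_mx R n m)).
Proof.
have [c c0 hc] := Pi_lower; have [C C0 hC] := Pi_upper.
apply: closed_measurable_mx; exact: (gauge_ball_closed p1 c0 C0 Pi_homo hc hC Pi_convex).
Qed.

Definition Pi_volume : R := fine (lebesgue_mx ([set u : 'M[R]_(n, m) | Pi_fun u <= 1] : set (borel_mx R n m))).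

Lemma Pi_volumeE : lebesgue_mx ([set u : 'M[R]_(n, m) | Pi_fun u <= 1] : set (borel_mx R n m)) = Pi_volume%:E.
Proof.
have [c c0 hc] := Pi_lower; rewrite fineK // enorm_bounded_fin_num //; first exact: measurable_Pi_ball.
by exists (c `^ p^-1)^-1 => u; exact: (gauge_ball_bounded p1 c0 hc).
Qed.

Lemma Pi_volume_gt0 : 0 < Pi_volume.
Proof.
have [C C0 hC] := Pi_upper; have [c c0 hc] := Pi_lower.
rewrite -lte_fin -Pi_volumeE.
apply: (@lt_le_trans _ _ (lebesgue_mx (eball (C `^ p^-1)^-1 : set (borel_mx R n m)))).
  by apply: lebesgue_eball_gt0; rewrite invr_gt0 powR_gt0.
apply: le_measure; rewrite ?inE; [exact: measurable_eball|exact: measurable_Pi_ball|].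
by move=> u; exact: (sub_gauge_ball p1 c0 C0 hc hC).
Qed.

End Pi.

(** * Test functions and the anisotropic capacity inequality *)

Section coordinate_derivatives.
Context (R : realType) (n : nat).
Implicit Types (f : 'cV[R]_n -> R) (x y z : 'cV[R]_n).
Local Notation e := (fun i : 'I_n => delta_mx i 0 : 'cV[R]_n).

Lemma is_derive_line (U : normedModType R) (f : U -> R) (z v : U) (t : R) : derivable f (z + t *: v) v ->
  is_derive t (1 : R) (fun s => f (z + s *: v)) ('D_v f (z + t *: v)).
Proof.
have E : (fun h => h^-1 *: (((fun s => f (z + s *: v)) \o shift t) (h *: (1 : R)) - f (z + t *: v))) =
         (fun h => h^-1 *: ((f \o shift (z + t *: v)) (h *: v) - f (z + t *: v))).
  apply/funext => h /=; congr (_ *: (f _ - _)).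
  by rewrite [h%:A]mulr1 scalerDl addrCA.
by move=> df; split; rewrite /derivable /derive E.
Qed.

Lemma line_diff_le (g dg : R -> R) (s M : R) : (forall t, is_derive t (1 : R) g (dg t)) ->
  (forall t, `|t| <= `|s| -> `|dg t| <= M) -> `|g s - g 0| <= M * `|s|.
Proof.
move=> gd b.
have cg a c : {within `[a, c], continuous g}.
  by apply: derivable_within_continuous => t _; have [] := gd t.
have [s0|/ltW s0] := leP 0 s.
  have [c /[!in_itv] /= /andP[c0 cs] ->] := MVT_segment s0 (fun t _ => gd t) (cg _ _).
  by rewrite subr0 normrM ler_wpM2r // b // !ger0_norm.
have [c /[!in_itv] /= /andP[c0 cs] E] := MVT_segment s0 (fun t _ => gd t) (cg _ _).
rewrite distrC E sub0r normrM normrN ler_wpM2r // b // !ler0_norm // lerN2 //.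
Qed.

(** [is_Ck] speaks of partial derivatives only, so the mean value theorem is used along a path that
    changes one coordinate at a time: [w k] has its first [k] coordinates from [x] and the others
    from [y]. The path never leaves the ball around [y] through [x]. *)
Lemma coordinate_diff_le f (d : 'I_n -> 'cV[R]_n -> R) x y (M : R) :
  (forall i z t, is_derive t (1 : R) (fun s => f (z + s *: e i)) (d i (z + t *: e i))) -> 0 <= M ->
  (forall i z, enorm (z - y) <= enorm (x - y) -> `|d i z| <= M) ->
  `|f x - f y| <= n%:R * (M * enorm (x - y)).
Proof.
move=> fd M0 b.
pose w (k : nat) : 'cV[R]_n := \col_j (if (j < k)%N then x j 0 else y j 0).
have near k (i : 'I_n) (t : R) : i = k :> nat -> `|t| <= `|x i 0 - y i 0| ->
    enorm (w k + t *: e i - y) <= enorm (x - y).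
  move=> ik tb; rewrite /enorm ler_sqrt ?inner_ge0 // !innerE.
  apply: ler_sum => j _; rewrite !big_ord1 -!expr2 !mxE eqxx andbT.
  have [jk|kj] := ltnP j k.
    by rewrite (_ : (j == i) = false) ?mulr0 ?addr0 // -val_eqE /= ik ltn_eqF.
  have [->|ji] := eqVneq j i.
    rewrite mulr1 (ord1 0) addrAC subrr add0r.
    by rewrite -(real_normK (num_real t)) -(real_normK (num_real (x i 0 - _))) lerXn2r ?nnegrE.
  by rewrite mulr0 addr0 subrr expr2 mul0r sqr_ge0.
have step k : (k <= n)%N -> `|f (w k) - f y| <= k%:R * (M * enorm (x - y)).
  elim: k => [_|k IH kn].
    by rewrite mul0r (_ : w 0%N = y) ?subrr ?normr0 //; apply/matrixP => i j; rewrite mxE (ord1 j).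
  pose i := Ordinal kn.
  have wS : w k.+1 = w k + (x i 0 - y i 0) *: e i.
    apply/matrixP => j l; rewrite !mxE (ord1 l) eqxx andbT ltnS leq_eqVlt.
    have [->|ji] := eqVneq j i; first by rewrite /= eqxx ltnn /= mulr1 addrC subrK.
    by rewrite (_ : (nat_of_ord j == k) = false) ?mulr0 ?addr0 //; apply/eqP => jk; case/eqP: ji; apply/val_inj.
  rewrite -natr1 mulrDl mul1r -(subrKA (f (w k))) addrC.
  apply: le_trans (ler_normD _ _) _; apply: lerD; first exact: IH (ltnW kn).
  rewrite wS.
  have := @line_diff_le (fun s => f (w k + s *: e i)) (fun s => d i (w k + s *: e i)) (x i 0 - y i 0) M
    (fd i (w k)) (fun t tb => b i _ (near k i t erefl tb)).
  rewrite scale0r addr0 => /le_trans; apply; rewrite ler_wpM2l //.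
  by have := le_coord_enorm (x - y) i 0; rewrite !mxE.
have := step n (leqnn n); rewrite (_ : w n = x) //.
by apply/matrixP => j l; rewrite !mxE (ord1 l) ltn_ord.
Qed.

Lemma partial_diff_le f x y (M : R) :
  (forall i z, derivable f z (e i)) -> 0 <= M ->
  (forall i z, enorm (z - y) <= enorm (x - y) -> `|partial i f z| <= M) ->
  `|f x - f y| <= n%:R * (M * enorm (x - y)).
Proof.
move=> fd; apply: (@coordinate_diff_le f (fun i => partial i f)) => i z t.
by apply: is_derive_line; exact: fd.
Qed.

Lemma taylor1_le f y x (L : R) : (forall i z, derivable f z (e i)) -> 0 <= L ->
  (forall i z, `|partial i f z - partial i f y| <= L * enorm (z - y)) ->
  `|f x - f y - inner (gradient f y) (x - y)| <= n%:R * (L * enorm (x - y) ^+ 2).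
Proof.
move=> fd L0 b; pose phi z := f z - inner (gradient f y) z.
rewrite (_ : f x - f y - _ = phi x - phi y); last by rewrite /phi innerDr innerNr; ring.
rewrite expr2 [L * _]mulrA; apply: (@coordinate_diff_le phi (fun i z => partial i f z - partial i f y)).
- move=> i z t; rewrite (_ : (fun s => _) = (fun s => f (z + s *: e i)) -
      (cst (inner (gradient f y) z) + partial i f y \*: id)).
    apply: is_derive_eq (is_deriveB (is_derive_line (fd i (z + t *: e i)))
      (is_deriveD (is_derive_cst (inner (gradient f y) z) t (1 : R)) (is_deriveZ (partial i f y) (is_derive_id t (1 : R))))) _.
    by rewrite add0r scaler1.
  apply/funext => s; rewrite /phi !fctE /=; congr (_ - _).
  rewrite innerDr innerZr mulrC; congr (_ + _ * _).
  rewrite innerE (bigD1 i) //= big_ord1 big1 ?addr0; last first.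
    by move=> j ji; rewrite big_ord1 [e i _ _]mxE (negbTE ji) mulr0.
  by rewrite /e !mxE !eqxx mulr1.
- by rewrite mulr_ge0 // enorm_ge0.
- by move=> i z zb; apply: le_trans (b i z) _; rewrite ler_wpM2l.
Qed.

End coordinate_derivatives.

Section compact_support.
Context (R : realType) (n : nat).
Implicit Types (f : 'cV[R]_n -> R) (S : set 'cV[R]_n).

Lemma partial_eq0 f S i : closed S -> (forall x, ~ S x -> f x = 0) ->
  forall x, ~ S x -> partial i f x = 0.
Proof.
move=> cS f0 x Sx; rewrite /partial (@near_eq_derive _ _ _ _ (cst 0)) ?derive_cst //.
have : nbhs x (~` S) by apply: open_nbhs_nbhs; split=> //; exact: closed_openC.
by apply: filterS => y; exact: f0.
Qed.

Lemma continuous_support_bounded f S : compact S -> continuous f -> (forall x, ~ S x -> f x = 0) ->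
  exists2 M, 0 < M & forall x, `|f x| <= M.
Proof.
move=> cS cf f0.
have /compact_bounded [M [Mr HM]] : compact (f @` S).
  by apply: continuous_compact => //; exact: continuous_subspaceT.
exists (`|M| + 1) => // x; have [Sx|/f0 ->] := pselect (S x); last by rewrite normr0 addr_ge0.
by apply: (HM (`|M| + 1)); [rewrite (le_lt_trans (ler_norm _)) // ltrDl|exists x].
Qed.

Lemma finite_bound (I : finType) (P : I -> R -> Prop) :
  (forall i a b, P i a -> a <= b -> P i b) ->
  (forall i, exists a, P i a) -> exists2 c, 0 < c & forall i, P i c.
Proof.
move=> mono /choice[a Pa]; exists (1 + \sum_i `|a i|).
  by rewrite ltr_pwDl // sumr_ge0.
move=> i; apply: mono (Pa i) _; rewrite (bigD1 i) //= addrCA.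
by rewrite (le_trans (ler_norm _)) // lerDl addr_ge0 // sumr_ge0.
Qed.

Section smooth.
Variable f : 'cV[R]_n -> R.
Hypothesis fs : is_Ccinfty f.
Let S := closure [set x | f x != 0].

Lemma Ccinfty_continuous : continuous f.
Proof. exact: (fs.1 0%N). Qed.

Lemma Ccinfty_derivable i x : derivable f x (delta_mx i 0).
Proof. exact: ((fs.1 1%N).1 i x). Qed.

Lemma Ccinfty_partial_continuous i : continuous (partial i f).
Proof. exact: ((fs.1 1%N).2 i). Qed.

Let clS : closed S. Proof. exact: closed_closure. Qed.

Let f0 x : ~ S x -> f x = 0.
Proof. by move=> Sx; apply/eqP; apply: contrapT => /negP fx; apply: Sx; exact: subset_closure. Qed.

Let df0 i x : ~ S x -> partial i f x = 0. Proof. by move=> Sx; rewrite (@partial_eq0 f S). Qed.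

Let ddf0 i j x : ~ S x -> partial j (partial i f) x = 0.
Proof. by move=> Sx; rewrite (@partial_eq0 (partial i f) S) // => y; exact: df0. Qed.

Lemma Ccinfty_support_bounded : exists2 r, 0 < r & forall x, f x != 0 -> enorm x <= r.
Proof.
have [r r0 b] := compact_enorm_bounded fs.2.
by exists r => // x fx; apply: b; exact: subset_closure.
Qed.

Lemma Ccinfty_partial_bounded : exists2 M, 0 < M & forall i x, `|partial i f x| <= M.
Proof.
have [|i|c c0 b] := @finite_bound 'I_n (fun i M => forall x, `|partial i f x| <= M).
- by move=> i a b h ab x; exact: le_trans (h x) ab.
- have [M _ h] := continuous_support_bounded fs.2 (@Ccinfty_partial_continuous i) (@df0 i).
  by exists M.
- by exists c.
Qed.

Lemma Ccinfty_partial_lipschitz : exists2 L, 0 < L & forall i x y,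
  `|partial i f x - partial i f y| <= L * enorm (x - y).
Proof.
have [|ij|c c0 b] := @finite_bound ('I_n * 'I_n)%type (fun ij M => forall x, `|partial ij.2 (partial ij.1 f) x| <= M).
- by move=> i a b h ab x; exact: le_trans (h x) ab.
- have [M _ h] := continuous_support_bounded fs.2 (((fs.1 2%N).2 ij.1).2 ij.2) (@ddf0 ij.1 ij.2).
  by exists M.
- exists (n%:R * c + 1); first by rewrite ltr_wpDl // mulr_ge0 // ltW.
  move=> i x y; apply: le_trans (partial_diff_le _ (ltW c0) _) _.
  + by move=> j z; exact: (((fs.1 2%N).2 i).1 j z).
  + by move=> j z _; exact: (b (i, j)).
  by rewrite mulrA ler_wpM2r ?enorm_ge0 // lerDl.
Qed.

Lemma Ccinfty_taylor : exists2 L, 0 < L & forall x y,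
  `|f x - f y - inner (gradient f y) (x - y)| <= L * enorm (x - y) ^+ 2.
Proof.
have [L L0 b] := Ccinfty_partial_lipschitz; exists (n%:R * L + 1).
  by rewrite ltr_wpDl // mulr_ge0 // ltW.
move=> x y; apply: le_trans (taylor1_le _ _ (ltW L0) _) _.
- by move=> i z; exact: Ccinfty_derivable.
- by move=> i z; exact: b.
by rewrite mulrA ler_wpM2r ?sqr_ge0 // lerDl.
Qed.

Lemma continuous_gradient : continuous (gradient f).
Proof.
apply/continuous_mxP => i j; rewrite (_ : (fun x => _) = partial i f); first exact: Ccinfty_partial_continuous.
by apply/funext => x; rewrite mxE.
Qed.

Lemma gradient_bounded : exists2 M, 0 < M & forall x, enorm (gradient f x) <= M.
Proof.
have [M M0 b] := Ccinfty_partial_bounded; exists ((n * 1)%:R * M + 1).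
  by rewrite ltr_wpDl // mulr_ge0 // ltW.
move=> x; apply: le_trans (enorm_le_mx_norm _) _; apply: (@le_trans _ _ ((n * 1)%:R * M)); last by rewrite lerDl.
rewrite ler_wpM2l // /Num.Def.normr /= mx_normrE; apply/bigmax_leP; split; first exact: ltW.
by move=> ij _; rewrite mxE; exact: b.
Qed.

End smooth.
End compact_support.

Section real_inequalities.
Context (R : realType).
Implicit Types (a b c p r s t x y : R).

Lemma powR_rootK (n : nat) x : (0 < n)%N -> 0 <= x -> (x `^ n%:R^-1) ^+ n = x.
Proof.
by move=> n0 x0; rewrite -powR_mulrn ?powR_ge0 // -powRrM mulVf ?pnatr_eq0 -?lt0n // powRr1.
Qed.

Lemma expr_addr_ge (n : nat) x y : 0 <= x -> 0 <= y ->
  x ^+ n + (x ^+ n.-1 * y) *+ n <= (x + y) ^+ n.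
Proof.
move=> x0 y0; elim: n => [|n IH]; first by rewrite !expr0 mulr0n addr0.
rewrite /= [leRHS]exprS; apply: le_trans (ler_wpM2l (addr_ge0 x0 y0) IH).
case: n {IH} => [|n]; first by rewrite !expr0 expr1 !mul1r mulr1n mulr0n addr0 mulr1.
have -> : n.+1.-1 = n by [].
rewrite -(mulr_natr _ n.+1) -(mulr_natr _ n.+2) (exprS x n.+1) (exprS x n) -[in n.+2%:R]natr1; set u := x ^+ n.
have : 0 <= y * (u * y) * n.+1%:R by rewrite !mulr_ge0 // exprn_ge0.
lra.
Qed.

Lemma powR_young p s t : 1 <= p -> 0 < s -> 0 <= t ->
  p * s `^ (p - 1) * t <= t `^ p + (p - 1) * s `^ p.
Proof.
move=> p1 s0 t0; have := bernoulli_powR p1 (divr_ge0 t0 (ltW s0)).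
rewrite -(ler_pM2r (powR_gt0 p s0)) -(powRM _ (divr_ge0 t0 (ltW s0)) (ltW s0)) (divfK (lt0r_neq0 s0)).
rewrite -lerBlDr => /(le_trans _); apply; rewrite le_eqVlt; apply/orP; left; apply/eqP.
have -> : s `^ p = s `^ (p - 1) * s.
  by rewrite -{3}(powRr1 (ltW s0)) -powRD ?subrK // (lt0r_neq0 s0) implybT.
by field; rewrite gt_eqF.
Qed.

Lemma powR_ge_1Dln x r : 0 < x -> 1 + r * ln x <= x `^ r.
Proof. by move=> x0; rewrite /powR gt_eqF // expR_ge1Dx. Qed.

(** The left side is the rectangle of least height under [t^(-(1+c))] on [[y, x]], and the right
    side is the integral of this function. *)
Lemma telescope_powRN c x y : 0 < c -> 0 < y -> y <= x ->
  (x - y) * x `^ (- (1 + c)) <= (y `^ (- c) - x `^ (- c)) / c.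
Proof.
move=> c0 y0 yx; have x0 : 0 < x by exact: lt_le_trans yx.
have r0 : 0 < y / x by rewrite divr_gt0.
have E : x `^ (- (1 + c)) = x^-1 * x `^ (- c).
  rewrite opprD powRD; last by rewrite [x == 0]gt_eqF // implybT.
  by rewrite (powR_inv1 (ltW x0)).
have yE : y `^ (- c) = (y / x) `^ (- c) * x `^ (- c).
  by rewrite -powRM ?divfK ?gt_eqF // ltW.
rewrite E yE ler_pdivlMr //.
have -> : (x - y) * (x^-1 * x `^ (- c)) * c = (1 - y / x) * c * x `^ (- c).
  by field; rewrite gt_eqF.
rewrite -[X in _ <= _ - X]mul1r -mulrBl ler_wpM2r ?powR_ge0 // lerBrDr addrC.
apply: le_trans (powR_ge_1Dln _ r0).
rewrite lerD2l mulNr mulrC -mulrN ler_wpM2l ?(ltW c0) // lerNr opprB.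
have := @le_ln1Dx R (y / x - 1); rewrite [1 + _]addrCA subrr addr0; apply.
by rewrite ltrBrDr addNr.
Qed.

End real_inequalities.

(** * Gradient energies and volumes of superlevel sets *)

Section capacity_lower.
Context (R : realType) (n : nat).
Hypothesis n0 : (0 < n)%N.
Local Notation T := (borel_mx R n 1).
Local Notation V := (@lebesgue_mx R n 1).
Local Notation L := (measurableTypeR R).
Variables (f : 'cV[R]_n -> R) (H : 'cV[R]_n -> R) (W : set 'cV[R]_n) (w C : R).
Hypotheses (fs : is_Ccinfty f) (cH : continuous H) (H0 : forall z, 0 <= H z).
Hypotheses (C0 : 0 < C) (HC : forall z, H z <= C * enorm z).
Hypotheses (cW : compact W) (w0 : 0 < w) (VW : V W = (w ^+ n)%:E).
Hypothesis (WH : forall x z, W x -> inner x z <= H z).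

Let G x := H (gradient f x).

Let cf : continuous f. Proof. exact: Ccinfty_continuous. Qed.

Let cG : continuous G.
Proof.
by move=> x; apply: (@continuous_comp _ _ _ (gradient f) H); [exact: continuous_gradient|exact: cH].
Qed.

Let mf : measurable_fun setT (f : T -> L). Proof. exact: continuous_measurable_mx. Qed.
Let mG : measurable_fun setT (G : T -> L). Proof. exact: continuous_measurable_mx. Qed.

Let G_bounded : exists2 M, 0 < M & forall x, G x <= M.
Proof.
have [M M0 b] := gradient_bounded fs; exists (C * M); first exact: mulr_gt0.
by move=> x; apply: le_trans (HC _) _; rewrite ler_pM2l.
Qed.

Let mlt (g : T -> L) (c : R) : measurable_fun setT g -> measurable ([set x | c < g x] : set T).
Proof.
move=> mg; rewrite (_ : [set x | _] = g @^-1` `]c, +oo[%classic); first exact: measurable_preimage.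
by apply/seteqP; split=> x /=; rewrite in_itv /= andbT.
Qed.

Let mge (g : T -> L) (c : R) : measurable_fun setT g -> measurable ([set x | c <= g x] : set T).
Proof.
move=> mg; rewrite (_ : [set x | _] = g @^-1` `[c, +oo[%classic); first exact: measurable_preimage.
by apply/seteqP; split=> x /=; rewrite in_itv /= andbT.
Qed.

Let bounded_pos (A : set 'cV[R]_n) : A `<=` [set x | 0 < f x] -> enorm_bounded A.
Proof.
have [r _ b] := Ccinfty_support_bounded fs => Af; exists r => x /Af /= fx.
by apply: b; rewrite gt_eqF.
Qed.

Let fin_pos (A : set T) : measurable A -> A `<=` [set x | 0 < f x] -> V A \is a fin_num.
Proof. by move=> mA /bounded_pos bA; exact: enorm_bounded_fin_num. Qed.

(* Brunn-Minkowski for [f > tau] and -s W, which by Taylor's formula at the new point adds up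
   inside [g > tau]. *)
Let superlevel_growth (eta eps tau s b v : R) : 0 < eta -> 0 < s -> 0 < tau -> tau < b -> 0 < v ->
  V [set x | b <= f x] = v%:E ->
  (forall x, f x <= f x + s * (G x + eta)) ->
  (forall x z, W z -> f x <= f (x - s *: z) + s * (G (x - s *: z) + eta)) ->
  (V [set x | (tau < f x)%R] + (n%:R * s * w * v `^ ((n%:R - 1) / n%:R))%:E <=
   V [set x | (tau < f x + s * (G x + eta))%R])%E.
Proof.
move=> eta0 s0 tau0 taub v0 Vb fg gW.
have mA := mlt tau mf; set A : set T := [set x | tau < f x] in mA *.
have bA : A `<=` [set x | 0 < f x] by move=> x; exact: lt_trans.
have AE := fineK (fin_pos mA bA).
have vA : v <= fine (V A).
  rewrite -lee_fin AE -Vb; apply: le_measure; rewrite ?inE //; first exact: mge.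
  by move=> x /=; exact: lt_le_trans.
have a0 := lt_le_trans v0 vA; set a := fine (V A) in AE vA a0 *.
pose B : set T := (fun x : 'cV[R]_n => (- s^-1) *: x) @^-1` W.
have mW := compact_measurable_mx cW.
have BE : B = (fun x : 'cV[R]_n => - x) @^-1` ((fun x : 'cV[R]_n => s^-1 *: x) @^-1` W).
  by apply/seteqP; split=> x; rewrite /B /= scalerN scaleNr.
have mWs : measurable (((fun x : 'cV[R]_n => s^-1 *: x) @^-1` W) : set T).
  apply: (@measurable_preimage _ _ _ _ (fun x : T => (s^-1 *: (x : 'cV[R]_n) : T))) => //.
  by apply: continuous_measurable_mx_mx => x; exact: scaler_continuous.
have mB : measurable B.
  rewrite BE; apply: (@measurable_preimage _ _ _ _ (fun x : T => (- (x : 'cV[R]_n) : T))) => //.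
  exact: measurable_fun_mxN.
have VB : V B = ((s * w) ^+ n)%:E.
  rewrite BE; apply: etrans (lebesgue_mxN mWs) _.
  apply: etrans (lebesgue_mx_scale _ mW) _; first by rewrite invr_gt0.
  by rewrite VW -EFinM invrK muln1 exprMn mulrC.
have bB : enorm_bounded B.
  have [r r0 b'] := compact_enorm_bounded cW; exists (s * r) => x /b'.
  by rewrite enormZ normrN gtr0_norm ?invr_gt0 // mulrC ler_pdivrMr // mulrC.
have mg : measurable_fun setT ((fun x => f x + s * (G x + eta)) : T -> L).
  apply: measurable_funD => //; apply: measurable_funM; first exact: measurable_cst.
  by apply: measurable_funD => //; exact: measurable_cst.
have rE := powR_rootK n0 (ltW a0).
have r0 : 0 < a `^ n%:R^-1 by rewrite powR_gt0.
have := @brunn_minkowski_add R n 1 (a `^ n%:R^-1) (s * w) A B [set x | tau < f x + s * (G x + eta)] r0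
  (mulr_gt0 s0 w0) mA mB (mlt tau mg) (bounded_pos bA) bB.
rewrite !muln1 rE => /(_ (esym AE) VB) bm.
apply: le_trans (bm _); last first.
  move=> x y /= Ax By; apply: lt_le_trans Ax _.
  have := gW x (- s^-1 *: y) By.
  by rewrite scalerA mulrN divff ?gt_eqF // scaleN1r opprK.
rewrite -/A -AE -EFinD lee_fin -{1}rE.
apply: le_trans (expr_addr_ge _ (ltW r0) (mulr_ge0 (ltW s0) (ltW w0))).
rewrite lerD2l -[leRHS]mulr_natl [_ * (s * w)]mulrC mulrA (mulrA n%:R).
rewrite ler_wpM2l //; first by rewrite !mulr_ge0 // ltW.
rewrite -powR_mulrn ?powR_ge0 // -powRrM.
have -> : n%:R^-1 * n.-1%:R = (n%:R - 1) / n%:R :> R.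
  by rewrite mulrC -subn1 natrB.
by apply: ler_powR_mono => //; [rewrite divr_ge0 // subr_ge0 ler1n|rewrite ltW].
Qed.

(** A finite-difference form of the coarea argument. Passing from [f] to [g = f + s (G + eta)]
    enlarges the superlevel sets by [superlevel_growth], while the integral of the truncated
    function grows by at most [s] times the integral of [G + eta] over the strip. *)
Let strip_approx (a b v eta eps : R) : 0 <= a -> 0 < eta -> 0 < eps -> eps < b - a -> 0 < v ->
  V [set x | b <= f x] = v%:E ->
  ((n%:R * (b - a - eps) * w * v `^ ((n%:R - 1) / n%:R))%:E <=
   \int[V]_(x in [set x | (a < f x < b)%R]) (G x + eta)%:E)%E.
Proof.
move=> a0 eta0 eps0 epsba v0 Vb.
have [M M0 GM] := G_bounded; have [r r0 rW] := compact_enorm_bounded cW.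
have [l l0 tay] := Ccinfty_taylor fs.
(* The first bound keeps the Taylor remainder [l s^2 |z|^2] below [s eta] for [z] in [W], the second
   gives [g <= f + eps]. *)
pose s := Num.min (eta / (l * r ^+ 2)) (eps / (M + eta)).
have s0 : 0 < s by rewrite lt_min !divr_gt0 ?mulr_gt0 ?exprn_gt0 ?addr_gt0.
have s1 : s * (l * r ^+ 2) <= eta.
  by rewrite -ler_pdivlMr ?mulr_gt0 ?exprn_gt0 // ge_min lexx.
have s2 : s * (M + eta) <= eps by rewrite -ler_pdivlMr ?addr_gt0 // ge_min lexx orbT.
have Ge x : 0 <= G x + eta by rewrite addr_ge0 ?(ltW eta0) //; exact: H0.
pose g x := f x + s * (G x + eta).
have fg x : f x <= g x by rewrite lerDl mulr_ge0 // ltW.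
have gf x : g x <= f x + eps.
  by rewrite lerD2l (le_trans _ s2) // ler_pM2l // lerD2r.
have gW x z : W z -> f x <= g (x - s *: z).
  move=> Wz; have := tay x (x - s *: z); rewrite opprB addrCA subrr addr0 => /ler_normlW.
  rewrite enormZ gtr0_norm // innerZr.
  have zr : enorm z ^+ 2 <= r ^+ 2 by rewrite lerXn2r ?nnegrE ?enorm_ge0 ?(ltW r0) ?rW.
  have := WH (gradient f (x - s *: z)) Wz; rewrite innerC -/(G _) /g.
  move: (f _) (inner _ _) (G _) => y i k ik h.
  have : l * (s * enorm z) ^+ 2 <= s * eta.
    have -> : l * (s * enorm z) ^+ 2 = s * (s * (l * enorm z ^+ 2)) by ring.
    by rewrite ler_pM2l // (le_trans _ s1) // ler_pM2l // ler_pM2l.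
  have : s * i <= s * k by rewrite ler_pM2l.
  lra.
have mg : measurable_fun setT (g : T -> L).
  apply: measurable_funD => //; apply: measurable_funM; first exact: measurable_cst.
  by apply: measurable_funD => //; exact: measurable_cst.
(* Truncation to levels between [a + eps] and [b]. Since [g <= f + eps], points with [f <= a] still
   contribute nothing after the change to [g], and points with [f >= b] are already saturated. *)
pose a1 := a + eps; pose tr (y : R) := Num.max 0 (Num.min y b - a1).
have a1b : a1 < b by rewrite /a1; lra.
have tr0 y : 0 <= tr y by rewrite /tr le_max lexx.
have mtr (k : T -> L) : measurable_fun setT k -> measurable_fun setT ((fun x => tr (k x)) : T -> L).
  move=> mk; apply: measurable_maxr; first exact: measurable_cst.
  apply: measurable_funB; last exact: measurable_cst.
  by apply: measurable_minr => //; exact: measurable_cst.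
have trD y k : 0 <= k -> tr (y + k) <= tr y + k.
  move=> k0; rewrite {1}/tr ge_max addr_ge0 //=.
  have : Num.min y b - a1 <= tr y by rewrite /tr le_max lexx orbT.
  have : Num.min (y + k) b <= Num.min y b + k.
    by have [yb|yb] := leP y b; rewrite ge_min ?lexx // lerDl k0 orbT.
  lra.
pose c := n%:R * s * w * v `^ ((n%:R - 1) / n%:R).
have c0 : 0 <= c by rewrite !mulr_ge0 ?powR_ge0 ?(ltW s0) ?(ltW w0).
pose J : set L := `[0, b - a1[%classic.
have trlt y t : 0 <= t -> (t < tr y) = (t < b - a1) && (a1 + t < y).
  move=> t0; rewrite /tr lt_max ltNge t0 /= ltrBrDr lt_min andbC.
  by rewrite ltrBrDr addrC.
have layer t : (V [set x | (0 <= t < tr (f x))%R] + (c * \1_J t)%:E <=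
                V [set x | (0 <= t < tr (g x))%R])%E.
  rewrite indicE; case: (boolP (t \in J)) => [|tJ].
    rewrite inE /J /= in_itv /= => /andP[t0 tb]; rewrite mulr1.
    have E (k : T -> L) : [set x | 0 <= t < tr (k x)] = [set x | a1 + t < k x].
      by apply/seteqP; split=> x /=; rewrite t0 trlt // tb.
    rewrite !E; apply: (@superlevel_growth eta eps (a1 + t) s b v) => //.
    - by rewrite ltr_pwDl // /a1 ltr_wpDl.
    - by rewrite -ltrBrDl.
  rewrite mulr0 adde0 (_ : [set x | _] = set0) ?measure0 // -subset0 => x /= /andP[t0].
  by rewrite trlt // => /andP[tb _]; move/negP: tJ; apply; rewrite inE /J /= in_itv /= t0.
have Jm : measurable J by exact: measurable_itv.
have mI : measurable_fun setT (fun t : L => (c * \1_J t)%:E).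
  by apply/measurable_EFinP; apply: measurable_funM => //; exact: measurable_indic.
have I0 t : (0 <= (c * \1_J t)%:E)%E by rewrite lee_fin mulr_ge0.
have key : (\int[V]_x (tr (f x))%:E + (c * (b - a1))%:E <= \int[V]_x (tr (g x))%:E)%E.
  rewrite (layer_cake V (mtr f mf) (fun x => tr0 _)) (layer_cake V (mtr g mg) (fun x => tr0 _)).
  have -> : (c * (b - a1))%:E = (\int[@lebesgue_measure R]_t (c * \1_J t)%:E)%E.
    under eq_integral do rewrite EFinM.
    have m1 : measurable_fun setT (fun t : L => (\1_J t)%:E : \bar R).
      by apply/measurable_EFinP; exact: measurable_indic.
    rewrite (@ge0_integralZl_EFin _ _ _ (@lebesgue_measure R) setT measurableT _ _ m1 c c0); last first.
      by move=> t _; rewrite lee_fin.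
    rewrite EFinM; congr (_ * _)%E; rewrite integral_indic // setIT.
    apply/esym; apply: etrans (lebesgue_measure_itv _) _.
    by rewrite /= lte_fin subr_gt0 a1b -EFinB subr0.
  have mlf := measurable_fun_layer V (mtr f mf).
  have mlg := measurable_fun_layer V (mtr g mg).
  rewrite -(@ge0_integralD _ _ _ (@lebesgue_measure R) setT measurableT _ _ _ mlf _ mI) //.
  apply: (@ge0_le_integral _ _ _ (@lebesgue_measure R) setT measurableT _ _ _ _ mlg).
  - by move=> t _; rewrite adde_ge0.
  - exact: emeasurable_funD.
  - by move=> t _; exact: layer.
pose D : set T := [set x | a < f x < b].
have mD : measurable D.
  rewrite (_ : D = f @^-1` `]a, b[%classic); first exact: measurable_preimage.
  by apply/seteqP; split=> x /=; rewrite in_itv.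
have mGe : measurable_fun D (fun x => (G x + eta)%:E).
  by apply/measurable_EFinP; apply: measurable_funTS; apply: measurable_funD => //; exact: measurable_cst.
have Ge' x : D x -> (0 <= (G x + eta)%:E)%E by rewrite lee_fin.
have up : (\int[V]_x (tr (g x))%:E <= \int[V]_x (tr (f x))%:E + s%:E * \int[V]_(x in D) (G x + eta)%:E)%E.
  rewrite -(@ge0_integralZl_EFin _ _ _ V D mD _ Ge' mGe s (ltW s0)) [X in (_ <= _ + X)%E]integral_mkcond.
  have mE : measurable_fun setT ((fun x => s%:E * (G x + eta)%:E)%E \_ D).
    by apply/(measurable_restrictT _ mD); apply: emeasurable_funM => //; exact: measurable_cst.
  have E0 x : (0 <= ((fun x => s%:E * (G x + eta)%:E)%E \_ D) x)%E.
    by rewrite patchE; case: ifP => // _; rewrite -EFinM lee_fin mulr_ge0 // ltW.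
  have mtf : measurable_fun setT (fun x : T => (tr (f x))%:E) by apply/measurable_EFinP; exact: mtr.
  have mtg : measurable_fun setT (fun x : T => (tr (g x))%:E) by apply/measurable_EFinP; exact: mtr.
  rewrite -(@ge0_integralD _ _ _ V setT measurableT _ _ _ mtf _ mE) //; last by move=> x _; rewrite lee_fin.
  apply: (@ge0_le_integral _ _ _ V setT measurableT _ _ _ mtg) => //.
  - by move=> x _; rewrite lee_fin.
  - exact: emeasurable_funD.
  move=> x _; rewrite patchE; case: ifPn => [_|]; first rewrite -EFinM -EFinD lee_fin.
    by apply: trD; rewrite mulr_ge0 // ltW.
  rewrite notin_setE /D /= => nD; rewrite adde0 lee_fin.
  have [fb|fb] := ltP (f x) b.
    have fa : f x <= a by rewrite leNgt; apply/negP => fa; apply: nD; rewrite fa fb.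
    rewrite [leLHS](_ : _ = 0) //; apply/eqP; rewrite eq_le tr0 andbT /tr ge_max lexx subr_le0 ge_min.
    by rewrite (le_trans (gf x)) // /a1 lerD2r.
  by rewrite /tr !min_r // (le_trans fb).
have ffin : (\int[V]_x (tr (f x))%:E)%E \is a fin_num.
  pose A : set T := [set x | 0 < f x]; have mA : measurable A := mlt 0 mf.
  rewrite (_ : (fun x => _) = (fun x => (tr (f x))%:E) \_ A); last first.
    apply/funext => x; rewrite patchE; case: ifPn => //; rewrite notin_setE /A /= => /negP.
    rewrite -leNgt => fx; congr (_%:E); apply/eqP; rewrite eq_le tr0 andbT /tr ge_max lexx subr_le0 ge_min.
    by rewrite (le_trans fx) // addr_ge0 // ltW.
  rewrite -integral_mkcond ge0_fin_numE; last by apply: integral_ge0 => x _; rewrite lee_fin.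
  have mtA : measurable_fun A (fun x => (tr (f x))%:E).
    by apply/measurable_EFinP; apply: measurable_funTS; exact: mtr.
  apply: (@le_lt_trans _ _ (\int[V]_(x in A) cst (b - a1)%:E x)%E).
    apply: (@ge0_le_integral _ _ _ V A mA _ _ _ mtA) => [x _|//|x _]; first by rewrite lee_fin.
    rewrite lee_fin /tr ge_max subr_ge0 (ltW a1b) lerD2r ge_min lexx orbT //.
  rewrite (_ : integral _ _ _ = (b - a1)%:E * V A)%E; first by rewrite -(fineK (fin_pos mA (fun x => id))) -EFinM ltry.
  by rewrite integral_cst.
rewrite -(@lee_pmul2l _ s%:E) // -(leeD2lE _ _ ffin); apply: le_trans up; apply: le_trans key.
by rewrite -EFinM leeD2l // lee_fin /c /a1 le_eqVlt; apply/orP; left; apply/eqP; ring.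
Qed.

(** [strip_approx] with [eta] and [eps] tending to 0: the anisotropic isoperimetric inequality
    integrated over the levels, at each of which the superlevel set has volume at least [v]. *)
Lemma strip_lower (a b v : R) : 0 <= a -> a < b -> 0 < v -> V [set x | b <= f x] = v%:E ->
  ((n%:R * (b - a) * w * v `^ ((n%:R - 1) / n%:R))%:E <=
   \int[V]_(x in [set x | (a < f x < b)%R]) (G x)%:E)%E.
Proof.
move=> a0 ab v0 Vb; set D : set T := [set x | _].
have mD : measurable D.
  rewrite (_ : D = f @^-1` `]a, b[%classic); first exact: measurable_preimage.
  by apply/seteqP; split=> x /=; rewrite in_itv.
have DE := fineK (fin_pos mD (fun x (xD : D x) => le_lt_trans a0 (andP xD).1)).
have d0 : 0 <= fine (V D) by rewrite fine_ge0.
set d := fine _ in DE d0.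
set q := n%:R * w * v `^ ((n%:R - 1) / n%:R).
have q0 : 0 <= q by rewrite !mulr_ge0 ?powR_ge0 // ltW.
have mGD : measurable_fun D (fun x => (G x)%:E) by apply/measurable_EFinP; exact: measurable_funTS.
apply/lee_addgt0Pr => e e0.
pose eta := e / 2 / (d + 1); pose eps := Num.min (e / 2 / (q + 1)) ((b - a) / 2).
have eta0 : 0 < eta by rewrite !divr_gt0 // ltr_wpDl.
have eps0 : 0 < eps by rewrite lt_min !divr_gt0 ?subr_gt0 // ltr_wpDl.
have epsb : eps < b - a.
  by apply: le_lt_trans (_ : (b - a) / 2 < _); [rewrite ge_min lexx orbT|rewrite ltr_pdivrMr // ltr_pMr ?subr_gt0 // ltr1n].
have := strip_approx a0 eta0 eps0 epsb v0 Vb; rewrite -/D.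
have G0 x : D x -> (0 <= (G x)%:E)%E by move=> _; rewrite lee_fin; exact: H0.
under eq_integral do rewrite EFinD.
have mc : measurable_fun D (cst eta%:E : T -> \bar R) by exact: measurable_cst.
have c0 x : D x -> (0 <= cst eta%:E x)%E by move=> _; rewrite lee_fin ltW.
rewrite (@ge0_integralD _ _ _ V D mD _ _ G0 mGD c0 mc).
rewrite (_ : (\int[V]_(x in D) cst eta%:E x = (eta * d)%:E)%E); last first.
  by rewrite (EFinM eta d) DE; exact: integral_cst.
move=> h.
have e1 : eta * d <= e / 2.
  by rewrite /eta mulrAC ler_pdivrMr ?ltr_wpDl // ler_pM2l ?divr_gt0 // lerDl.
have e2 : eps * q <= e / 2.
  apply: (@le_trans _ _ (e / 2 / (q + 1) * q)); first by rewrite ler_wpM2r // ge_min lexx.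
  by rewrite mulrAC ler_pdivrMr ?ltr_wpDl // ler_pM2l ?divr_gt0 // lerDl.
apply: (@le_trans _ _ ((n%:R * (b - a - eps) * w * v `^ ((n%:R - 1) / n%:R)) + e / 2)%:E).
  rewrite lee_fin; move: e2; rewrite /q; lra.
rewrite EFinD; apply: le_trans (leeD2r _ h) _; rewrite -addeA leeD2l // -EFinD lee_fin.
lra.
Qed.

(** Young's inequality with a free weight [s] passes from [G] to [G^p]. The price is proportional to
    the volume of the strip, which is at most [u - v]. *)
Let strip_energy (p a b s u v : R) : 1 < p -> 0 <= a -> a < b -> 0 < s -> 0 < v ->
  V [set x | a <= f x] = u%:E -> V [set x | b <= f x] = v%:E ->
  ((p * s `^ (p - 1) * (n%:R * (b - a) * w * v `^ ((n%:R - 1) / n%:R)))%:E <=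
   \int[V]_(x in [set x | (a < f x < b)%R]) (G x `^ p)%:E + ((p - 1) * s `^ p * (u - v))%:E)%E.
Proof.
move=> p1 a0 ab s0 v0 Va Vb; set D : set T := [set x | _].
have mD : measurable D.
  rewrite (_ : D = f @^-1` `]a, b[%classic); first exact: measurable_preimage.
  by apply/seteqP; split=> x /=; rewrite in_itv.
have VD : (V D <= (u - v)%:E)%E.
  have mb : measurable ([set x | b <= f x] : set T) by exact: mge.
  have : (V (D `|` [set x | (b <= f x)%R]) <= u%:E)%E.
    rewrite -Va; apply: le_measure; rewrite ?inE; [exact: measurableU|exact: mge|].
    move=> x /= [/andP[/ltW]//|]; apply: le_trans; exact: ltW.
  have -> : V (D `|` [set x | (b <= f x)%R]) = (V D + v%:E)%E.
    apply: etrans (measureU _ mD mb _) _; last by rewrite -Vb.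
    by rewrite -subset0 => x [/andP[_ fb]] /=; rewrite leNgt fb.
  by rewrite EFinB leeBrDr.
have mGD : measurable_fun D (fun x => (G x)%:E) by apply/measurable_EFinP; exact: measurable_funTS.
have mGp : measurable_fun D (fun x => (G x `^ p)%:E).
  by apply/measurable_EFinP; apply: measurable_funTS; exact: measurable_powR_comp.
have k0 : 0 <= p * s `^ (p - 1) by rewrite mulr_ge0 ?powR_ge0 //; lra.
rewrite EFinM; apply: le_trans (lee_wpmul2l _ (strip_lower a0 ab v0 Vb)) _; first by rewrite lee_fin.
have G0 x : D x -> (0 <= (G x)%:E)%E by move=> _; rewrite lee_fin; exact: H0.
rewrite -(@ge0_integralZl_EFin _ _ _ V D mD _ G0 mGD _ k0).
have mc : measurable_fun D (cst ((p - 1) * s `^ p)%:E : T -> \bar R) by exact: measurable_cst.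
have c0 x : D x -> (0 <= cst ((p - 1) * s `^ p)%:E x)%E.
  by move=> _; rewrite lee_fin mulr_ge0 ?powR_ge0 // subr_ge0 ltW.
have Gp0 x : D x -> (0 <= (G x `^ p)%:E)%E by rewrite lee_fin powR_ge0.
have : (\int[V]_(x in D) cst ((p - 1) * s `^ p)%:E x <= ((p - 1) * s `^ p * (u - v))%:E)%E.
  rewrite (EFinM _ (u - v)) (_ : integral _ _ _ = ((p - 1) * s `^ p)%:E * V D)%E; last exact: integral_cst.
  by rewrite lee_wpmul2l // lee_fin mulr_ge0 ?powR_ge0 // subr_ge0 ltW.
move=> /(leeD2l (\int[V]_(x in D) (G x `^ p)%:E)%E) h; apply: le_trans h.
rewrite -(@ge0_integralD _ _ _ V D mD _ _ Gp0 mGp c0 mc).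
apply: (@ge0_le_integral _ _ _ V D mD _ _ _ _ (emeasurable_funD mGp mc)).
- by move=> x Dx; rewrite mule_ge0 ?G0.
- by apply: emeasurable_funM => //; exact: measurable_cst.
move=> x _; rewrite -EFinM -EFinD lee_fin; apply: powR_young; [exact: ltW|by []|exact: H0].
Qed.

Let superlevel (t : R) : R := fine (V [set x | (t <= f x)%R]).

Let superlevelE t : 0 < t -> V [set x | (t <= f x)%R] = (superlevel t)%:E.
Proof.
move=> t0; rewrite /superlevel fineK //; apply: fin_pos; first exact: mge.
by move=> x /=; exact: lt_le_trans.
Qed.

Let superlevel_mono s t : 0 < s -> s <= t -> superlevel t <= superlevel s.
Proof.
move=> s0 st; rewrite -lee_fin -!superlevelE ?(lt_le_trans s0) //.
apply: le_measure; rewrite ?inE; try exact: mge.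
by move=> x /=; exact: le_trans.
Qed.

(* With the step weights s_i = mu v_i^(-kappa) both sums telescope. *)
Let energy_partition (p a mu : R) (J i : nat) (tau := fun k : nat => a + (1 - a) / J%:R * k%:R)
    (v := fun k => superlevel (tau k)) (c := (n%:R - p) / (n%:R * (p - 1))) : 1 < p -> p < n%:R -> 0 < a -> a < 1 -> 0 < mu ->
  0 < superlevel 1 -> (0 < J)%N -> (i <= J)%N ->
  ((p * mu `^ (p - 1) * (n%:R * w) * ((1 - a) / J%:R) *
      (i%:R + (n%:R - 1) / n%:R * ln (v i / v 0%N)))%:E <=
    \int[V]_(x in [set x | (a < f x < tau i)%R]) (G x `^ p)%:E +
      ((p - 1) * mu `^ p * ((v i `^ (- c) - v 0%N `^ (- c)) / c))%:E)%E.
Proof.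
move=> p1 pn a0 a1 mu0 s1 J0.
have d0 : 0 < (1 - a) / J%:R by rewrite divr_gt0 ?subr_gt0 ?ltr0n.
have tau0 k : 0 < tau k by rewrite /tau ltr_wpDr // mulr_ge0 // ltW.
have tau1 k : (k <= J)%N -> tau k <= 1.
  move=> kJ; rewrite /tau -lerBrDl mulrAC ler_pdivrMr ?ltr0n //.
  by rewrite ler_wpM2l ?ler_nat // subr_ge0 ltW.
have v0 k : (k <= J)%N -> 0 < v k.
  by move=> /tau1 h; exact: lt_le_trans s1 (superlevel_mono (tau0 k) h).
have n1 : (0 : R) < n%:R by rewrite ltr0n.
have c0 : 0 < c by rewrite /c divr_gt0 ?mulr_gt0 ?subr_gt0.
elim: i => [|i IH] iJ.
  rewrite divff ?gt_eqF ?v0 // ln1 subrr mulr0 add0r mul0r !mulr0 adde0.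
  by apply: integral_ge0 => x _; rewrite lee_fin powR_ge0.
have tauS : tau i < tau i.+1 by rewrite /tau ltrD2l ltr_pM2l // ltr_nat.
have vi := v0 _ (ltnW iJ); have vS := v0 _ iJ.
have {}IH := IH (ltnW iJ).
set al := (n%:R - 1) / n%:R in IH *; set d := (1 - a) / J%:R in d0 IH *.
(* The exponent is chosen so that [s^(p-1)] equals [v_i^(-al)] up to a constant, leaving on the left
   only a power of the ratio [v_(i+1) / v_i], which is bounded by a logarithm. At the same time
   [s^p] becomes [v_i^(-(1+c))], the form required by [telescope_powRN]. *)
pose s := mu * v i `^ (- (al / (p - 1))).
have p10 : p - 1 != 0 by rewrite subr_eq0 gt_eqF.
have sp x : s `^ x = mu `^ x * v i `^ (- (al / (p - 1)) * x).
  by rewrite /s powRM ?powR_ge0 ?(ltW mu0) // powRrM.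
have s0 : 0 < s by rewrite mulr_gt0 ?powR_gt0.
have := strip_energy p1 (ltW (tau0 i)) tauS s0 vS (superlevelE (tau0 i)) (superlevelE (tau0 _)).
rewrite -/al -/(v i) -/(v i.+1).
have -> : tau i.+1 - tau i = d by rewrite /tau -/d -natr1 mulrDr mulr1 opprD addrACA subrr add0r addrAC subrr add0r.
rewrite !sp mulNr divfK //.
have -> : - (al / (p - 1)) * p = - (1 + c).
  by rewrite /al /c; field; rewrite p10 gt_eqF.
move=> S; have := leeD IH S; rewrite addeACA => {}S.
apply: le_trans (_ : (_ <= (_ + _)%:E)%E) (le_trans S _).
  rewrite lee_fin.
  have -> : p * (mu `^ (p - 1) * v i `^ (- al)) * (n%:R * d * w * v i.+1 `^ al) =
      p * mu `^ (p - 1) * (n%:R * w) * d * (v i.+1 / v i) `^ al.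
    rewrite powRM ?invr_ge0 ?(ltW vS) ?(ltW vi) // -(powR_inv1 (ltW vi)) -powRrM mulN1r.
    ring.
  rewrite -mulrDr ler_wpM2l //.
    by rewrite !mulr_ge0 ?powR_ge0 ?(ltW w0) ?(ltW d0) //; lra.
  have := powR_ge_1Dln al (divr_gt0 vS vi).
  have v00 := v0 0%N isT; rewrite !ln_div ?posrE // -natr1; lra.
apply: leeD.
  pose D k : set T := [set x | a < f x < tau k]; pose S' : set T := [set x | tau i < f x < tau i.+1].
  have mo (u y : R) : measurable ([set x | u < f x < y] : set T).
    rewrite (_ : [set x | _] = f @^-1` `]u, y[%classic); first exact: measurable_preimage.
    by apply/seteqP; split=> x /=; rewrite in_itv.
  have mGp (B : set T) : measurable_fun B (fun x : T => (G (x : 'cV[R]_n) `^ p)%:E).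
    by apply/measurable_EFinP; apply: measurable_funTS; exact: measurable_powR_comp.
  have G0 x : (0 <= (G x `^ p)%:E)%E by rewrite lee_fin powR_ge0.
  have ai : a <= tau i by rewrite /tau lerDl mulr_ge0 // ltW.
  rewrite -(@ge0_integral_setU _ _ _ V (D i) S' (mo _ _) (mo _ _) _ (mGp _)) //; last first.
    by apply/disj_setPS => x [/andP[_ ft] /andP[tf _]]; move: (lt_trans ft tf); rewrite ltxx.
  apply: (@ge0_subset_integral _ _ _ V (D i `|` S') (D i.+1) (measurableU _ _ (mo _ _) (mo _ _)) (mo _ _) _ (mGp _)) => //.
  move=> x; rewrite /D /S' /= => -[/andP[-> h]|/andP[h ->]]; first by rewrite (lt_trans h).
  by rewrite (le_lt_trans ai).
have K0 : 0 <= (p - 1) * mu `^ p by rewrite mulr_ge0 ?powR_ge0 // subr_ge0 ltW.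
have vle : v i.+1 <= v i by exact: superlevel_mono (tau0 i) (ltW tauS).
have := ler_wpM2l K0 (telescope_powRN c0 vS vle); rewrite -EFinD lee_fin.
move: (p - 1) (mu `^ p) (v i `^ _) (v i `^ _) (v i.+1 `^ _) (v 0%N `^ _) (c^-1) => k l y1 y2 y3 y4 c'; lra.
Qed.

Let lim_natr (A B X : R) : (forall J : nat, (0 < J)%N -> A + B / J%:R <= X) -> A <= X.
Proof.
move=> h; apply/ler_addgt0Pr => e e0.
pose J := (Num.truncn (`|B| / e)).+1.
have J0 : (0 : R) < J%:R by rewrite ltr0n.
have BJ : - e <= B / J%:R.
  rewrite ler_pdivlMr // mulNr lerNl (le_trans (ler_norm _)) // normrN mulrC -ler_pdivrMr //.
  by apply/ltW; rewrite truncnS_gt.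
have := h J isT; lra.
Qed.

(** The partition is refined first, with [a > 0] fixed so that all volumes involved are finite: the
    logarithm carries a factor [1/J] and disappears. Then [a] tends to 0. *)
Theorem energy_lower (p : R) : 1 < p -> p < n%:R -> 0 < superlevel 1 ->
  ((n%:R * w `^ p * superlevel 1 `^ ((n%:R - p) / n%:R) * ((n%:R - p) / (p - 1)) `^ (p - 1))%:E <=
   \int[V]_x (G x `^ p)%:E)%E.
Proof.
move=> p1 pn v0; set E := integral _ _ _.
have E0 : (0 <= E)%E by apply: integral_ge0 => x _; rewrite lee_fin powR_ge0.
have [Ey|Ey] := eqVneq E +oo%E; first by rewrite Ey leey.
have Efin : E \is a fin_num by rewrite ge0_fin_numE // lt_neqAle Ey leey.
rewrite -(fineK Efin) lee_fin; set v := superlevel 1 in v0 *.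
have n1 : (0 : R) < n%:R by rewrite ltr0n.
pose c := (n%:R - p) / (n%:R * (p - 1)).
have c0 : 0 < c by rewrite /c divr_gt0 ?mulr_gt0 ?subr_gt0.
(* This [mu] maximizes [p mu^(p-1) n w - (p-1) mu^p v^(-c) / c]. *)
pose mu := n%:R * w * c * v `^ c.
have mu0 : 0 < mu := mulr_gt0 (mulr_gt0 (mulr_gt0 n1 w0) c0) (powR_gt0 c v0).
set A := p * mu `^ (p - 1) * (n%:R * w).
have A0 : 0 <= A by rewrite !mulr_ge0 ?powR_ge0 ?(ltW w0) //; lra.
set X := fine E + (p - 1) * mu `^ p * (v `^ (- c) / c).
have main a : 0 < a -> a < 1 -> A * (1 - a) <= X.
  move=> a0 a1; apply: (@lim_natr _ (A * (1 - a) * ((n%:R - 1) / n%:R * ln (v / superlevel a)))) => J J0.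
  have JR : J%:R != 0 :> R by rewrite pnatr_eq0 -lt0n.
  have := energy_partition p1 pn a0 a1 mu0 v0 J0 (leqnn J).
  rewrite /= mulr0 addr0 divfK // addrCA subrr addr0 -/c -/v -/A => h.
  have {}h := le_trans h (leeD2r _ (_ : (_ <= E)%E)).
  have : (fine E)%:E = E by rewrite fineK.
  have sub : (\int[V]_(x in [set x | (a < f x < 1)%R]) (G x `^ p)%:E <= E)%E.
    apply: (@ge0_subset_integral _ _ _ V _ setT _ measurableT) => //.
    - rewrite (_ : [set x | _] = f @^-1` `]a, 1[%classic); first exact: measurable_preimage.
      by apply/seteqP; split=> x /=; rewrite in_itv.
    - by apply/measurable_EFinP; exact: measurable_powR_comp.
    - by move=> x _; rewrite lee_fin powR_ge0.
  move=> EE; move: (h sub); rewrite -EE -EFinD lee_fin => {}h.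
  have : A * ((1 - a) / J%:R) * (J%:R + (n%:R - 1) / n%:R * ln (v / superlevel a)) =
      A * (1 - a) + A * (1 - a) * ((n%:R - 1) / n%:R * ln (v / superlevel a)) / J%:R.
    by move: (_ / _ * ln _) => z; field.
  move=> <-; apply: le_trans h _; rewrite /X lerD2l ler_wpM2l ?mulr_ge0 ?powR_ge0 //.
    by rewrite subr_ge0 ltW.
  by rewrite ler_wpM2r ?invr_ge0 ?(ltW c0) // lerBlDr lerDl powR_ge0.
have AX : A <= X.
  apply: (@lim_natr _ (- (A / 2))) => J J0; rewrite mulNr -mulrA -[X in X - _]mulr1 -mulrBr.
  have J1 : (1 : R) <= J%:R by rewrite ler1n.
  have J2 : (J%:R^-1 : R) <= 1 by rewrite invf_le1 // (lt_le_trans ltr01).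
  have J3 : (0 : R) < J%:R^-1 by rewrite invr_gt0 (lt_le_trans ltr01).
  by apply: main; lra.
have muE : mu `^ p * (v `^ (- c) / c) = mu `^ (p - 1) * (n%:R * w).
  have -> : mu `^ p = mu `^ (p - 1) * mu.
    by rewrite -{3}(powRr1 (ltW mu0)) -powRD ?subrK // (lt0r_neq0 mu0) implybT.
  rewrite {2}/mu powRN; field; rewrite gt_eqF //= gt_eqF // powR_gt0 //.
have : mu `^ (p - 1) * (n%:R * w) <= fine E.
  by move: AX; rewrite /A /X -[(p - 1) * _ * _]mulrA muE -mulrA; lra.
apply: le_trans; rewrite le_eqVlt; apply/orP; left; apply/eqP.
have -> : mu = w * v `^ c * ((n%:R - p) / (p - 1)).
  by rewrite /mu /c; field; rewrite subr_eq0 !gt_eqF.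
have g0 : 0 <= (n%:R - p) / (p - 1) by rewrite divr_ge0 ?subr_ge0 ?(ltW pn) ?(ltW p1).
move: (_ / (p - 1)) g0 => g g0.
rewrite !powRM ?mulr_ge0 ?powR_ge0 ?(ltW w0) //.
have -> : w `^ p = w `^ (p - 1) * w.
  by rewrite -{3}(powRr1 (ltW w0)) -powRD ?subrK // (lt0r_neq0 w0) implybT.
rewrite -powRrM (_ : c * (p - 1) = (n%:R - p) / n%:R); first ring.
by rewrite /c; field; rewrite subr_eq0 !gt_eqF.
Qed.

Theorem energy_lower1 : 0 < superlevel 1 ->
  ((n%:R * w * superlevel 1 `^ ((n%:R - 1) / n%:R))%:E <= \int[V]_x (G x)%:E)%E.
Proof.
move=> v0; have := strip_lower (lexx 0) ltr01 v0 (superlevelE ltr01).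
rewrite subr0 mulr1 => /le_trans; apply.
apply: (@ge0_subset_integral _ _ _ V _ setT _ measurableT) => //.
- rewrite (_ : [set x | _] = f @^-1` `]0, 1[%classic); first exact: measurable_preimage.
  by apply/seteqP; split=> x /=; rewrite in_itv.
- exact/measurable_EFinP.
- by move=> x _; rewrite lee_fin; exact: H0.
Qed.

End capacity_lower.

(** * Firey sums and Steiner symmetrization *)

Section firey.
Context (R : realType) (n m : nat) (p : R) (Q : set 'rV[R]_m).
Hypotheses (hQ : convex_body_o Q) (p1 : 1 <= p).
Implicit Types (W : set 'cV[R]_n) (u : 'M[R]_(n, m)).

Let p0 : 0 < p. Proof. exact: lt_le_trans p1. Qed.

(** The part of the unit ball of the dual exponent [p' = p / (p-1)] lying in the first quadrant,
    described by duality so that [p = 1] is included. *)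
Definition firey_weights : set (R * R) := [set z | [/\ 0 <= z.1, 0 <= z.2 &
  forall a b, 0 <= a -> 0 <= b -> z.1 * a + z.2 * b <= (a `^ p + b `^ p) `^ p^-1]].

(* For convex W containing 0 this is the L_p sum of W and u Q^T, whose support function at z is
   (h_W(z)^p + h_Q(z^T u)^p)^(1/p). *)
Definition firey W u : set 'cV[R]_n := [set x | exists z : R * R, exists w, exists y,
  [/\ firey_weights z, W w, Q y & x = z.1 *: w + z.2 *: (u *m y^T)]].

Lemma firey_weights10 : firey_weights (1, 0).
Proof.
split=> // a b a0 b0; rewrite /= mul1r mul0r addr0 -[leLHS](powRr1 a0) -(divff (lt0r_neq0 p0)) powRrM.
by rewrite ler_powR_mono ?invr_ge0 ?powR_ge0 ?(ltW p0) // lerDl powR_ge0.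
Qed.

Lemma firey_weights_le1 z : firey_weights z -> z.1 <= 1 /\ z.2 <= 1.
Proof.
have one q : 1 `^ q = 1 :> R by rewrite powR1.
move=> [_ _ h]; have := h 1 0; have := h 0 1.
by rewrite !one !powR0 ?gt_eqF // add0r addr0 !one !mulr0 !mulr1 add0r addr0; split; auto.
Qed.

Lemma firey_weights_convex z z' (t : R) : firey_weights z -> firey_weights z' -> 0 <= t <= 1 ->
  firey_weights (t * z.1 + (1 - t) * z'.1, t * z.2 + (1 - t) * z'.2).
Proof.
move=> [z1 z2 zh] [z'1 z'2 zh'] /andP[t0 t1]; have s0 : 0 <= 1 - t by rewrite subr_ge0.
split=> /=; [by rewrite addr_ge0 ?mulr_ge0|by rewrite addr_ge0 ?mulr_ge0|].
move=> a b a0 b0; have := ler_wpM2l t0 (zh a b a0 b0); have := ler_wpM2l s0 (zh' a b a0 b0).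
lra.
Qed.

Lemma compact_firey_weights : compact firey_weights.
Proof.
have cB : compact ((`[0, 1]%classic : set R) `*` (`[0, 1]%classic : set R)).
  by apply: compact_setX; exact: segment_compact.
apply: (subclosed_compact _ cB).
- move=> z cz.
  have H (f : R * R -> R) c : continuous f -> (forall z, firey_weights z -> f z <= c) -> f z <= c.
    move=> cf fc; have cl : closed [set z | f z <= c].
      by apply: (@preimage_closed _ _ f [set y | y <= c]); [move=> ? _; exact: cf|exact: closed_le].
    by apply: cl; exact: closure_subset cz.
  have c1 : continuous (fun z : R * R => z.1) by move=> ?; exact: cvg_fst.
  have c2 : continuous (fun z : R * R => z.2) by move=> ?; exact: cvg_snd.
  split.
  + rewrite -oppr_le0; apply: (H (fun z => - z.1)); first by move=> x; apply: cvgN; exact: c1.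
    by move=> x []; rewrite oppr_le0.
  + rewrite -oppr_le0; apply: (H (fun z => - z.2)); first by move=> x; apply: cvgN; exact: c2.
    by move=> x []; rewrite oppr_le0.
  + move=> a b a0 b0; apply: (H (fun z => z.1 * a + z.2 * b)); last by move=> x [_ _]; exact.
    move=> x; apply: cvgD; apply: cvgM; [exact: c1|exact: cvg_cst|exact: c2|exact: cvg_cst].
move=> z zT; have [h1 h2] := firey_weights_le1 zT; case: zT => z1 z2 _.
by split=> /=; rewrite in_itv /= ?z1 ?z2.
Qed.

Lemma convex_comb2 k l (K : set 'M[R]_(k, l)) (a b : R) x y : is_convex K -> K x -> K y ->
  0 <= a -> 0 <= b -> exists2 v, K v & a *: x + b *: y = (a + b) *: v.
Proof.
move=> cK Kx Ky a0 b0; have [ab0|ab0] := eqVneq (a + b) 0.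
  have /andP[/eqP -> /eqP ->] : (a == 0) && (b == 0) by rewrite -paddr_eq0 // ab0.
  by exists x => //; rewrite !scale0r !addr0 scale0r.
have abp : 0 < a + b by rewrite lt_neqAle eq_sym ab0 addr_ge0.
exists ((a / (a + b)) *: x + (1 - a / (a + b)) *: y).
  by apply: cK => //; rewrite divr_ge0 ?(ltW abp) //= ler_pdivrMr // mul1r lerDl.
rewrite scalerDr !scalerA mulrBr mulr1 mulrCA divff // mulr1.
by congr (_ + _ *: _); ring.
Qed.

Lemma sub_firey W u : W `<=` firey W u.
Proof.
case: hQ => _ _ _ Q0; move=> x Wx; exists (1, 0), x, 0; split=> //; first exact: firey_weights10.
by rewrite /= scale1r scale0r addr0.
Qed.

Lemma firey_mono W W' u : W `<=` W' -> firey W u `<=` firey W' u.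
Proof. by move=> WW x [z [w [y [? /WW ? ? ?]]]]; exists z, w, y. Qed.

Lemma firey_convex W u : is_convex W -> is_convex (firey W u).
Proof.
move=> cW x x' t [z [w [y [Tz Ww Qy ->]]]] [z' [w' [y' [Tz' Ww' Qy' ->]]]] /andP[t0 t1].
have s0 : 0 <= 1 - t by rewrite subr_ge0.
have TT := firey_weights_convex Tz Tz' (andb_true_intro (conj t0 t1)).
case: Tz Tz' => [a0 b0 _] [a0' b0' _].
have [v Wv vE] := convex_comb2 cW Ww Ww' (mulr_ge0 t0 a0) (mulr_ge0 s0 a0').
have [q Qq qE] := convex_comb2 (convex_body_convex hQ) Qy Qy' (mulr_ge0 t0 b0) (mulr_ge0 s0 b0').
exists (t * z.1 + (1 - t) * z'.1, t * z.2 + (1 - t) * z'.2), v, q; split=> //=.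
rewrite -vE; have -> : (t * z.2 + (1 - t) * z'.2) *: (u *m q^T) =
    u *m ((t * z.2) *: y + ((1 - t) * z'.2) *: y')^T by rewrite qE linearZ /= scalemxAr.
rewrite (_ : (_ + _)^T = (t * z.2) *: y^T + ((1 - t) * z'.2) *: y'^T); last first.
  by apply/matrixP => i j; rewrite !mxE.
rewrite mulmxDr -!scalemxAr; move: (u *m _) (u *m _) => v1 v2.
by apply/matrixP => i j; rewrite !mxE; ring.
Qed.

Lemma compact_firey W u : compact W -> compact (firey W u).
Proof.
move=> cW; case: hQ => cQ _ _ _.
pose f (z : (R * R) * ('cV[R]_n * 'rV[R]_m)) : 'cV[R]_n := z.1.1 *: z.2.1 + z.1.2 *: (u *m z.2.2^T).
have -> : firey W u = f @` (firey_weights `*` (W `*` Q)).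
  apply/seteqP; split=> x; first by move=> [z [w [y [? ? ? ->]]]]; exists (z, (w, y)).
  by move=> [[z [w y]] [/= ? [/= ? ?]] <-]; exists z, w, y.
apply: continuous_compact; last first.
  by apply: compact_setX; [exact: compact_firey_weights|exact: compact_setX].
apply: continuous_subspaceT => z.
have cu : continuous (fun y : 'rV[R]_m => u *m y^T).
  move=> y; apply: (@continuous_comp _ _ _ (fun y : 'rV[R]_m => y^T) (fun y => u *m y)).
    by apply: continuous_mxP => i j; under eq_fun do rewrite mxE; exact: coord_continuous.
  exact: continuous_mulmxl.
have c1 : (z0.1.1 @[z0 --> z] --> z.1.1)%classic by apply: (@cvg_comp _ _ _ fst fst); exact: cvg_fst.
have c2 : (z0.1.2 @[z0 --> z] --> z.1.2)%classic by apply: (@cvg_comp _ _ _ fst snd); [exact: cvg_fst|exact: cvg_snd].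
have c3 : (z0.2.1 @[z0 --> z] --> z.2.1)%classic by apply: (@cvg_comp _ _ _ snd fst); [exact: cvg_snd|exact: cvg_fst].
have c4 : (z0.2.2 @[z0 --> z] --> z.2.2)%classic by apply: (@cvg_comp _ _ _ snd snd); exact: cvg_snd.
apply: cvgD; apply: cvgZ => //.
exact: (cvg_comp _ _ c4 (cu _)).
Qed.

Lemma inner_mulmx_tr (z : 'cV[R]_n) u (y : 'rV[R]_m) : inner (z^T *m u) y = inner z (u *m y^T).
Proof. by rewrite innerC /inner mxtrace_mulC mulmxA. Qed.

Lemma firey_support W u (z : 'cV[R]_n) (c : R) x : firey W u x -> 0 <= c ->
  (forall w, W w -> inner z w <= c) ->
  inner z x <= (c `^ p + support_fun Q (z^T *m u) `^ p) `^ p^-1.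
Proof.
move=> [[a b] [w [y [[/= a0 b0 h] Ww Qy ->]]]] c0 Wc; rewrite innerDr !innerZr.
apply: le_trans (h _ _ c0 (support_ge0 hQ _)); apply: lerD; rewrite ler_wpM2l ?Wc //.
by rewrite -inner_mulmx_tr; exact: le_support.
Qed.

Lemma enorm_tr k l (x : 'M[R]_(k, l)) : enorm x^T = enorm x.
Proof. by rewrite /enorm /inner trmxK mxtrace_mulC. Qed.

Lemma enorm_mulmx_tr u (y : 'rV[R]_m) : enorm (u *m y^T) <= enorm u * enorm y.
Proof.
rewrite -enorm_tr trmx_mul mulrC -(enorm_tr u) -(enorm_tr y).
exact: (enorm_trmx_mul (y^T) (u^T)).
Qed.

(** Replacing [u] by [u'] moves a point by at most [c |u - u'|]. This displacement is a small
    multiple of a vector in the ball [eball s] inside [W], and convexity absorbs it after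
    shrinking. *)
Lemma firey_near W (s : R) : 0 < s -> is_convex W -> eball s `<=` W ->
  exists2 k, 0 < k & forall u u' x, firey W u x ->
    firey W u' ((1 + k * enorm (u - u'))^-1 *: x).
Proof.
move=> s0 cW sW; have [c c0 Qc] := convex_body_bounded hQ; exists (c / s); first exact: divr_gt0.
move=> u u' x [z [w [y [Tz Ww Qy xE]]]].
have [t0|t0] := eqVneq (enorm (u - u')) 0.
  rewrite t0 mulr0 addr0 invr1 scale1r; exists z, w, y; split=> //; rewrite xE.
  by move/eqP: t0; rewrite enorm_eq0 subr_eq0 => /eqP ->.
set t := c / s * enorm (u - u').
have tp : 0 < t by rewrite mulr_gt0 ?divr_gt0 // lt_neqAle eq_sym t0 enorm_ge0.
have [_ b1] := firey_weights_le1 Tz; have b0 : 0 <= z.2 by case: Tz.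
pose e := t^-1 *: (z.2 *: ((u - u') *m y^T)).
have We : firey W u' e.
  apply: sub_firey; apply: sW; rewrite /eball /= /e !enormZ !ger0_norm ?invr_ge0 ?(ltW tp) //.
  rewrite mulrC ler_pdivrMr // /t mulrA [s * _]mulrC divfK ?gt_eqF //.
  have h : enorm ((u - u') *m y^T) <= c * enorm (u - u').
    by apply: le_trans (enorm_mulmx_tr _ _) _; rewrite mulrC ler_wpM2r ?enorm_ge0 // Qc.
  by apply: le_trans h; rewrite ler_piMl ?enorm_ge0.
have Wf : firey W u' (z.1 *: w + z.2 *: (u' *m y^T)) by exists z, w, y.
have t1 : 0 < 1 + t by rewrite addr_gt0.
have := firey_convex cW Wf We (_ : 0 <= (1 + t)^-1 <= 1); rewrite invr_ge0 ltW //= invf_le1 // lerDl ltW //.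
move=> /(_ isT); congr (firey W u' _).
have -> : 1 - (1 + t)^-1 = (1 + t)^-1 * t by field; rewrite gt_eqF.
rewrite /e scalerA -(mulrA _ t) divff ?gt_eqF // mulr1 -scalerDr xE -addrA -scalerDr -mulmxDl.
by rewrite addrCA subrr addr0.
Qed.

End firey.

(** * Steiner symmetrization *)

Section steiner.
Context (R : realType) (n : nat).
Implicit Types (A B W : set 'cV[R]_n) (w x : 'cV[R]_n).

(* Steiner symmetrization of A in direction w when A = B is convex. *)
Definition steiner w A B : set 'cV[R]_n := [set x | exists a, exists b, exists t : R,
  [/\ A a, B b, a - b = t *: w & x = 2^-1 *: (a + reflection w *m b)]].

Lemma steiner_convex w A B : is_convex A -> is_convex B -> is_convex (steiner w A B).
Proof.
move=> cA cB x x' t [a [b [r [Aa Bb ab ->]]]] [a' [b' [r' [Aa' Bb' ab' ->]]]] t01.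
exists (t *: a + (1 - t) *: a'), (t *: b + (1 - t) *: b'), (t * r + (1 - t) * r'); split.
- exact: cA.
- exact: cB.
- rewrite (_ : _ - _ = t *: (a - b) + (1 - t) *: (a' - b')).
    by rewrite ab ab' !scalerA -scalerDl.
  by apply/matrixP => i j; rewrite !mxE; ring.
rewrite mulmxDr -!scalemxAr; move: (_ *m b) (_ *m b') => v v'.
by apply/matrixP => i j; rewrite !mxE; ring.
Qed.

Lemma compact_steiner w A B : enorm w = 1 -> compact A -> compact B -> compact (steiner w A B).
Proof.
move=> w1 cA cB.
pose f (z : 'cV[R]_n * 'cV[R]_n) : 'cV[R]_n := 2^-1 *: (z.1 + reflection w *m z.2).
pose P : 'M[R]_n := 1%:M - w *m w^T.
have PE v : P *m v = v - inner w v *: w.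
  by rewrite mulmxBl mul1mx -mulmxA mxtrace_cV1 mul_mx_scalar.
pose g (z : 'cV[R]_n * 'cV[R]_n) : R := enorm (P *m (z.1 - z.2)).
have cs : continuous (fun z : 'cV[R]_n * 'cV[R]_n => z.1 - z.2).
  by move=> z; apply: cvgB; [exact: cvg_fst|exact: cvg_snd].
have cg : continuous g.
  have ci : continuous (fun v : 'cV[R]_n => enorm (P *m v)).
    move=> v; apply: (@continuous_comp _ _ _ (fun v : 'cV[R]_n => P *m v) (@enorm R n 1)); last exact: continuous_enorm.
    exact: continuous_mulmxl.
  by move=> z; apply: (@continuous_comp _ _ _ (fun z : 'cV[R]_n * 'cV[R]_n => z.1 - z.2) (fun v : 'cV[R]_n => enorm (P *m v)) z (cs z)); exact: ci.
have -> : steiner w A B = f @` ((A `*` B) `&` g @^-1` [set y | y <= 0]).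
  apply/seteqP; split=> x.
    move=> [a [b [t [Aa Bb ab ->]]]]; exists (a, b) => //; split=> //; rewrite /g /= PE ab innerZr.
    by rewrite -enorm_sqr w1 expr1n mulr1 subrr enorm0.
  move=> [[a b] [[/= Aa Bb]]]; rewrite /g /= PE le_eqVlt ltNge enorm_ge0 orbF enorm_eq0 subr_eq0 => /eqP ab <-.
  by exists a, b, (inner w (a - b)).
apply: continuous_compact.
  apply: continuous_subspaceT => z; apply: cvgZ; first exact: cvg_cst.
  apply: cvgD; first exact: cvg_fst.
  by apply: (cvg_comp _ _ cvg_snd); exact: continuous_mulmxl.
apply: compact_closedI; first exact: compact_setX.
by apply: (@preimage_closed _ _ g [set y | y <= 0]); [move=> ? _; exact: cg|exact: closed_le].
Qed.

Lemma steiner_sub w A B x : enorm w = 1 -> A x -> B (reflection w *m x) -> steiner w A B x.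
Proof.
move=> w1 Ax Bx; exists x, (reflection w *m x), (2 * inner w x); split=> //.
  by rewrite reflectionE opprB addrCA subrr addr0.
by rewrite mulmxA reflectionK // mul1mx; apply/matrixP => i j; rewrite !mxE; lra.
Qed.

(** This inclusion is why [steiner] takes two sets: the Firey sum of the symmetral at the mean of
    [u] and the reflected [v] is compared with the two different sums at [u] and [v]. The same
    weights and the same point of [Q] serve for both. *)
Lemma firey_steiner m (p : R) (Q : set 'rV[R]_m) w W (u v : 'M[R]_(n, m)) (c : 'rV[R]_m) :
  u - v = w *m c ->
  firey p Q (steiner w W W) (2^-1 *: (u + reflection w *m v)) `<=`
  steiner w (firey p Q W u) (firey p Q W v).
Proof.
move=> uv x [z [_ [y [Tz [a [b [t [Wa Wb ab ->]]]] Qy ->]]]].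
exists (z.1 *: a + z.2 *: (u *m y^T)), (z.1 *: b + z.2 *: (v *m y^T)), (z.1 * t + z.2 * (c *m y^T) 0 0).
split; [by exists z, a, y|by exists z, b, y| |].
  rewrite opprD addrACA -!scalerBr ab -mulmxBl uv -mulmxA scalerDl -!scalerA; congr (_ + _ *: _).
  by rewrite {1}[c *m y^T]mx11_scalar mul_mx_scalar.
rewrite -scalemxAl (mulmxDl u) -(mulmxA (reflection w)) (mulmxDr (reflection w)) -!(scalemxAr _ (reflection w)).
move: (_ *m b) (u *m _) (_ *m (v *m _)) => v1 v2 v3.
by apply/matrixP => i j; rewrite !mxE; ring.
Qed.

End steiner.

(** * Fibres in the direction of symmetrization *)

Section column_slices.
Context (R : realType) (n m : nat) (A : set (borel_mx R (1 + n) m)).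
Hypothesis mA : measurable A.

Let S : set (borel_mx R 1 m * borel_mx R n m) := [set z | A (col_mx z.1 z.2)].

Let mS : measurable S.
Proof. exact: (measurable_preimage (@measurable_col_mx R 1 n m)). Qed.

Lemma measurable_col_slice (y : 'M[R]_(n, m)) :
  measurable ([set t | A (col_mx t y)] : set (borel_mx R 1 m)).
Proof. exact: (measurable_set_slice2 mS). Qed.

Lemma measurable_fun_col_slice : measurable_fun setT (fun y : borel_mx R n m =>
  lebesgue_mx ([set t | A (col_mx t y)] : set (borel_mx R 1 m))).
Proof. exact: (measurable_fun_slice2 lebesgue_mx mS). Qed.

Lemma lebesgue_col_slices : (lebesgue_mx A = \int[lebesgue_mx]_(y in [set: borel_mx R n m])
  lebesgue_mx ([set t | A (col_mx t y)] : set (borel_mx R 1 m)))%E.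
Proof.
apply: etrans (lebesgue_mx_col_mx mA) _.
apply: etrans (product_measure_slice1 lebesgue_mx lebesgue_mx S) _.
exact: (fubini_slice lebesgue_mx lebesgue_mx mS).
Qed.

End column_slices.

Section first_axis.
Context (R : realType) (n : nat).

Definition first_axis : 'cV[R]_(1 + n) := col_mx 1%:M 0.

Lemma first_axis_mul m (c : 'rV[R]_m) : first_axis *m c = col_mx c 0.
Proof. by rewrite /first_axis mul_col_mx mul1mx mul0mx. Qed.

Lemma reflection_first_axis m (t : 'rV[R]_m) y : reflection first_axis *m col_mx t y = col_mx (- t) y.
Proof.
rewrite /reflection mulmxBl mul1mx -scalemxAl -mulmxA {2}/first_axis tr_col_mx mul_row_col.
rewrite trmx1 mul1mx trmx0 mul0mx addr0 first_axis_mul scale_col_mx scaler0 opp_col_mx add_col_mx.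
by rewrite oppr0 addr0; congr col_mx; apply/matrixP => i j; rewrite !mxE; ring.
Qed.

Lemma enorm_first_axis : enorm first_axis = 1.
Proof.
rewrite /enorm /inner {1}/first_axis tr_col_mx trmx1 trmx0 /first_axis mul_row_col mul1mx mul0mx addr0.
by rewrite mxtrace1 sqrtr1.
Qed.

Lemma le_enorm_col_mx m (t : 'rV[R]_m) (y : 'M[R]_(n, m)) : enorm t <= enorm (col_mx t y).
Proof.
rewrite /enorm /inner tr_col_mx mul_row_col mxtraceD.
by rewrite ler_sqrt ?addr_ge0 ?(inner_ge0 t) ?(inner_ge0 y) // lerDl (inner_ge0 y).
Qed.

Lemma ortho_first_axis w : enorm w = 1 -> exists2 O : 'M[R]_(1 + n), is_ortho O & O *m first_axis = w.
Proof.
move=> w1; have [->|nw] := eqVneq w first_axis.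
  by exists 1%:M; [rewrite /is_ortho trmx1 mul1mx|rewrite mul1mx].
have [||v v1 vE] := @reflection_swap R (1 + n) first_axis w; first by rewrite enorm_first_axis.
  by rewrite eq_sym.
by exists (reflection v) => //; exact: reflection_ortho.
Qed.

Lemma reflection_conj k (O : 'M[R]_k) w m (x : 'M[R]_(k, m)) : is_ortho O ->
  reflection (O *m w) *m (O *m x) = O *m (reflection w *m x).
Proof.
move=> oO; rewrite /reflection !mulmxBl !mul1mx mulmxBr -!scalemxAl -scalemxAr trmx_mul !mulmxA.
by rewrite -(mulmxA _ O^T) oO mulmx1.
Qed.

End first_axis.

Section steiner_volume.
Context (R : realType).

(** An orthogonal map takes [w] to the first axis. Matrices differing by some [w c] then differ in
    the first row only, and the reflection changes the sign of that row. Each [m]-dimensional fibre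
    of [D'] contains half the difference set of the fibre of [D]. *)
Lemma le_lebesgue_steiner n m (w : 'cV[R]_n) (D D' : set (borel_mx R n m)) : enorm w = 1 ->
  measurable D -> measurable D' -> enorm_bounded D ->
  (forall u v c, D u -> D v -> u - v = w *m c -> D' (2^-1 *: (u + reflection w *m v))) ->
  (lebesgue_mx D <= lebesgue_mx D')%E.
Proof.
case: n w D D' => [|n] w D D' w1 mD mD' bD DD.
  by have := w1; rewrite (flatmx0 w) enorm0 => /eqP; rewrite eq_sym oner_eq0.
have [Om oO Ow] := ortho_first_axis w1.
pose E (X : set (borel_mx R n.+1 m)) : set (borel_mx R (1 + n) m) := (fun x : 'M[R]_(1 + n, m) => Om *m x) @^-1` X.
have mE X : measurable X -> measurable (E X).
  by move=> mX; apply: (measurable_preimage (@measurable_mulmxl R (1 + n) m (1 + n) Om)).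
have VE X : measurable X -> lebesgue_mx X = lebesgue_mx (E X).
  by move=> mX; rewrite -(lebesgue_mx_ortho oO mX).
rewrite (VE _ mD) (VE _ mD') (lebesgue_col_slices (mE _ mD)) (lebesgue_col_slices (mE _ mD')).
apply: (@ge0_le_integral _ _ _ lebesgue_mx setT measurableT) => //.
- exact: measurable_fun_col_slice (mE _ mD).
- exact: measurable_fun_col_slice (mE _ mD').
move=> y _; apply: le_lebesgue_half_diff.
- exact: measurable_col_slice (mE _ mD) y.
- exact: measurable_col_slice (mE _ mD') y.
- have [r Dr] := bD; exists r => t /Dr; rewrite enorm_ortho //; apply: le_trans.
  exact: le_enorm_col_mx.
move=> t t' Et Et'; rewrite /E /=.
have := DD _ _ (t - t') Et Et'; rewrite -mulmxBr opp_col_mx add_col_mx subrr -Ow -first_axis_mul mulmxA.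
move=> /(_ erefl); rewrite reflection_conj // reflection_first_axis -mulmxDr add_col_mx scalemxAr.
congr (D' (Om *m _)); rewrite scale_col_mx; congr col_mx.
by apply/matrixP => i j; rewrite !mxE; lra.
Qed.

Lemma enorm_mx11 (t : 'M[R]_(1, 1)) : enorm t = `|t 0 0|.
Proof. by rewrite /enorm innerE !big_ord1 -expr2 sqrtr_sqr. Qed.

(** A bounded convex set on the line fills the open interval between its infimum and its supremum,
    so the length of half the difference set is the mean of the two lengths. *)
Let half_diff_interval (A B S : set (borel_mx R 1 1)) : measurable A -> measurable B -> measurable S ->
  is_convex A -> is_convex B -> enorm_bounded A -> enorm_bounded B ->
  (forall t, S t -> exists a, exists b, [/\ A a, B b & t = 2^-1 *: (a - b)]) ->
  (lebesgue_mx S <= 2^-1%:E * (lebesgue_mx A + lebesgue_mx B))%E.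
Proof.
move=> mA mB mS cA cB bA bB AB.
have ends (Z : set (borel_mx R 1 1)) a0 : measurable Z -> is_convex Z -> enorm_bounded Z -> Z a0 ->
    exists l, exists r, [/\ l <= r, forall t : 'M[R]_(1, 1), Z t -> l <= t 0 0 <= r &
      ((r - l)%:E <= lebesgue_mx Z)%E].
  move=> mZ cZ [c Zc] Za0; pose X := [set y | exists2 t : 'M[R]_(1, 1), Z t & t 0 0 = y].
  have Xb t : Z t -> - c <= (t : 'M[R]_(1, 1)) 0 0 <= c by move=> /Zc; rewrite enorm_mx11 ler_norml.
  have X0 : X !=set0 by exists ((a0 : 'M[R]_(1, 1)) 0 0), a0.
  have uX : has_ubound X by exists c => y [t /Xb /andP[_ ? ] <-].
  have lX : has_lbound X by exists (- c) => y [t /Xb /andP[? _] <-].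
  have lr t : Z t -> inf X <= (t : 'M[R]_(1, 1)) 0 0 <= sup X.
    by move=> Zt; rewrite ge_inf //=; [rewrite ub_le_sup //; exists t|exists t].
  exists (inf X), (sup X); split=> //.
    by have /andP[? ?] := lr _ Za0; lra.
  apply/lee_addgt0Pr => e e0.
  have [se|se] := leP (sup X - inf X) e.
    by apply: le_trans (_ : (e%:E <= _)%E); rewrite ?lee_fin // leeDr.
  have -> : sup X - inf X = (sup X - (inf X + e)) + e by ring.
  rewrite EFinD leeD2r //.
  have := @lebesgue_mx_cube R 1 1 (inf X + e) (sup X); rewrite expr1 => <-; last lra.
  apply: le_measure; rewrite ?inE //; first exact: measurable_mx_cube.
  move=> t /(_ 0 0) /andP[lt tr].
  have [y1 [t1 At1 t1E] y1l] := inf_adherent e0 (conj X0 lX).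
  have [y2 [t2 At2 t2E] y2r] : exists2 y, X y & t 0 0 < y.
    by apply: sup_gt.
  have d0 : 0 < y2 - y1 by lra.
  have := cZ t2 t1 ((t 0 0 - y1) / (y2 - y1)) At2 At1.
  rewrite divr_ge0 ?(ltW d0) /= ?ler_pdivrMr //; [|lra].
  have <- : t = ((t 0 0 - y1) / (y2 - y1)) *: t2 + (1 - (t 0 0 - y1) / (y2 - y1)) *: t1 :> 'M[R]_(1, 1).
    2: by apply; lra.
  apply/matrixP => i j; rewrite !ord1 !mxE t1E t2E; field; lra.
have [->|/set0P[t0 St0]] := eqVneq S set0; first by rewrite measure0 mule_ge0 // adde_ge0.
have [a0 [b0 [Aa0 Bb0 _]]] := AB _ St0.
have [l [r [lr Alr VA]]] := ends A a0 mA cA bA Aa0.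
have [l' [r' [lr' Blr VB]]] := ends B b0 mB cB bB Bb0.
apply: (@le_trans _ _ (2^-1 * ((r - l) + (r' - l')))%:E); last first.
  by rewrite EFinM lee_wpmul2l // EFinD leeD.
apply/lee_addgt0Pr => e e0; rewrite -EFinD.
have := @lebesgue_mx_cube R 1 1 (2^-1 * (l - r')) (2^-1 * (r - l') + e); rewrite expr1.
move=> h; have : 2^-1 * (l - r') <= 2^-1 * (r - l') + e by lra.
move=> /h; have -> : 2^-1 * (r - l') + e - 2^-1 * (l - r') = 2^-1 * (r - l + (r' - l')) + e by ring.
move=> <-; apply: le_measure; rewrite ?inE //; first exact: measurable_mx_cube.
move=> t /AB [a [b [/Alr /andP[a1 a2] /Blr /andP[b1 b2] ->]]] i j; rewrite !ord1 !mxE.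
apply/andP; split; lra.
Qed.

(** Fibrewise application of [half_diff_interval]. The upper bound by the mean relies on
    one-dimensional fibres, hence on columns and convex sets. *)
Lemma steiner_volume_le n (w : 'cV[R]_n) (A B : set 'cV[R]_n) : enorm w = 1 ->
  compact A -> compact B -> is_convex A -> is_convex B ->
  (lebesgue_mx (steiner w A B : set (borel_mx R n 1)) <=
   2^-1%:E * (lebesgue_mx (A : set (borel_mx R n 1)) + lebesgue_mx (B : set (borel_mx R n 1))))%E.
Proof.
case: n w A B => [|n] w A B w1 kA kB cA cB.
  by have := w1; rewrite (flatmx0 w) enorm0 => /eqP; rewrite eq_sym oner_eq0.
have [Om oO Ow] := ortho_first_axis w1.
pose E (X : set (borel_mx R n.+1 1)) : set (borel_mx R (1 + n) 1) := (fun x : 'M[R]_(1 + n, 1) => Om *m x) @^-1` X.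
have mE X : measurable X -> measurable (E X).
  by move=> mX; apply: (measurable_preimage (@measurable_mulmxl R (1 + n) 1 (1 + n) Om)).
have VE X : measurable X -> lebesgue_mx X = lebesgue_mx (E X).
  by move=> mX; rewrite -(lebesgue_mx_ortho oO mX).
have mA := compact_measurable_mx kA; have mB := compact_measurable_mx kB.
have mS := compact_measurable_mx (compact_steiner w1 kA kB).
have sl (X : set (borel_mx R n.+1 1)) (mX : measurable X) y := measurable_col_slice (mE X mX) y.
have bsl (X : set 'cV[R]_n.+1) (y : 'cV[R]_n) : compact X -> enorm_bounded [set t | E X (col_mx t y)].
  move=> kX; have [r _ Xr] := compact_enorm_bounded kX; exists r => t /Xr; rewrite enorm_ortho //; apply: le_trans.
  exact: le_enorm_col_mx.
have csl (X : set 'cV[R]_n.+1) (y : 'cV[R]_n) : is_convex X -> is_convex [set t | E X (col_mx t y)].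
  move=> cX t t' s Xt Xt' s01; have := cX _ _ _ Xt Xt' s01; rewrite /E /= !scalemxAr -mulmxDr.
  rewrite !scale_col_mx add_col_mx -scalerDl addrCA subrr addr0 scale1r //.
have mfA := measurable_fun_col_slice (mE _ mA); have mfB := measurable_fun_col_slice (mE _ mB).
rewrite (VE _ mS) (VE _ mA) (VE _ mB).
rewrite (lebesgue_col_slices (mE _ mS)) (lebesgue_col_slices (mE _ mA)) (lebesgue_col_slices (mE _ mB)).
rewrite -(@ge0_integralD _ _ _ lebesgue_mx setT measurableT _ _ _ mfA _ mfB) //.
rewrite -(@ge0_integralZl_EFin _ _ _ lebesgue_mx setT measurableT _ _ (emeasurable_funD mfA mfB)) //; last first.
  by move=> y _; rewrite adde_ge0.
apply: (@ge0_le_integral _ _ _ lebesgue_mx setT measurableT).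
- by [].
- exact: measurable_fun_col_slice (mE _ mS).
- by apply: emeasurable_funM; [exact: measurable_cst|exact: emeasurable_funD].
move=> y _; apply: (half_diff_interval (sl _ mA y) (sl _ mB y) (sl _ mS y) (csl _ y cA) (csl _ y cB) (bsl _ y kA) (bsl _ y kB)).
move=> t [a [b [s [Aa Bb ab tE]]]].
have OK k (x : 'M[R]_(1 + n, k)) : Om *m (Om^T *m x) = x.
  by rewrite mulmxA (mulmx1C oO) mul1mx.
have OI k : injective (fun x : 'M[R]_(1 + n, k) => Om *m x).
  by move=> x x' /(congr1 (fun z => Om^T *m z)); rewrite !mulmxA oO !mul1mx.
have EE (z : 'cV[R]_(1 + n)) : exists ta, exists ya, z = Om *m col_mx ta ya.
  by exists (usubmx (Om^T *m z)), (dsubmx (Om^T *m z)); rewrite vsubmxK OK.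
have [ta [ya aE]] := EE a; have [tb [yb bE]] := EE b.
move: ab tE; rewrite aE bE -Ow reflection_conj // reflection_first_axis.
rewrite -mulmxBr scalemxAr => /OI; rewrite opp_col_mx add_col_mx /first_axis scale_col_mx scaler0.
move=> /eq_col_mx[_ /subr0_eq yab]; rewrite -mulmxDr scalemxAr => /OI.
rewrite add_col_mx scale_col_mx => /eq_col_mx[tE yE].
have ya_y : ya = y.
  by rewrite yE -yab; apply/matrixP => i j; rewrite !mxE; lra.
exists ta, tb; split=> //.
- by rewrite /E /= -ya_y -aE.
- by rewrite /E /= -ya_y yab -bE.
Qed.

End steiner_volume.

(** * Sublevel sets of Firey volumes under symmetrization *)

Section fat_bodies.
Context (R : realType) (n m : nat) (p : R) (Q : set 'rV[R]_m).
Hypotheses (hQ : convex_body_o Q) (p1 : 1 <= p).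
Local Notation V := (@lebesgue_mx R n 1).
Local Notation F := (firey p Q).

(** The inscribed ball is preserved by symmetrization and is what makes the volume of the Firey sum
    vary continuously with [u]. *)
Definition fat_body (s : R) (W : set 'cV[R]_n) := [/\ compact W, is_convex W & eball s `<=` W].

Lemma steiner_fat_body s W w : enorm w = 1 -> fat_body s W -> fat_body s (steiner w W W).
Proof.
move=> w1 [kW cW sW]; split; [exact: compact_steiner|exact: steiner_convex|].
move=> x sx; apply: steiner_sub => //; apply: sW => //.
by rewrite /eball /= enorm_ortho //; exact: reflection_ortho.
Qed.

Lemma measurable_firey s W (u : 'M[R]_(n, m)) : fat_body s W -> measurable (F W u : set (borel_mx R n 1)).
Proof. by move=> [kW _ _]; apply: compact_measurable_mx; exact: compact_firey. Qed.

Lemma firey_volume_near s W : 0 < s -> fat_body s W -> exists2 k, 0 < k & forall u u' : 'M[R]_(n, m),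
  (V (F W u) <= ((1 + k * enorm (u - u')) ^+ n)%:E * V (F W u'))%E.
Proof.
move=> s0 fW; have [kW cW sW] := fW.
have [k k0 near] := firey_near hQ p1 s0 cW sW; exists k => // u u'.
set t := 1 + _; have t0 : 0 < t by rewrite ltr_wpDr // mulr_ge0 ?enorm_ge0 // ltW.
have mF' := measurable_firey u' fW.
have -> : t ^+ n = (t^-1)^-1 ^+ (n * 1) by rewrite invrK muln1.
rewrite muleC -lebesgue_mx_scale ?invr_gt0 //.
apply: le_measure; rewrite ?inE; last by move=> x /near; exact.
  exact: measurable_firey fW.
apply: (@measurable_preimage _ _ _ _ (fun x : borel_mx R n 1 => t^-1 *: (x : 'cV[R]_n) : borel_mx R n 1)) => //.
by apply: continuous_measurable_mx_mx => x; exact: scaler_continuous.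
Qed.

(** The cutoff [|u| <= r] makes the set bounded, as fibrewise Brunn-Minkowski requires, and it is
    respected by averaging with a reflected matrix. *)
Definition firey_sublevel W (c r : R) : set (borel_mx R n m) :=
  [set u : 'M[R]_(n, m) | enorm u <= r /\ (V (F W u) <= c%:E)%E].

(** The set is closed: by [firey_volume_near] the volume at a limit point [u0] is at most
    [(1 + k |u0 - u|)^n c] for members [u] arbitrarily close to [u0]. *)
Lemma measurable_firey_sublevel s W c r : 0 < s -> fat_body s W -> measurable (firey_sublevel W c r).
Proof.
move=> s0 fW; apply: closed_measurable_mx.
have [k k0 near] := firey_volume_near s0 fW.
rewrite (_ : firey_sublevel W c r = eball r `&` [set u | (V (F W u) <= c%:E)%E]); last by [].
apply: closedI; first exact: closed_eball.
move=> u0 cu0 /=.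
have [c0|c0] := ltP c 0.
  exfalso; have [u [/= Vc _]] : [set u : 'M[R]_(n, m) | (V (F W u) <= c%:E)%E] `&` setT !=set0.
    by apply: cu0; exact: filterT.
  by have := le_trans (measure_ge0 V _) Vc; rewrite lee_fin leNgt c0.
have fin := fineK (enorm_bounded_fin_num (measurable_firey u0 fW) _).
have bF : enorm_bounded (F W u0).
  by case: fW => kW _ _; have [d _ b] := compact_enorm_bounded (compact_firey hQ p1 (u := u0) kW); exists d.
rewrite -fin // lee_fin; set v := fine _.
pose g (u : 'M[R]_(n, m)) := - ((1 + k * enorm (u0 - u)) ^+ n * c).
have cg : continuous g.
  have cG : continuous (fun y : R => - ((1 + k * y) ^+ n * c)).
    move=> y; apply: cvgN; apply: cvgM; last exact: cvg_cst.
    apply: (@continuous_comp _ _ _ (fun y : R => 1 + k * y) (fun y => y ^+ n)); last exact: exprn_continuous.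
    by apply: cvgD; [exact: cvg_cst|apply: cvgM; [exact: cvg_cst|exact: cvg_id]].
  rewrite (_ : g = (fun y => - ((1 + k * y) ^+ n * c)) \o (fun u => enorm (u - u0))).
    by move=> u; apply: continuous_comp; [exact: continuous_enormB|exact: cG].
  by apply/funext => u; rewrite /g /= -enormN opprB.
have cl : closed [set u | g u <= - v] := closed_le_continuous (c := - v) cg.
have : [set u | g u <= - v] u0.
  apply: cl; apply: closure_subset cu0 => u /= Vu; rewrite /g lerN2 -lee_fin /v fin //.
  apply: le_trans (near u0 u) _; rewrite EFinM lee_wpmul2l // lee_fin exprn_ge0 //.
  by rewrite addr_ge0 ?mulr_ge0 ?enorm_ge0 // ltW.
by rewrite /g /= subrr enorm0 mulr0 addr0 expr1n mul1r lerN2.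
Qed.

Lemma firey_sublevel_mono s W W' c r : fat_body s W -> fat_body s W' -> W `<=` W' ->
  firey_sublevel W' c r `<=` firey_sublevel W c r.
Proof.
move=> fW fW' WW u [ur Vc]; split=> //; apply: le_trans Vc.
by apply: le_measure; rewrite ?inE; [exact: measurable_firey fW|exact: measurable_firey fW'|exact: firey_mono].
Qed.

(** For members [u] and [v] with [u - v = w d], [firey_steiner] and [steiner_volume_le] bound the
    Firey volume of the symmetral at the mean of [u] and the reflected [v] by the average of two
    volumes at most [c]. So this mean lies in the new sublevel set, and [le_lebesgue_steiner]
    applies. *)
Lemma steiner_firey_sublevel s W w c r : 0 < s -> fat_body s W -> enorm w = 1 ->
  (lebesgue_mx (firey_sublevel W c r) <= lebesgue_mx (firey_sublevel (steiner w W W) c r))%E.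
Proof.
move=> s0 fW w1; have fS := steiner_fat_body w1 fW.
apply: (le_lebesgue_steiner w1 (measurable_firey_sublevel c r s0 fW) (measurable_firey_sublevel c r s0 fS)).
  by exists r => u [].
move=> u v d [ur Vu] [vr Vv] uv; split.
  rewrite enormZ ger0_norm ?invr_ge0 // mulrC ler_pdivrMr //.
  apply: le_trans (enormD _ _) _; rewrite enorm_ortho; last exact: reflection_ortho.
  lra.
have [kW cW _] := fW.
have kF z : compact (F W z) by exact: compact_firey.
have cF (z : 'M[R]_(n, m)) : is_convex (F W z) by exact: firey_convex.
apply: le_trans (_ : (V (steiner w (F W u) (F W v)) <= _)%E).
  apply: le_measure; rewrite ?inE; [exact: measurable_firey fS| |exact: firey_steiner uv].
  by apply: compact_measurable_mx; exact: compact_steiner.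
apply: le_trans (steiner_volume_le w1 (kF u) (kF v) (cF u) (cF v)) _.
apply: le_trans (lee_wpmul2l _ (leeD Vu Vv)) _ => //.
by rewrite -EFinD -EFinM lee_fin; lra.
Qed.

Lemma steiner_volume_ge W w : compact W -> enorm w = 1 -> (V W <= V (steiner w W W))%E.
Proof.
move=> kW w1; apply: (le_lebesgue_steiner w1).
- exact: compact_measurable_mx.
- by apply: compact_measurable_mx; exact: compact_steiner.
- by have [r _ b] := compact_enorm_bounded kW; exists r.
move=> u v d Wu Wv uv; exists u, v, (d 0 0); split=> //.
by rewrite uv {1}[d]mx11_scalar mul_mx_scalar.
Qed.

Inductive steiner_reach (W : set 'cV[R]_n) : set 'cV[R]_n -> Prop :=
| steiner_reach0 : steiner_reach W W
| steiner_reachS W' w : steiner_reach W W' -> enorm w = 1 -> steiner_reach W (steiner w W' W').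

Lemma steiner_reach_fat_body s W W' : fat_body s W -> steiner_reach W W' -> fat_body s W'.
Proof. by move=> fW; elim=> // ? w _ fW' w1; exact: steiner_fat_body. Qed.

Lemma steiner_reach_trans W W' W'' : steiner_reach W W' -> steiner_reach W' W'' -> steiner_reach W W''.
Proof. by move=> r1; elim=> // ? w _ r2 w1; exact: steiner_reachS. Qed.

Lemma steiner_reach_volume s W W' : fat_body s W -> steiner_reach W W' -> (V W <= V W')%E.
Proof.
move=> fW; elim=> // X w rX h w1; apply: le_trans h _; apply: steiner_volume_ge => //.
by case: (steiner_reach_fat_body fW rX).
Qed.

Lemma steiner_reach_sublevel s W W' c r : 0 < s -> fat_body s W -> steiner_reach W W' ->
  (lebesgue_mx (firey_sublevel W c r) <= lebesgue_mx (firey_sublevel W' c r))%E.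
Proof.
move=> s0 fW; elim=> // X w rX h w1; apply: le_trans h _; apply: (@steiner_firey_sublevel s) => //.
exact: steiner_reach_fat_body rX.
Qed.

End fat_bodies.

(** * Rounding by finitely many symmetrizations *)

Section rounding.
Context (R : realType) (n : nat).
Implicit Types (W : set 'cV[R]_n) (x y w : 'cV[R]_n).

Let norm_comb (a b : R) x w : enorm x = 1 -> enorm w = 1 ->
  enorm (a *: x + b *: w) ^+ 2 = a ^+ 2 + 2 * a * b * inner w x + b ^+ 2.
Proof.
move=> x1 w1; rewrite enorm_sqr !innerE_lin (innerC x w) -!enorm_sqr x1 w1; ring.
Qed.

Let mid W (e : R) x y : is_convex W -> unit_ball `<=` W -> W ((1 + e) *: x) ->
  enorm (2 *: y - (1 + e) *: x) ^+ 2 <= 1 -> W y.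
Proof.
move=> cW BW Wx h; have By : enorm (2 *: y - (1 + e) *: x) <= 1.
  by rewrite leNgt; apply/negP => g; move: h; rewrite leNgt exprn_egt1.
have := cW _ _ 2^-1 Wx (BW _ By).
rewrite invr_ge0 ler0n invf_le1 ?ltr0n // ler1n => /(_ isT); congr (W _).
by apply/matrixP => i j; rewrite !mxE; lra.
Qed.

(** A direction in which [W] exceeds the unit ball keeps a definite excess after symmetrization, and
    so does its mirror image. The loss from [8 d] to [d^3] is harmless because it is uniform in [W],
    [x] and [w]. *)
Let progress_unit W (d : R) x w : 0 < d -> 8 * d <= 1 -> is_convex W -> unit_ball `<=` W ->
  enorm x = 1 -> enorm w = 1 -> W ((1 + 8 * d) *: x) ->
  steiner w W W ((1 + d ^+ 3) *: x) /\
  steiner w W W ((1 + d ^+ 3) *: (reflection w *m x)).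
Proof.
move=> d0 d1 cW BW x1 w1 Wx.
have d2 : d ^+ 2 <= d * 8^-1.
  by rewrite expr2 ler_pM2l // -[8^-1]mul1r ler_pdivlMr // mulrC.
have psie : d ^+ 3 <= d * 64^-1.
  by rewrite exprS; apply: le_trans (ler_wpM2l (ltW d0) d2) _; lra.
have psis : d ^+ 3 = d * d ^+ 2 by rewrite exprS.
have psi0 : 0 < d ^+ 3 by rewrite exprn_gt0.
move: (d ^+ 3) psie psis psi0 => psi psie psis psi0.
pose a := inner w x.
have refx : reflection w *m x = x - (2 * a) *: w by exact: reflectionE.
(* The two points differ by a multiple of [w]; taking them in either order as the pair defining
   [steiner] cancels the shift [t w] and yields the two desired points. *)
suff [t Wp Wq] : exists2 t, W ((1 + psi) *: x + t *: w) & W ((1 + psi) *: (reflection w *m x) + t *: w).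
  have rw : reflection w *m w = - w.
    rewrite reflectionE -enorm_sqr w1 expr1n mulr1.
    by apply/matrixP => i j; rewrite !mxE; lra.
  split.
    exists ((1 + psi) *: x + t *: w), ((1 + psi) *: (reflection w *m x) + t *: w), (2 * (1 + psi) * a); split=> //.
      by rewrite refx; apply/matrixP => i j; rewrite !mxE; ring.
    rewrite mulmxDr -!scalemxAr mulmxA reflectionK // mul1mx rw.
    by apply/matrixP => i j; rewrite !mxE; field.
  exists ((1 + psi) *: (reflection w *m x) + t *: w), ((1 + psi) *: x + t *: w), (- (2 * (1 + psi) * a)); split=> //.
    by rewrite refx; apply/matrixP => i j; rewrite !mxE; ring.
  rewrite mulmxDr -!scalemxAr rw; move: (reflection w *m x) => z.
  by apply/matrixP => i j; rewrite !mxE; field.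
have a1 : a ^+ 2 <= 1.
  rewrite -(real_normK (num_real a)) exprn_ile1 //.
  by rewrite (le_trans (norm_inner_le _ _)) // x1 w1 mulr1.
have a0 : 0 <= a ^+ 2 by rewrite sqr_ge0.
(* If [x] is nearly orthogonal to [w], its mirror image is close to it and lies in the same cap, so
   [t = 0] works. Otherwise the shift [3 d a] pushes the mirror image into the unit ball while the
   first point remains in the cap. *)
have [small|/ltW big] := leP (a ^+ 2) (d ^+ 2).
  exists 0; rewrite scale0r addr0; apply: (@mid _ (8 * d) x) => //.
    rewrite scalerA -scalerBl -[_ *: x]addr0 -(scale0r w) norm_comb // mulr0 mul0r !addr0 expr0n addr0.
    have : 0 <= 2 * (1 + psi) - (1 + 8 * d) <= 1 by apply/andP; split; lra.
    by move=> /andP[h0 h1]; rewrite exprn_ile1.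
  rewrite refx (_ : 2 *: _ - _ = (1 + 2 * psi - 8 * d) *: x + (- (4 * (1 + psi) * a)) *: w); last first.
    by apply/matrixP => i j; rewrite !mxE; ring.
  rewrite norm_comb // -/a.
  set A := 1 + 2 * psi - 8 * d.
  have A0 : 0 <= A by rewrite /A; lra.
  have -> : A ^+ 2 + 2 * A * - (4 * (1 + psi) * a) * a + (- (4 * (1 + psi) * a)) ^+ 2 =
      A ^+ 2 + 8 * (1 + psi) * (1 + 8 * d) * a ^+ 2 by rewrite /A; ring.
  have : A ^+ 2 <= A by rewrite expr2 ler_piMr // /A; lra.
  have : (1 + psi) * (1 + 8 * d) <= (1 + 1) * (1 + 1) by apply: ler_pM; lra.
  move=> h1 h2; have : (1 + psi) * (1 + 8 * d) * a ^+ 2 <= 4 * (d * 8^-1).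
    apply: ler_pM => //; [by rewrite mulr_ge0 // addr_ge0 // ltW // mulr_gt0|lra|lra].
  have -> : 8 * (1 + psi) * (1 + 8 * d) * a ^+ 2 = 8 * ((1 + psi) * (1 + 8 * d) * a ^+ 2) by ring.
  have AE : A = 1 + 2 * psi - 8 * d by [].
  move: (_ * a ^+ 2) => z; lra.
exists (3 * d * a).
  apply: (@mid _ (8 * d) x) => //.
  rewrite (_ : 2 *: _ - _ = (1 + 2 * psi - 8 * d) *: x + (6 * d * a) *: w); last first.
    by apply/matrixP => i j; rewrite !mxE; ring.
  rewrite norm_comb // -/a; set A := 1 + 2 * psi - 8 * d.
  have A0 : 0 <= A by rewrite /A; lra.
  have -> : A ^+ 2 + 2 * A * (6 * d * a) * a + (6 * d * a) ^+ 2 =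
      A ^+ 2 + (12 * d * A + 36 * d ^+ 2) * a ^+ 2 by ring.
  have : (12 * d * A + 36 * d ^+ 2) * a ^+ 2 <= 12 * d * A + 36 * d ^+ 2.
    by rewrite ler_piMr // addr_ge0 ?mulr_ge0 ?sqr_ge0 // ltW.
  have -> : 12 * d * A + 36 * d ^+ 2 = (A + 6 * d) ^+ 2 - A ^+ 2 by ring.
  have : (A + 6 * d) ^+ 2 <= 1 by rewrite exprn_ile1 //; rewrite /A; lra.
  lra.
apply: BW; rewrite /unit_ball /=.
rewrite leNgt; apply/negP => h; have : 1 < enorm ((1 + psi) *: (reflection w *m x) + (3 * d * a) *: w) ^+ 2.
  by rewrite exprn_egt1.
apply/negP; rewrite -leNgt.
rewrite refx (_ : _ + _ = (1 + psi) *: x + (3 * d * a - 2 * (1 + psi) * a) *: w); last first.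
  by apply/matrixP => i j; rewrite !mxE; ring.
rewrite norm_comb // -/a.
have -> : (1 + psi) ^+ 2 + 2 * (1 + psi) * (3 * d * a - 2 * (1 + psi) * a) * a +
    (3 * d * a - 2 * (1 + psi) * a) ^+ 2 =
    (1 + psi) ^+ 2 - (6 * (1 + psi) - 9 * d) * (d * a ^+ 2) by ring.
have h1 : psi <= d * a ^+ 2 by rewrite psis ler_pM2l.
have : 4 * (d * a ^+ 2) <= (6 * (1 + psi) - 9 * d) * (d * a ^+ 2).
  by apply: ler_wpM2r; [exact: mulr_ge0 (ltW d0) a0|lra].
have : psi ^+ 2 <= psi by rewrite expr2 ler_piMl ?(ltW psi0) //; lra.
have -> : (1 + psi) ^+ 2 = 1 + 2 * psi + psi ^+ 2 by ring.
lra.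
Qed.

(** Midpoints of [(1 + k) x] with points of the unit ball: nearby unit vectors inherit a quarter of
    the excess. *)
Let cap_unit W (k : R) x y : 0 < k -> k <= 1 -> is_convex W -> unit_ball `<=` W ->
  enorm x = 1 -> enorm y = 1 -> W ((1 + k) *: x) -> enorm (y - x) <= k / 8 ->
  W ((1 + k / 4) *: y).
Proof.
move=> k0 k1 cW BW x1 y1 Wx yx; apply: (mid cW BW Wx).
rewrite exprn_ile1 ?enorm_ge0 //.
rewrite (_ : _ - _ = (2 * (1 + k / 4)) *: (y - x) + (1 - k / 2) *: x); last first.
  by apply/matrixP => i j; rewrite !mxE; lra.
apply: le_trans (enormD _ _) _; rewrite !enormZ x1 mulr1 !ger0_norm; [|lra|lra].
have : 2 * (1 + k / 4) * enorm (y - x) <= 2 * (1 + k / 4) * (k / 8) by rewrite ler_wpM2l //; lra.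
nra.
Qed.

Let scaleset (l : R) W : set 'cV[R]_n := [set x | W (l *: x)].

Let scale_convex l W : is_convex W -> is_convex (scaleset l W).
Proof.
by move=> cW x y t Wx Wy t01; rewrite /scaleset /= scalerDr !scalerA !(mulrC l) -!scalerA; exact: cW.
Qed.

Let scale_ball l W : 0 < l -> eball l `<=` W -> unit_ball `<=` scaleset l W.
Proof. by move=> l0 lW x x1; apply: lW; rewrite /eball /= enormZ gtr0_norm // ler_piMr // ltW. Qed.

Let scale_steiner l W w x : steiner w (scaleset l W) (scaleset l W) x -> steiner w W W (l *: x).
Proof.
move=> [a [b [t [Wa Wb ab ->]]]]; exists (l *: a), (l *: b), (l * t); split=> //.
  by rewrite -scalerBr ab scalerA.
by rewrite -scalemxAr -scalerDr !scalerA mulrC.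
Qed.

Lemma steiner_progress W (l e : R) x w : 0 < l -> 0 < e -> e <= 1 -> is_convex W -> eball l `<=` W ->
  enorm x = 1 -> enorm w = 1 -> W ((l * (1 + e)) *: x) ->
  steiner w W W ((l * (1 + (e / 8) ^+ 3)) *: x) /\
  steiner w W W ((l * (1 + (e / 8) ^+ 3)) *: (reflection w *m x)).
Proof.
move=> l0 e0 e1 cW lW x1 w1; rewrite -scalerA => Wx.
have e8 : 8 * (e / 8) = e by rewrite mulrC divfK.
have [|||h1 h2] := @progress_unit (scaleset l W) (e / 8) x w _ _ (scale_convex cW) (scale_ball l0 lW) x1 w1.
- by rewrite divr_gt0.
- by rewrite e8.
- by rewrite e8.
by rewrite -!scalerA; split; exact: scale_steiner.
Qed.

Lemma unit_sphere_net (k : R) : 0 < k -> exists s : seq 'cV[R]_n,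
  (forall y, y \in s -> enorm y = 1) /\
  (forall x, enorm x = 1 -> exists2 y, y \in s & enorm (x - y) <= k).
Proof.
move=> k0; pose S : set 'cV[R]_n := [set x | enorm x = 1].
have kS : compact S.
  apply: (@compact_mx R n 1 S 1); last by move=> x ->.
  rewrite (_ : S = (@enorm R n 1) @^-1` [set 1]); last by [].
  apply: preimage_closed; first by move=> ? _; exact: continuous_enorm.
  exact: closed_eq.
move: kS; rewrite compact_cover => /(_ _ S (fun y => [set x | enorm (x - y) < k])) [||D DS SD].
- move=> y _; apply: (@open_comp _ _ (fun x => enorm (x - y)) [set t | t < k]); last exact: open_lt.
  by move=> ? _; exact: continuous_enormB.
- by move=> x Sx; exists x => //; rewrite /= subrr enorm0.
exists (finmap.enum_fset D); split.
  by move=> y yD; have := DS y yD; rewrite inE.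
by move=> x /SD[y yD] /ltW; exists y.
Qed.

Let P (l k : R) W : set 'cV[R]_n := [set x | enorm x = 1 /\ W ((l * (1 + k)) *: x)].

(* The reflections exchanging a fixed unit vector e and the points of a net carry a cap around e
   over the whole sphere. *)
Let spread (l k r : R) e W (s : seq 'cV[R]_n) : 0 < l -> 0 < k -> k <= 1 ->
  fat_body l W -> enorm e = 1 -> (forall y, y \in s -> enorm y = 1) ->
  [set x | enorm x = 1 /\ enorm (x - e) <= r] `<=` P l k W ->
  exists2 W', steiner_reach W W' & exists k', [/\ 0 < k', k' <= 1,
    k' = iter (size s) (fun t => (t / 8) ^+ 3) k &
    forall x y, enorm x = 1 -> y \in e :: s -> enorm (x - y) <= r -> P l k' W' x].
Proof.
move=> l0 k0 k1 fW e1; elim: s => [|y s IH] s1 cap.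
  exists W; first exact: steiner_reach0.
  by exists k; split=> // x y x1; rewrite inE => /eqP -> xr; exact: cap.
have [|W' rW [k' [k'0 k'1 k'E H]]] := IH _ cap.
  by move=> z zs; apply: s1; rewrite inE zs orbT.
have fW' := steiner_reach_fat_body fW rW; have [_ cW' lW'] := fW'.
have p0 : 0 < (k' / 8) ^+ 3 by rewrite exprn_gt0 // divr_gt0.
have p1 : (k' / 8) ^+ 3 <= k'.
  have k8 : k' / 8 <= k' by rewrite ler_pdivrMr // ler_peMr ?ler1n // ltW.
  by apply: le_trans k8; rewrite exprS ler_piMr ?exprn_ile1 ?divr_ge0 ?(ltW k'0) // ler_pdivrMr // mul1r (le_trans k'1) // ler1n.
have [ye|ye] := eqVneq e y.
  exists W' => //; exists ((k' / 8) ^+ 3); split=> //; [exact: le_trans p1 _|by rewrite k'E|].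
  move=> x z x1 zin xz; have [_ Wx] : P l k' W' x.
    apply: (H x z) => //; move: zin; rewrite !inE ye => /orP[->//|/orP[->//|->]]; by rewrite orbT.
  split=> //; have W0 : W' 0 by apply: lW'; rewrite /eball /= enorm0 ltW.
  have lk : 0 < l * (1 + k') by rewrite mulr_gt0 // addr_gt0.
  have := cW' _ _ ((l * (1 + (k' / 8) ^+ 3)) / (l * (1 + k'))) Wx W0.
  rewrite scaler0 addr0 scalerA divfK ?gt_eqF // ler_pdivrMr // mul1r ler_pM2l // lerD2l p1 andbT.
  by apply; rewrite divr_ge0 ?(ltW lk) // mulr_ge0 ?addr_ge0 ?(ltW l0) // ltW.
have y1 : enorm y = 1 by apply: s1; rewrite inE eqxx.
have [|//|w w1 wE] := @reflection_swap R n e y; first by rewrite e1.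
exists (steiner w W' W'); first exact: steiner_reachS.
exists ((k' / 8) ^+ 3); split=> //; [exact: le_trans p1 _|by rewrite k'E|].
move=> x z x1 zin xz; have prog v (v1 : enorm v = 1) := steiner_progress l0 k'0 k'1 cW' lW' v1 w1.
have [zy|zy] := eqVneq z y.
  have wx1 : enorm (reflection w *m x) = 1 by rewrite enorm_ortho //; exact: reflection_ortho.
  have [|_ Wx] := H (reflection w *m x) e wx1 (mem_head _ _).
    have -> : e = reflection w *m y by rewrite -wE mulmxA reflectionK // mul1mx.
    by rewrite -mulmxBr enorm_ortho -?zy //; exact: reflection_ortho.
  have [_] := prog _ wx1 Wx.
  by rewrite mulmxA reflectionK // mul1mx; split.
have [|_ Wx] := H x z x1 _ xz; first by move: zin; rewrite !inE (negbTE zy).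
by split=> //; have [] := prog _ x1 Wx.
Qed.

(** The net, and with it the number of symmetrizations, depends on [e] alone. Hence so does the gain
    [d], which prevents the iteration from stalling. *)
Let growth (e : R) : 0 < e -> e <= 1 -> exists2 d, 0 < d & forall (l : R) W x, 0 < l ->
  fat_body l W -> W x -> l * (1 + e) <= enorm x ->
  exists2 W', steiner_reach W W' & eball (l * (1 + d)) `<=` W'.
Proof.
move=> e0 e1; have [s [s1 net]] : exists s : seq 'cV[R]_n, (forall y, y \in s -> enorm y = 1) /\
  (forall x, enorm x = 1 -> exists2 y, y \in s & enorm (x - y) <= e / 8).
  by apply: unit_sphere_net; rewrite divr_gt0.
pose k0 := e / 4; have k00 : 0 < k0 by rewrite divr_gt0.
have k01 : k0 <= 1 by rewrite /k0; lra.
exists (iter (size s) (fun t => (t / 8) ^+ 3) k0).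
  by elim: (size s) => //= j h; rewrite exprn_gt0 // divr_gt0.
move=> l W x l0 fW Wx xl; have [_ cW lW] := fW.
have xp : 0 < enorm x by apply: lt_le_trans xl; rewrite mulr_gt0 // addr_gt0.
have xn0 : x != 0 by rewrite -enorm_gt0.
pose x' := (enorm x)^-1 *: x; have x'1 : enorm x' = 1 by exact: enorm_normalize.
have Wx' : scaleset l W ((1 + e) *: x').
  have W0 : W 0 by apply: lW; rewrite /eball /= enorm0 ltW.
  have := cW _ _ (l * (1 + e) / enorm x) Wx W0; rewrite scaler0 addr0 ler_pdivrMr // mul1r xl andbT.
  rewrite divr_ge0 ?mulr_ge0 ?addr_ge0 ?(ltW l0) ?(ltW e0) ?(ltW xp) // => /(_ isT).
  by rewrite /scaleset /= /x' !scalerA.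
have [|W' rW [k' [k'0 k'1 k'E H]]] := @spread l k0 (e / 8) x' W s l0 k00 k01 fW x'1 s1.
  move=> y [y1 yx]; split=> //; rewrite -scalerA.
  exact: (cap_unit e0 e1 (scale_convex cW) (scale_ball l0 lW) x'1 y1 Wx').
exists W' => // y; rewrite -k'E /eball /= => yl.
have [_ cW' lW'] := steiner_reach_fat_body fW rW.
have W0 : W' 0 by apply: lW'; rewrite /eball /= enorm0 ltW.
have [->//|y0] := eqVneq y 0.
have yp : 0 < enorm y by rewrite enorm_gt0.
have u1 := enorm_normalize y0.
have [z zs yz] := net _ u1.
have [_ Wy] := H _ z u1 (mem_behead (s := _ :: _) zs) yz.
have lk : 0 < l * (1 + k') by rewrite mulr_gt0 // addr_gt0.
have := cW' _ _ (enorm y / (l * (1 + k'))) Wy W0.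
rewrite scaler0 addr0 !scalerA divfK ?gt_eqF // divff ?gt_eqF // scale1r.
by apply; rewrite divr_ge0 ?(ltW yp) ?(ltW lk) //= ler_pdivrMr // mul1r.
Qed.

(** While the inscribed radius [l] is below [r'], the body has a point at distance at least
    [l (1 + e)]: otherwise it would lie in the ball of radius [r' (1 + e) < r], against its volume,
    which never decreases. Each application of [growth] multiplies the inscribed radius by [1 + d],
    so it passes [r'] after finitely many steps. *)
Lemma steiner_rounding (s r r' : R) W : (0 < n)%N -> 0 < s -> 0 < r' -> r' < r -> fat_body s W ->
  (lebesgue_mx (eball r : set (borel_mx R n 1)) <= lebesgue_mx (W : set (borel_mx R n 1)))%E ->
  exists2 W', steiner_reach W W' & eball r' `<=` W'.
Proof.
move=> n0 s0 r'0 r'r fW VW.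
have [r0 d0] : 0 < r /\ 0 < (r - r') / (2 * r') by rewrite divr_gt0 ?mulr_gt0 ?subr_gt0 // (lt_trans r'0).
pose e := Num.min 1 ((r - r') / (2 * r')).
have e0 : 0 < e by rewrite lt_min ltr01.
have e1 : e <= 1 by rewrite ge_min lexx.
have er : r' * (1 + e) < r.
  have : r' * e <= r' * ((r - r') / (2 * r')) by rewrite ler_pM2l // ge_min lexx orbT.
  have -> : r' * ((r - r') / (2 * r')) = (r - r') / 2 by field; rewrite gt_eqF.
  lra.
have [d dp grow] := growth e0 e1.
apply: contrapT => nex.
have iterate k : exists2 W', steiner_reach W W' & eball (s * (1 + d) ^+ k) `<=` W'.
  elim: k => [|k [W' rW lW]].
    by exists W; [exact: steiner_reach0|rewrite expr0 mulr1; case: fW].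
  set l := s * (1 + d) ^+ k in lW; have l0 : 0 < l by rewrite mulr_gt0 // exprn_gt0 // addr_gt0.
  have lr : l < r'.
    rewrite ltNge; apply/negP => r'l; apply: nex; exists W' => // x xr; apply: lW.
    exact: le_trans r'l.
  have fW' : fat_body l W' by have [kW cW _] := steiner_reach_fat_body fW rW.
  have [x Wx xl] : exists2 x, W' x & l * (1 + e) <= enorm x.
    apply: contrapT => nx; have sub : W' `<=` eball (r' * (1 + e)).
      move=> x Wx; rewrite /eball /= ltW //; apply: (@lt_trans _ _ (l * (1 + e))).
        by rewrite ltNge; apply/negP => h; apply: nx; exists x.
      by rewrite ltr_pM2r // addr_gt0.
    have := le_trans VW (steiner_reach_volume fW rW) => V1.
    have : (lebesgue_mx (eball r : set (borel_mx R n 1)) <= lebesgue_mx (eball (r' * (1 + e)) : set (borel_mx R n 1)))%E.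
      apply: le_trans V1 _; apply: le_measure; rewrite ?inE //; last exact: measurable_eball.
      by apply: compact_measurable_mx; case: fW'.
    have re0 : 0 < r' * (1 + e) by rewrite mulr_gt0 // addr_gt0.
    rewrite (lebesgue_eball _ _ r0) (lebesgue_eball _ _ re0).
    have B0 := @lebesgue_eball_gt0 R n 1 1 ltr01.
    have BE : (lebesgue_mx (eball 1 : set (borel_mx R n 1)) \is a fin_num).
      by rewrite ge0_fin_numE //; exact: lebesgue_eball_lty.
    rewrite lee_pmul2r // lee_fin !muln1 ler_pXn2r ?nnegrE ?(ltW r0) ?(ltW re0) //.
    by rewrite leNgt er.
  have [W'' rW'' lW''] := grow l W' x l0 fW' Wx xl.
  exists W''; first exact: steiner_reach_trans rW''.
  by rewrite exprSr mulrA.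
have sd : 0 < s * d by rewrite mulr_gt0.
pose k := (Num.truncn (r' / (s * d))).+1.
have kr : r' <= s * (1 + d) ^+ k.
  have := expr_addr_ge k ler01 (ltW dp); rewrite !expr1n mul1r => h.
  have : s * (1 + d *+ k) <= s * (1 + d) ^+ k by rewrite ler_pM2l.
  apply: le_trans; rewrite mulrDr mulr1 -mulr_natr mulrA.
  have : r' < k%:R * (s * d) by rewrite -ltr_pdivrMr // truncnS_gt.
  rewrite [k%:R * _]mulrC => /ltW; lra.
have [W' rW lW] := iterate k; apply: nex; exists W' => // x xr; apply: lW.
exact: le_trans kr.
Qed.

End rounding.

(** * The volume of Lp centroid bodies *)

Section polytope.
Context (R : realType) (n m : nat) (p : R) (Q : set 'rV[R]_m).
Hypotheses (hQ : convex_body_o Q) (p1 : 1 <= p).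
Local Notation T := (borel_mx R n 1).
Local Notation V := (@lebesgue_mx R n 1).
Local Notation F := (firey p Q).
Variables (z : nat -> 'cV[R]_n) (b : nat -> R) (J : nat).
Hypotheses (b0 : forall j, 0 < b j) (J0 : (0 < J)%N).

Let p0 : 0 < p. Proof. exact: lt_le_trans p1. Qed.

Definition polytope : set 'cV[R]_n := [set x | forall j, (j < J)%N -> inner x (z j) <= b j].

Hypothesis kW : compact polytope.

Let g j (x : 'cV[R]_n) := inner x (z j) / b j.

(* The cone over the j-th facet of the polytope. *)
Let K j : set T := [set x : 'cV[R]_n | (j < J)%N /\
  forall i, ((i < J)%N -> g i x <= g j x) /\ ((i < j)%N -> g i x < g j x)].

Let mg j : measurable_fun setT (g j : T -> measurableTypeR R).
Proof.
apply: continuous_measurable_mx; rewrite (_ : g j = fun x => inner x ((b j)^-1 *: z j)).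
  exact: continuous_inner.
by apply/funext => x; rewrite innerZr mulrC.
Qed.

Let mK j : measurable (K j).
Proof.
have [jJ|jJ] := boolP (j < J)%N; last first.
  rewrite (_ : K j = set0) // -subset0 => x [jJ' _]; by rewrite jJ' in jJ.
rewrite (_ : K j = \bigcap_i [set x : T | ((i < J)%N -> g i x <= g j x) /\ ((i < j)%N -> g i x < g j x)]).
  apply: bigcapT_measurable => i; apply: measurableI.
    case: (i < J)%N; last by rewrite [X in measurable X](_ : _ = setT) // -subTset => x _.
    rewrite [X in measurable X](_ : _ = [set x : T | g i x <= g j x]); last by apply/seteqP; split=> x /=; auto.
    have := @measurable_fun_ler _ _ R setT (g i : T -> R) (g j : T -> R) (mg i) (mg j).
    by move=> /(_ measurableT [set true] Logic.I); rewrite setTI.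
  case: (i < j)%N; last by rewrite [X in measurable X](_ : _ = setT) // -subTset => x _.
  rewrite [X in measurable X](_ : _ = [set x : T | g i x < g j x]); last by apply/seteqP; split=> x /=; auto.
  have := @measurable_fun_ltr _ _ R setT (g i : T -> R) (g j : T -> R) (mg i) (mg j).
  by move=> /(_ measurableT [set true] Logic.I); rewrite setTI.
apply/seteqP; split=> x; first by move=> [_ h] i _; exact: h.
by move=> h; split=> // i; exact: h.
Qed.

(** Ties between facets go to the least index, so the cones form a genuine partition. *)
Let K_disjoint : trivIset setT K.
Proof.
have lt j j' x : K j x -> K j' x -> ~~ (j < j')%N.
  move=> [jJ h] [j'J h']; apply/negP => jj'; have := (h' j).2 jj'; have := (h j').1 j'J.
  by move=> /le_lt_trans h1 /h1; rewrite ltxx.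
apply/trivIsetP => j j' _ _ jj'; rewrite -subset0 => x [Kj Kj'].
by have := lt _ _ _ Kj Kj'; have := lt _ _ _ Kj' Kj; rewrite -!leqNgt => h1 h2; case/eqP: jj'; apply/eqP; rewrite eqn_leq h1 h2.
Qed.

Let K_cover x : exists j, K j x.
Proof.
have H : forall k, (0 < k)%N -> exists2 j, (j < k)%N & forall i, ((i < k)%N -> g i x <= g j x) /\ ((i < j)%N -> g i x < g j x).
  elim=> // -[_ _|k /(_ isT) [j jk h] _].
    by exists 0%N => // i; split=> //; rewrite ltnS leqn0 => /eqP ->.
  have [le|gt] := leP (g k.+1 x) (g j x).
    exists j; first exact: ltnW.
    by move=> i; split; [rewrite ltnS leq_eqVlt => /orP[/eqP ->//|]; exact: (h i).1|exact: (h i).2].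
  exists k.+1 => // i; split; last by move=> /(h i).1 /le_lt_trans; apply.
  by rewrite ltnS leq_eqVlt => /orP[/eqP ->//|/(h i).1 /le_trans]; apply; exact: ltW.
by have [j jJ h] := H J J0; exists j.
Qed.

Let split_volume (X : set T) : measurable X -> (V X = \sum_(j < J) V (X `&` K j))%E.
Proof.
move=> mX; rewrite -[in LHS](_ : \big[setU/set0]_(j < J) (X `&` K j) = X).
  apply: (measure_bigsetU V (F := fun j => X `&` K j)); first by move=> j; exact: measurableI.
  apply/trivIsetP => j j' _ _ jj'; move/trivIsetP : K_disjoint => /(_ j j' Logic.I Logic.I jj') KK.
  by rewrite setIACA setIid KK setI0.
rewrite -(bigcup_mkord J (fun j => X `&` K j)); apply/seteqP; split=> x; first by move=> [j _ []].
by move=> Xx; have [j Kj] := K_cover x; exists j => //; case: Kj.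
Qed.

Definition facet_volume j := fine (V (polytope `&` K j)).

Let mW : measurable (polytope : set T). Proof. exact: compact_measurable_mx. Qed.

Let mWK j : measurable (polytope `&` K j : set T). Proof. exact: measurableI. Qed.

Let facetE j : V (polytope `&` K j) = (facet_volume j)%:E.
Proof.
rewrite fineK // enorm_bounded_fin_num //; have [r _ h] := compact_enorm_bounded kW.
by exists r => x [/h].
Qed.

Lemma facet_volume_ge0 j : 0 <= facet_volume j. Proof. exact: fine_ge0. Qed.

Lemma polytope_volume : V polytope = (\sum_(j < J) facet_volume j)%:E.
Proof. by rewrite split_volume // -sumEFin; apply: eq_bigr => j _; exact: facetE. Qed.

Definition facet_energy j (u : 'M[R]_(n, m)) := (support_fun Q ((z j)^T *m u) / b j) `^ p.

(** In the cone over the [j]-th facet, [firey_support] with [c = b j] bounds [g j] by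
    [t = (1 + facet_energy j u)^(1/p)]. Dividing by [t] therefore maps this part of the Firey sum
    into the part of the polytope in the same cone. *)
Lemma polytope_firey_le (u : 'M[R]_(n, m)) :
  (V (F polytope u) <= (\sum_(j < J) facet_volume j * (1 + facet_energy j u) `^ (n%:R / p))%:E)%E.
Proof.
have mF : measurable (F polytope u : set T) by apply: compact_measurable_mx; exact: compact_firey.
rewrite split_volume // -sumEFin; apply: lee_sum => j _.
have e0 : 0 <= facet_energy j u by exact: powR_ge0.
set t := (1 + facet_energy j u) `^ p^-1.
have t0 : 0 < t by rewrite powR_gt0 // ltr_pwDl.
have -> : (1 + facet_energy j u) `^ (n%:R / p) = t^-1^-1 ^+ (n * 1).
  by rewrite invrK muln1 -powR_mulrn ?powR_ge0 // -powRrM mulrC.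
rewrite EFinM -facetE -lebesgue_mx_scale ?invr_gt0 //.
apply: le_measure; rewrite ?inE.
- exact: measurableI.
- apply: (@measurable_preimage _ _ _ _ (fun x : T => t^-1 *: (x : 'cV[R]_n) : T)) => //.
  by apply: continuous_measurable_mx_mx => x; exact: scaler_continuous.
move=> x [Fx [jJ Kx]].
have gZ i : g i (t^-1 *: x) = t^-1 * g i x by rewrite /g innerZl mulrA.
have ti : 0 < t^-1 by rewrite invr_gt0.
have gj : g j (t^-1 *: x) <= 1.
  rewrite gZ mulrC ler_pdivrMr // mul1r /g ler_pdivrMr //.
  have := firey_support hQ Fx (ltW (b0 j)) (c := b j) (z := z j) (_ : forall w, polytope w -> inner (z j) w <= b j).
  rewrite innerC => /(_ _)/le_trans; apply; first by move=> w /(_ j jJ); rewrite innerC.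
  have bp : (b j `^ p) `^ p^-1 = b j by rewrite -powRrM divff ?gt_eqF // powRr1 // ltW.
  have hb : 0 <= support_fun Q ((z j)^T *m u) / b j by rewrite divr_ge0 ?(ltW (b0 j)) //; exact: support_ge0.
  have -> : b j `^ p + support_fun Q ((z j)^T *m u) `^ p = (1 + facet_energy j u) * b j `^ p.
    by rewrite mulrDl mul1r /facet_energy -(powRM p hb (ltW (b0 j))) (divfK (lt0r_neq0 (b0 j))).
  by rewrite (powRM p^-1 (addr_ge0 ler01 e0) (powR_ge0 _ _)) bp.
split=> /=.
  move=> i iJ; have : g i (t^-1 *: x) <= 1.
    by apply: le_trans gj; rewrite !gZ ler_pM2l //; exact: (Kx i).1.
  by rewrite /g ler_pdivrMr // mul1r.
split=> // i; rewrite !gZ ler_pM2l // ltr_pM2l //.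
Qed.

End polytope.

(** * Firey sums of balls *)

Section ball.
Context (R : realType) (n m : nat) (p : R) (Q : set 'rV[R]_m).
Hypotheses (hQ : convex_body_o Q) (p1 : 1 <= p) (n0 : (0 < n)%N) (pn : p <= n%:R).
Local Notation h := (support_fun Q).
Local Notation T := (borel_mx R n 1).
Local Notation V := (@lebesgue_mx R n 1).
Local Notation F := (firey p Q).

Let p0 : 0 < p. Proof. exact: lt_le_trans p1. Qed.

(* These weights are optimal for the values (1, theta) of the two support functions. *)
Lemma firey_weights_optimal (theta : R) : 0 < theta ->
  firey_weights p ((1 + theta `^ p) `^ (p^-1 - 1), (1 + theta `^ p) `^ (p^-1 - 1) * theta `^ (p - 1)).
Proof.
move=> t0; set X := theta `^ p; have X0 : 0 < X by rewrite powR_gt0.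
have X1 : 0 < 1 + X by rewrite addr_gt0.
split=> /=; [exact: powR_ge0|by rewrite mulr_ge0 ?powR_ge0|].
move=> a b a0 b0.
have bt : 0 <= b / theta by rewrite divr_ge0 // ltW.
set l := (1 + X)^-1.
have l01 : 0 <= l <= 1 by rewrite invr_ge0 (ltW X1) /= invf_le1 // lerDl ltW.
have cv := powR_convex p1 l01 a0 bt.
set M := l * a + (1 - l) * (b / theta) in cv.
have M0 : 0 <= M.
  case/andP: l01 => l0 l1; apply: addr_ge0 (mulr_ge0 l0 a0) (mulr_ge0 _ bt).
  by rewrite subr_ge0.
have tX : theta `^ (p - 1) * theta = X.
  by rewrite -{2}(powRr1 (ltW t0)) -powRD ?subrK // (lt0r_neq0 t0) implybT.
have -> : (1 + X) `^ (p^-1 - 1) * a + (1 + X) `^ (p^-1 - 1) * theta `^ (p - 1) * b = (1 + X) `^ p^-1 * M.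
  have -> : (1 + X) `^ p^-1 = (1 + X) `^ (p^-1 - 1) * (1 + X).
    by rewrite -{3}(powRr1 (ltW X1)) -powRD ?subrK // (lt0r_neq0 X1) implybT.
  rewrite /M /l -tX; field; rewrite gt_eqF //= tX; exact: lt0r_neq0.
have -> : M = (M `^ p) `^ p^-1 by rewrite -powRrM divff ?gt_eqF // powRr1.
rewrite -(powRM p^-1 (ltW X1) (powR_ge0 M p)); apply: ler_powR_mono; first by rewrite invr_ge0 ltW.
  exact: mulr_ge0 (ltW X1) (powR_ge0 _ _).
apply: le_trans (ler_wpM2l (ltW X1) cv) _.
have -> : (b / theta) `^ p = b `^ p / X.
  by rewrite powRM ?invr_ge0 ?(ltW t0) // -powR_inv1 ?(ltW t0) // -powRrM mulN1r powRN.
rewrite /l le_eqVlt; apply/orP; left; apply/eqP; field.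
by rewrite !lt0r_neq0.
Qed.

Lemma support_attained x : exists2 y, Q y & h x = inner x y.
Proof.
case: (hQ) => kQ _ _ Q0.
have [|||y yQ ymax] := @compact_EVT_max _ R (fun y : 'rV[R]_m => inner y x) Q.
- by exists 0.
- exact: kQ.
- by apply: continuous_subspaceT; exact: continuous_inner.
rewrite inE in yQ; exists y => //; apply/eqP; rewrite eq_le (le_support hQ x yQ) andbT.
by apply: (support_le hQ) => y' Qy'; rewrite !(innerC x); apply: ymax; rewrite inE.
Qed.

(** A lower bound for the radial function in the direction [x]. The point of [Q] maximizing the
    support function gives [u y^T = k x + d] with [d] orthogonal to [x]; cancelling [d] by a tilt in
    the ball costs only a term of second order. *)
Lemma firey_ball_radial (r b : R) (u : 'M[R]_(n, m)) x (rho : R) : 0 < r -> b <= r ->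
  (forall y, Q y -> enorm (u *m y^T) <= b) -> enorm x = 1 -> 0 <= rho ->
  rho <= r * ((1 + (h (x^T *m u) / r) `^ p) `^ p^-1 - (b / r) `^ (2 * p)) ->
  F (eball r) u (rho *: x).
Proof.
move=> r0 br bQ x1 rho0 hrho.
have b0 : 0 <= b by apply: le_trans (bQ 0 _); [exact: enorm_ge0|case: hQ].
have br0 : 0 <= b / r by rewrite divr_ge0 // ltW.
have [y Qy hy] := support_attained (x^T *m u); rewrite inner_mulmx_tr in hy.
set k := h _ in hy hrho; have k0 : 0 <= k by exact: support_ge0.
have [kz|kz] := eqVneq k 0.
  apply: (sub_firey hQ p1); rewrite /eball /= enormZ x1 mulr1 ger0_norm //.
  have one q : 1 `^ q = 1 :> R by rewrite powR1.
  move: hrho; rewrite kz mul0r powR0 ?gt_eqF // addr0 one => /le_trans; apply.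
  by rewrite ler_piMr ?(ltW r0) // lerBlDr lerDl powR_ge0.
have kp : 0 < k by rewrite lt_neqAle eq_sym kz.
set v := u *m y^T in hy.
have [d vE] : exists d, v = k *: x + d by exists (v - k *: x); rewrite addrC subrK.
have xd : inner x d = 0.
  move: hy; rewrite vE innerDr innerZr -enorm_sqr x1 expr1n mulr1 => /eqP.
  by rewrite -subr_eq0 opprD addrA subrr sub0r oppr_eq0 => /eqP.
have vd : enorm v ^+ 2 = k ^+ 2 + enorm d ^+ 2.
  by rewrite !enorm_sqr vE !innerE_lin (innerC d x) xd -!enorm_sqr x1; ring.
have vb : enorm v <= b by exact: bQ.
have kb : k <= b.
  by apply: le_trans vb; rewrite -(ler_pXn2r (ltn0Sn 1)) ?nnegrE ?enorm_ge0 // vd lerDl sqr_ge0.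
have db : enorm d <= b.
  by apply: le_trans vb; rewrite -(ler_pXn2r (ltn0Sn 1)) ?nnegrE ?enorm_ge0 // vd lerDr sqr_ge0.
pose th := k / r; have th0 : 0 < th by rewrite divr_gt0.
have := firey_weights_optimal th0; set X := th `^ p => Tw.
have X1 : 0 < 1 + X by rewrite addr_gt0 // powR_gt0.
set al := (1 + X) `^ (p^-1 - 1) in Tw; set s := th `^ (p - 1) in Tw.
have s0 : 0 <= s by exact: powR_ge0.
have al0 : 0 <= al by exact: powR_ge0.
have al1 : al <= 1 by have [] := firey_weights_le1 p1 Tw.
pose t := s * enorm d.
have t0 : 0 <= t by rewrite mulr_ge0 ?enorm_ge0.
have tr : t / r <= (b / r) `^ p.
  have [bz|bz] := eqVneq (b / r) 0.
    have dz : enorm d = 0.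
      apply/le_anti; rewrite enorm_ge0 andbT; apply: le_trans db _.
      by rewrite -(divfK (lt0r_neq0 r0) b) bz mul0r.
    by rewrite /t dz mulr0 mul0r powR_ge0.
  have bp : 0 < b / r by rewrite lt_neqAle eq_sym bz.
  have -> : (b / r) `^ p = (b / r) `^ (p - 1) * (b / r).
    by rewrite -{3}(powRr1 br0) -powRD ?subrK // bz implybT.
  rewrite /t -mulrA; apply: ler_pM => //; first by rewrite divr_ge0 ?enorm_ge0 // ltW.
    by apply: ler_powR_mono; rewrite ?subr_ge0 // ?(ltW th0) // ler_pM2r ?invr_gt0.
  by rewrite ler_pM2r ?invr_gt0.
have tr2 : (t / r) ^+ 2 <= (b / r) `^ (2 * p).
  rewrite [2 * p]mulrC powRrM (powR_mulrn 2 (powR_ge0 _ _)) ler_pXn2r ?nnegrE ?powR_ge0 //.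
  exact: divr_ge0 t0 (ltW r0).
have b1 : b / r <= 1 by rewrite ler_pdivrMr // mul1r.
have tr1 : t / r <= 1.
  apply: le_trans tr _; have one q : 1 `^ q = 1 :> R by rewrite powR1.
  by rewrite -(one p); apply: ler_powR_mono => //; exact: ltW.
(* The tilt [- s d] cancels the orthogonal part of [s u y^T]; shortening the component along [x] by
   [t^2 / r] keeps [w] in the ball, as [t = s |d| <= r]. *)
pose w := (r - t ^+ 2 / r) *: x - s *: d.
have Bw : eball r w.
  rewrite /eball /= -(ler_pXn2r (ltn0Sn 1)) ?nnegrE ?enorm_ge0 ?(ltW r0) //.
  rewrite enorm_sqr /w !innerE_lin (innerC d x) xd -!enorm_sqr x1.
  rewrite (_ : _ + _ = (r - t ^+ 2 / r) ^+ 2 + t ^+ 2); last by rewrite /t; ring.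
  have -> : (r - t ^+ 2 / r) ^+ 2 + t ^+ 2 = r ^+ 2 - t ^+ 2 * (1 - (t / r) ^+ 2).
    by field; rewrite gt_eqF.
  rewrite lerBlDr lerDl; apply: mulr_ge0; first exact: sqr_ge0.
  by rewrite subr_ge0; apply: exprn_ile1 => //; exact: divr_ge0 t0 (ltW r0).
pose rho' := al * (r - t ^+ 2 / r) + al * s * k.
have F' : F (eball r) u (rho' *: x).
  exists (al, al * s), w, y; split=> //=.
  rewrite -/v vE /w /rho'; apply/matrixP => i j; rewrite !mxE; ring.
have rr : rho <= rho'.
  apply: le_trans hrho _; rewrite -/th -/X.
  have -> : (1 + X) `^ p^-1 = al * (1 + X).
    by rewrite /al -{3}(powRr1 (ltW X1)) -powRD ?subrK // (lt0r_neq0 X1) implybT.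
  have sX : s * th = X.
    by rewrite /s -{2}(powRr1 (ltW th0)) -powRD ?subrK // (lt0r_neq0 th0) implybT.
  have -> : rho' = r * (al * (1 + X) - al * (t / r) ^+ 2).
    by rewrite /rho' -sX /th; field; rewrite gt_eqF.
  rewrite ler_pM2l // lerD2l lerN2; apply: le_trans tr2.
  by rewrite ler_piMl ?sqr_ge0.
have [->|rz] := eqVneq rho 0.
  by rewrite scale0r; apply: (sub_firey hQ p1); rewrite /eball /= enorm0 ltW.
have rp : 0 < rho' by apply: lt_le_trans rr; rewrite lt_neqAle eq_sym rz.
have cB : is_convex (eball r : set 'cV[R]_n).
  move=> a a' l Ba Ba' /andP[l0 l1]; rewrite /eball /=; apply: le_trans (enormD _ _) _.
  rewrite !enormZ !ger0_norm ?subr_ge0 //.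
  have := ler_wpM2l l0 Ba; have := ler_wpM2l (_ : 0 <= 1 - l) Ba'; rewrite subr_ge0 => /(_ l1); lra.
have F0 : F (eball r) u 0 by apply: (sub_firey hQ p1); rewrite /eball /= enorm0 ltW.
have := firey_convex hQ (p := p) (u := u) cB F' F0 (t := rho / rho').
rewrite divr_ge0 ?(ltW rp) //= ler_pdivrMr // mul1r => /(_ rr).
by rewrite scaler0 addr0 scalerA divfK ?gt_eqF //.
Qed.

Let mS : measurable (unit_sphere : set T).
Proof.
rewrite (_ : unit_sphere = (@enorm R n 1 : T -> measurableTypeR R) @^-1` [set 1]) //.
exact: (measurable_preimage (@measurable_enorm R n 1)).
Qed.

Let nS : (0 < n * 1)%N. Proof. by rewrite muln1. Qed.

Let sphere_total : sphere_measure (unit_sphere : set T) = (n%:R%:E * V unit_ball)%E.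
Proof.
have := volume_sublevel nS (@measurable_enorm R n 1) (@enorm_ge0 R n 1).
rewrite muln1 => /(_ _) <-; last by move=> t x t0; rewrite enormZ gtr0_norm.
rewrite -[LHS]mul1e -(integral_cst _ mS); apply: eq_integral => v; rewrite inE => v1.
have one q : 1 `^ q = 1 :> R by rewrite powR1.
by rewrite v1 npoweRE ?ltr0n // oner_eq0 one.
Qed.

(** Polar coordinates with the radial bound of [firey_ball_radial]. For small [u] the term with
    [Pi_fun] is of order [|u|^p], and the error [(b/r)^(2p)] is of the square of that order. *)
Theorem firey_ball_volume (r b : R) (u : 'M[R]_(n, m)) (om := fine (omega R n)) : 0 < r -> b <= r ->
  (forall y, Q y -> enorm (u *m y^T) <= b) -> n.+1%:R * (b / r) `^ (2 * p) <= 1 ->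
  ((r ^+ n * (om * (1 - n%:R * n.+1%:R * (b / r) `^ (2 * p)) + Pi_fun Q p u / (p * r `^ p)))%:E <=
   V (F (eball r) u))%E.
Proof.
move=> r0 br bQ nb; set tau := (b / r) `^ (2 * p) in nb *.
have tau0 : 0 <= tau by exact: powR_ge0.
have nR : (1 : R) <= n%:R by rewrite ler1n.
have n1R : n.+1%:R = n%:R + 1 :> R by rewrite natr1.
have tau1 : tau < 1.
  by rewrite ltNge; apply/negP => t1; have := ler_wpM2l (ler0n R n.+1) t1; rewrite n1R in nb *; lra.
have one q : 1 `^ q = 1 :> R by rewrite powR1.
pose X (v : 'cV[R]_n) := (h (v^T *m u) / r) `^ p.
have X0 v : 0 <= X v by exact: powR_ge0.
have X1 v : enorm v = 1 -> X v <= 1.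
  move=> v1; rewrite -(one p); apply: ler_powR_mono; [exact: ltW|by rewrite divr_ge0 ?(ltW r0) //; exact: support_ge0|].
  rewrite ler_pdivrMr // mul1r; apply: le_trans br; apply: (support_le hQ) => y Qy.
  by rewrite inner_mulmx_tr (le_trans (inner_le _ _)) // v1 mul1r bQ.
pose g (v : 'cV[R]_n) := r * ((1 + X v) `^ p^-1 - tau).
have Y1 v : 1 <= (1 + X v) `^ p^-1.
  by rewrite -[leLHS](one p^-1); apply: ler_powR_mono; rewrite ?invr_ge0 ?(ltW p0) // lerDl.
have g0 v : 0 < g v by rewrite mulr_gt0 // subr_gt0 (lt_le_trans tau1).
have mX : measurable_fun setT (X : T -> measurableTypeR R).
  apply: measurable_powR_comp; apply: measurable_funM; last exact: measurable_cst.
  exact: (measurable_support2 hQ (@measurable_id _ T _) (@measurable_cst _ _ _ (borel_mx R n m) _ u)).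
have mg : measurable_fun setT (g : T -> measurableTypeR R).
  apply: measurable_funM; first exact: measurable_cst.
  apply: measurable_funB; last exact: measurable_cst.
  by apply: measurable_powR_comp; apply: measurable_funD => //; exact: measurable_cst.
pose H (x : T) : measurableTypeR R := enorm (x : 'cV[R]_n) * (g (normalize (x : 'cV[R]_n))) `^ (-1).
have mH : measurable_fun setT H.
  apply: measurable_funM; first exact: measurable_enorm.
  by apply: measurable_powR_comp; apply: (measurableT_comp mg); exact: measurable_normalize.
have HE x : H x = enorm (x : 'cV[R]_n) / g (normalize (x : 'cV[R]_n)).
  by rewrite /H powR_inv1 // ltW.
have H0 x : 0 <= H x by rewrite HE divr_ge0 ?enorm_ge0 // ltW.
have HZ t (x : 'cV[R]_n) : 0 < t -> H (t *: x) = t * H x.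
  by move=> t0; rewrite !HE normalizeZ // enormZ gtr0_norm // mulrA.
have sub : [set x : T | H x <= 1] `<=` F (eball r) u.
  move=> x /=; have [->|x0] := eqVneq (x : 'cV[R]_n) 0.
    by move=> _; apply: (sub_firey hQ p1); rewrite /eball /= enorm0 ltW.
  have xp : 0 < enorm (x : 'cV[R]_n) by rewrite enorm_gt0.
  rewrite HE ler_pdivrMr // mul1r => xg; rewrite -(scale_normalize x).
  apply: (firey_ball_radial r0 br bQ) => //; [exact: enorm_normalize1|exact: enorm_ge0].
have mHs : measurable ([set x : T | H x <= 1]).
  rewrite (_ : [set x : T | _] = H @^-1` `]-oo, 1]%classic); first by apply: measurable_preimage.
  by apply/seteqP; split=> x /=; rewrite in_itv.
have mF : measurable (F (eball r) u : set T).
  apply: compact_measurable_mx; apply: (compact_firey hQ p1); apply: (@compact_mx R n 1 _ r); last by [].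
  exact: closed_eball.
have VH : (V [set x | (H x <= 1)%R] <= V (F (eball r) u))%E by apply: le_measure; rewrite ?inE.
have vol := volume_sublevel nS mH H0 HZ.
rewrite muln1 in vol.
have intg : (\int[sphere_measure]_(v in (unit_sphere : set T)) ((g v) ^+ n)%:E <= n%:R%:E * V (F (eball r) u))%E.
  apply: (@le_trans _ _ (n%:R%:E * V [set x | (H x <= 1)%R])%E); last by rewrite lee_wpmul2l // lee_fin.
  rewrite -vol le_eqVlt; apply/orP; left; apply/eqP; apply: eq_integral => v; rewrite inE => v1.
  have gp := g0 v; have gi : 0 < (g v)^-1 by rewrite invr_gt0.
  have nv : normalize v = v by rewrite /normalize v1 invr1 scale1r.
  rewrite npoweRE ?H0 ?ltr0n // HE nv v1 mul1r (gt_eqF gi) -powR_inv1 ?(ltW gp) // -powRrM.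
  by rewrite mulN1r opprK powR_mulrn ?(ltW gp).
have rn0 : 0 <= r ^+ n by rewrite exprn_ge0 // ltW.
(* Bernoulli's inequality twice: [(1 + X)^(n/p) >= 1 + (n/p) X], where [p <= n] enters, and
   [(1 - tau)^n >= 1 - n tau]. Since [Y >= 1], [Y - tau >= Y (1 - tau)]. *)
have point v : enorm v = 1 ->
    r ^+ n + r ^+ n * (n%:R / p) * X v <= g v ^+ n + r ^+ n * (n%:R * n.+1%:R * tau).
  move=> v1; set Y := (1 + X v) `^ p^-1; have Yp : 0 < Y by apply: lt_le_trans (Y1 v).
  have Yn : 1 + n%:R / p * X v <= Y ^+ n.
    rewrite -powR_mulrn ?(ltW Yp) // -powRrM (mulrC p^-1).
    have := @bernoulli_powR R (n%:R / p) (1 + X v).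
    rewrite ler_pdivlMr // mul1r => /(_ pn); rewrite [1 + X v]addrC addrK; apply.
    by rewrite addr_ge0.
  have bern : 1 - n%:R * tau <= (1 - tau) ^+ n.
    have := @bernoulli_powR R n%:R (1 - tau) nR; rewrite subr_ge0 => /(_ (ltW tau1)).
    rewrite powR_mulrn ?subr_ge0 ?(ltW tau1) //; lra.
  have : (Y * (1 - tau)) ^+ n <= (Y - tau) ^+ n.
    rewrite lerXn2r ?nnegrE ?mulr_ge0 ?subr_ge0 ?(ltW Yp) ?(ltW tau1) //.
      by rewrite (le_trans (ltW tau1)) // Y1.
    rewrite mulrBr mulr1 lerD2l lerN2 ler_peMl //; exact: Y1.
  rewrite exprMn => gY; rewrite /g exprMn -/Y -mulrA -[X in X + _]mulr1 -!mulrDr ler_wpM2l //.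
  apply: le_trans (lerD gY (lexx _)).
  have : (1 + n%:R / p * X v) * (1 - n%:R * tau) <= Y ^+ n * (1 - tau) ^+ n.
    apply: ler_pM => //; first by rewrite addr_ge0 // mulr_ge0 // divr_ge0 // ltW.
    rewrite subr_ge0 (le_trans _ nb) // ler_wpM2r // ler_nat //.
  have k1 : n%:R / p * X v <= n%:R.
    rewrite -[leRHS]mulr1 ler_pM ?X1 // ?divr_ge0 ?(ltW p0) //.
    by rewrite ler_pdivrMr // ler_peMr.
  move: (_ / p * _) k1 => k k1.
  have : k * (n%:R * tau) <= n%:R * (n%:R * tau) by rewrite ler_wpM2r // mulr_ge0.
  rewrite n1R; lra.
have omE : V unit_ball = om%:E by rewrite /om fineK // ge0_fin_numE //; exact: lebesgue_eball_lty.
have Se (k : R) : (\int[sphere_measure]_(v in (unit_sphere : set T)) k%:E = (k * (n%:R * om))%:E)%E.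
  have E : (\int[sphere_measure]_(v in (unit_sphere : set T)) cst k%:E v = k%:E * sphere_measure (unit_sphere : set T))%E.
    exact: integral_cst.
  by rewrite -[LHS]/(\int[sphere_measure]_(v in (unit_sphere : set T)) cst k%:E v)%E E sphere_total omE.
have mXS : measurable_fun (unit_sphere : set T) (fun v => (X v)%:E).
  by apply/measurable_EFinP; exact: measurable_funTS.
have intX : (\int[sphere_measure]_(v in (unit_sphere : set T)) (X v)%:E = (Pi_fun Q p u / r `^ p)%:E)%E.
  rewrite mulrC EFinM -(Pi_funE hQ p1 n0) -(@ge0_integralZl_EFin _ _ _ sphere_measure _ mS).
  - apply: eq_integral => v _; rewrite -EFinM /X powRM ?invr_ge0 ?(ltW r0) //; last exact: support_ge0.
    by rewrite mulrC -(powR_inv1 (ltW r0)) -powRrM mulN1r powRN.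
  - by move=> v _; rewrite lee_fin powR_ge0.
  - apply/measurable_EFinP; apply: measurable_funTS; apply: measurable_powR_comp.
    exact: (measurable_support2 hQ (@measurable_id _ T _) (@measurable_cst _ _ _ (borel_mx R n m) _ u)).
  - by rewrite invr_ge0 powR_ge0.
have c0 : 0 <= r ^+ n * (n%:R / p) by rewrite mulr_ge0 // divr_ge0 // ltW.
have mc (k : R) : measurable_fun (unit_sphere : set T) (fun _ => k%:E : \bar R) by exact: measurable_cst.
have mcX : measurable_fun (unit_sphere : set T) (fun v => (r ^+ n * (n%:R / p) * X v)%:E).
  by apply/measurable_EFinP; apply: measurable_funTS; apply: measurable_funM => //; exact: measurable_cst.
have mgn : measurable_fun (unit_sphere : set T) (fun v => (g v ^+ n)%:E).
  by apply/measurable_EFinP; apply: measurable_funTS; exact: measurable_funX.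
have i1 : (\int[sphere_measure]_(v in (unit_sphere : set T)) (r ^+ n + r ^+ n * (n%:R / p) * X v)%:E =
    (r ^+ n * (n%:R * om) + r ^+ n * (n%:R / p) * (Pi_fun Q p u / r `^ p))%:E)%E.
  under eq_integral do rewrite EFinD.
  rewrite (@ge0_integralD _ _ _ sphere_measure _ mS (fun _ => (r ^+ n)%:E) _ _ (mc _) _ mcX); last 2 first.
  - by move=> v _; rewrite lee_fin.
  - by move=> v _; rewrite lee_fin mulr_ge0.
  rewrite Se EFinD; congr (_ + _)%E; under eq_integral do rewrite EFinM.
  rewrite (@ge0_integralZl_EFin _ _ _ sphere_measure _ mS _ _ mXS _ c0) ?intX //.
  by move=> v _; rewrite lee_fin.
have k0 : 0 <= r ^+ n * (n%:R * n.+1%:R * tau) by rewrite !mulr_ge0.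
have i2 : (\int[sphere_measure]_(v in (unit_sphere : set T)) (g v ^+ n + r ^+ n * (n%:R * n.+1%:R * tau))%:E =
    \int[sphere_measure]_(v in (unit_sphere : set T)) (g v ^+ n)%:E + (r ^+ n * (n%:R * n.+1%:R * tau) * (n%:R * om))%:E)%E.
  under eq_integral do rewrite EFinD.
  rewrite (@ge0_integralD _ _ _ sphere_measure _ mS _ (fun _ => (r ^+ n * (n%:R * n.+1%:R * tau))%:E) _ mgn _ (mc _)); last 2 first.
  - by move=> v _; rewrite lee_fin exprn_ge0 // ltW.
  - by move=> v _; rewrite lee_fin.
  by rewrite Se.
have : ((r ^+ n * (n%:R * om) + r ^+ n * (n%:R / p) * (Pi_fun Q p u / r `^ p))%:E <=
    n%:R%:E * V (F (eball r) u) + (r ^+ n * (n%:R * n.+1%:R * tau) * (n%:R * om))%:E)%E.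
  rewrite -i1; apply: le_trans (leeD2r _ intg); rewrite -i2.
  apply: (@ge0_le_integral _ _ _ sphere_measure _ mS).
  - by move=> v _; rewrite lee_fin addr_ge0 // mulr_ge0.
  - by apply/measurable_EFinP; apply: measurable_funTS; apply: measurable_funD; [exact: measurable_cst|apply: measurable_funM => //; exact: measurable_cst].
  - by apply/measurable_EFinP; apply: measurable_funTS; apply: measurable_funD; [exact: measurable_funX|exact: measurable_cst].
  - by move=> v v1; rewrite lee_fin; exact: point.
have VF : V (F (eball r) u) \is a fin_num.
  apply: enorm_bounded_fin_num => //.
  have [|c _ hc] := @compact_enorm_bounded R n 1 (F (eball r) u); last by exists c.
  by apply: (compact_firey hQ p1); apply: (@compact_mx R n 1 _ r); [exact: closed_eball|].
rewrite -(fineK VF) -EFinM -EFinD !lee_fin => main.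
have nR0 : (0 : R) < n%:R by rewrite ltr0n.
rewrite -(ler_pM2l nR0) -(lerD2r (r ^+ n * (n%:R * n.+1%:R * tau) * (n%:R * om))).
apply: le_trans main; rewrite le_eqVlt; apply/orP; left; apply/eqP; field.
by rewrite !gt_eqF // powR_gt0.
Qed.

End ball.

(** * Comparison of a polytope with a ball of the same volume *)

Section polytope_inequality.
Context (R : realType) (n m : nat) (p : R) (Q : set 'rV[R]_m).
Hypotheses (hQ : convex_body_o Q) (p1 : 1 <= p) (n0 : (0 < n)%N) (m0 : (0 < m)%N) (pn : p <= n%:R).
Local Notation h := (support_fun Q).
Local Notation T := (borel_mx R n m).
Local Notation V := (@lebesgue_mx R n m).
Local Notation F := (firey p Q).
Local Notation Pi := (@Pi_fun R n m Q p).
Local Notation om := (fine (omega R n)).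
Local Notation N := (n * m)%N.

Let p0 : 0 < p. Proof. exact: lt_le_trans p1. Qed.

Let omE : omega R n = om%:E.
Proof. by rewrite fineK // ge0_fin_numE //; exact: lebesgue_eball_lty. Qed.

Lemma fine_omega_gt0 : 0 < om.
Proof. by rewrite -lte_fin -omE; exact: lebesgue_eball_gt0. Qed.

Lemma lebesgue_eball_omega (r : R) : 0 < r ->
  lebesgue_mx (eball r : set (borel_mx R n 1)) = (om * r ^+ n)%:E.
Proof. by move=> r0; rewrite (lebesgue_eball _ _ r0) muln1 EFinM -omE muleC. Qed.

Lemma Pi_sublevel_volume (y : R) : 0 < y ->
  V [set u | (Pi u <= y)%R] = (Pi_volume n Q p * y `^ (N%:R / p))%:E.
Proof.
move=> y0; set t := y `^ p^-1; have t0 : 0 < t by rewrite powR_gt0.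
have tp : t `^ p = y by rewrite /t -powRrM mulVf ?gt_eqF // powRr1 // ltW.
have -> : y `^ (N%:R / p) = t^-1^-1 ^+ N by rewrite invrK -powR_mulrn ?powR_ge0 // -powRrM mulrC.
rewrite EFinM -(Pi_volumeE hQ p1 n0 m0) -lebesgue_mx_scale ?invr_gt0 //; last exact: measurable_Pi_ball.
congr (V _); apply/seteqP; split=> u /=; rewrite (Pi_homo hQ p1) ?invr_ge0 ?(ltW t0) //;
  by rewrite -powR_inv1 ?(ltW t0) // -powRrM mulN1r powRN tp ler_pdivrMl // mulr1.
Qed.

Lemma measurable_scale_preimage k l (t : R) (X : set (borel_mx R k l)) : measurable X ->
  measurable ((fun x : 'M[R]_(k, l) => t *: x) @^-1` X : set (borel_mx R k l)).
Proof.
apply: (@measurable_preimage _ _ _ _ (fun x : borel_mx R k l => t *: (x : 'M[R]_(k, l)) : borel_mx R k l)).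
by apply: continuous_measurable_mx_mx => x; exact: scaler_continuous.
Qed.

Lemma eball_fat_body (s r : R) : s <= r -> fat_body s (eball r : set 'cV[R]_n).
Proof.
move=> sr; split.
- by apply: (@compact_mx R n 1 _ r); [exact: closed_eball|].
- move=> a a' l Ba Ba' /andP[l0 l1]; rewrite /eball /=; apply: le_trans (enormD _ _) _.
  rewrite !enormZ !ger0_norm ?subr_ge0 //.
  have := ler_wpM2l l0 Ba; have := ler_wpM2l (_ : 0 <= 1 - l) Ba'; rewrite subr_ge0 => /(_ l1); lra.
- by move=> x /le_trans; apply.
Qed.

Lemma fat_body_le (s s' : R) (W : set 'cV[R]_n) : s <= s' -> fat_body s' W -> fat_body s W.
Proof. by move=> ss [kW cW sW]; split=> // x xs; apply: sW; exact: le_trans ss. Qed.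

(** Bernoulli's inequality at [(1 + y)^-1], giving a first-order upper bound with an explicit
    remainder factor. *)
Lemma powR_1D_le (q y : R) : 1 <= q -> q <= n%:R -> 0 <= y -> (1 + y) `^ q <= 1 + q * y * (1 + y) ^+ n.
Proof.
move=> q1 qn y0; have y1 : 0 < 1 + y by rewrite ltr_pwDl.
have := bernoulli_powR q1 (ltW (_ : 0 < (1 + y)^-1)); rewrite invr_gt0 => /(_ y1).
rewrite -(ler_pM2r (powR_gt0 q y1)) -powRM ?invr_ge0 ?(ltW y1) // mulVf ?gt_eqF //.
have one k : 1 `^ k = 1 :> R by rewrite powR1.
rewrite one => h1.
have h2 : (1 + y) `^ q <= (1 + y) ^+ n.
  rewrite -powR_mulrn ?(ltW y1) //; apply: ler_powR => //; by rewrite lerDl.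
have qy : 0 <= q * y by rewrite mulr_ge0 // (le_trans ler01).
have h3 : q * y / (1 + y) * (1 + y) `^ q <= q * y * (1 + y) ^+ n.
  apply: ler_pM => //; [by rewrite divr_ge0 // ltW|exact: powR_ge0|].
  by rewrite ler_pdivrMr // ler_peMr // lerDl.
have e : q * y / (1 + y) = - (q * ((1 + y)^-1 - 1)) by field; rewrite gt_eqF.
by move: h1 h3; rewrite e; move: (_ - 1) (_ `^ q) => k l; lra.
Qed.

Lemma continuous_neg_near0 (f : R -> R) (d : R) : continuous f -> f 0 < 0 -> 0 < d ->
  exists2 e, 0 < e < d & f e < 0.
Proof.
move=> cf f0 d0.
have /nbhs_ballP[r /= r0 H] : \forall e \near (0 : R), f e < 0.
  exact: (cf 0 _ (open_nbhs_nbhs (conj (@open_lt R 0) f0))).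
have md : 0 < Num.min r d by rewrite lt_min r0.
have half : Num.min r d / 2 < Num.min r d by rewrite ltr_pdivrMr // ltr_pMr // ltr1n.
exists (Num.min r d / 2).
  by rewrite divr_gt0 //= (lt_le_trans half) // ge_min lexx orbT.
apply: H; rewrite /ball /= sub0r normrN gtr0_norm ?divr_gt0 //.
by rewrite (lt_le_trans half) // ge_min lexx.
Qed.

Section body.
Variables (z : nat -> 'cV[R]_n) (b : nat -> R) (J : nat) (s r : R).
Hypotheses (b0 : forall j, 0 < b j) (J0 : (0 < J)%N) (s0 : 0 < s) (r0 : 0 < r).
Local Notation W := (polytope z b J).
Hypotheses (fW : fat_body s W) (VW : lebesgue_mx (W : set (borel_mx R n 1)) = (om * r ^+ n)%:E).

Let kW : compact W. Proof. by case: fW. Qed.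

(** Up to the factor [n/p], the first-order term in [u] of the bound in [polytope_firey_le]. *)
Definition polytope_energy (u : 'M[R]_(n, m)) : R :=
  \sum_(j < J) facet_volume z b J j * facet_energy p Q z b j u.

Lemma polytope_energy_ge0 u : 0 <= polytope_energy u.
Proof. by apply: sumr_ge0 => j _; rewrite mulr_ge0 ?powR_ge0 // facet_volume_ge0. Qed.

Lemma measurable_facet_energy j : measurable_fun setT (facet_energy p Q z b j : T -> measurableTypeR R).
Proof.
apply: measurable_powR_comp; apply: measurable_funM; last exact: measurable_cst.
exact: (measurable_support2 hQ (@measurable_cst _ _ T (borel_mx R n 1) setT (z j)) (@measurable_id _ T _)).
Qed.

Lemma measurable_polytope_energy : measurable_fun setT (polytope_energy : T -> measurableTypeR R).
Proof.
apply: measurable_sum => j; apply: measurable_funM; first exact: measurable_cst.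
exact: measurable_facet_energy.
Qed.

Let energy_bounded (k : R) : exists2 K, 0 < K & forall (j : 'I_J) u, enorm u <= k -> facet_energy p Q z b j u <= K.
Proof.
have [c c0 hc] := @support2_le R n m Q hQ.
have [|j|K K0 H] := @finite_bound R 'I_J (fun j K => forall u, enorm u <= k -> facet_energy p Q z b j u <= K).
- by move=> j a a' ha aa u uk; exact: le_trans (ha u uk) aa.
- exists ((c * enorm (z j) * k / b j) `^ p) => u uk; apply: ler_powR_mono; first exact: ltW.
    by rewrite divr_ge0 ?(ltW (b0 j)) //; exact: support_ge0.
  rewrite ler_pM2r ?invr_gt0 //; apply: le_trans (hc _ _) _.
  by rewrite ler_wpM2l // mulr_ge0 ?enorm_ge0 // ltW.
- by exists K.
Qed.

Let energyZ j t u : 0 <= t -> facet_energy p Q z b j (t *: u) = t `^ p * facet_energy p Q z b j u.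
Proof.
move=> t0; rewrite /facet_energy -scalemxAr supportZ // -mulrA powRM //.
by rewrite divr_ge0 ?(ltW (b0 j)) //; exact: support_ge0.
Qed.

(* Comparison of the first variations of the volume of firey W u at u = 0 for W and for the ball. *)
Lemma sublevel_compare (k t t' : R) : 0 < k -> 0 < t -> t < t' ->
  (V (eball k `&` [set u | (polytope_energy u <= t)%R]) <=
   V [set u | (Pi u <= n%:R * t' * r `^ p / r ^+ n)%R])%E.
Proof.
move=> k0 t0 tt; have [K K0 HK] := energy_bounded k.
have [c c0 hc] := convex_body_bounded hQ.
have om0 := fine_omega_gt0.
have rn : 0 < r ^+ n by rewrite exprn_gt0.
pose D := (2 * (c * k) / r) `^ (2 * p); have D0 : 0 <= D by exact: powR_ge0.
pose E := p * om * r ^+ n * (1 + n.+1%:R * D).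
have E0 : 0 <= E by rewrite !mulr_ge0 ?(ltW p0) ?(ltW om0) ?(ltW rn) // addr_ge0 // mulr_ge0.
(* [psi] collects all error terms at step [e], and [psi 0 = t - t'] is negative. A violation of the
   claim would force [psi e >= 0]. *)
pose psi (e : R) := E * e + t * (1 + K * e) ^+ n + n%:R * t' * e ^+ 2 - t'.
have cpsi : continuous psi.
  have cM (x : R) : continuous (fun e : R => x * e).
    by move=> y; apply: cvgM; [exact: cvg_cst|exact: cvg_id].
  move=> y; apply: cvgB; last exact: cvg_cst.
  apply: cvgD; last by apply: cvgM; [exact: cvg_cst|exact: exprn_continuous].
  apply: cvgD; first exact: cM.
  apply: cvgM; first exact: cvg_cst.
  apply: (@continuous_comp _ _ _ (fun e : R => 1 + K * e) (fun y => y ^+ n)); last exact: exprn_continuous.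
  by apply: cvgD; [exact: cvg_cst|exact: cM].
have nR : (1 : R) <= n%:R by rewrite ler1n.
have nD : 0 < 1 / (2 * (1 + n.+1%:R * D)).
  by rewrite divr_gt0 // mulr_gt0 // ltr_pwDl // mulr_ge0.
have [|e /andP[e0 ed] psie] := continuous_neg_near0 cpsi _ nD.
  by rewrite /psi !mulr0 addr0 expr1n mulr1 expr0n /= mulr0 add0r addr0 subr_lt0.
have nD1 : 1 <= 1 + n.+1%:R * D by rewrite lerDl mulr_ge0.
have e2 : 2 * e < 1.
  have : e * (2 * (1 + n.+1%:R * D)) < 1 by rewrite -ltr_pdivlMr // mulr_gt0 // (lt_le_trans ltr01).
  by apply: le_lt_trans; rewrite mulrC ler_pM2l // ler_peMr.
have ee : e ^+ 2 <= e / 2 by rewrite expr2 ler_pM2l //; lra.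
have De : n.+1%:R * (D * e ^+ 2) <= 1.
  have : e * (2 * (1 + n.+1%:R * D)) < 1 by rewrite -ltr_pdivlMr // mulr_gt0 // (lt_le_trans ltr01).
  have h1 : n.+1%:R * D * e ^+ 2 <= n.+1%:R * D * (e / 2) by rewrite ler_wpM2l // mulr_ge0.
  rewrite mulrA; move: h1; move: (n.+1%:R * D) (mulr_ge0 (ler0n R n.+1) D0) => x x0 h1; nra.
(* Scaling matrices by [la] multiplies both energies, which are homogeneous of degree [p], by
   [e]. *)
pose la := e `^ p^-1; have la0 : 0 < la by rewrite powR_gt0.
have lap : la `^ p = e by rewrite /la -powRrM mulVf ?gt_eqF // powRr1 // ltW.
(* The rounded body contains only a ball of radius less than [r]; a relative loss [e^2] is
   negligible against the gain of order [e]. *)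
pose r' := r * (1 - e ^+ 2).
have r'1 : r / 2 <= r' by rewrite /r' ler_pM2l //; lra.
have r'0 : 0 < r' by apply: lt_le_trans r'1; rewrite divr_gt0.
have r'r : r' < r by rewrite /r' gtr_pMr // ltrBlDr ltrDl exprn_gt0.
(* The volume that [polytope_firey_le] allows for the Firey sum at [la u] when the polytope energy
   of [u] is at most [t]. *)
pose ce := om * r ^+ n + n%:R / p * e * t * (1 + K * e) ^+ n.
have q1 : 1 <= n%:R / p by rewrite ler_pdivlMr // mul1r.
have qn : n%:R / p <= n%:R by rewrite ler_pdivrMr // ler_peMr.
have up u : enorm u <= k -> polytope_energy u <= t -> firey_sublevel p Q W ce (la * k) (la *: u).
  move=> uk ut; split; first by rewrite enormZ gtr0_norm // ler_pM2l.
  apply: le_trans (polytope_firey_le hQ p1 b0 J0 kW _) _; rewrite lee_fin.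
  have Kn : 0 <= (1 + K * e) ^+ n by rewrite exprn_ge0 // addr_ge0 // mulr_ge0 // ltW.
  apply: (@le_trans _ _ (\sum_(j < J) (facet_volume z b J j +
      n%:R / p * e * (1 + K * e) ^+ n * (facet_volume z b J j * facet_energy p Q z b j u)))).
    apply: ler_sum => j _; rewrite energyZ ?(ltW la0) // lap.
    have f0 : 0 <= facet_energy p Q z b j u by exact: powR_ge0.
    have ef : 0 <= e * facet_energy p Q z b j u by rewrite mulr_ge0 // ltW.
    apply: le_trans (ler_wpM2l (facet_volume_ge0 _ _ _ _) (powR_1D_le q1 qn ef)) _.
    rewrite mulrDr mulr1 lerD2l.
    have -> : n%:R / p * e * (1 + K * e) ^+ n * (facet_volume z b J j * facet_energy p Q z b j u) =
      facet_volume z b J j * (n%:R / p * (e * facet_energy p Q z b j u) * (1 + K * e) ^+ n) by ring.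
    rewrite ler_wpM2l ?facet_volume_ge0 // ler_wpM2l //; first exact: mulr_ge0 (le_trans ler01 q1) ef.
    rewrite lerXn2r ?nnegrE ?addr_ge0 ?mulr_ge0 ?(ltW K0) ?(ltW e0) //.
    by rewrite lerD2l mulrC ler_pM2r //; exact: HK.
  rewrite big_split /= -mulr_sumr -/(polytope_energy u).
  have -> : \sum_(j < J) facet_volume z b J j = om * r ^+ n.
    by apply: EFin_inj; rewrite -VW polytope_volume.
  rewrite /ce lerD2l -!mulrA ler_wpM2l // ler_wpM2l ?invr_ge0 ?(ltW p0) // ler_wpM2l ?(ltW e0) //.
  by rewrite mulrC ler_wpM2r.
have [|W' rW lW'] := steiner_rounding n0 s0 r'0 r'r fW.
  by rewrite lebesgue_eball_omega // VW.
have ms : 0 < Num.min s r' by rewrite lt_min s0.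
have fW1 : fat_body (Num.min s r') W by apply: fat_body_le fW; rewrite ge_min lexx.
have fW1' := steiner_reach_fat_body fW1 rW.
have fB : fat_body (Num.min s r') (eball r' : set 'cV[R]_n) by apply: eball_fat_body; rewrite ge_min lexx orbT.
have mSW := @measurable_firey_sublevel R n m p Q hQ p1 _ _ ce (la * k) ms fW1.
have mSB := @measurable_firey_sublevel R n m p Q hQ p1 _ _ ce (la * k) ms fB.
have mSW' := @measurable_firey_sublevel R n m p Q hQ p1 _ _ ce (la * k) ms fW1'.
apply: (@le_trans _ _ (V ((fun u : 'M[R]_(n, m) => la *: u) @^-1` firey_sublevel p Q W ce (la * k)))).
  apply: le_measure; rewrite ?inE; [|exact: measurable_scale_preimage|by move=> u [uk ut]; exact: up].
  apply: measurableI; first exact: measurable_eball.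
  rewrite (_ : [set u | _] = (polytope_energy : T -> measurableTypeR R) @^-1` `]-oo, t]%classic).
    by apply: (measurable_preimage measurable_polytope_energy).
  by apply/seteqP; split=> u /=; rewrite in_itv.
apply: (@le_trans _ _ (V ((fun u : 'M[R]_(n, m) => la *: u) @^-1` firey_sublevel p Q (eball r') ce (la * k)))).
  rewrite !lebesgue_mx_scale //; apply: lee_wpmul2r.
    by rewrite lee_fin exprn_ge0 // invr_ge0 ltW.
  apply: le_trans (steiner_reach_sublevel hQ p1 ce (la * k) ms fW1 rW) _.
  apply: le_measure; rewrite ?inE //.
  exact: (firey_sublevel_mono hQ p1 fB fW1' lW').
have yp : 0 < n%:R * t' * r `^ p / r ^+ n.
  have nR0 : (0 : R) < n%:R by rewrite ltr0n.
  by rewrite divr_gt0 // !mulr_gt0 ?powR_gt0 // (lt_trans t0).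
apply: le_measure; rewrite ?inE; [exact: measurable_scale_preimage| |].
  have [d d0 hd] := Pi_lower hQ p1 n0 m0; have [d' d'0 hd'] := @Pi_upper R n m Q p hQ p1 n0.
  rewrite (_ : [set u | _] = (Pi : T -> measurableTypeR R) @^-1` `]-oo, n%:R * t' * r `^ p / r ^+ n]%classic).
    apply: measurable_preimage => //.
    exact: (measurable_gauge_F p1 d0 d'0 (Pi_homo hQ p1 n0) hd hd' (Pi_convex hQ p1 n0)).
  by apply/seteqP; split=> u /=; rewrite in_itv.
move=> u [uk Vu] /=.
have {}uk : enorm u <= k by move: uk; rewrite enormZ gtr0_norm // ler_pM2l.
have bQ y : Q y -> enorm (la *: u *m y^T) <= c * (la * k).
  move=> Qy; apply: le_trans (enorm_mulmx_tr _ _) _; rewrite enormZ gtr0_norm // mulrC.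
  apply: ler_pM; rewrite ?enorm_ge0 ?mulr_ge0 ?enorm_ge0 ?(ltW la0) //; first exact: hc.
  by rewrite ler_pM2l.
have ck0 : 0 <= c * (la * k) by rewrite !mulr_ge0 // ltW.
pose tau := (c * (la * k) / r') `^ (2 * p).
have tauD : tau <= D * e ^+ 2.
  have -> : e ^+ 2 = la `^ (2 * p) by rewrite [2 * p]mulrC powRrM lap powR_mulrn // ltW.
  rewrite /D -powRM ?(ltW la0) //; last by rewrite divr_ge0 ?(ltW r0) // !mulr_ge0 // ltW.
  apply: ler_powR_mono; [by rewrite mulr_ge0 // ltW|by rewrite divr_ge0 // ltW|].
  rewrite ler_pdivrMr //; apply: le_trans (ler_wpM2l _ r'1); last first.
    by rewrite mulr_ge0 ?(ltW la0) // divr_ge0 ?(ltW r0) // !mulr_ge0 // ltW.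
  by rewrite le_eqVlt; apply/orP; left; apply/eqP; field; rewrite gt_eqF.
have tau1 : n.+1%:R * tau <= 1.
  by apply: le_trans De; rewrite ler_wpM2l.
have br : c * (la * k) <= r'.
  rewrite leNgt; apply/negP => bb; have one q : 1 `^ q = 1 :> R by rewrite powR1.
  have : 1 <= tau.
    rewrite -(one (2 * p)); apply: ler_powR_mono => //; first by rewrite mulr_ge0 // ltW.
    by rewrite ler_pdivlMr // mul1r ltW.
  have : 0 <= tau by exact: powR_ge0.
  move: tau1; rewrite -natr1 mulrDl mul1r => h1 h2 h3.
  have := ler_peMr (ler0n R n) h3; have : 1 <= n%:R :> R by rewrite ler1n.
  move: h1 h3; clear - hQ p1 n0 m0 pn b0 J0 s0 r0 fW VW p0 omE kW energy_bounded energyZ; lra.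
have := le_trans (firey_ball_volume hQ p1 n0 pn r'0 br bQ tau1) Vu.
rewrite lee_fin (Pi_homo hQ p1) ?(ltW la0) // lap -/tau.
set P := Pi u => main.
(* If [Pi u] were larger, the lower bound for the ball would exceed [ce] unless [psi e >= 0]. *)
rewrite leNgt; apply/negP => big; move: psie; apply/negP; rewrite -leNgt subr_ge0.
have Kn0 : 0 <= t * (1 + K * e) ^+ n.
  by rewrite mulr_ge0 ?(ltW t0) // exprn_ge0 // addr_ge0 // mulr_ge0 // ltW.
have [neg|pos] := ltP (1 - n%:R * e ^+ 2) 0.
  have : t' <= n%:R * t' * e ^+ 2.
    by rewrite mulrAC ler_peMl ?(ltW (lt_trans t0 tt)) //; move: neg; clear - hQ p1 n0 m0 pn b0 J0 s0 r0 fW VW p0 omE kW energy_bounded energyZ; lra.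
  by have := mulr_ge0 E0 (ltW e0); move: big Kn0; clear - hQ p1 n0 m0 pn b0 J0 s0 r0 fW VW p0 omE kW energy_bounded energyZ; lra.
have bern : 1 - n%:R * e ^+ 2 <= (1 - e ^+ 2) ^+ n.
  have e21 : 0 <= 1 - e ^+ 2.
    by rewrite subr_ge0 -(ler_pM2l (lt_le_trans ltr01 nR)) mulr1; move: pos nR; clear - hQ p1 n0 m0 pn b0 J0 s0 r0 fW VW p0 omE kW energy_bounded energyZ; lra.
  have := bernoulli_powR nR e21; rewrite powR_mulrn //; clear - hQ p1 n0 m0 pn b0 J0 s0 r0 fW VW p0 omE kW energy_bounded energyZ; lra.
have rr : r' ^+ n = r ^+ n * (1 - e ^+ 2) ^+ n by rewrite /r' exprMn.
have rn' : 0 < r' ^+ n by rewrite exprn_gt0.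
have bp : 0 < r `^ p by rewrite powR_gt0.
have bp' : 0 < r' `^ p by rewrite powR_gt0.
have bb : r' `^ p <= r `^ p by apply: ler_powR_mono; exact: ltW.
have aa : r ^+ n * (1 - n%:R * e ^+ 2) <= r' ^+ n by rewrite rr ler_pM2l.
have aa' : r' ^+ n <= r ^+ n by rewrite lerXn2r ?nnegrE ?(ltW r0) ?(ltW r'0) // ltW.
have S1 : (1 - n%:R * e ^+ 2) * (n%:R * t') <= r' ^+ n / r' `^ p * P.
  have -> : (1 - n%:R * e ^+ 2) * (n%:R * t') = (r ^+ n * (1 - n%:R * e ^+ 2) / r `^ p) * (n%:R * t' * r `^ p / r ^+ n).
    by field; rewrite !gt_eqF.
  apply: ler_pM => //; [|exact: ltW|apply: ler_pM => //|exact: ltW].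
  - by rewrite divr_ge0 ?(ltW bp) // mulr_ge0 // ltW.
  - by rewrite mulr_ge0 // ltW.
  - by rewrite invr_ge0 ltW.
  - by rewrite lef_pV2.
have S2 : r' ^+ n * om * (n%:R * n.+1%:R * tau) <= r ^+ n * om * (n%:R * n.+1%:R * (D * e ^+ 2)).
  apply: ler_pM; rewrite ?mulr_ge0 ?(ltW rn') ?(ltW om0) ?powR_ge0 //; first by rewrite ler_pM2r.
  by rewrite ler_wpM2l // mulr_ge0.
have S3 : r ^+ n * om * (1 - n%:R * e ^+ 2) <= r' ^+ n * om by rewrite mulrAC ler_pM2r.
have S4 : r' ^+ n * (om * (1 - n%:R * n.+1%:R * tau) + e * P / (p * r' `^ p)) =
    r' ^+ n * om - r' ^+ n * om * (n%:R * n.+1%:R * tau) + e / p * (r' ^+ n / r' `^ p * P).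
  by field; rewrite !gt_eqF.
have S5 : e / p * ((1 - n%:R * e ^+ 2) * (n%:R * t')) <= e / p * (r' ^+ n / r' `^ p * P).
  by rewrite ler_wpM2l // divr_ge0 // ltW.
move: main; rewrite S4 /ce => main.
have S6 : e / p * ((1 - n%:R * e ^+ 2) * (n%:R * t')) <= e / p * (n%:R * (E * e + t * (1 + K * e) ^+ n)).
  have -> : e / p * (n%:R * (E * e + t * (1 + K * e) ^+ n)) =
     r ^+ n * om * (n%:R * e ^+ 2) + r ^+ n * om * (n%:R * n.+1%:R * (D * e ^+ 2)) + n%:R / p * e * t * (1 + K * e) ^+ n.
    by rewrite /E; field; rewrite gt_eqF.
  rewrite mulrBr mulr1 in S3; move: main S2 S3 S5; clear - hQ p1 n0 m0 pn b0 J0 s0 r0 fW VW p0 omE kW energy_bounded energyZ; lra.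
move: S6; rewrite ler_pM2l ?divr_gt0 // mulrCA ler_pM2l ?(lt_le_trans ltr01) //; move: big; clear - hQ p1 n0 m0 pn b0 J0 s0 r0 fW VW p0 omE kW energy_bounded energyZ; lra.
Qed.

(* The bathtub principle turns the comparison of sublevel sets into a bound on the volume of A. *)
Theorem polytope_inequality (A : set T) (k a : R) : measurable A -> 0 < k -> A `<=` eball k ->
  0 < a -> V A = a%:E -> (\int[V]_(u in A) (polytope_energy u)%:E <= (om * r ^+ n)%:E)%E ->
  a `^ (1 + p / N%:R) * (N%:R / (N%:R + p)) <= om * n%:R * r `^ p * Pi_volume n Q p `^ (p / N%:R).
Proof.
move=> mA k0 Ak a0 VA intA.
have N0 : (0 < N)%N by rewrite muln_gt0 n0 m0.
have NR : (0 : R) < N%:R by rewrite ltr0n.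
have nR : (0 : R) < n%:R by rewrite ltr0n.
have om0 := fine_omega_gt0; have rn : 0 < r ^+ n by rewrite exprn_gt0.
have rp : 0 < r `^ p by rewrite powR_gt0.
have V0 := Pi_volume_gt0 hQ p1 n0 m0.
pose e := N%:R / p; have e0 : 0 < e by rewrite divr_gt0.
pose y0 := n%:R * r `^ p / r ^+ n.
have y00 : 0 < y0 by rewrite divr_gt0 // mulr_gt0.
(* The factor [x > 1] is the slack [t' = t x] in [sublevel_compare], removed at the end. *)
have main x : 1 < x -> a `^ (1 + p / N%:R) * (N%:R / (N%:R + p)) <= om * n%:R * r `^ p * Pi_volume n Q p `^ (p / N%:R) * x.
  move=> x1; have x0 : 0 < x by exact: lt_trans x1.
  pose v := Pi_volume n Q p * (y0 * x) `^ e.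
  have v0 : 0 < v by rewrite mulr_gt0 // powR_gt0 // mulr_gt0.
  have cmp t : 0 < t -> (V (A `&` [set u | (polytope_energy u <= t)%R]) <= (v * t `^ e)%:E)%E.
    move=> t0; have tx : t < t * x by rewrite ltr_pMr.
    have := sublevel_compare k0 t0 tx.
    have -> : n%:R * (t * x) * r `^ p / r ^+ n = y0 * x * t by rewrite /y0; ring.
    rewrite (Pi_sublevel_volume (mulr_gt0 (mulr_gt0 y00 x0) t0)) (powRM e (ltW (mulr_gt0 y00 x0)) (ltW t0)) mulrA.
    apply: le_trans; apply: le_measure; rewrite ?inE; last by move=> u [/Ak].
      apply: measurableI => //; rewrite (_ : [set u | _] = (polytope_energy : T -> measurableTypeR R) @^-1` `]-oo, t]%classic).
        by apply: (measurable_preimage measurable_polytope_energy).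
      by apply/seteqP; split=> u /=; rewrite in_itv.
    apply: measurableI; first exact: measurable_eball.
    rewrite (_ : [set u | _] = (polytope_energy : T -> measurableTypeR R) @^-1` `]-oo, t]%classic).
      by apply: (measurable_preimage measurable_polytope_energy).
    by apply/seteqP; split=> u /=; rewrite in_itv.
  (* The optimal level in [bathtub], where the comparison volume [v c^e] equals [a]. *)
  pose c := (a / v) `^ e^-1; have c0 : 0 < c by rewrite powR_gt0 // divr_gt0.
  have ce : c `^ e = a / v by rewrite /c -powRrM mulVf ?gt_eqF // powRr1 // divr_ge0 // ltW.
  have bt : (c%:E * V A <= \int[V]_(u in A) (polytope_energy u)%:E + (v * (c `^ (e + 1) / (e + 1)))%:E)%E.
    exact: (bathtub mA measurable_polytope_energy polytope_energy_ge0 c0 e0 (ltW v0) cmp).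
  move: bt; rewrite VA => /le_trans/(_ (leeD2r _ intA)); rewrite -EFinM -EFinD lee_fin.
  have -> : c `^ (e + 1) = a / v * c by rewrite powRD ?ce ?powRr1 ?(ltW c0) // (gt_eqF c0) implybT.
  have -> : v * (a / v * c / (e + 1)) = c * a / (e + 1).
    by field; rewrite gt_eqF ?addr_gt0 // gt_eqF.
  move=> h1; have h2 : c * a * (e / (e + 1)) <= om * r ^+ n.
    have E1 : c * a * (e / (e + 1)) = c * a - c * a / (e + 1) by field; rewrite gt_eqF ?addr_gt0.
    by rewrite E1; lra.
  have eE : e^-1 = p / N%:R by rewrite /e invf_div.
  have cE : c = a `^ (p / N%:R) / (Pi_volume n Q p `^ (p / N%:R) * (y0 * x)).
    rewrite /c powRM ?invr_ge0 ?(ltW a0) ?(ltW v0) // eE; congr (_ * _).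
    rewrite -powR_inv1 ?(ltW v0) // -powRrM mulN1r powRN /v powRM ?powR_ge0 ?(ltW V0) //.
    by rewrite -(powRrM (y0 * x)) -eE divff ?gt_eqF // powRr1 // mulr_ge0 // ltW.
  have y0x : 0 < Pi_volume n Q p `^ (p / N%:R) * (y0 * x) := mulr_gt0 (powR_gt0 _ V0) (mulr_gt0 y00 x0).
  have ee : e / (e + 1) = N%:R / (N%:R + p).
    rewrite /e; move: (N%:R : R) NR => k1 k10; field.
    by rewrite (gt_eqF p0) gt_eqF // addr_gt0.
  have -> : a `^ (1 + p / N%:R) = a * a `^ (p / N%:R).
    by rewrite powRD ?powRr1 ?(ltW a0) // (gt_eqF a0) implybT.
  move: h2; rewrite ee cE -(ler_pM2r y0x).
  have -> : a `^ (p / N%:R) / (Pi_volume n Q p `^ (p / N%:R) * (y0 * x)) * a * (N%:R / (N%:R + p)) *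
    (Pi_volume n Q p `^ (p / N%:R) * (y0 * x)) = a * a `^ (p / N%:R) * (N%:R / (N%:R + p)).
    move: y0x; move: (_ * (y0 * x)) (_ / (_ + p)) => z1 z2 z10; field.
    by rewrite gt_eqF.
  move/le_trans; apply; rewrite le_eqVlt; apply/orP; left; apply/eqP.
  by rewrite /y0; field; rewrite gt_eqF.
set X := om * n%:R * r `^ p * _; have X0 : 0 < X by rewrite !mulr_gt0 ?powR_gt0.
apply/ler_addgt0Pr => d d0; have := main (1 + d / X); rewrite ltrDl divr_gt0 // => /(_ isT).
by rewrite -/X mulrDr mulr1 [X * _]mulrC divfK ?gt_eqF.
Qed.

End body.
End polytope_inequality.

(** * The centroid body as a limit of polytopes *)

Section centroid_body.
Context (R : realType) (n m : nat) (p : R) (Q : set 'rV[R]_m) (A : set (borel_mx R n m)) (d k : R).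
Hypotheses (hQ : convex_body_o Q) (p1 : 1 <= p) (n0 : (0 < n)%N) (m0 : (0 < m)%N).
Hypotheses (mA : measurable A) (d0 : 0 < d) (k0 : 0 < k) (dA : eball d `<=` A) (Ak : A `<=` eball k).
Local Notation h := (support_fun Q).
Local Notation om := (fine (omega R n)).
Local Notation T := (borel_mx R n m).
Local Notation V := (@lebesgue_mx R n m).

Let p0 : 0 < p. Proof. exact: lt_le_trans p1. Qed.

Let kern (u : T) (z : 'cV[R]_n) : R := h (z^T *m (u : 'M[R]_(n, m))).

Definition centroid_power : 'cV[R]_n -> R := power_mean V A kern p.

Definition centroid_support : 'cV[R]_n -> R := gauge_root centroid_power p.

Definition centroid_body : set 'cV[R]_n :=
  [set x | forall z, inner x z <= centroid_support z].

Let muA : (V A < +oo)%E. Proof. exact: enorm_bounded_lty Ak. Qed.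

Let kern0 u z : 0 <= kern u z. Proof. exact: support_ge0. Qed.

Let kernD u y z : kern u (y + z) <= kern u y + kern u z.
Proof. by rewrite /kern linearD /= mulmxDl; exact: supportD. Qed.

Let kernZ u t z : 0 <= t -> kern u (t *: z) = t * kern u z.
Proof. by move=> t0; rewrite /kern linearZ /= -scalemxAl supportZ. Qed.

Let kern_bound : {c : R | 0 < c & forall u z, A u -> kern u z <= c * enorm z}.
Proof.
apply: cid2; have [c c0 hc] := @support2_le R n m Q hQ; exists (c * k); first exact: mulr_gt0.
move=> u z /Ak uk; apply: le_trans (hc _ _) _; rewrite -!mulrA ler_pM2l // mulrC.
by rewrite ler_wpM2r ?enorm_ge0.
Qed.

Let mkernT z : measurable_fun setT (kern ^~ z : T -> measurableTypeR R).
Proof.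
exact: (measurable_support2 hQ (@measurable_cst _ _ T (borel_mx R n 1) setT z) (@measurable_id _ T _)).
Qed.

Let mkern z : measurable_fun A (kern ^~ z : T -> measurableTypeR R).
Proof. exact: measurable_funTS. Qed.

Lemma centroid_powerE z : (\int[V]_(u in A) (h (z^T *m (u : 'M[R]_(n, m))) `^ p)%:E = (centroid_power z)%:E)%E.
Proof. by case: kern_bound => c _ hc; exact: (power_meanE mA muA p1 kern0 hc mkern z). Qed.

Let centroid_powerZ t z : 0 <= t -> centroid_power (t *: z) = t `^ p * centroid_power z.
Proof. by case: kern_bound => c _ hc; exact: (power_meanZ mA muA p1 kern0 kernZ hc mkern). Qed.

Let centroid_power_convex t y z : 0 <= t <= 1 ->
  centroid_power (t *: y + (1 - t) *: z) <= t * centroid_power y + (1 - t) * centroid_power z.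
Proof. by case: kern_bound => c _ hc; exact: (power_mean_convex mA muA p1 kern0 kernD kernZ hc mkern). Qed.

Let centroid_upper : exists2 C, 0 < C & forall z, centroid_power z <= C * enorm z `^ p.
Proof.
case: kern_bound => c c0 hc; exists (fine (V A) * c `^ p + 1).
  by rewrite ltr_wpDl // mulr_ge0 ?powR_ge0 ?fine_ge0.
move=> z; apply: (@le_trans _ _ (fine (V A) * c `^ p * enorm z `^ p)).
  exact: (power_mean_upper mA muA p1 (ltW c0) kern0 hc mkern).
by rewrite ler_wpM2r ?powR_ge0 // lerDl.
Qed.

Let centroid_lower : exists2 c, 0 < c & forall z, c * enorm z `^ p <= centroid_power z.
Proof.
have [c c0 hc] := support_sym_lower hQ.
have d4 : 0 < d / 4 by rewrite divr_gt0.
have Bfin : V (eball (d / 4)) \is a fin_num by rewrite ge0_fin_numE // lebesgue_eball_lty.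
have Bpos : 0 < fine (V (eball (d / 4))).
  by rewrite fine_gt0 // lebesgue_eball_gt0 //= lebesgue_eball_lty.
pose s := c * d / 8; have s0 : 0 < s by rewrite divr_gt0 // mulr_gt0.
exists (s `^ p * fine (V (eball (d / 4))) / 2) => [|z].
  by rewrite divr_gt0 // mulr_gt0 // powR_gt0.
have Fge0 : 0 <= centroid_power z.
  by case: kern_bound => c' _ hc'; exact: (power_mean_ge0 mA muA p1 kern0 hc' mkern z).
have [z0|z0] := eqVneq z 0; first by move: Fge0; rewrite z0 enorm0 powR0 ?gt_eqF // mulr0.
have zp : 0 < enorm z by rewrite enorm_gt0.
pose e : 'rV[R]_m := delta_mx 0 (Ordinal m0).
have e1 : enorm e = 1.
  rewrite /enorm innerE big_ord1 (bigD1 (Ordinal m0)) //= !mxE !eqxx big1 ?addr0 ?mulr1 ?sqrtr1 //.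
  by move=> j ji; rewrite !mxE (negbTE ji) mulr0.
(* A matrix of rank one with norm at most [d/2] and [|z^T w| = (d/2) |z|]. The ball of radius [d/4]
   about it lies in [eball d], and on it [|z^T u| >= (d/4) |z|]. *)
pose w : 'M[R]_(n, m) := (d / 2 / enorm z) *: (z *m e).
have zw : z^T *m w = (d / 2 * enorm z) *: e.
  rewrite /w -scalemxAr mulmxA mxtrace_cV1 mul_scalar_mx scalerA -enorm_sqr; congr (_ *: _).
  by field; rewrite gt_eqF.
have wn : enorm w <= d / 2.
  have ze : enorm (z *m e) = enorm z.
    have : inner (z *m e) (z *m e) = inner z z.
      have ee : \tr (e^T *m e) = 1 by rewrite -[LHS]/(inner e e) -enorm_sqr e1 expr1n.
      rewrite {1}/inner trmx_mul mulmxA -(mulmxA e^T) mxtrace_cV1 mul_mx_scalar -scalemxAl mxtraceZ.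
      by rewrite ee mulr1.
    by rewrite /enorm => ->.
  have dz : 0 <= d / 2 / enorm z by rewrite !divr_ge0 // ltW.
  by rewrite /w enormZ ze ger0_norm // divfK // gt_eqF.
pose B : set T := [set u : 'M[R]_(n, m) | enorm (u - w) <= d / 4].
have mB : measurable B.
  by apply: closed_measurable_mx; apply: closed_le_continuous; exact: continuous_enormB.
have VB : V B = V (eball (d / 4)).
  by rewrite -(lebesgue_mx_shift (- w) (@measurable_eball _ _ _ (d / 4))).
have BD : B `<=` eball d.
  move=> u; rewrite /B /eball /= => uw; have h1 := enormB_le u w; lra.
have low u : B u -> s * enorm z <= Num.max (kern u z) (kern (- (u : 'M[R]_(n, m))) z).
  move=> Bu; rewrite /kern mulmxN.
  have lw : d / 4 * enorm z <= enorm (z^T *m (u : 'M[R]_(n, m))).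
    have t1 : enorm (z^T *m w) - enorm (z^T *m (u - w)) <= enorm (z^T *m (u : 'M[R]_(n, m))).
      rewrite lerBlDr; have := enormD (z^T *m (u : 'M[R]_(n, m))) (- (z^T *m (u - w))).
      by rewrite enormN -mulmxN -mulmxDr opprB addrCA subrr addr0.
    have t2 : enorm (z^T *m (u - w)) <= d / 4 * enorm z.
      by apply: le_trans (enorm_trmx_mul _ _) _; rewrite mulrC ler_wpM2r ?enorm_ge0.
    have t3 : enorm (z^T *m w) = d / 2 * enorm z.
      by rewrite zw enormZ e1 mulr1 ger0_norm // mulr_ge0 ?(ltW zp) // divr_ge0 // ltW.
    lra.
  have := hc (z^T *m (u : 'M[R]_(n, m))); set q := enorm (z^T *m (u : 'M[R]_(n, m))) in lw * => hs.
  have q2 : s * enorm z * 2 <= c * q.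
    rewrite (_ : _ * 2 = c * (d / 4 * enorm z)); last by rewrite /s; field.
    by rewrite ler_wpM2l // ltW.
  rewrite le_max; apply/orP.
  by case: (leP (s * enorm z) (h (z^T *m (u : 'M[R]_(n, m))))) => [|h3]; [left|right; lra].
pose f (u : T) : \bar R := (kern u z `^ p)%:E.
have mf : measurable_fun setT f by apply/measurable_EFinP; exact: measurable_powR_comp.
have f0 u : (0 <= f u)%E by rewrite lee_fin powR_ge0.
have DN : (fun u : 'M[R]_(n, m) => - u) @^-1` eball d = eball d.
  by apply/seteqP; split=> u; rewrite /eball /= enormN.
have su0 : 0 <= s * enorm z by rewrite mulr_ge0 ?enorm_ge0 // ltW.
have Bf u : B u -> (((s * enorm z) `^ p)%:E <= f u + f (- (u : 'M[R]_(n, m)))%R)%E.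
  move=> Bu; rewrite -EFinD lee_fin; have := low u Bu; rewrite le_max => /orP[] hx.
    by rewrite -[leLHS]addr0 lerD ?powR_ge0 // ler_powR_mono // ltW.
  by rewrite -[leLHS]add0r lerD ?powR_ge0 // ler_powR_mono // ltW.
have mD : measurable (eball d : set T) by exact: measurable_eball.
have sub : (\int[V]_(u in eball d) f u <= (centroid_power z)%:E)%E.
  rewrite -centroid_powerE; apply: (@ge0_subset_integral _ _ _ V (eball d : set T) A mD mA f) => //.
  exact: measurable_funTS.
have := le_integral_symmetric DN mD mB BD mf f0 (powR_ge0 _ _) Bf.
rewrite VB -(fineK Bfin) -EFinM => /le_trans/(_ (leeD sub sub)); rewrite -EFinD lee_fin.
rewrite powRM ?enorm_ge0 ?(ltW s0) //; lra.
Qed.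

Lemma continuous_centroid_support : continuous centroid_support.
Proof.
have [c c0 hc] := centroid_lower; have [C C0 hC] := centroid_upper.
exact: (continuous_gauge_root p1 c0 C0 centroid_powerZ hc hC centroid_power_convex).
Qed.

Lemma centroid_support_ge0 z : 0 <= centroid_support z. Proof. exact: gauge_root_ge0. Qed.

Lemma centroid_support_powE z : centroid_support z `^ p = centroid_power z.
Proof. by have [c c0 hc] := centroid_lower; exact: (gauge_rootK p1 c0 hc). Qed.

Lemma centroid_support_upper : exists2 C, 0 < C & forall z, centroid_support z <= C * enorm z.
Proof.
have [c c0 hc] := centroid_lower; have [C C0 hC] := centroid_upper.
exists (C `^ p^-1); first by rewrite powR_gt0.
by move=> z; exact: (gauge_root_upper p1 c0 C0 hc hC z).
Qed.

Lemma centroid_support_lower : exists2 c, 0 < c & forall z, c * enorm z <= centroid_support z.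
Proof.
have [c c0 hc] := centroid_lower.
exists (c `^ p^-1); first by rewrite powR_gt0.
by move=> z; exact: (gauge_root_lower p1 c0 hc z).
Qed.

Lemma compact_centroid_body : compact centroid_body.
Proof.
have [C C0 hC] := centroid_support_upper.
apply: (@compact_mx R n 1 _ C).
  rewrite (_ : centroid_body = \bigcap_z [set x | inner x z <= centroid_support z]); last first.
    by apply/seteqP; split=> x; [move=> h z _; exact: h|move=> h z; exact: h].
  by apply: closed_bigI => z _; apply: closed_le_continuous; exact: continuous_inner.
move=> x Kx; have [->|x0] := eqVneq x 0; first by rewrite enorm0 ltW.
move: (Kx x) => /le_trans/(_ (hC x)); rewrite -enorm_sqr expr2 ler_pM2r // enorm_gt0 //.
Qed.

Section dense_directions.

Let e0 : 'cV[R]_n := delta_mx (Ordinal n0) 0.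

Let e0_neq0 : e0 != 0.
Proof.
apply/eqP => /matrixP/(_ (Ordinal n0) 0); rewrite !mxE !eqxx => /eqP; by rewrite oner_eq0.
Qed.

Let dir (j : nat) : 'cV[R]_n :=
  if unpickle j is Some q then (if map_mx (@ratr R) (q : 'cV[rat]_n) == 0 then e0 else map_mx (@ratr R) q) else e0.

Let dir_neq0 j : dir j != 0.
Proof. by rewrite /dir; case: (unpickle j) => [q|] //; case: ifP => // /negbT. Qed.

Let dir_rat (q : 'cV[rat]_n) : map_mx (@ratr R) q != 0 -> exists j, dir j = map_mx (@ratr R) q.
Proof. by move=> q0; exists (pickle q); rewrite /dir pickleK (negbTE q0). Qed.

Let bound j := centroid_support (dir j).

Let bound_gt0 j : 0 < bound j.
Proof.
have [c c0 hc] := centroid_support_lower; apply: lt_le_trans (hc _).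
by rewrite mulr_gt0 // enorm_gt0.
Qed.

Let W J := polytope dir bound J.

(** Rational directions determine the body because the support function is continuous. The
    intersection starts at an arbitrary [J], so that it can begin where the polytopes are already
    compact. *)
Let W_bigcap J : centroid_body = \bigcap_i W (J + i).
Proof.
apply/seteqP; split=> x; first by move=> Kx i _ j _; exact: Kx.
move=> Wx z; have Hx j : inner x (dir j) <= bound j by apply: (Wx j.+1) => //; rewrite addnS ltnS leq_addl.
have Hq (q : 'cV[rat]_n) : inner x (map_mx (@ratr R) q) <= centroid_support (map_mx (@ratr R) q).
  have [->|q0] := eqVneq (map_mx (@ratr R) q) 0; first by rewrite inner0r centroid_support_ge0.
  by have [j <-] := dir_rat q0; exact: Hx.
rewrite leNgt; apply/negP => lt.
pose f (y : 'cV[R]_n) := inner y x - centroid_support y.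
have cf : continuous f.
  have c1 : continuous (fun y : 'cV[R]_n => inner y x) := @continuous_inner R n 1 x.
  move=> y; exact: (@cvgB R R _ (nbhs y) _ (fun y => inner y x) centroid_support _ _ (c1 y) (@continuous_centroid_support y)).
have /nbhs_ballP[r /= r0 H] : \forall y \near z, 0 < f y.
  apply: (cf z _ (open_nbhs_nbhs (conj (@open_gt R 0) _))).
  by rewrite /f /= subr_gt0 innerC.
have /choice[q Hq'] : forall ij : 'I_n * 'I_1, exists q : rat, ball (z ij.1 ij.2) r (ratr q : R).
  move=> ij; have /rat_in_itvoo[q qx] : z ij.1 ij.2 - r < z ij.1 ij.2 + r by rewrite ltrD2l gtrN.
  by exists q; rewrite /ball /= ltr_distlC; move: qx; rewrite in_itv.
pose qm : 'cV[rat]_n := \matrix_(i, j) q (i, j).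
have : ball z r (map_mx (@ratr R) qm) by split=> // i j; rewrite !mxE; exact: (Hq' (i, j)).
by move=> /H; rewrite /f subr_gt0 innerC ltNge Hq.
Qed.

Let closed_W J : closed (W J).
Proof.
rewrite (_ : W J = \bigcap_(j in [set j | (j < J)%N]) [set x | inner x (dir j) <= bound j]); last first.
  by apply/seteqP; split=> x h j; exact: h.
by apply: closed_bigI => j _; apply: closed_le_continuous; exact: continuous_inner.
Qed.

(** The rational vectors [e_i] and [-e_i] occur among the directions; once all of them have
    occurred, the polytopes lie in a fixed box. *)
Let W_bounded : exists J0, exists r, forall J, (J0 <= J)%N -> forall x, W J x -> enorm x <= r.
Proof.
have neq0 (i : 'I_n) (s : R) : s != 0 -> s *: delta_mx i 0 != 0 :> 'cV[R]_n.
  move=> s0; apply/eqP => /matrixP/(_ i 0); rewrite !mxE !eqxx mulr1 => /eqP; exact/negP.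
have coord (i : 'I_n) : exists JM : nat * R, forall J, (JM.1 <= J)%N -> forall x, W J x -> `|x i 0| <= JM.2.
  have side (s : rat) : ratr s != 0 :> R -> exists JM : nat * R, forall J, (JM.1 <= J)%N -> forall x, W J x -> ratr s * x i 0 <= JM.2.
    move=> s0; have E : map_mx (@ratr R) (s *: delta_mx i 0 : 'cV[rat]_n) = ratr s *: delta_mx i 0.
      by apply/matrixP => a b; rewrite !mxE rmorphM /= rmorph_nat.
    have [|j jE] := @dir_rat (s *: delta_mx i 0); first by rewrite E neq0.
    exists (j.+1, bound j) => J jJ x Wx; have := Wx j jJ; rewrite jE E innerZr.
    rewrite [inner _ _](_ : _ = x i 0) // innerE (bigD1 i) //= big_ord1 mxE !eqxx mulr1 big1 ?addr0 // => a ai.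
    by rewrite big_ord1 mxE (negbTE ai) mulr0.
  have [|[J1 M1] h1] := side 1; first by rewrite rmorph1 oner_eq0.
  have [|[J2 M2] h2] := side (-1); first by rewrite rmorphN1 oppr_eq0 oner_eq0.
  exists (maxn J1 J2, Num.max M1 M2) => J /=; rewrite geq_max => /andP[J1J J2J] x Wx.
  have := h1 J J1J x Wx; have := h2 J J2J x Wx; rewrite rmorphN1 rmorph1 mulN1r mul1r /= => a2 a1.
  by rewrite ler_norml lerNl !le_max a1 a2 orbT.
have /choice[JM HJM] := coord.
exists (\sum_i (JM i).1)%N, ((n * 1)%:R * \sum_i `|(JM i).2|) => J JJ x Wx.
apply: le_trans (enorm_le_mx_norm _) _; rewrite ler_wpM2l // {1}/Num.Def.normr /= mx_normrE.
apply/bigmax_leP; split; first by apply: sumr_ge0.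
move=> ij _; rewrite (ord1 ij.2) (bigD1 ij.1) //=.
apply: le_trans (_ : _ <= `|(JM ij.1).2|) _; last by rewrite lerDl sumr_ge0.
apply: le_trans (ler_norm _); apply: HJM Wx.
by apply: leq_trans JJ; rewrite (bigD1 ij.1) //= leq_addr.
Qed.

Let W_fat : exists2 s, 0 < s & forall J, compact (W J) -> fat_body s (W J).
Proof.
have [c c0 hc] := centroid_support_lower; exists c => // J kW; split=> //.
- move=> x y t Wx Wy /andP[t0 t1] j jJ; rewrite innerDl !innerZl.
  have := ler_wpM2l t0 (Wx j jJ); have := ler_wpM2l (_ : 0 <= 1 - t) (Wy j jJ); rewrite subr_ge0 => /(_ t1).
  lra.
- move=> x xc j jJ; apply: le_trans (inner_le _ _) _; apply: le_trans (hc _).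
  by rewrite ler_wpM2r ?enorm_ge0.
Qed.

(** The facet distance is the support function of the body, whose [p]-th power is the integral over
    [A] of the unnormalized facet energy. Consequently the polytope energy has integral over [A]
    equal to the volume of the polytope, which is the hypothesis of [polytope_inequality]. *)
Let facet_integral j :
  (\int[V]_(u in A) (facet_energy p Q dir bound j (u : 'M[R]_(n, m)))%:E = 1)%E.
Proof.
have bp : bound j `^ p = centroid_power (dir j) by exact: centroid_support_powE.
have cp : 0 < centroid_power (dir j) by rewrite -bp powR_gt0.
transitivity (\int[V]_(u in A) ((centroid_power (dir j))^-1%:E * (h ((dir j)^T *m (u : 'M[R]_(n, m))) `^ p)%:E))%E.
  apply: eq_integral => u _; rewrite /facet_energy -EFinM; congr (_%:E).
  rewrite powRM ?invr_ge0 ?(ltW (bound_gt0 j)) //; last exact: support_ge0.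
  by rewrite -powR_inv1 ?(ltW (bound_gt0 j)) // -powRrM mulN1r powRN bp mulrC.
rewrite (@ge0_integralZl_EFin _ _ _ V A mA).
- by rewrite centroid_powerE -EFinM mulVf // gt_eqF.
- by move=> u _; rewrite lee_fin powR_ge0.
- by apply/measurable_EFinP; apply: measurable_funTS; apply: measurable_powR_comp; exact: mkernT.
- by rewrite invr_ge0 ltW.
Qed.

Let energy_integral J : compact (W J) -> (0 < J)%N ->
  (\int[V]_(u in A) (polytope_energy p Q dir bound J (u : 'M[R]_(n, m)))%:E = lebesgue_mx (W J : set (borel_mx R n 1)))%E.
Proof.
move=> kW J0; rewrite (polytope_volume J0 kW) /polytope_energy.
under eq_integral do rewrite -sumEFin.
have mfe (j : 'I_J) : measurable_fun A (fun u : T => (facet_volume dir bound J j * facet_energy p Q dir bound j (u : 'M[R]_(n, m)))%:E).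
  apply/measurable_EFinP; apply: measurable_funTS; apply: measurable_funM; first exact: measurable_cst.
  exact: measurable_facet_energy.
rewrite (@ge0_integral_sum _ _ _ V A mA 'I_J (fun j u => (facet_volume dir bound J j * facet_energy p Q dir bound j (u : 'M[R]_(n, m)))%:E) mfe); last first.
  by move=> j u _; rewrite lee_fin mulr_ge0 ?powR_ge0 // facet_volume_ge0.
rewrite -sumEFin; apply: eq_bigr => j _; under eq_integral do rewrite EFinM.
rewrite (@ge0_integralZl_EFin _ _ _ V A mA) ?facet_volume_ge0 //.
- by rewrite facet_integral // mule1.
- by move=> u _; rewrite lee_fin powR_ge0.
- by apply/measurable_EFinP; apply: measurable_funTS; exact: measurable_facet_energy.
Qed.

(** The polytopes decrease to the body, so by continuity of the measure one of them has at most [x]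
    times its volume, for any [x > 1]; [polytope_inequality] for this one loses at most the factor
    [x]. *)
Theorem centroid_inequality (a : R) : p <= n%:R -> V A = a%:E -> exists2 r, 0 < r &
  lebesgue_mx (centroid_body : set (borel_mx R n 1)) = (om * r ^+ n)%:E /\
  a `^ (1 + p / (n * m)%:R) * ((n * m)%:R / ((n * m)%:R + p)) <=
    om * n%:R * r `^ p * Pi_volume n Q p `^ (p / (n * m)%:R).
Proof.
move=> pn VA.
have [J0 [rb Hb]] := W_bounded; have [s s0 fat] := W_fat.
have om0 : 0 < om := @fine_omega_gt0 R n.
have kW i : compact (W (J0.+1 + i)).
  apply: (@compact_mx R n 1 _ rb); first exact: closed_W.
  by apply: Hb; rewrite addSn (leq_trans (leq_addr i J0)).
have fW i : fat_body s (W (J0.+1 + i)) := fat _ (kW i).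
have mW i : measurable (W (J0.+1 + i) : set (borel_mx R n 1)) := compact_measurable_mx (kW i).
have hb i : (J0 <= J0.+1 + i)%N by rewrite addSn (leq_trans (leq_addr i J0)).
have Wfin i := fineK (enorm_bounded_fin_num (mW i) (ex_intro _ rb (Hb _ (hb i)))).
have kK := compact_centroid_body; have mK := compact_measurable_mx kK.
have KE := W_bigcap J0.+1.
have sK : eball s `<=` centroid_body.
  by rewrite KE => x xs i _; have [_ _ h] := fW i; exact: h.
have Kfin : lebesgue_mx (centroid_body : set (borel_mx R n 1)) \is a fin_num.
  by apply: enorm_bounded_fin_num => //; have [c _ h] := compact_enorm_bounded kK; exists c.
have a0 : 0 < a.
  rewrite -lte_fin -VA; apply: lt_le_trans (@lebesgue_eball_gt0 R n m d d0) _.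
  by apply: le_measure; rewrite ?inE //; exact: measurable_eball.
pose v := fine (lebesgue_mx (centroid_body : set (borel_mx R n 1))).
have vE : lebesgue_mx (centroid_body : set (borel_mx R n 1)) = v%:E by rewrite fineK.
have v0 : 0 < v.
  rewrite -lte_fin -vE; apply: lt_le_trans (@lebesgue_eball_gt0 R n 1 s s0) _.
  by apply: le_measure; rewrite ?inE //; exact: measurable_eball.
pose r := (v / om) `^ n%:R^-1.
have rn : r ^+ n = v / om by apply: powR_rootK => //; rewrite divr_ge0 // ltW.
have r0 : 0 < r by rewrite powR_gt0 // divr_gt0.
exists r => //; split; first by rewrite vE rn mulrC divfK ?gt_eqF.
set X := om * n%:R * r `^ p * _.
have Pv0 : 0 < Pi_volume n Q p := Pi_volume_gt0 hQ p1 n0 m0.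
have X0 : 0 < X.
  have nR : (0 : R) < n%:R by rewrite ltr0n.
  exact: (mulr_gt0 (mulr_gt0 (mulr_gt0 om0 nR) (powR_gt0 _ r0)) (powR_gt0 _ Pv0)).
have main x : 1 < x -> a `^ (1 + p / (n * m)%:R) * ((n * m)%:R / ((n * m)%:R + p)) <= X * x.
  move=> x1; have x0 : 0 < x by exact: lt_trans x1.
  have [i Vi] : exists i, (lebesgue_mx (W (J0.+1 + i)%N : set (borel_mx R n 1)) <= (x * v)%:E)%E.
    apply: contrapT => nex.
    have cv : (lebesgue_mx (W (J0.+1 + i)%N : set (borel_mx R n 1)) @[i --> \oo] -->
        lebesgue_mx (centroid_body : set (borel_mx R n 1)))%classic.
      rewrite KE; apply: (@nonincreasing_cvg_mu _ (borel_mx R n 1) R lebesgue_mx (fun i => W (J0.+1 + i)%N)).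
      - by have := ltry (fine (lebesgue_mx (W (J0.+1 + 0)%N : set (borel_mx R n 1)))); rewrite (Wfin 0%N).
      - exact: mW.
      - by rewrite -KE.
      - move=> i j ij; apply/subsetPset => y Wy l lJ; apply: Wy.
        by apply: leq_trans lJ _; rewrite leq_add2l.
    suff : x * v <= v by rewrite leNgt ltr_pMl // x1.
    rewrite -lee_fin -vE; apply: (cvge_to_ge cv); apply: nearW => i; rewrite leNgt; apply/negP => h2; apply: nex; exists i; exact: ltW.
  pose vi := fine (lebesgue_mx (W (J0.+1 + i)%N : set (borel_mx R n 1))).
  have viE : lebesgue_mx (W (J0.+1 + i)%N : set (borel_mx R n 1)) = vi%:E by rewrite -(Wfin i).
  have vvi : v <= vi.
    rewrite -lee_fin -vE -viE; apply: le_measure; [by rewrite inE|by rewrite inE; exact: mW|].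
    by rewrite KE => y; apply.
  have vi0 : 0 < vi := lt_le_trans v0 vvi.
  pose ri := (vi / om) `^ n%:R^-1.
  have rin : ri ^+ n = vi / om by apply: powR_rootK => //; rewrite divr_ge0 // ltW.
  have ri0 : 0 < ri by rewrite powR_gt0 // divr_gt0.
  have VW : lebesgue_mx (W (J0.+1 + i)%N : set (borel_mx R n 1)) = (om * ri ^+ n)%:E.
    by rewrite viE rin mulrC divfK // gt_eqF.
  have intA : (\int[V]_(u in A) (polytope_energy p Q dir bound (J0.+1 + i) (u : 'M[R]_(n, m)))%:E <= (om * ri ^+ n)%:E)%E.
    by rewrite energy_integral // VW.
  have nR : (0 : R) < n%:R by rewrite ltr0n.
  have pw y : 0 <= y -> y `^ p = (y ^+ n) `^ (p / n%:R).
    by move=> y0; rewrite -powR_mulrn // -powRrM mulrCA divff ?gt_eqF // mulr1.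
  have q0 : 0 <= p / n%:R by rewrite divr_ge0 ?(ltW nR) // (le_trans ler01).
  have q1 : p / n%:R <= 1 by rewrite ler_pdivrMr // mul1r.
  (* [r^p] is the power [p/n <= 1] of [r^n], so a volume ratio of at most [x] costs at most the
     factor [x]. *)
  have rirx : ri `^ p <= r `^ p * x.
    rewrite (pw ri (ltW ri0)) (pw r (ltW r0)).
    apply: (@le_trans _ _ ((r ^+ n * x) `^ (p / n%:R))).
      apply: ler_powR_mono => //; first by rewrite exprn_ge0 // ltW.
      rewrite rin rn mulrAC ler_pM2r ?invr_gt0 // mulrC -lee_fin -viE //.
    rewrite (powRM (p / n%:R) (exprn_ge0 n (ltW r0)) (ltW x0)) ler_wpM2l ?powR_ge0 //.
    by rewrite -[leRHS](powRr1 (ltW x0)) ler_powR // ltW.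
  have := polytope_inequality hQ p1 n0 m0 pn bound_gt0 (isT : (0 < J0.+1 + i)%N) s0 ri0 (fW i) VW mA k0 Ak a0 VA intA.
  move/le_trans; apply; rewrite /X.
  move: (Pi_volume n Q p `^ _) (powR_ge0 (Pi_volume n Q p) (p / (n * m)%:R)) => P P0.
  have nom : 0 <= om * n%:R := mulr_ge0 (ltW om0) (ltW nR).
  have := ler_wpM2r P0 (ler_wpM2l nom rirx).
  by move: (ri `^ p) (r `^ p) => s1 s2; rewrite -!mulrA [x * P]mulrC.
apply/ler_addgt0Pr => e e0'; have := main (1 + e / X); rewrite ltrDl divr_gt0 // => /(_ isT).
by rewrite mulrDr mulr1 [X * _]mulrC divfK ?gt_eqF.
Qed.

End dense_directions.
End centroid_body.

(** * Lower bound for the affine energy *)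

Section affine_energy_lower.
Context (R : realType) (n m : nat) (p : R) (Q : set 'rV[R]_m) (f : 'cV[R]_n -> R).
Hypotheses (hQ : convex_body_o Q) (p1 : 1 <= p) (n0 : (0 < n)%N) (m0 : (0 < m)%N) (fs : is_Ccinfty f).
Local Notation h := (support_fun Q).
Local Notation om := (fine (omega R n)).
Local Notation T := (borel_mx R n m).
Local Notation V := (@lebesgue_mx R n m).
Local Notation X := (borel_mx R n 1).
Local Notation N := (n * m)%N.

Let p0 : 0 < p. Proof. exact: lt_le_trans p1. Qed.

Let N0 : (0 < N)%N. Proof. by rewrite muln_gt0 n0. Qed.

Let NR : (0 : R) < N%:R. Proof. by rewrite ltr0n. Qed.

Let S : set X := closure [set x | f x != 0].

Let kS : compact S. Proof. exact: fs.2. Qed.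

Let mS : measurable S. Proof. exact: compact_measurable_mx. Qed.

Let muS : (@lebesgue_mx R n 1 S < +oo)%E. Proof. exact: compact_lebesgue_lty. Qed.

Let kern (x : X) (u : 'M[R]_(n, m)) : R := h ((gradient f x)^T *m u).

Definition gradient_power : 'M[R]_(n, m) -> R := power_mean (@lebesgue_mx R n 1) S kern p.

Let kern0 x u : 0 <= kern x u. Proof. exact: support_ge0. Qed.

Let kernZ x t u : 0 <= t -> kern x (t *: u) = t * kern x u.
Proof. by move=> t0; rewrite /kern -scalemxAr supportZ. Qed.

Let kern_bound : {c : R | 0 < c & forall x u, S x -> kern x u <= c * enorm u}.
Proof.
apply: cid2; have [c c0 hc] := @support2_le R n m Q hQ; have [M M0 hM] := gradient_bounded fs.
exists (c * M) => [|x u _]; first exact: mulr_gt0.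
apply: le_trans (hc _ _) _; rewrite ler_wpM2r ?enorm_ge0 // ler_pM2l //; exact: hM.
Qed.

Let mgrad : measurable_fun setT (gradient f : X -> X).
Proof. apply/measurable_fun_mxP => i j; apply: continuous_measurable_mx.
by rewrite (_ : (fun x => _) = partial i f); [exact: Ccinfty_partial_continuous|apply/funext => x; rewrite mxE]. Qed.

Let mkernT u : measurable_fun setT (kern ^~ u : X -> measurableTypeR R).
Proof. exact: (measurable_support2 hQ mgrad (@measurable_cst _ _ X T setT u)). Qed.

Let mkern u : measurable_fun S (kern ^~ u : X -> measurableTypeR R).
Proof. exact: measurable_funTS. Qed.

Let support0 : h 0 = 0.
Proof. by rewrite -(scale0r (0 : 'rV[R]_m)) supportZ // mul0r. Qed.

Let kern_out x u : ~ S x -> kern x u = 0.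
Proof.
move=> Sx; rewrite /kern (_ : gradient f x = 0) ?trmx0 ?mul0mx //.
apply/matrixP => i j; rewrite !mxE; apply: (@partial_eq0 R n f S i) => //; first exact: closed_closure.
by move=> y Sy; apply: contrapT => /eqP fy; apply: Sy; exact: subset_closure.
Qed.

Lemma gradient_powerE u :
  (\int[@lebesgue_mx R n 1]_x (h ((gradient f x)^T *m u) `^ p)%:E = (gradient_power u)%:E)%E.
Proof.
have [c _ hc] := kern_bound.
rewrite -(power_meanE mS muS p1 kern0 hc mkern u) [RHS]integral_mkcond; apply: eq_integral => x _.
rewrite patchE; case: ifPn => // /negP; rewrite inE => Sx.
by rewrite -/(kern x u) kern_out // powR0 // gt_eqF.
Qed.

Lemma gradient_power_ge0 u : 0 <= gradient_power u.
Proof. by have [c _ hc] := kern_bound; exact: (power_mean_ge0 mS muS p1 kern0 hc mkern). Qed.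

Lemma gradient_powerZ t u : 0 <= t -> gradient_power (t *: u) = t `^ p * gradient_power u.
Proof. by have [c _ hc] := kern_bound; exact: (power_meanZ mS muS p1 kern0 kernZ hc mkern). Qed.

Lemma gradient_power_upper : exists2 C, 0 < C & forall u, gradient_power u <= C * enorm u `^ p.
Proof.
have [c c0 hc] := kern_bound; set a := fine (@lebesgue_mx R n 1 S) * c `^ p.
have a0 : 0 <= a by rewrite /a mulr_ge0 ?powR_ge0 ?fine_ge0.
exists (a + 1) => [|u]; first by rewrite ltr_wpDl.
apply: (@le_trans _ _ (a * enorm u `^ p)); last by rewrite ler_wpM2r ?powR_ge0 // lerDl.
exact: (power_mean_upper mS muS p1 (ltW c0) kern0 hc mkern).
Qed.

Let mF : measurable_fun setT (fun xu : X * T => (h ((gradient f xu.1)^T *m (xu.2 : 'M[R]_(n, m))) `^ p)%:E).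
Proof.
apply/measurable_EFinP; apply: measurable_powR_comp.
apply: (measurable_support2 hQ (measurableT_comp mgrad _) _); [exact: measurable_fst|exact: measurable_snd].
Qed.

Lemma measurable_gradient_power : measurable_fun setT (gradient_power : T -> measurableTypeR R).
Proof.
have F0 (xu : X * T) : (0 <= (h ((gradient f xu.1)^T *m (xu.2 : 'M[R]_(n, m))) `^ p)%:E)%E by rewrite lee_fin powR_ge0.
have := @measurable_fun_fubini_tonelli_G _ _ X T R (@lebesgue_mx R n 1) _ mF F0.
rewrite /fubini_G; under eq_fun do rewrite gradient_powerE.
by move/measurable_EFinP.
Qed.

Let one (q : R) : 1 `^ q = 1 :> R. Proof. by rewrite powR1. Qed.

Let root u := gradient_power u `^ p^-1.

Let root_le1 u : (root u <= 1) = (gradient_power u <= 1).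
Proof.
have G0 := gradient_power_ge0 u; rewrite /root.
have E : (gradient_power u `^ p^-1) `^ p = gradient_power u by rewrite -powRrM mulVf ?gt_eqF // powRr1.
apply/idP/idP => g1.
  by rewrite -E -[leRHS](one p); apply: ler_powR_mono; rewrite ?powR_ge0 // ltW.
by rewrite -[leRHS](one p^-1); apply: ler_powR_mono; rewrite ?invr_ge0 // ltW.
Qed.

(** The [p]-th root of [gradient_power] is homogeneous of degree 1 and has the same sublevel set at
    1, so [volume_sublevel] applies to it. *)
Lemma affine_energyE :
  affine_energy p Q f = npoweR (N%:R%:E * V [set u | (gradient_power u <= 1)%R])%E (p / N%:R).
Proof.
rewrite /affine_energy; congr (npoweR _ _).
rewrite (_ : [set u | gradient_power u <= 1] = [set u | root u <= 1]); last first.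
  by apply/seteqP; split=> u /=; rewrite root_le1.
rewrite -(@volume_sublevel R n m N0 root).
- by apply: eq_integral => u _; rewrite /gradient_norm /gradient_in gradient_powerE poweR_EFin.
- by apply: measurable_powR_comp; exact: measurable_gradient_power.
- by move=> u; exact: powR_ge0.
- move=> t u t0; rewrite /root gradient_powerZ ?(ltW t0) // powRM ?powR_ge0 ?gradient_power_ge0 //.
  by rewrite -powRrM mulfV ?gt_eqF // powRr1 // ltW.
Qed.

(** The cut by a ball makes the volume finite; the bound obtained below does not depend on [k]. *)
Let A k : set T := [set u | gradient_power u <= 1] `&` eball k.

Let mG1 : measurable ([set u | gradient_power u <= 1] : set T).
Proof.
rewrite (_ : [set u | _] = (gradient_power : T -> measurableTypeR R) @^-1` `]-oo, 1]%classic).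
  exact: (measurable_preimage measurable_gradient_power).
by apply/seteqP; split=> u /=; rewrite in_itv.
Qed.

Let mA k : measurable (A k). Proof. by apply: measurableI => //; exact: measurable_eball. Qed.

(** For [s = t^(1/p) <= 1] the dilate [s A] is contained in [A] and in [{G <= t}], which gives the
    lower bound [a t^(N/p)] required by [layer_lower]. *)
Let layer k a : 0 < k -> V (A k) = a%:E -> 0 <= a ->
  (\int[V]_(u in A k) (gradient_power u)%:E <= (a * (N%:R / (N%:R + p)))%:E)%E.
Proof.
move=> k0 VA a0; have e0 : 0 < N%:R / p by rewrite divr_gt0.
have -> : N%:R / (N%:R + p) = (N%:R / p) / (N%:R / p + 1).
  move: (N%:R : R) NR => y y0; field; rewrite ?gt_eqF ?addr_gt0 //.
apply: (@layer_lower _ T R _ (A k) gradient_power a _ (mA k) measurable_gradient_power gradient_power_ge0 e0 a0 VA).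
  by move=> u [].
move=> t /andP[t0 t1]; pose s := t `^ p^-1; have s0 : 0 < s by exact: powR_gt0.
have s1 : s <= 1 by rewrite -[leRHS](one p^-1); apply: ler_powR_mono; rewrite ?invr_ge0 // ltW.
have sp : s `^ p = t by rewrite -powRrM mulVf ?gt_eqF // powRr1 // ltW.
have sN : (s^-1)^-1 ^+ N = t `^ (N%:R / p).
  by rewrite invrK -powR_mulrn ?(ltW s0) // -powRrM mulrC.
have V1 : V ((fun u : 'M[R]_(n, m) => s^-1 *: u) @^-1` (A k)) = (a * t `^ (N%:R / p))%:E.
  apply: etrans (lebesgue_mx_scale _ (mA k)) _; first by rewrite invr_gt0.
  by rewrite sN EFinM; congr (_ * _)%E; exact: VA.
rewrite -V1; apply: le_measure.
- by rewrite inE; apply: measurable_scale_preimage => //; rewrite invr_gt0.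
- rewrite inE; apply: measurableI => //.
  rewrite (_ : [set u | _] = (gradient_power : T -> measurableTypeR R) @^-1` `]-oo, t]%classic).
    exact: (measurable_preimage measurable_gradient_power).
  by apply/seteqP; split=> u /=; rewrite in_itv.
- move=> u [/= g1 u1].
  have uE : u = s *: (s^-1 *: u) :> 'M[R]_(n, m) by rewrite scalerA divff ?scale1r // gt_eqF.
  have gu : gradient_power u <= t.
    by rewrite uE gradient_powerZ ?(ltW s0) // sp -[leRHS]mulr1 ler_pM2l.
  split; last by [].
  split; first exact: le_trans t1.
  rewrite /eball /= uE enormZ ger0_norm ?(ltW s0) //; apply: le_trans u1.
  by rewrite -[leRHS]mul1r ler_wpM2r // enorm_ge0.
Qed.

Let energy_fubini k : 0 < k ->
  (\int[@lebesgue_mx R n 1]_x (centroid_power p Q (A k) (gradient f x))%:E =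
   \int[V]_(u in A k) (gradient_power u)%:E)%E.
Proof.
move=> k0; have Ak : A k `<=` eball k by move=> u [].
have mI : measurable_fun setT (fun u : T => (\1_(A k) u : R)) by exact: measurable_indic.
pose F (xu : X * T) := ((h ((gradient f xu.1)^T *m (xu.2 : 'M[R]_(n, m))) `^ p)%:E * (\1_(A k) xu.2)%:E)%E.
have mF1 : measurable_fun setT F.
  apply: emeasurable_funM => //; apply/measurable_EFinP.
  exact: (measurableT_comp mI measurable_snd).
have F0 xu : (0 <= F xu)%E by rewrite /F mule_ge0 // lee_fin // powR_ge0.
have := @fubini_tonelli _ _ X T R (@lebesgue_mx R n 1) V F mF1 F0; rewrite /F /=.
move=> E; transitivity (\int[@lebesgue_mx R n 1]_x \int[V]_y F (x, y))%E.
  apply: eq_integral => x _; rewrite -(centroid_powerE hQ p1 (mA k) k0 Ak) integral_mkcond.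
  by apply: eq_integral => u _; rewrite epatch_indic.
rewrite /F E [RHS]integral_mkcond; apply: eq_integral => u _.
rewrite epatch_indic /= -gradient_powerE.
under eq_integral do rewrite muleC.
rewrite [RHS]muleC; apply: (@ge0_integralZl_EFin _ X R (@lebesgue_mx R n 1) setT measurableT (fun x => (h ((gradient f x)^T *m (u : 'M[R]_(n, m))) `^ p)%:E) _ _ (\1_(A k) u)).
- by move=> x _; rewrite lee_fin powR_ge0.
- by apply/measurable_EFinP; apply: measurable_powR_comp; exact: mkernT.
- by rewrite indicE.
Qed.

Let v := fine (lebesgue_mx ([set x | 1 <= f x] : set X)).
Let P := Pi_volume n Q p.
Let G := ((n%:R - p) / (p - 1)) `^ (p - 1).

(** [centroid_inequality] bounds [r^p] from below in terms of [a^(1 + p/N)], while [energy_lower]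
    and [layer] bound [r^p] from above in terms of [a]. Eliminating [r^p] leaves a bound on
    [a^(p/N)]. *)
Let section_bound k : p < n%:R -> 0 < v -> 0 < k -> exists2 a, 0 < a & V (A k) = a%:E /\
  a `^ (p / N%:R) * ((v / om) `^ ((n%:R - p) / n%:R) * G) <= P `^ (p / N%:R).
Proof.
move=> pn v0 k0; have nR : (0 : R) < n%:R by rewrite ltr0n.
have om0 : 0 < om := fine_omega_gt0 R n.
have [C C0 hC] := gradient_power_upper.
(* [G <= C |u|^p] puts a ball of radius [d] inside [A k], which makes the centroid body
   nondegenerate. *)
pose d := Num.min k (C `^ p^-1)^-1.
have Cp : 0 < (C `^ p^-1)^-1 by rewrite invr_gt0 powR_gt0.
have d0 : 0 < d by rewrite lt_min k0.
have Ak : A k `<=` eball k by move=> u [].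
have dA : eball d `<=` A k.
  move=> u; rewrite /eball /= le_min => /andP[uk uC]; split=> //=; apply: le_trans (hC u) _.
  rewrite -ler_pdivlMl // mulr1 (_ : C^-1 = C^-1 `^ 1); last by rewrite powRr1 // invr_ge0 ltW.
  rewrite (_ : C^-1 `^ 1 = ((C `^ p^-1)^-1) `^ p); last first.
    by rewrite -powRN -powRrM mulNr mulVf ?gt_eqF // powRN !powRr1 ?invr_ge0 ?(ltW C0).
  by apply: ler_powR_mono => //; [exact: ltW|exact: enorm_ge0].
have Afin : V (A k) \is a fin_num by apply: enorm_bounded_fin_num => //; exists k.
pose a := fine (V (A k)); have VA : V (A k) = a%:E by rewrite fineK.
have a0 : 0 < a.
  rewrite -lte_fin -VA; apply: lt_le_trans (@lebesgue_eball_gt0 R n m d d0) _.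
  by apply: le_measure; [rewrite inE; exact: measurable_eball|rewrite inE|].
exists a => //; split=> //.
have [r r0 [VW CI]] := centroid_inequality hQ p1 n0 m0 (mA k) d0 k0 dA Ak (ltW pn) VA.
pose w := om `^ n%:R^-1 * r.
have w0 : 0 < w := mulr_gt0 (powR_gt0 _ om0) r0.
have VW' : lebesgue_mx (centroid_body p Q (A k) : set X) = (w ^+ n)%:E.
  by rewrite VW /w exprMn powR_rootK // ltW.
have wp : w `^ p = om `^ (p / n%:R) * r `^ p.
  by rewrite /w (powRM p (powR_ge0 om _) (ltW r0)) -powRrM [_ * p]mulrC.
have [CC CC0 hCC] := centroid_support_upper hQ p1 m0 (mA k) d0 k0 dA Ak.
have cH := continuous_centroid_support hQ p1 m0 (mA k) d0 k0 dA Ak.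
have kW := compact_centroid_body hQ p1 m0 (mA k) d0 k0 dA Ak.
have WH (x z : 'cV[R]_n) : centroid_body p Q (A k) x -> inner x z <= centroid_support p Q (A k) z by move=> h1; exact: h1.
have energy : ((n%:R * w `^ p * v `^ ((n%:R - p) / n%:R) * G)%:E <=
    \int[@lebesgue_mx R n 1]_x (centroid_power p Q (A k) (gradient f x))%:E)%E.
  have E x : centroid_power p Q (A k) (gradient f x) = centroid_support p Q (A k) (gradient f x) `^ p.
    by rewrite (centroid_support_powE hQ p1 m0 (mA k) d0 k0 dA Ak).
  under [leRHS]eq_integral do rewrite E.
  move: p1; rewrite le_eqVlt => /predU1P[p1'|p1'].
    have pw1 y : 0 <= y -> y `^ p = y by move=> y0; rewrite -p1' powRr1.
    have -> : G = 1 by rewrite /G -p1' subrr powRr0.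
    have -> : n%:R - p = n%:R - 1 by rewrite -p1'.
    rewrite mulr1 (pw1 _ (ltW w0)); under [leRHS]eq_integral do rewrite (pw1 _ (centroid_support_ge0 _ _ _ _)).
    exact: (energy_lower1 n0 fs cH (@centroid_support_ge0 R n m p Q (A k)) CC0 hCC kW w0 VW' WH v0).
  exact: (energy_lower n0 fs cH (@centroid_support_ge0 R n m p Q (A k)) CC0 hCC kW w0 VW' WH p1' pn v0).
have := le_trans energy _; rewrite energy_fubini // => /(_ _ (layer k0 VA (ltW a0))); rewrite lee_fin.
rewrite wp; move: CI; have N1 : 0 < N%:R / (N%:R + p) by rewrite divr_gt0 // addr_gt0.
rewrite powRD ?(lt0r_neq0 a0) ?implybT // powRr1 ?(ltW a0) // -/P.
have -> : (v / om) `^ ((n%:R - p) / n%:R) = v `^ ((n%:R - p) / n%:R) * om `^ (p / n%:R) / om.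
  rewrite (powRM _ (ltW v0)) ?invr_ge0 ?(ltW om0) // -mulrA; congr (_ * _).
  rewrite -powR_inv1 ?(ltW om0) // -powRrM -powRD ?(lt0r_neq0 om0) ?implybT //; congr (_ `^ _).
  by move: nR; move: (n%:R : R) => y y0; field; rewrite gt_eqF.
have rp : 0 < r `^ p := powR_gt0 _ r0.
have ap := powR_ge0 a (p / N%:R).
move: (a `^ (p / N%:R)) ap (r `^ p) rp (P `^ (p / N%:R)) (om `^ (p / n%:R)) (v `^ ((n%:R - p) / n%:R)) (N%:R / (N%:R + p)) N1 => x x0 y y0 z o t s s0 h1 h2.
have ony : 0 < om * n%:R * y := mulr_gt0 (mulr_gt0 om0 nR) y0.
rewrite -(ler_pM2r ony) [leRHS]mulrC; apply: le_trans h1.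
rewrite [leRHS](_ : _ = x * (a * s)); last by ring.
rewrite [leLHS](_ : _ = x * (n%:R * (o * y) * t * G)); last by field; rewrite gt_eqF.
by rewrite ler_wpM2l.
Qed.

Theorem affine_energy_lower : p < n%:R -> 0 < v ->
  (((v / om) `^ ((n%:R - p) / n%:R) * G * (N%:R * P) `^ (- (p / N%:R)))%:E <= affine_energy p Q f)%E.
Proof.
move=> pn v0; have om0 : 0 < om := fine_omega_gt0 R n.
have P0 : 0 < P := Pi_volume_gt0 hQ p1 n0 m0.
have G0 : 0 < G.
  rewrite /G; move: p1; rewrite le_eqVlt => /predU1P[<-|p1']; first by rewrite subrr powRr0.
  by rewrite powR_gt0 // divr_gt0 // subr_gt0.
set K := (v / om) `^ ((n%:R - p) / n%:R) * G.
have K0 : 0 < K := mulr_gt0 (powR_gt0 _ (divr_gt0 v0 om0)) G0.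
have pN : 0 < p / N%:R by rewrite divr_gt0.
(* [b] is the extreme value in [section_bound]: it solves [b^(p/N) K = P^(p/N)]. *)
pose b := (P `^ (p / N%:R) / K) `^ (N%:R / p).
have PK : 0 < P `^ (p / N%:R) / K := divr_gt0 (powR_gt0 _ P0) K0.
have b0 : 0 < b := powR_gt0 _ PK.
have bp : b `^ (p / N%:R) = P `^ (p / N%:R) / K.
  by rewrite -powRrM mulrA divfK ?gt_eqF // divff ?gt_eqF // powRr1 // ltW.
have Gb : (V [set u | (gradient_power u <= 1)%R] <= b%:E)%E.
  have cv : (V (A k.+1%:R) @[k --> \oo] --> V (\bigcup_k A k.+1%:R))%classic.
    apply: (@nondecreasing_cvg_mu _ T R V (fun k => A k.+1%:R)) => [k||i j ij]; first exact: mA.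
      by apply: bigcupT_measurable => k; exact: mA.
    apply/subsetPset => u [u1 ui]; split=> //; apply: le_trans ui _.
    by rewrite ler_nat ltnS.
  have E : \bigcup_k A k.+1%:R = [set u | gradient_power u <= 1].
    apply/seteqP; split=> [u [k _ []] //|u u1]; exists (Num.truncn (enorm (u : 'M[R]_(n, m)))) => //; split=> //.
    by apply: ltW; exact: truncnS_gt.
  move: cv; rewrite E => cv; apply: (cvge_to_le cv); apply: nearW => k.
  have [|a a0 [-> ha]] := @section_bound k.+1%:R pn v0; first by rewrite ltr0n.
  rewrite lee_fin; rewrite -/K in ha.
  have : a `^ (p / N%:R) <= b `^ (p / N%:R) by rewrite bp ler_pdivlMr.
  move/(ler_powR_mono (ltW (divr_gt0 NR p0)) (powR_ge0 _ _)); rewrite -[(a `^ _) `^ _]powRrM -[(b `^ _) `^ _]powRrM.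
  rewrite (_ : p / N%:R * (N%:R / p) = 1); last by rewrite mulrA divfK ?gt_eqF // divff ?gt_eqF.
  by rewrite (powRr1 (ltW a0)) (powRr1 (ltW b0)).
rewrite affine_energyE; move: Gb; set z := lebesgue_mx _ => Gb.
have zfin : z \is a fin_num by rewrite ge0_fin_numE ?measure_ge0 //; exact: le_lt_trans Gb (ltry _).
have z0 : 0 <= fine z by rewrite fine_ge0 // measure_ge0.
move: Gb; rewrite -(fineK zfin); move: (fine z) z0 => y y0; rewrite lee_fin => yb.
rewrite -EFinM npoweRE ?mulr_ge0 ?(ltW NR) //; case: ifPn => [_|Ny0]; first by rewrite leey.
have yp : 0 < y by rewrite lt_neqAle y0 andbT eq_sym; apply: contraNneq Ny0 => ->; rewrite mulr0.
rewrite lee_fin; apply: (@le_trans _ _ ((N%:R * b) `^ (- (p / N%:R)))).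
  rewrite (powRM _ (ltW NR) (ltW P0)) (powRM _ (ltW NR) (ltW b0)) mulrCA [leRHS]mulrC.
  rewrite [leLHS]mulrC -mulrA; move: (powR_gt0 (- (p / N%:R)) NR) => h1.
  have -> : b `^ (- (p / N%:R)) = K * P `^ (- (p / N%:R)) by rewrite powRN bp invf_div powRN.
  by rewrite mulrA.
rewrite !powRN lef_pV2 ?posrE ?powR_gt0 ?mulr_gt0 //.
by apply: ler_powR_mono; rewrite ?(ltW pN) ?mulr_ge0 ?(ltW NR) // ler_pM2l.
Qed.

End affine_energy_lower.

(** * Smooth truncated powers *)

Section smooth_functions.
Context (R : realType) (n : nat).
Implicit Types (f g : 'cV[R]_n -> R) (x : 'cV[R]_n).

(** A syntactic class closed under partial derivatives. In [smooth_comp], [d] is the whole sequence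
    of derivatives of the outer function, and it has to be differentiable only at values taken by
    [g]; this admits powers of shifted nonnegative functions. *)
Inductive smooth_fun : ('cV[R]_n -> R) -> Prop :=
| smooth_cst c : smooth_fun (fun=> c)
| smooth_coord i : smooth_fun (fun x => x i 0)
| smoothD f g : smooth_fun f -> smooth_fun g -> smooth_fun (fun x => f x + g x)
| smoothM f g : smooth_fun f -> smooth_fun g -> smooth_fun (fun x => f x * g x)
| smooth_comp g (d : nat -> R -> R) : smooth_fun g ->
    (forall k x, is_derive (g x) (1 : R) (d k) (d k.+1 (g x))) -> smooth_fun (fun x => d 0 (g x)).

Lemma smooth_sum (I : Type) (r : seq I) (F : I -> 'cV[R]_n -> R) :
  (forall i, smooth_fun (F i)) -> smooth_fun (fun x => \sum_(i <- r) F i x).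
Proof.
move=> sF; elim: r => [|i r IH].
  rewrite (_ : (fun _ => _) = fun=> 0); first exact: smooth_cst.
  by apply/funext => x; rewrite big_nil.
rewrite (_ : (fun _ => _) = fun x => F i x + \sum_(i <- r) F i x); first exact: smoothD.
by apply/funext => x; rewrite big_cons.
Qed.

Lemma line_is_derive (U : normedModType R) (F : U -> R) (z v : U) (df : R) :
  is_derive 0 (1 : R) (fun s => F (z + s *: v)) df -> is_derive z v F df.
Proof.
have E : (fun h => h^-1 *: (((fun s => F (z + s *: v)) \o shift 0) (h *: (1 : R)) - F (z + 0 *: v))) =
         (fun h => h^-1 *: ((F \o shift z) (h *: v) - F z)).
  apply/funext => h /=; congr (_ *: (F _ - F _)); last by rewrite scale0r addr0.
  by rewrite [h%:A]mulr1 addr0 addrC.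
by case; rewrite /derivable /derive E => h1 h2; split.
Qed.

Lemma is_derive_comp_line (U : normedModType R) (G : U -> R) (d : R -> R) (z v : U) (a b : R) :
  is_derive (G z) (1 : R) d a -> is_derive z v G b -> is_derive z v (fun s => d (G s)) (a * b).
Proof.
move=> Dd Dg; apply: line_is_derive.
have Dl : is_derive 0 (1 : R) (fun s => G (z + s *: v)) b.
  have [] := Dg; rewrite -[z in derivable _ z](addr0 z) -(scale0r v) => h1 <-.
  by have := is_derive_line h1; rewrite scale0r addr0.
apply: (@is_derive1_comp R d (fun s => G (z + s *: v)) 0 a b) => //.
by rewrite scale0r addr0.
Qed.

Lemma is_derive_coord i x v : is_derive x v (fun y => y i 0) (v i 0).
Proof.
apply: line_is_derive.
rewrite (_ : (fun s => _) = cst (x i 0) + v i 0 \*: id); last by apply/funext => s; rewrite !fctE !mxE mulrC.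
by apply: is_derive_eq (is_deriveD (is_derive_cst (x i 0) 0 (1 : R)) (is_deriveZ (v i 0) (is_derive_id 0 (1 : R)))) _; rewrite add0r scaler1.
Qed.

Lemma smooth_is_derive f i : smooth_fun f ->
  exists2 df, smooth_fun df & forall x, is_derive x (delta_mx i 0) f (df x).
Proof.
elim=> [c|j|f1 g1 sf [df sdf Df] sg [dg sdg Dg]|f1 g1 sf [df sdf Df] sg [dg sdg Dg]|g d sg [dg sdg Dg] dD].
- by exists (fun=> 0); [exact: smooth_cst|move=> x; exact: is_derive_cst].
- exists (fun=> (delta_mx i 0 : 'cV[R]_n) j 0); first exact: smooth_cst.
  by move=> x; exact: is_derive_coord.
- by exists (fun x => df x + dg x); [exact: smoothD|move=> x; exact: is_deriveD].
- exists (fun x => f1 x * dg x + g1 x * df x); first by apply: smoothD; exact: smoothM.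
  by move=> x; exact: (is_deriveM (Df x) (Dg x)).
- exists (fun x => d 1 (g x) * dg x).
    by apply: smoothM => //; apply: (smooth_comp (d := fun k => d k.+1)) => // k x; exact: dD.
  by move=> x; apply: is_derive_comp_line.
Qed.

Lemma smooth_continuous f : smooth_fun f -> continuous f.
Proof.
elim=> [c|j|f1 g1 _ cf _ cg|f1 g1 _ cf _ cg|g d _ cg dD] x.
- exact: cst_continuous.
- exact: coord_continuous.
- exact: (cvgD (cf x) (cg x)).
- exact: (cvgM (cf x) (cg x)).
- apply: (@continuous_comp _ _ _ g (d 0)); first exact: cg.
  by have [/derivable1_diffP/differentiable_continuous] := dD 0 x.
Qed.

Lemma smooth_Ck f k : smooth_fun f -> is_Ck k f.
Proof.
elim: k f => [|k IH] f sf /=; first exact: smooth_continuous.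
split=> [i x|i]; have [df sdf Df] := smooth_is_derive i sf; first by have [] := Df x.
rewrite (_ : partial i f = df); first exact: IH.
by apply/funext => x; have [_ <-] := Df x.
Qed.

End smooth_functions.

(** * A smooth positive part *)

Section flat.
Context (R : realType).
Implicit Types (P : {poly R}) (t y : R).

(** The family [P(1/t) exp(-1/t)], extended by 0, is closed under differentiation, so all
    derivatives of [exp(-1/t)] are treated at once; [flat_step] is the action on [P]. *)
Definition flat_fun P t : R := if 0 < t then P.[t^-1] * expR (- t^-1) else 0.

Let exprn_le_expR j y : 0 < y -> y ^+ j <= j`!%:R * expR y.
Proof.
case: j => [|j] y0; first by rewrite expr0 fact0 mul1r -expR0 ler_expR ltW.
have := @expR_ge1Dxn R y j (ltW y0).
have f0 : (0 : R) < (j.+1)`!%:R by rewrite ltr0n fact_gt0.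
move=> h; rewrite -ler_pdivrMl // mulrC; apply: le_trans h; by rewrite lerDr.
Qed.

Let poly_expR_bound P : forall j, exists2 C, 0 <= C & forall y, 0 < y -> `|P.[y]| * y ^+ j <= C * expR y.
Proof.
elim/poly_ind: P => [|P c IH] j.
  by exists 0 => // y _; rewrite horner0 normr0 !mul0r.
have [C C0 hC] := IH j.+1; exists (C + `|c| * j`!%:R) => [|y y0].
  by rewrite addr_ge0 // mulr_ge0.
rewrite hornerMXaddC; have yj : 0 <= y ^+ j by rewrite exprn_ge0 // ltW.
apply: (@le_trans _ _ ((`|P.[y]| * y + `|c|) * y ^+ j)).
  by apply: ler_wpM2r => //; apply: le_trans (ler_normD _ _) _; rewrite normrM (gtr0_norm y0).
rewrite mulrDl -mulrA -exprS mulrDl lerD ?hC // -mulrA.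
by rewrite ler_wpM2l // exprn_le_expR.
Qed.

Definition flat_step P : {poly R} := 'X ^+ 2 * (P - P^`()).

Lemma is_derive_flat P t : is_derive t (1 : R) (flat_fun P) (flat_fun (flat_step P) t).
Proof.
have [t0|t0|t0] := ltgtP 0 t; last rewrite -t0.
- apply: (@near_eq_is_derive R R R (fun s : R => P.[s^-1] * expR (- s^-1))).
    near=> s; rewrite /flat_fun ifT //; near: s; exact: lt_nbhsr.
  have DV : is_derive t (1 : R) (fun s => s^-1) (- t ^- 2).
    by have := @is_deriveV R id t 1 1 (lt0r_neq0 t0) (is_derive_id _ _); rewrite scaler1.
  have DP := @is_derive1_comp R (horner P) (fun s => s^-1) t _ _ (is_derive_poly P _) DV.
  have DN := @is_derive1_comp R expR (fun s => - s^-1) t _ _ (is_derive_expR _) (is_deriveN DV).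
  apply: is_derive_eq (is_deriveM DP DN) _.
  rewrite /flat_fun t0 /flat_step !hornerE /=; move: (expR _) (P.[_]) => E p; rewrite /GRing.scale /=.
  by field; rewrite gt_eqF.
- apply: (@near_eq_is_derive _ _ _ (cst 0)).
    near=> s; rewrite /flat_fun ifF //; apply/negbTE; rewrite -leNgt ltW //; near: s; exact: lt_nbhsl.
  by rewrite /flat_fun ltNge (ltW t0) /=; exact: is_derive_cst.
- have [C C0 hC] := poly_expR_bound P 2.
  have b h : `|flat_fun P h| <= C * h ^+ 2.
    rewrite /flat_fun; case: ifPn => h0; last by rewrite normr0 mulr_ge0 // sqr_ge0.
    have hi : 0 < h^-1 by rewrite invr_gt0.
    rewrite normrM (gtr0_norm (expR_gt0 _)) expRN ler_pdivrMr ?expR_gt0 // mulrAC.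
    by rewrite -ler_pdivrMr ?exprn_gt0 // -exprVn; exact: hC.
  have f0 P' : flat_fun P' 0 = 0 by rewrite /flat_fun ltxx.
  have cv : h^-1 *: ((flat_fun P \o shift 0) (h *: (1 : R)) - flat_fun P 0) @[h --> 0^'] --> (0 : R).
    apply/cvgr0Pnorm_lt => e e0; have C1 : 0 < C + 1 by rewrite ltr_wpDl.
    near=> h; rewrite f0 subr0 /= addr0 [h%:A]mulr1 normrM normfV.
    have h0 : 0 < `|h| by rewrite normr_gt0; near: h; exact: nbhs_dnbhs_neq.
    rewrite mulrC ltr_pdivrMr //; apply: le_lt_trans (b h) _.
    rewrite -real_normK ?num_real // expr2 mulrA ltr_pM2r //.
    apply: (@le_lt_trans _ _ ((C + 1) * `|h|)); first by rewrite ler_wpM2r // lerDl.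
    rewrite mulrC -ltr_pdivlMr //; near: h; apply: dnbhs0_lt; exact: divr_gt0.
  rewrite f0; split; first by apply/cvg_ex; exists 0.
  exact: cvg_lim cv.
Unshelve. all: by end_near.
Qed.

Let one1 y : (1 : {poly R}).[y] = 1. Proof. by rewrite -polyC1 hornerC. Qed.

Lemma smooth_flat n g : smooth_fun g -> smooth_fun (fun x : 'cV[R]_n => flat_fun 1 (g x)).
Proof.
move=> sg; pose d k := flat_fun (iter k flat_step 1).
by apply: (smooth_comp (d := d)) => // k x; exact: is_derive_flat.
Qed.

(* Since exp(-1/t) (1 + 1/t) <= 1, this smooth version of [Num.max 0 t] has slopes in [0, 1]. *)
Definition soft t : R := t * flat_fun 1 t.

Definition dsoft t : R := if 0 < t then expR (- t^-1) * (1 + t^-1) else 0.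

Lemma is_derive_soft t : is_derive t (1 : R) soft (dsoft t).
Proof.
apply: is_derive_eq (is_deriveM (is_derive_id t 1) (is_derive_flat 1 t)) _.
rewrite /dsoft /flat_fun; case: ifPn => t0; rewrite /GRing.scale /=; last by rewrite !mulr0 mul0r addr0.
rewrite /flat_step -[1]polyC1 derivC subr0 hornerM hornerXn polyC1 !one1; move: (expR _) => E; field; by rewrite gt_eqF.
Qed.

Lemma dsoft_ge0 t : 0 <= dsoft t.
Proof. by rewrite /dsoft; case: ifP => // t0; rewrite mulr_ge0 ?expR_ge0 // addr_ge0 // invr_ge0 ltW. Qed.

Lemma dsoft_le1 t : dsoft t <= 1.
Proof.
rewrite /dsoft; case: ifP => // t0; rewrite expRN mulrC ler_pdivrMr ?expR_gt0 // mul1r.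
exact: expR_ge1Dx.
Qed.

Lemma dsoft_le0 t : t <= 0 -> dsoft t = 0.
Proof. by move=> t0; rewrite /dsoft ltNge t0. Qed.

Lemma soft_le0 t : t <= 0 -> soft t = 0.
Proof. by move=> t0; rewrite /soft /flat_fun ltNge t0 mulr0. Qed.

Lemma soft_ge t : t - 1 <= soft t.
Proof.
rewrite /soft /flat_fun; case: ifPn => t0; last by rewrite mulr0; rewrite -leNgt in t0; lra.
rewrite one1 mul1r; have := expR_ge1Dx (- t^-1).
by move=> /(ler_wpM2l (ltW t0)); rewrite mulrDr mulr1 mulrN divff ?gt_eqF.
Qed.

Lemma soft_mono s t : s <= t -> soft s <= soft t.
Proof.
move=> st; have [s0|s0] := leP s 0.
  rewrite (soft_le0 s0) /soft /flat_fun; case: ifPn => t0; rewrite ?mulr0 //.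
  by rewrite one1 mul1r mulr_ge0 ?expR_ge0 // ltW.
have t0 := lt_le_trans s0 st.
rewrite /soft /flat_fun s0 t0 !one1 !mul1r; apply: ler_pM => //; rewrite ?(ltW s0) ?expR_ge0 //.
by rewrite ler_expR lerN2 lef_pV2.
Qed.

End flat.

Section power_profile.
Context (R : realType) (e a : R).
Hypothesis e0 : 0 < e.

Let is_derive_powR_shift (b t : R) : 0 < t + e ->
  is_derive t (1 : R) (fun s => (s + e) `^ b) (b * (t + e) `^ (b - 1)).
Proof.
move=> te; have D : is_derive t (1 : R) (fun s => s + e) 1.
  by apply: is_derive_eq (is_deriveD (is_derive_id t (1 : R)) (is_derive_cst e t (1 : R))) _; rewrite addr0.
have := @is_derive1_comp R (fun s => s `^ b) (fun s => s + e) t _ _ (is_derive1_powR b te) D.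
by rewrite mulr1.
Qed.

Let coef k : R := \prod_(l < k) (a - l%:R).

Let power_derive k t : R := coef k * (t + e) `^ (a - k%:R).

Let power_derive_is_derive k (t : R) : 0 <= t -> is_derive t (1 : R) (power_derive k) (power_derive k.+1 t).
Proof.
move=> t0; have te : 0 < t + e by rewrite ltr_wpDl.
apply: is_derive_eq (is_deriveZ _ (is_derive_powR_shift _ te)) _.
by rewrite /power_derive /coef big_ord_recr /= /GRing.scale /= -mulrA -natr1 opprD addrA.
Qed.

Lemma smooth_power_shift n (q : 'cV[R]_n -> R) : (forall x, 0 <= q x) -> smooth_fun q ->
  smooth_fun (fun x => (q x + e) `^ a).
Proof.
move=> q0 sq; rewrite (_ : (fun x => _) = fun x => power_derive 0 (q x)).
  by apply: smooth_comp => // k x; exact: power_derive_is_derive.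
by apply/funext => x; rewrite /power_derive /coef big_ord0 mul1r subr0.
Qed.

Lemma is_derive_power_shift (t : R) : 0 <= t ->
  is_derive t (1 : R) (fun s => (s + e) `^ a) (a * (t + e) `^ (a - 1)).
Proof. by move=> t0; apply: is_derive_powR_shift; rewrite ltr_wpDl. Qed.

End power_profile.

(** * Smooth truncation of a negative power *)

Section profile.
Context (R : realType) (g e M : R).
Hypotheses (g0 : 0 < g) (e0 : 0 < e) (M3 : 3 < M).

Let s t := (1 + e) `^ (g / 2) * (t + e) `^ (- (g / 2)).
Let A1 := soft (M - 1).
Let A := soft A1.

(** With [t = |y|^2], [s] is a smoothing of [|y|^(-g)] normalized by [s 1 = 1]. The inner [soft]
    vanishes where [M s <= 1], giving bounded support; the outer one vanishes where [s >= 1], so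
    that the profile is exactly 1 on [[0, 1]]. As [A >= M - 3], truncation costs only the factor
    [M / (M - 3)] in the slope. Sums with [- 1] times a term match the constructors of
    [smooth_fun]. *)
Definition profile t : R := A^-1 * (A + - 1 * soft (A1 + - 1 * soft (M * s t + - 1))).

Definition profile_slope t : R :=
  A^-1 * (dsoft (A1 - soft (M * s t - 1)) * dsoft (M * s t - 1)) *
  (M * (1 + e) `^ (g / 2) * (g / 2) * (t + e) `^ (- (g / 2) - 1)).

Let A_ge : M - 3 <= A.
Proof. have := soft_ge (M - 1); have := soft_ge A1; rewrite -/A -/A1; lra. Qed.

Let A0 : 0 < A. Proof. by move: A_ge M3; lra. Qed.

Let M0 : 0 < M. Proof. by move: M3; lra. Qed.

Let s_ge1 t : 0 <= t <= 1 -> 1 <= s t.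
Proof.
move=> /andP[t0 t1]; rewrite /s powRN ler_pdivlMr ?mul1r ?powR_gt0 ?ltr_wpDl //.
by apply: ler_powR_mono; [rewrite divr_ge0 // ltW|rewrite addr_ge0 // ltW|rewrite lerD2r].
Qed.

Let inner_le0 t : 0 <= t <= 1 -> A1 - soft (M * s t - 1) <= 0.
Proof.
move=> /s_ge1 s1; rewrite subr_le0; apply: soft_mono; rewrite lerB //.
by rewrite -[leLHS]mulr1 ler_pM2l.
Qed.

Lemma profile_eq1 t : 0 <= t <= 1 -> profile t = 1.
Proof.
by move=> /inner_le0 t1; rewrite /profile !mulN1r (soft_le0 t1) oppr0 addr0 mulVf ?gt_eqF.
Qed.

Lemma profile_slope_eq0 t : 0 <= t <= 1 -> profile_slope t = 0.
Proof. by move=> /inner_le0 t1; rewrite /profile_slope (dsoft_le0 t1) !(mul0r, mulr0). Qed.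

Lemma profile_support : exists2 r, 0 < r & forall t, 0 <= t -> profile t != 0 -> t <= r.
Proof.
exists ((1 + e) * M `^ (2 / g)) => [|t t0]; first by rewrite mulr_gt0 ?powR_gt0 // addr_gt0.
apply: contraR; rewrite -ltNge => rt.
have te : 0 < t + e by rewrite ltr_wpDl.
have g2 : 0 <= g / 2 by rewrite divr_ge0 // ltW.
have h : M * s t - 1 <= 0.
  rewrite subr_le0 /s powRN mulrA ler_pdivrMr ?powR_gt0 // mul1r.
  have -> : M = (M `^ (2 / g)) `^ (g / 2).
    by rewrite -powRrM mulrA divfK ?gt_eqF // divff // powRr1 // ltW.
  rewrite -powRM ?powR_ge0 ?addr_ge0 ?(ltW e0) //; apply: ler_powR_mono => //.
    by rewrite mulr_ge0 ?powR_ge0 // addr_ge0 // ltW.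
  by rewrite mulrC (le_trans (ltW rt)) // lerDl ltW.
by rewrite /profile !mulN1r (soft_le0 h) subr0 subrr mulr0.
Qed.

Lemma is_derive_profile (t : R) : 0 <= t -> is_derive t (1 : R) profile (- profile_slope t).
Proof.
move=> t0; have D1 := is_derive_power_shift (- (g / 2)) e0 t0.
have D2 : is_derive t (1 : R) (fun y => M * s y + - 1) (M * ((1 + e) `^ (g / 2) * (- (g / 2) * (t + e) `^ (- (g / 2) - 1)))).
  apply: is_derive_eq (is_deriveD (is_deriveZ M (is_deriveZ ((1 + e) `^ (g / 2)) D1)) (is_derive_cst (- 1 : R) t (1 : R))) _.
  by rewrite addr0.
have D3 := @is_derive1_comp R (@soft R) (fun y => M * s y + - 1) t _ _ (is_derive_soft (M * s t + - 1)) D2.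
have D4 : is_derive t (1 : R) (fun y => A1 + - 1 * soft (M * s y + - 1))
  (- 1 * (dsoft (M * s t + - 1) * (M * ((1 + e) `^ (g / 2) * (- (g / 2) * (t + e) `^ (- (g / 2) - 1)))))).
  by apply: is_derive_eq (is_deriveD (is_derive_cst A1 t (1 : R)) (is_deriveZ (- 1) D3)) _; rewrite add0r.
have D5 := @is_derive1_comp R (@soft R) (fun y => A1 + - 1 * soft (M * s y + - 1)) t _ _
  (is_derive_soft (A1 + - 1 * soft (M * s t + - 1))) D4.
apply: is_derive_eq (is_deriveZ A^-1 (is_deriveD (is_derive_cst A t (1 : R)) (is_deriveZ (- 1) D5))) _.
rewrite add0r /profile_slope !mulN1r /GRing.scale /=.
move: (dsoft (M * s t - 1)) (dsoft (A1 - soft (M * s t - 1))) ((1 + e) `^ (g / 2)) ((t + e) `^ (- (g / 2) - 1)) (A^-1) (g / 2).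
by move=> x1 x2 x3 x4 x5 x6; ring.
Qed.

Lemma smooth_profile n (q : 'cV[R]_n -> R) : (forall x, 0 <= q x) -> smooth_fun q ->
  smooth_fun (fun x => profile (q x)).
Proof.
move=> q0 sq.
have sS f : smooth_fun f -> smooth_fun (fun x : 'cV[R]_n => soft (f x)).
  by move=> sf; apply: smoothM => //; exact: smooth_flat.
have c := @smooth_cst R n.
apply: (smoothM (c _)); apply: (smoothD (c _)); apply: (smoothM (c _)); apply: (sS).
apply: (smoothD (c _)); apply: (smoothM (c _)); apply: (sS); apply: smoothD (c _).
apply: (smoothM (c _)); apply: (smoothM (c _)); exact: smooth_power_shift.
Qed.

Lemma profile_slope_ge0 t : 0 <= t -> 0 <= profile_slope t.
Proof.
move=> t0; rewrite /profile_slope; apply: mulr_ge0.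
  by apply: mulr_ge0; [rewrite invr_ge0 ltW|exact: (mulr_ge0 (dsoft_ge0 _) (dsoft_ge0 _))].
by apply: mulr_ge0 (powR_ge0 _ _); apply: mulr_ge0 (mulr_ge0 (ltW M0) (powR_ge0 _ _)) _; rewrite divr_ge0 // ltW.
Qed.

Lemma profile_slope_le t : 0 < t ->
  profile_slope t <= M / (M - 3) * (1 + e) `^ (g / 2) * (g / 2) * t `^ (- (g / 2) - 1).
Proof.
move=> t0; have MM : 0 < M - 3 by move: M3; lra.
have te : 0 < t + e by rewrite addr_gt0.
rewrite /profile_slope.
have d1 := mulr_ge0 (dsoft_ge0 (A1 - soft (M * s t - 1))) (dsoft_ge0 (M * s t - 1)).
have d2 : dsoft (A1 - soft (M * s t - 1)) * dsoft (M * s t - 1) <= 1.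
  by apply: mulr_ile1; rewrite ?dsoft_ge0 ?dsoft_le1.
have d3 : (t + e) `^ (- (g / 2) - 1) <= t `^ (- (g / 2) - 1).
  rewrite -opprD !powRN lef_pV2 ?posrE ?powR_gt0 //.
  by apply: ler_powR_mono; [rewrite addr_ge0 // divr_ge0 // ltW|exact: ltW|rewrite lerDl ltW].
have d4 : A^-1 <= (M - 3)^-1 by rewrite lef_pV2.
have d5 : 0 <= M * (1 + e) `^ (g / 2) * (g / 2).
  by apply: mulr_ge0 (mulr_ge0 (ltW M0) (powR_ge0 _ _)) _; rewrite divr_ge0 // ltW.
have Ai : 0 <= A^-1 by rewrite invr_ge0 ltW.
apply: (@le_trans _ _ ((M - 3)^-1 * (M * (1 + e) `^ (g / 2) * (g / 2) * t `^ (- (g / 2) - 1)))).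
  apply: ler_pM; [exact: mulr_ge0|exact: mulr_ge0 (powR_ge0 _ _)| |exact: ler_wpM2l].
  by rewrite -[leRHS]mulr1; apply: ler_pM.
by move: (_ `^ (g / 2)) (t `^ _) (M - 3)^-1 => x1 x2 x3; rewrite le_eqVlt; apply/orP; left; apply/eqP; field.
Qed.

End profile.

Lemma npoweR_le (R : realType) (b a : R) (x : \bar R) : 0 < b -> 0 < a -> (b%:E <= x)%E ->
  (npoweR x a <= (b `^ (- a))%:E)%E.
Proof.
move=> b0 a0; case: x => [x||] //.
- rewrite lee_fin => bx; have x0 := lt_le_trans b0 bx.
  rewrite npoweRE ?(ltW x0) // gt_eqF // lee_fin !powRN lef_pV2 ?posrE ?powR_gt0 //.
  by apply: ler_powR_mono => //; exact: ltW.
- by move=> _; rewrite /npoweR poweRyr ?gt_eqF // invey lee_fin powR_ge0.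
Qed.

(** * Energies of the test functions *)

Section test_function.
Context (R : realType) (n m : nat) (p : R) (Q : set 'rV[R]_m) (psi : 'M[R]_n) (y0 : 'cV[R]_n) (g e M : R).
Hypotheses (hQ : convex_body_o Q) (p1 : 1 <= p) (n0 : (0 < n)%N) (m0 : (0 < m)%N).
Hypotheses (upsi : psi \in unitmx) (g0 : 0 < g) (e0 : 0 < e) (M3 : 3 < M) (gp : n%:R < (g + 1) * p).
Local Notation h := (support_fun Q).
Local Notation N := (n * m)%N.
Local Notation X := (borel_mx R n 1).

Let p0 : 0 < p. Proof. exact: lt_le_trans p1. Qed.

Let y x : 'cV[R]_n := psi *m (x - y0).
Let q x : R := inner (y x) (y x).

(** In the variable [psi (x - y0)] this is a truncated power of exponent [-g]. Its gradient decays
    with exponent [-(g + 1)], so [gp] is the integrability of the [p]-th power at infinity. *)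
Definition test_function x : R := profile g e M (q x).

Let q0 x : 0 <= q x. Proof. by rewrite /q -enorm_sqr sqr_ge0. Qed.

Let smooth_q : smooth_fun q.
Proof.
have yE i : smooth_fun (fun x => y x i 0).
  rewrite (_ : (fun x => y x i 0) = fun x : 'cV[R]_n => \sum_j psi i j * (x j 0 + - y0 j 0)).
    apply: (@smooth_sum R n _ _ (fun j (x : 'cV[R]_n) => psi i j * (x j 0 + - y0 j 0))) => j.
    apply: (@smoothM R n (fun=> psi i j) (fun x => x j 0 + - y0 j 0)); first exact: smooth_cst.
    apply: (@smoothD R n (fun x => x j 0) (fun=> - y0 j 0)); [exact: smooth_coord|exact: smooth_cst].
  by apply/funext => x; rewrite /y mxE; apply: eq_bigr => j _; rewrite !mxE.
rewrite (_ : q = fun x => \sum_i y x i 0 * y x i 0).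
  by apply: (@smooth_sum R n _ _ (fun i x => y x i 0 * y x i 0)) => i; exact: (smoothM (yE i) (yE i)).
by apply/funext => x; rewrite /q innerE; apply: eq_bigr => i _; rewrite big_ord1.
Qed.

Lemma test_function_eq1 x : enorm (psi *m (x - y0)) <= 1 -> test_function x = 1.
Proof.
move=> x1; apply: profile_eq1 => //; rewrite q0 /q -enorm_sqr.
by rewrite expr_le1 // enorm_ge0.
Qed.

Lemma test_function_Ccinfty : is_Ccinfty test_function.
Proof.
split; first by move=> k; apply: smooth_Ck; exact: (smooth_profile g M e0 q0 smooth_q).
have [r r0 hr] := profile_support g0 e0 M3.
pose F (z : 'cV[R]_n) := invmx psi *m z + y0.
have kB : compact (F @` eball (Num.sqrt r)).
  apply: continuous_compact.
    apply: continuous_subspaceT => z; apply: (@continuousD _ _ _ (fun z => invmx psi *m z) (cst y0)).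
      exact: continuous_mulmxl.
    exact: cst_continuous.
  by apply: (@compact_mx R n 1 _ (Num.sqrt r)) => //; apply: closed_le_continuous; exact: continuous_enorm.
apply: (subclosed_compact (@closed_closure _ _) kB).
rewrite closureE => x; apply; split; first exact: (compact_closed (@norm_hausdorff _ _) kB).
move=> z /(hr _ (q0 z)) qr; exists (y z).
  by rewrite /eball /= /enorm; exact: ler_wsqrtr.
by rewrite /F /y mulKmx // subrK.
Qed.

Lemma gradient_test_function x :
  gradient test_function x = - (2 * profile_slope g e M (q x)) *: (psi^T *m y x).
Proof.
apply/matrixP => i j; rewrite (ord1 j) mxE.
have Dq : is_derive x (delta_mx i 0) q (2 * inner (y x) (psi *m delta_mx i 0)).
  apply: line_is_derive; set v := psi *m _.
  rewrite (_ : (fun s => _) = cst (q x) + (2 * inner (y x) v) \*: id + inner v v \*: (id * id)).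
    have Did := @is_derive_id R R 0 1.
    apply: is_derive_eq (is_deriveD (is_deriveD (is_derive_cst (q x) 0 (1 : R)) (is_deriveZ _ Did)) (is_deriveZ _ (is_deriveM Did Did))) _.
    by rewrite add0r !scale0r addr0 scaler0 addr0; exact: mulr1.
  apply/funext => s; rewrite !fctE /q /=.
  have -> : y (x + s *: delta_mx i 0) = y x + s *: v by rewrite /y addrAC mulmxDr -scalemxAr.
  rewrite innerDl !innerDr !innerZl !innerZr [inner v (y x)]innerC; rewrite /GRing.scale /=; ring.
have [_ E] := @is_derive_comp_line R _ q (profile g e M) x _ _ _ (is_derive_profile g M e0 (q0 x)) Dq.
rewrite /partial E !mxE [inner _ _](_ : _ = \sum_j0 psi^T i j0 * y x j0 0); first by ring.
rewrite innerE; apply: eq_bigr => k _; rewrite big_ord1 -colE !mxE; exact: mulrC.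
Qed.

Let L := M / (M - 3) * (1 + e) `^ (g / 2) * g.
Let a := (g + 1) * p.

Let L0 : 0 < L.
Proof.
have M0 : 0 < M by move: M3; lra.
have M30 : 0 < M - 3 by move: M3; lra.
exact: (mulr_gt0 (mulr_gt0 (divr_gt0 M0 M30) (powR_gt0 _ (addr_gt0 ltr01 e0))) g0).
Qed.

Let a0 : 0 < a - n%:R. Proof. by rewrite subr_gt0. Qed.

Let slope_le t : 0 < t -> 2 * profile_slope g e M (t ^+ 2) <= L * t `^ (- (g + 2)).
Proof.
move=> t0; have t20 : 0 < t ^+ 2 by rewrite exprn_gt0.
have := ler_wpM2l (ler0n R 2) (profile_slope_le g0 e0 M3 t20) => /le_trans; apply.
have -> : (t ^+ 2) `^ (- (g / 2) - 1) = t `^ (- (g + 2)).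
  by rewrite -powR_mulrn ?(ltW t0) // -powRrM; congr (_ `^ _); field.
by rewrite /L; move: (M / (M - 3)) (_ `^ (g / 2)) (t `^ _) => x1 x2 x3; rewrite le_eqVlt; apply/orP; left; apply/eqP; field.
Qed.

Let ker (w : 'M[R]_(n, m)) (v : 'cV[R]_n) : R := h ((- v)^T *m w) `^ p.

Let ker0 w v : 0 <= ker w v. Proof. exact: powR_ge0. Qed.

Let mker w : measurable_fun setT (ker w : X -> measurableTypeR R).
Proof.
apply: measurable_powR_comp.
have mN : measurable_fun setT (fun x : X => - (x : 'cV[R]_n) : X).
  rewrite (_ : (fun x : X => _) = fun x : X => - 1%:M *m (x : 'cV[R]_n)); first exact: measurable_mulmxl.
  by apply/funext => x; rewrite mulNmx mul1mx.
exact: (measurable_support2 hQ mN (@measurable_cst _ _ X (borel_mx R n m) setT w)).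
Qed.

Let D : set X := [set x : 'cV[R]_n | 1 <= enorm x].

Let mD : measurable D.
Proof.
rewrite (_ : D = (@enorm R n 1 : X -> measurableTypeR R) @^-1` `[1, +oo[%classic).
  exact: (measurable_preimage (@measurable_enorm R n 1)).
by apply/seteqP; split=> x; rewrite /D /= in_itv /= andbT.
Qed.

Let tail w : X -> \bar R := (fun x : X => (enorm (x : 'cV[R]_n) `^ (- a) * ker w (normalize (x : 'cV[R]_n)))%:E) \_ D.

Let tail_ge0 w x : (0 <= tail w x)%E.
Proof. by rewrite /tail patchE; case: ifP => // _; rewrite lee_fin mulr_ge0 // powR_ge0. Qed.

Let mtail w : measurable_fun setT (tail w).
Proof.
apply/(measurable_restrictT _ mD); apply/measurable_EFinP; apply: measurable_funTS.
apply: measurable_funM.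
  by apply: measurable_powR_comp; exact: measurable_enorm.
exact: (measurableT_comp (mker w) (@measurable_normalize R n 1)).
Qed.

Let integral_tail w : (\int[@lebesgue_mx R n 1]_x tail w x = ((a - n%:R)^-1 * Pi_fun Q p w)%:E)%E.
Proof.
have n10 : (0 < n * 1)%N by rewrite muln1.
have na : (n * 1)%:R < a by rewrite muln1.
rewrite -integral_mkcond (tail_integral n10 (mker w) (ker0 w) na) muln1 EFinM; congr (_ * _)%E.
exact: Pi_funN.
Qed.

(** The gradient vanishes on the ellipsoid [|y x| <= 1]. Outside it the gradient is a nonnegative
    multiple of [- psi^T (y x)], with the multiple times [|y x|] at most [L |y x|^(-(g+1))];
    homogeneity of [h] moves [psi] onto [u] and separates radius from direction. *)
Let energy_le_tail u x :
  ((h ((gradient test_function x)^T *m u) `^ p)%:E <= (L `^ p)%:E * tail (psi *m u) (y x))%E.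
Proof.
set w := psi *m u.
have [G G0 [E G1 Gt]] : exists2 G, 0 <= G & [/\ (gradient test_function x)^T *m u = G *: ((- y x)^T *m w),
    enorm (y x) < 1 -> G = 0 & 0 < enorm (y x) -> G <= L * enorm (y x) `^ (- (g + 2))].
  exists (2 * profile_slope g e M (q x)); first by apply: mulr_ge0 => //; exact: profile_slope_ge0.
  split=> [|x1|t0].
  - rewrite gradient_test_function linearZ /= trmx_mul trmxK -scalemxAl -mulmxA.
    by rewrite [(- y x)^T]linearN /= mulNmx scalerN scaleNr.
  - by rewrite profile_slope_eq0 ?mulr0 // q0 /q -enorm_sqr expr_le1 ?enorm_ge0 // ltW.
  - by rewrite /q -enorm_sqr; exact: slope_le.
rewrite E (supportZ hQ _ G0) (powRM _ G0 (support_ge0 hQ _)).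
have [x1|x1] := leP 1 (enorm (y x)); last first.
  rewrite (G1 x1) powR0 ?gt_eqF // mul0r; apply: mule_ge0 (tail_ge0 _ _); rewrite lee_fin; exact: powR_ge0.
rewrite /tail patchE ifT ?inE // -EFinM lee_fin.
have t0 : 0 < enorm (y x) := lt_le_trans ltr01 x1.
have := Gt t0; set t := enorm (y x) in t0 x1 * => {}Gt.
have kE : h ((- y x)^T *m w) `^ p = t `^ p * ker w (normalize (y x)).
  have {1}-> : - y x = t *: - normalize (y x) by rewrite scalerN /normalize scalerA divff ?gt_eqF // scale1r.
  rewrite linearZ /= -scalemxAl (supportZ hQ _ (ltW t0)).
  exact: (powRM _ (ltW t0) (support_ge0 hQ _)).
rewrite kE mulrA [leRHS]mulrA ler_wpM2r // -(powRM _ G0 (ltW t0)).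
have -> : L `^ p * t `^ (- a) = (L * t `^ (- (g + 1))) `^ p.
  by rewrite (powRM _ (ltW L0) (powR_ge0 _ _)) -powRrM mulNr.
apply: ler_powR_mono; [exact: ltW|exact: mulr_ge0 (ltW t0)|].
apply: le_trans (ler_wpM2r (ltW t0) Gt) _.
rewrite -mulrA -{2}(powRr1 (ltW t0)) -powRD ?(lt0r_neq0 t0) ?implybT //.
by rewrite (_ : - (g + 2) + 1 = - (g + 1)) //; ring.
Qed.

(** After the affine change of variable, which yields [dil psi], the tail integral splits into a
    radial factor and the spherical integral defining [Pi_fun]. *)
Lemma gradient_power_test_function u :
  gradient_power p Q test_function u <= dil psi * (L `^ p / (a - n%:R)) * Pi_fun Q p (psi *m u).
Proof.
have fs := test_function_Ccinfty.
rewrite -lee_fin -(gradient_powerE hQ p1 fs).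
have Lp : 0 <= L `^ p := powR_ge0 _ _.
have mT : measurable_fun setT (fun x : X => tail (psi *m u) (psi *m (x : 'cV[R]_n))).
  exact: (measurableT_comp (mtail _) (@measurable_mulmxl R n 1 n psi)).
have mT' : measurable_fun setT (fun x : X => tail (psi *m u) (y x)).
  exact: (measurableT_comp mT (@measurable_mx_shift R n 1 (- y0))).
apply: (@le_trans _ _ (\int[@lebesgue_mx R n 1]_x ((L `^ p)%:E * tail (psi *m u) (y x)))%E).
  apply: (@ge0_le_integral _ X R (@lebesgue_mx R n 1) setT measurableT).
  - by move=> x _; rewrite lee_fin powR_ge0.
  - apply/measurable_EFinP; apply: measurable_powR_comp.
    apply: (measurable_support2 hQ _ (@measurable_cst _ _ X (borel_mx R n m) setT u)).
    apply/measurable_fun_mxP => i j; apply: continuous_measurable_mx.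
    rewrite (_ : (fun x => _) = partial i test_function); first exact: Ccinfty_partial_continuous.
    by apply/funext => x; rewrite mxE.
  - by apply: emeasurable_funM mT'; exact: measurable_cst.
  - by move=> x _; exact: energy_le_tail.
rewrite (@ge0_integralZl_EFin _ X R (@lebesgue_mx R n 1) setT measurableT _ (fun x _ => tail_ge0 _ _) mT' _ Lp).
rewrite (@integral_mx_shift R n 1 (- y0) (fun x : X => tail (psi *m u) (psi *m (x : 'cV[R]_n))) mT) //.
rewrite (integral_mull_setT upsi (mtail _) (tail_ge0 _)) integral_tail expr1 -!EFinM lee_fin.
by rewrite le_eqVlt; apply/orP; left; apply/eqP; ring.
Qed.

(** The set [{G <= 1}] contains the preimage under [psi] of a sublevel set of [Pi_fun]. Acting on
    [m] columns, [psi] contributes [(dil psi)^m], whose power [-p/N] combines with the factor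
    [dil psi] in the level to the exponent [(n - p)/n]. *)
Theorem affine_energy_test_function :
  (affine_energy p Q test_function <=
   (dil psi `^ ((n%:R - p) / n%:R) * (L `^ p / (a - n%:R)) * (N%:R * Pi_volume n Q p) `^ (- (p / N%:R)))%:E)%E.
Proof.
have fs := test_function_Ccinfty; have d0 := dil_gt0 upsi.
have nR : (0 : R) < n%:R by rewrite ltr0n.
have mR : (0 : R) < m%:R by rewrite ltr0n.
have NR : (0 : R) < N%:R by rewrite natrM mulr_gt0.
have P0 : 0 < Pi_volume n Q p := Pi_volume_gt0 hQ p1 n0 m0.
set B := L `^ p / _; have B0 : 0 < B := divr_gt0 (powR_gt0 _ L0) a0.
pose k := dil psi * B; have k0 : 0 < k := mulr_gt0 d0 B0.
have ki : 0 < k^-1 by rewrite invr_gt0.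
have mP : measurable ([set u : 'M[R]_(n, m) | Pi_fun Q p u <= k^-1] : set (borel_mx R n m)).
  rewrite (_ : [set u | _] = (Pi_fun Q p : borel_mx R n m -> measurableTypeR R) @^-1` `]-oo, k^-1]%classic).
    have [c c0 hc] := Pi_lower hQ p1 n0 m0; have [C C0 hC] := Pi_upper hQ p1 n0.
    exact: (measurable_preimage (measurable_gauge_F p1 c0 C0 (Pi_homo hQ p1 n0) hc hC (Pi_convex hQ p1 n0))).
  by apply/seteqP; split=> u /=; rewrite in_itv.
pose b := Pi_volume n Q p * k^-1 `^ (N%:R / p) * dil psi ^+ m.
have b0 : 0 < b := mulr_gt0 (mulr_gt0 P0 (powR_gt0 _ ki)) (exprn_gt0 _ d0).
have Vb : lebesgue_mx ((fun u : 'M[R]_(n, m) => psi *m u) @^-1` [set u | Pi_fun Q p u <= k^-1] : set (borel_mx R n m)) = b%:E.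
  by apply: etrans (lebesgue_mx_mull upsi mP) _; rewrite (Pi_sublevel_volume hQ p1 n0 m0 ki) -EFinM.
rewrite (affine_energyE hQ p1 n0 m0 fs).
have pN : 0 < p / N%:R by rewrite divr_gt0.
apply: le_trans (npoweR_le (mulr_gt0 NR b0) pN _) _.
  rewrite EFinM lee_pmul2l // -Vb; apply: le_measure.
  - by rewrite inE; exact: (measurable_preimage (@measurable_mulmxl R n m n psi)).
  - rewrite inE (_ : [set u | _] = (gradient_power p Q test_function : borel_mx R n m -> measurableTypeR R) @^-1` `]-oo, 1]%classic).
      exact: (measurable_preimage (measurable_gradient_power hQ p1 fs)).
    by apply/seteqP; split=> u /=; rewrite in_itv.
  - move=> u /= hu; apply: le_trans (gradient_power_test_function u) _.
    by rewrite -/B -/k -ler_pdivlMl // mulr1.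
rewrite lee_fin le_eqVlt; apply/orP; left; apply/eqP.
have E : k^-1 `^ (N%:R / p) `^ (- (p / N%:R)) = k.
  rewrite -powRrM mulrN mulrA divfK ?gt_eqF // divff ?gt_eqF // powRN powRr1 ?invrK //; exact: ltW.
have E2 : (dil psi ^+ m) `^ (- (p / N%:R)) = dil psi `^ (- (p / n%:R)).
  rewrite -powR_mulrn ?(ltW d0) // -powRrM; congr (_ `^ _); rewrite natrM.
  by move: nR mR; move: (n%:R : R) (m%:R : R) => n' m' n'0 m'0; field; rewrite !gt_eqF.
have E3 : dil psi `^ ((n%:R - p) / n%:R) = dil psi * dil psi `^ (- (p / n%:R)).
  rewrite -{2}(powRr1 (ltW d0)) -powRD ?(lt0r_neq0 d0) ?implybT //; congr (_ `^ _).
  by move: nR; move: (n%:R : R) => n' n'0; field; rewrite gt_eqF.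
rewrite /b (powRM _ (ltW NR) (ltW b0)) (powRM _ (mulr_ge0 (ltW P0) (powR_ge0 _ _)) (exprn_ge0 _ (ltW d0))).
rewrite (powRM _ (ltW P0) (powR_ge0 _ _)) E E2 E3 (powRM _ (ltW NR) (ltW P0)) /k; ring.
Qed.

End test_function.

(** * Affine capacity *)

Lemma le_mul_gt1 (R : realType) (x : \bar R) (c : R) : 0 <= c ->
  (forall k, 1 < k -> (x <= (k * c)%:E)%E) -> (x <= c%:E)%E.
Proof.
move=> c0; case: x => [x||] H; rewrite ?leNye //; last by have := H 2; rewrite ltr1n => /(_ isT).
rewrite lee_fin; apply/ler_addgt0Pr => e e0.
have [cE|cN] := eqVneq c 0.
  by have := H 2; rewrite ltr1n => /(_ isT); rewrite lee_fin cE mulr0 add0r => /le_trans; apply; exact: ltW.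
have cp : 0 < c by rewrite lt_neqAle eq_sym cN.
have := H (1 + e / c); rewrite ltrDl divr_gt0 // => /(_ isT); rewrite lee_fin.
by rewrite mulrDl mul1r divfK.
Qed.

Lemma npoweR_ge0 (R : realType) (x : \bar R) (a : R) : (0 <= npoweR x a)%E.
Proof. by rewrite /npoweR inve_ge0 poweR_ge0. Qed.

Section capacity.
Context (R : realType) (n m : nat) (p : R) (Q : set 'rV[R]_m).
Hypotheses (hQ : convex_body_o Q) (p1 : 1 <= p) (n0 : (0 < n)%N) (m0 : (0 < m)%N).
Local Notation om := (fine (omega R n)).
Local Notation N := (n * m)%N.
Local Notation X := (borel_mx R n 1).
Local Notation D := ((N%:R * Pi_volume n Q p) `^ (- (p / N%:R))).
Local Notation G := (((n%:R - p) / (p - 1)) `^ (p - 1)).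

Let p0 : 0 < p. Proof. exact: lt_le_trans p1. Qed.
Let nR : (0 : R) < n%:R. Proof. by rewrite ltr0n. Qed.
Let om0 : 0 < om. Proof. exact: fine_omega_gt0. Qed.

Lemma omega_fin : omega R n = om%:E.
Proof.
rewrite fineK // /omega; apply: enorm_bounded_fin_num; first exact: (@measurable_eball R n 1 1).
by exists 1.
Qed.

Lemma Pi_volume_powR_gt0 : 0 < D.
Proof.
by apply: powR_gt0; apply: mulr_gt0; [rewrite ltr0n muln_gt0 n0|exact: Pi_volume_gt0 hQ p1 n0 m0].
Qed.

Lemma d_constE : (n%:R%:E * omega R n * d_const n p Q = D%:E)%E.
Proof.
have NR : (0 : R) < N%:R by rewrite ltr0n muln_gt0 n0.
have P0 := Pi_volume_gt0 hQ p1 n0 m0.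
have nom : 0 < n%:R * om := mulr_gt0 nR om0.
rewrite /d_const (polar_Pi_body hQ p1 n0 m0) (Pi_volumeE hQ p1 n0 m0) omega_fin -!EFinM.
rewrite npoweRE ?(ltW (mulr_gt0 NR P0)) ?divr_gt0 // (gt_eqF (mulr_gt0 NR P0)).
by rewrite inver (gt_eqF nom) -!EFinM mulrA divff ?mul1r ?gt_eqF.
Qed.

Lemma affine_capacity_ge0 (K : set 'cV[R]_n) : (0 <= affine_capacity p Q K)%E.
Proof. by apply: le_ereal_inf_tmp => _ [f _ <-]; exact: npoweR_ge0. Qed.

Lemma affine_capacity_lower (K : set 'cV[R]_n) : p < n%:R -> compact K ->
  0 < fine (lebesgue_mx (K : set X)) ->
  (((fine (lebesgue_mx (K : set X)) / om) `^ ((n%:R - p) / n%:R) * G * D)%:E <= affine_capacity p Q K)%E.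
Proof.
move=> pn cK v0; apply: le_ereal_inf_tmp => _ [f [fs fK] <-].
have mK := compact_measurable_mx cK.
have m1 : measurable ([set x | 1 <= f x] : set X).
  apply: closed_measurable_mx; apply: (@preimage_closed _ _ f [set y | 1 <= y]).
    by move=> x _; exact: Ccinfty_continuous.
  exact: closed_ge.
have fin1 : lebesgue_mx ([set x | 1 <= f x] : set X) \is a fin_num.
  apply: enorm_bounded_fin_num => //; have [r r0 hr] := Ccinfty_support_bounded fs.
  by exists r => x /= fx; apply: hr; rewrite gt_eqF // (lt_le_trans ltr01).
have finK : lebesgue_mx (K : set X) \is a fin_num.
  by rewrite ge0_fin_numE ?measure_ge0 //; exact: compact_lebesgue_lty.
have le1 : fine (lebesgue_mx (K : set X)) <= fine (lebesgue_mx ([set x | 1 <= f x] : set X)).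
  by apply: fine_le => //; apply: le_measure; rewrite ?inE.
have v1 := lt_le_trans v0 le1.
apply: le_trans (affine_energy_lower hQ p1 n0 m0 fs pn v1); rewrite lee_fin.
apply: ler_wpM2r; first exact: (ltW Pi_volume_powR_gt0).
apply: ler_wpM2r; first exact: powR_ge0.
apply: ler_powR_mono; last by rewrite ler_pM2r // invr_gt0.
  by rewrite divr_ge0 ?(ltW nR) // subr_ge0 ltW.
by rewrite divr_ge0 ?(ltW om0) // ltW.
Qed.

(** The test functions come arbitrarily close, up to a factor [k > 1], to the energy of the
    untruncated power [|psi (x - y0)|^(-g)] outside the ellipsoid. *)
Lemma affine_capacity_upper (K : set 'cV[R]_n) (psi : 'M[R]_n) (y0 : 'cV[R]_n) (g : R) : psi \in unitmx ->
  (forall x, K x -> enorm (psi *m (x - y0)) <= 1) -> 0 < g -> n%:R < (g + 1) * p ->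
  (affine_capacity p Q K <= (dil psi `^ ((n%:R - p) / n%:R) * (g `^ p / ((g + 1) * p - n%:R)) * D)%:E)%E.
Proof.
move=> upsi hK g0 gp.
have gp0 : 0 < (g + 1) * p - n%:R by rewrite subr_gt0.
apply: le_mul_gt1.
  exact: mulr_ge0 (mulr_ge0 (powR_ge0 _ _) (divr_ge0 (powR_ge0 _ _) (ltW gp0))) (ltW Pi_volume_powR_gt0).
move=> k k1; have k0 : 0 < k := lt_trans ltr01 k1.
have gt1 (x q : R) : 1 < x -> 0 < q -> 1 < x `^ q.
  move=> x1 q0; have one : 1 `^ q = 1 :> R by rewrite powR1.
  rewrite -[ltLHS]one; apply: gt0_ltr_powR => //; rewrite nnegrE ?ler01 //.
  exact: ltW (lt_trans ltr01 x1).
have pi0 : 0 < p^-1 / 2 by rewrite divr_gt0 // invr_gt0.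
(* The two losses [M / (M - 3)] and [(1 + e)^(g/2)] are both made equal to [mu], with
   [(mu * mu)^p = k]. *)
pose mu := k `^ (p^-1 / 2); have mu1 : 1 < mu by exact: gt1.
have mu0 : 0 < mu := lt_trans ltr01 mu1.
have mu10 : 0 < mu - 1 by rewrite subr_gt0.
pose M := 3 * mu / (mu - 1).
have M3 : 3 < M by rewrite /M ltr_pdivlMr // mulrBr mulr1 gtrBl.
have MM : M / (M - 3) = mu.
  have -> : M - 3 = 3 / (mu - 1) by rewrite /M; field; rewrite gt_eqF.
  by rewrite /M; field; rewrite gt_eqF.
have g2 : 0 < 2 / g by rewrite divr_gt0.
pose e := mu `^ (2 / g) - 1; have e0 : 0 < e by rewrite subr_gt0; exact: gt1.
have ee : (1 + e) `^ (g / 2) = mu.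
  rewrite /e addrC subrK -powRrM (_ : 2 / g * (g / 2) = 1) ?powRr1 ?(ltW mu0) //.
  by field; rewrite gt_eqF.
have fs := test_function_Ccinfty y0 upsi g0 e0 M3.
apply: (@le_trans _ _ (affine_energy p Q (test_function psi y0 g e M))).
  apply: ereal_inf_lbound; exists (test_function psi y0 g e M) => //; split=> // x /hK x1.
  by rewrite (test_function_eq1 g0 e0 M3).
apply: le_trans (affine_energy_test_function y0 hQ p1 n0 m0 upsi g0 e0 M3 gp) _.
rewrite MM ee lee_fin (powRM _ (ltW (mulr_gt0 mu0 mu0)) (ltW g0)).
have -> : (mu * mu) `^ p = k.
  rewrite /mu -powRD ?(lt0r_neq0 k0) ?implybT // -powRrM (_ : _ * p = 1) ?powRr1 ?(ltW k0) //.
  by field; rewrite gt_eqF.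
by rewrite le_eqVlt; apply/orP; left; apply/eqP; ring.
Qed.

Lemma volume_ellipsoid (phi : 'M[R]_n) (y0 : 'cV[R]_n) : phi \in unitmx ->
  lebesgue_mx ([set phi *m x + y0 | x in unit_ball] : set X) = (om * dil (invmx phi))%:E.
Proof.
move=> uphi; have mB := @measurable_eball R n 1 1.
have mE : measurable ((fun x : 'cV[R]_n => invmx phi *m x) @^-1` eball 1 : set X).
  exact: (measurable_preimage (@measurable_mulmxl R n 1 n (invmx phi)) mB).
have ui : invmx phi \in unitmx by rewrite unitmx_inv.
rewrite (_ : [set _ | _ in _] = (fun x : 'cV[R]_n => x + - y0) @^-1` ((fun x : 'cV[R]_n => invmx phi *m x) @^-1` eball 1)).
  apply: etrans (lebesgue_mx_shift _ mE) _; apply: etrans (lebesgue_mx_mull ui mB) _.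
  by rewrite (lebesgue_eball_omega n ltr01) expr1n mulr1 expr1 EFinM.
apply/seteqP; split=> [_ [x x1 <-]|x x1] /=; first by rewrite addrK mulKmx.
by exists (invmx phi *m (x - y0)) => //; rewrite mulKVmx // subrK.
Qed.

Lemma compact_ellipsoid (phi : 'M[R]_n) (y0 : 'cV[R]_n) : compact [set phi *m x + y0 | x in unit_ball].
Proof.
apply: continuous_compact.
  apply: continuous_subspaceT => z; apply: (@continuousD _ _ _ (fun z => phi *m z) (cst y0)).
    exact: continuous_mulmxl.
  exact: cst_continuous.
by apply: (@compact_mx R n 1 _ 1) => //; apply: closed_le_continuous; exact: continuous_enorm.
Qed.

Lemma affine_capacity_ellipsoid (phi : 'M[R]_n) (y0 : 'cV[R]_n) : p < n%:R -> phi \in unitmx ->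
  affine_capacity p Q [set phi *m x + y0 | x in unit_ball] =
  (dil (invmx phi) `^ ((n%:R - p) / n%:R) * G * D)%:E.
Proof.
move=> pn uphi; set K := [set _ | _ in _]; have ui : invmx phi \in unitmx by rewrite unitmx_inv.
have d0 := dil_gt0 ui; have D0 := Pi_volume_powR_gt0; set dd := _ `^ ((n%:R - p) / n%:R).
have hK x : K x -> enorm (invmx phi *m (x - y0)) <= 1 by move=> [z z1 <-]; rewrite addrK mulKmx.
have VK := volume_ellipsoid y0 uphi.
apply/eqP; rewrite eq_le; apply/andP; split; last first.
  have := @affine_capacity_lower K pn (@compact_ellipsoid phi y0).
  rewrite /K VK /= => /(_ (mulr_gt0 om0 d0)).
  by rewrite [om * _]mulrC mulfK ?gt_eqF.
move: p1; rewrite [1 <= p]le_eqVlt => /predU1P[pE|p1'].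
  apply: le_mul_gt1; first exact: mulr_ge0 (mulr_ge0 (powR_ge0 _ _) (powR_ge0 _ _)) (ltW D0).
  move=> k k1; have n1 : 0 < n%:R - 1 :> R by rewrite subr_gt0 [X in X < _]pE.
  have k10 : 0 < k - 1 by rewrite subr_gt0.
  have k0 : 0 < k := lt_trans ltr01 k1.
  (* For [p = 1] the constant is [g / (g + 1 - n)], which tends to 1 as [g] grows; this [g] makes it
     exactly [k]. *)
  pose g := k * (n%:R - 1) / (k - 1).
  have g0 : 0 < g := divr_gt0 (mulr_gt0 k0 n1) k10.
  have gE : g + 1 - n%:R = (n%:R - 1) / (k - 1) by rewrite /g; field; rewrite gt_eqF.
  have gp : n%:R < (g + 1) * p by rewrite -pE mulr1 -subr_gt0 gE divr_gt0.
  apply: le_trans (affine_capacity_upper ui hK g0 gp) _; rewrite lee_fin.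
  have -> : g `^ p / ((g + 1) * p - n%:R) = k.
    by rewrite -pE mulr1 gE powRr1 ?(ltW g0) // /g; field; rewrite !gt_eqF.
  have -> : G = 1 by rewrite -pE subrr powRr0.
  by rewrite -/dd mulr1 [dd * k]mulrC mulrA.
(* For this exponent [(g + 1) p - n = g], so the constant of [affine_capacity_upper] reduces to
   [g^(p-1)] and matches the lower bound. *)
pose g := (n%:R - p) / (p - 1).
have g0 : 0 < g by rewrite divr_gt0 // subr_gt0.
have gE : (g + 1) * p - n%:R = g by rewrite /g; field; rewrite gt_eqF // subr_gt0.
have gp : n%:R < (g + 1) * p by rewrite -subr_gt0 gE.
apply: le_trans (affine_capacity_upper ui hK g0 gp) _; rewrite lee_fin gE -/dd.
have gpE : g `^ p = g `^ (p - 1) * g.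
  by rewrite -[X in _ = _ * X](powRr1 (ltW g0)) -powRD ?subrK // (lt0r_neq0 g0) implybT.
by rewrite gpE mulfK // gt_eqF.
Qed.

Let unit_ballE : (unit_ball : set 'cV[R]_n) = [set 1%:M *m x + 0 | x in unit_ball].
Proof.
apply/seteqP; split=> [x x1|_ [x x1 <-]]; last by rewrite mul1mx addr0.
by exists x => //; rewrite mul1mx addr0.
Qed.

Let dil1 : dil (1%:M : 'M[R]_n) = 1.
Proof. by rewrite dil_scalar // invr1 expr1n. Qed.

Let one (q : R) : 1 `^ q = 1 :> R. Proof. by rewrite powR1. Qed.

Lemma affine_capacity_ball : p < n%:R -> affine_capacity p Q (unit_ball : set 'cV[R]_n) = (D * G)%:E.
Proof.
move=> pn; rewrite unit_ballE (affine_capacity_ellipsoid 0 pn (unitmx1 _ _)) invmx1 dil1 one.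
by rewrite mul1r mulrC.
Qed.

(** For [p >= n] every [g > 0] is admissible in [affine_capacity_upper], and the constant
    [g^p / ((g + 1) p - n)] is at most [g] when [g <= 1]. *)
Lemma affine_capacity_ball0 : (2 <= n)%N -> n%:R <= p -> affine_capacity p Q (unit_ball : set 'cV[R]_n) = 0%E.
Proof.
move=> n2 np; apply/eqP; rewrite eq_le affine_capacity_ge0 andbT; have D0 := Pi_volume_powR_gt0.
(* [p >= 2] gives [g^(p-1) <= g], which beats the denominator [g p + (p - n)] also when [p = n]. *)
have p2 : 2 <= p by apply: le_trans np; rewrite ler_nat.
suff H g : 0 < g -> g <= 1 -> (affine_capacity p Q (unit_ball : set 'cV[R]_n) <= (g * D)%:E)%E.
  apply/lee_addgt0Pr => e e0; rewrite add0e.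
  pose g := Num.min 1 (e / D); have g0 : 0 < g by rewrite lt_min ltr01 divr_gt0.
  apply: le_trans (H g g0 _) _; first by rewrite ge_min lexx.
  by rewrite lee_fin -ler_pdivlMr // ge_min lexx orbT.
move=> g0 g1.
have gp : n%:R < (g + 1) * p by rewrite mulrDl mul1r (le_lt_trans np) // ltrDr mulr_gt0.
have hB (x : 'cV[R]_n) : unit_ball x -> enorm (1%:M *m (x - 0)) <= 1 by rewrite subr0 mul1mx.
apply: le_trans (affine_capacity_upper (unitmx1 _ _) hB g0 gp) _; rewrite dil1 one mul1r lee_fin.
rewrite ler_pM2r // ler_pdivrMr ?subr_gt0 //.
rewrite -{1}(subrK 1 p) powRD ?(lt0r_neq0 g0) ?implybT // powRr1 ?(ltW g0) // mulrC ler_pM2l //.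
apply: (@le_trans _ _ (g * p)); last by rewrite mulrDl mul1r -addrA lerDl subr_ge0.
apply: (@le_trans _ _ g); last by rewrite ler_peMr // ltW.
by apply: ge1r_powR; [rewrite g0|rewrite lerBrDr].
Qed.

End capacity.

Theorem theorem4p4 (R : realType) (n m : nat) (Q : set 'rV[R]_m)
    (K : set 'cV[R]_n) (hn : (2 <= n)%N) (hm : (1 <= m)%N)
    (hQ : convex_body_o Q) (hK : compact K) :
  let B := (unit_ball : set 'cV[R]_n) in
  let V := (lebesgue_mx : set 'cV[R]_n -> \bar R) in
  [/\ forall p : R, n%:R <= p -> affine_capacity p Q B = 0%E,
      forall p : R, 1 < p -> p < n%:R ->
        affine_capacity p Q B =
          (n%:R%:E * omega R n * d_const n p Q *
             (((n%:R - p) / (p - 1)) `^ (p - 1))%:E)%E,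
      affine_capacity 1 Q B = (n%:R%:E * omega R n * d_const n 1 Q)%E
    & forall p : R, 1 <= p -> p < n%:R ->
        ((V K / V B) `^ n%:R^-1 <=
           (affine_capacity p Q K / affine_capacity p Q B) `^ (n%:R - p)^-1)%E
        /\ (is_ellipsoid K ->
              ((V K / V B) `^ n%:R^-1 =
                 (affine_capacity p Q K / affine_capacity p Q B)
                   `^ (n%:R - p)^-1)%E)].
Proof.
have n0 : (0 < n)%N by exact: leq_trans hn.
have nR : (0 : R) < n%:R by rewrite ltr0n.
have n1 : (1 : R) < n%:R by rewrite ltr1n.
move=> B V; split.
- move=> p np; apply: affine_capacity_ball0 => //; exact: le_trans (ltW n1) np.
- move=> p p1 pn; rewrite (d_constE hQ (ltW p1) n0 hm) -EFinM.
  exact: affine_capacity_ball (ltW p1) n0 hm pn.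
- rewrite (d_constE hQ (lexx 1) n0 hm) /B (affine_capacity_ball hQ (lexx 1) n0 hm n1).
  by rewrite subrr powRr0 mulr1.
move=> p p1 pn; have om0 := fine_omega_gt0 R n; set om := fine _ in om0.
have VB : V B = om%:E := omega_fin R n.
have Kfin : V K \is a fin_num by rewrite ge0_fin_numE ?measure_ge0 //; exact: compact_lebesgue_lty.
set v := fine (V K); have VK : V K = v%:E by rewrite fineK.
have v0 : 0 <= v by apply: fine_ge0; exact: measure_ge0.
have D0 := Pi_volume_powR_gt0 hQ p1 n0 hm; set D := _ `^ _ in D0.
pose G : R := ((n%:R - p) / (p - 1)) `^ (p - 1).
have G0 : 0 < G.
  move: p1; rewrite [1 <= p]le_eqVlt => /predU1P[pE|p1']; first by rewrite /G -pE subrr powRr0.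
  by rewrite /G powR_gt0 // divr_gt0 // subr_gt0.
have CB : affine_capacity p Q B = (D * G)%:E := affine_capacity_ball hQ p1 n0 hm pn.
have DG0 : 0 < D * G := mulr_gt0 D0 G0.
have np0 : 0 < n%:R - p by rewrite subr_gt0.
have dE (c d : R) : 0 < d -> (c%:E / d%:E = (c / d)%:E)%E by move=> d0; rewrite inver (gt_eqF d0).
have rootE y : 0 <= y -> (y `^ ((n%:R - p) / n%:R) * G * D / (D * G)) `^ (n%:R - p)^-1 = y `^ n%:R^-1.
  move=> y0; have -> : y `^ ((n%:R - p) / n%:R) * G * D / (D * G) = y `^ ((n%:R - p) / n%:R).
    by rewrite -[_ * G * D]mulrA [D * G]mulrC mulfK // gt_eqF // mulrC.
  by rewrite -powRrM mulrAC divff ?mul1r ?gt_eqF.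
rewrite VK VB (dE _ _ om0) poweR_EFin CB; split=> [|[phi [y0 [uphi KE]]]].
(* [affine_capacity_lower] requires positive volume; for volume zero the left side is 0. *)
- have [vE|vN] := eqVneq v 0.
    by rewrite vE mul0r powR0 ?invr_eq0 ?gt_eqF // poweR_ge0.
  have vp : 0 < v by rewrite lt_neqAle eq_sym vN.
  have low := affine_capacity_lower hQ p1 n0 hm pn hK vp.
  rewrite -(rootE (v / om)) ?divr_ge0 ?(ltW om0) // -poweR_EFin.
  have Di : (0 <= (D * G)%:E^-1)%E by rewrite inve_ge0 lee_fin ltW.
  have le1 : (((v / om) `^ ((n%:R - p) / n%:R) * G * D / (D * G))%:E <= affine_capacity p Q K / (D * G)%:E)%E.
    by rewrite -dE //; exact: lee_wpmul2r.
  have ge1 : 0 <= (v / om) `^ ((n%:R - p) / n%:R) * G * D / (D * G).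
    exact: divr_ge0 (mulr_ge0 (mulr_ge0 (powR_ge0 _ _) (ltW G0)) (ltW D0)) (ltW DG0).
  apply: gt0_ler_poweR => //; first by rewrite invr_ge0 ltW.
  + by rewrite in_itv /= leey andbT lee_fin.
  + by rewrite in_itv /= leey andbT (le_trans _ le1) // lee_fin.
- have E := affine_capacity_ellipsoid hQ p1 n0 hm y0 pn uphi.
  rewrite KE E -/G -/D dE // poweR_EFin rootE; last by rewrite ltW // dil_gt0 // unitmx_inv.
  congr (_ `^ _)%:E; have := volume_ellipsoid y0 uphi; rewrite -KE => VE.
  have -> : v = om * dil (invmx phi) by apply: EFin_inj; rewrite -VK; exact: VE.
  by rewrite [om * _]mulrC mulfK // gt_eqF.
Qed.
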